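(* Let $c\in\mathcal{C}$, $a=c_s$, $b=c_t$, and let $\mathcal{F}$ be a cuspidal Calogero-Moser $c$-family of the dihedral group $W$ of order $2d$. Let $\mathrm{Lie}_c(\mathcal{F})=\mathfrak{m}_{\mathcal{F}}^c/(\mathfrak{m}_{\mathcal{F}}^c)^2$ with the Lie bracket induced by the Poisson bracket of $Z_c$. Then: (a) If $d=4$ (i.e. $W$ is of type $B_2$) and $a=b\ne0$, then $\mathrm{Lie}_c(\mathcal{F})\simeq\mathfrak{sl}_3(\mathbb{C})$ is a simple Lie algebra of type $A_2$. (b) If $d=6$ (i.e. $W$ is of type $G_2$) and $ab(a^2-b^2)\ne0$, then $\mathrm{Lie}_c(\mathcal{F})\simeq\mathfrak{sp}_4(\mathbb{C})$ is a simple Lie algebra of type $B_2$.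
   Context: Let $\zeta$ be a primitive $d$-th root of unity. $V=\mathbb{C}^2$ has canonical basis $(x,y)$, $V^*$ dual basis $(X,Y)$; $\mathbb{C}[V]=\mathbb{C}[X,Y]$, $\mathbb{C}[V^*]=\mathbb{C}[x,y]$. For $i\in\mathbb{Z}/d\mathbb{Z}$, $s_i=\begin{pmatrix}0&\zeta^i\\ \zeta^{-i}&0\end{pmatrix}$, $\alpha_i^\vee=\zeta^ix-y$, $\alpha_i=X-\zeta^iY$; $s=s_0$, $t=s_1$, $W=\langle s,t\rangle$, $\mathrm{Ref}(W)=\{s_i\}$. $\mathcal{C}$ is the space of functions $\mathrm{Ref}(W)\to\mathbb{C}$ constant on conjugacy classes, $C_i\in\mathcal{C}^*$ is evaluation at $s_i$. $\mathbf{H}$ (generic rational Cherednik algebra at $t=0$) is the quotient of $\mathbb{C}[\mathcal{C}]\otimes(T(V\oplus V^* )\rtimes W)$ by $[u,u']=[U,U']=0$, $[u,U]=-2\sum_iC_i\frac{\langle u,\alpha_i\rangle\langle\alpha_i^\vee,U\rangle}{\langle\alpha_i^\vee,\alpha_i\rangle}s_i$ ($u,u'\in V$, $U,U'\in V^*$). $Z$ is its centre. For $c\in\mathcal{C}$, $\mathbf{H}_c=\mathbf{H}/(C_i-c_{s_i})_i\mathbf{H}$ and $Z_c=Z/(C_i-c_{s_i})_iZ$ is the centre of $\mathbf{H}_c$. Poisson bracket: let $\tilde{\mathbf{H}}$ be defined over $\mathbb{C}[\mathcal{C}][T]$ as $\mathbf{H}$ but with $[u,U]=T\langle u,U\rangle-2\sum_iC_i\frac{\langle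 u,\alpha_i\rangle\langle\alpha_i^\vee,U\rangle}{\langle\alpha_i^\vee,\alpha_i\rangle}s_i$, so $\tilde{\mathbf{H}}/T\tilde{\mathbf{H}}=\mathbf{H}$. For $z,z'\in Z$ with lifts $\tilde z,\tilde z'\in\tilde{\mathbf{H}}$, $\{z,z'\}$ is the image in $\mathbf{H}$ of $T^{-1}[\tilde z,\tilde z']$. This is a $\mathbb{C}[\mathcal{C}]$-linear Poisson bracket on $Z$ and it induces one on $Z_c$. Families: for $\chi\in\mathrm{Irr}(W)$, let $\mathcal{L}_c(\chi)$ be the unique simple quotient of the baby Verma module $\overline{\mathbf{H}}_c\otimes_{\overline{\mathbf H}_c^-}E_\chi$, where $\overline{\mathbf{H}}_c$ is the quotient of $\mathbf{H}_c$ by the ideal generated by the elements of $\mathbb{C}[V]^W$ and $\mathbb{C}[V^*]^W$ with zero constant term, $\overline{\mathbf H}_c^-$ is its subalgebra generated by $V$ and $W$, and $V$ acts by $0$ on the representation $E_\chi$ of character $\chi$. $Z$ acts on $\mathcal{L}_c(\chi)$ by a character $\Omega_\chi^c:Z\to\mathbb{C}$, which factors through $Z_c$. Two irreducible characters are in the same Calogero-Moser $c$-family iff $\Omega_\chi^c=\Omega_{\chi'}^c$. For a family $\mathcal{F}$ and $\chi\in\mathcal{F}$, $\mathfrak{m}_{\mathcal{F}}^c=\ker(\Omega_\chi^c)\subset Z_c$. $\mathcal{F}$ is cuspidal if $\{\mathfrak{m}_{\mathcal{F}}^c,\mathfrak{m}_{\mathcal{F}}^c\}\subset\mathfrak{m}_{\mathcal{F}}^c$;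 then $\{,\}$ induces a Lie bracket on $\mathfrak{m}_{\mathcal{F}}^c/(\mathfrak{m}_{\mathcal{F}}^c)^2$. *)

(* Defs.v *)
From HB Require Import structures.
From mathcomp Require Import all_boot all_order all_algebra.
From mathcomp Require Import generic_quotient ring_quotient.
From mathcomp Require Import complex monalg mpoly.
From mathcomp Require Import boolp classical_sets reals.

Set Implicit Arguments.
Unset Strict Implicit.
Unset Printing Implicit Defensive.

Import GRing.Theory.

Local Open Scope classical_set_scope.
Local Open Scope ring_scope.
Local Open Scope complex_scope.
Local Open Scope quotient_scope.

Section Submodules.
Context {K : pzRingType} {V : lmodType K}.

Definition is_submod (P : set V) : Prop :=
  P 0 /\ forall a u v, P u -> P v -> P (a *: u + v).

Definition submod_span (S : set V) : {pred V} :=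
  fun v => `[< forall P : set V, is_submod P -> S `<=` P -> P v >].

Lemma submod_span_closed S : submod_closed (submod_span S).
Proof.
split; first by apply/asboolP => P [].
move=> a u v /asboolP hu /asboolP hv; apply/asboolP => P hP SP.
by case: (hP) => _; apply; [apply: hu | apply: hv].
Qed.

HB.instance Definition _ S :=
  GRing.isSubmodClosed.Build K V (submod_span S) (submod_span_closed S).

End Submodules.

Definition quotmod {K : pzRingType} {V : lmodType K} (S : set V) : Type :=
  Quotient.quot (submod_span S).

Section QuotientModule.
Context {K : pzRingType} {V : lmodType K} (S : set V).

HB.instance Definition _ := GRing.Zmodule.on (quotmod S).
HB.instance Definition _ := EqQuotient.copy (quotmod S) (Quotient.quot (submod_span S)).

Implicit Types (u v : V) (x y : quotmod S).

Lemma quotmod_eqP u v :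
  \pi_(quotmod S) u = \pi_(quotmod S) v <-> u - v \in submod_span S.
Proof.
rewrite Quotient.idealrBE.
by split=> [h|/eqP //]; apply/eqP; exact: h.
Qed.

Lemma quotmod_piD u v :
  \pi_(quotmod S) (u + v) = \pi_(quotmod S) u + \pi_(quotmod S) v.
Proof. exact: (Quotient.pi_add (submod_span S)). Qed.

Definition quotmod_scale (a : K) x : quotmod S := \pi_(quotmod S) (a *: repr x).

Lemma quotmod_piZ a u : \pi_(quotmod S) (a *: u) = quotmod_scale a (\pi_(quotmod S) u).
Proof.
apply/quotmod_eqP; rewrite -scalerBr; apply: rpredZ.
by apply/quotmod_eqP; rewrite reprK.
Qed.

Fact quotmod_scaleA a b x :
  quotmod_scale a (quotmod_scale b x) = quotmod_scale (a * b) x.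
Proof.
by elim/quotW: x => u; rewrite -(quotmod_piZ b) -!quotmod_piZ scalerA.
Qed.

Fact quotmod_scale1 : left_id 1 quotmod_scale.
Proof. by elim/quotW => u; rewrite -quotmod_piZ scale1r. Qed.

Fact quotmod_scaleDr : right_distributive quotmod_scale +%R.
Proof.
move=> a; elim/quotW => u; elim/quotW => v.
by rewrite -quotmod_piD -!quotmod_piZ -quotmod_piD scalerDr.
Qed.

Fact quotmod_scaleDl x : {morph quotmod_scale^~ x : a b / a + b}.
Proof.
by elim/quotW: x => u a b; rewrite -!quotmod_piZ -quotmod_piD scalerDl.
Qed.

HB.instance Definition _ := GRing.Zmodule_isLmodule.Build K (quotmod S)
  quotmod_scaleA quotmod_scale1 quotmod_scaleDr quotmod_scaleDl.

End QuotientModule.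

Definition simple_module (A : pzRingType) (M : lmodType A) : Prop :=
  (exists m : M, m <> 0) /\
  forall P : set M, is_submod P -> P = [set 0] \/ P = setT.

(* MathComp's lalgType and algType require 1 != 0, which is not available a   *)
(* priori for algebras given by a presentation.                               *)
HB.mixin Record PzRing_isPzAlgebra (K : pzRingType) A of GRing.PzRing A := {
  algc : {rmorphism K -> A};
  algc_central : forall (a : K) (x : A), algc a * x = x * algc a
}.

#[short(type="pzAlgType")]
HB.structure Definition PzAlgebra (K : pzRingType) :=
  { A of GRing.PzRing A & PzRing_isPzAlgebra K A }.

Definition asmod {K : pzRingType} (A : pzAlgType K) : Type := A.

Section AsMod.
Context {K : pzRingType} (A : pzAlgType K).

HB.instance Definition _ := GRing.Zmodule.on (asmod A).

Definition asmod_scale (a : K) (x : asmod A) : asmod A := (algc a : A) * (x : A).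

Fact asmod_scaleA a b x :
  asmod_scale a (asmod_scale b x) = asmod_scale (a * b) x.
Proof. by rewrite /asmod_scale mulrA rmorphM. Qed.

Fact asmod_scale1 : left_id 1 asmod_scale.
Proof. by move=> x; rewrite /asmod_scale rmorph1 mul1r. Qed.

Fact asmod_scaleDr : right_distributive asmod_scale +%R.
Proof. by move=> a x y; exact: mulrDr. Qed.

Fact asmod_scaleDl x : {morph asmod_scale^~ x : a b / a + b}.
Proof. by move=> a b; rewrite /asmod_scale rmorphD; exact: mulrDl. Qed.

HB.instance Definition _ := GRing.Zmodule_isLmodule.Build K (asmod A)
  asmod_scaleA asmod_scale1 asmod_scaleDr asmod_scaleDl.

End AsMod.

Section Ideals.
Context {A : pzRingType}.

Definition is_ideal (P : set A) : Prop :=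
  [/\ P 0, forall x y, P x -> P y -> P (x - y),
      forall a x, P x -> P (a * x) & forall a x, P x -> P (x * a)].

Definition ideal_span (S : set A) : {pred A} :=
  fun x => `[< forall P : set A, is_ideal P -> S `<=` P -> P x >].

Lemma ideal_span_closed S : zmod_closed (ideal_span S).
Proof.
split; first by apply/asboolP => P [].
move=> x y /asboolP hx /asboolP hy; apply/asboolP => P hP SP.
by case: (hP) => _ + _ _; apply; [apply: hx | apply: hy].
Qed.

HB.instance Definition _ S :=
  GRing.isZmodClosed.Build A (ideal_span S) (ideal_span_closed S).

Lemma ideal_spanMl S a x : x \in ideal_span S -> a * x \in ideal_span S.
Proof.
move=> /asboolP hx; apply/asboolP => P hP SP.
by case: (hP) => _ _ + _; apply; apply: hx.
Qed.

Lemma ideal_spanMr S a x : x \in ideal_span S -> x * a \in ideal_span S.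
Proof.
move=> /asboolP hx; apply/asboolP => P hP SP.
by case: (hP) => _ _ _; apply; apply: hx.
Qed.

End Ideals.

Definition quotalg {A : pzRingType} (S : set A) : Type :=
  Quotient.quot (ideal_span S).

Section QuotientRing.
Context {A : pzRingType} (S : set A).

HB.instance Definition _ := GRing.Zmodule.on (quotalg S).
HB.instance Definition _ := EqQuotient.copy (quotalg S) (Quotient.quot (ideal_span S)).

Implicit Types (u v : A) (x y : quotalg S).

Lemma quotalg_eqP u v :
  \pi_(quotalg S) u = \pi_(quotalg S) v <-> u - v \in ideal_span S.
Proof.
rewrite Quotient.idealrBE.
by split=> [h|/eqP //]; apply/eqP; exact: h.
Qed.

Lemma quotalg_piD u v :
  \pi_(quotalg S) (u + v) = \pi_(quotalg S) u + \pi_(quotalg S) v.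
Proof. exact: (Quotient.pi_add (ideal_span S)). Qed.

Definition quotalg_mul x y : quotalg S := \pi_(quotalg S) (repr x * repr y).

Lemma quotalg_piM u v :
  \pi_(quotalg S) (u * v) = quotalg_mul (\pi_(quotalg S) u) (\pi_(quotalg S) v).
Proof.
apply/quotalg_eqP.
set u' := repr _; set v' := repr _.
have -> : u * v - u' * v' = (u - u') * v + u' * (v - v').
  by rewrite mulrBl mulrBr addrA subrK.
apply: rpredD; [apply: ideal_spanMr | apply: ideal_spanMl];
  by apply/quotalg_eqP; rewrite reprK.
Qed.

Fact quotalg_mulA : associative quotalg_mul.
Proof.
elim/quotW => u; elim/quotW => v; elim/quotW => w.
by rewrite -(quotalg_piM v) -(quotalg_piM u v) -!quotalg_piM mulrA.
Qed.

Fact quotalg_mul1l : left_id (\pi_(quotalg S) 1) quotalg_mul.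
Proof. by elim/quotW => u; rewrite -quotalg_piM mul1r. Qed.

Fact quotalg_mul1r : right_id (\pi_(quotalg S) 1) quotalg_mul.
Proof. by elim/quotW => u; rewrite -quotalg_piM mulr1. Qed.

Fact quotalg_mulDl : left_distributive quotalg_mul +%R.
Proof.
elim/quotW => u; elim/quotW => v; elim/quotW => w.
by rewrite -quotalg_piD -!quotalg_piM -quotalg_piD mulrDl.
Qed.

Fact quotalg_mulDr : right_distributive quotalg_mul +%R.
Proof.
elim/quotW => u; elim/quotW => v; elim/quotW => w.
by rewrite -quotalg_piD -!quotalg_piM -quotalg_piD mulrDr.
Qed.

HB.instance Definition _ := GRing.Zmodule_isPzRing.Build (quotalg S)
  quotalg_mulA quotalg_mul1l quotalg_mul1r quotalg_mulDl quotalg_mulDr.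

End QuotientRing.

Section QuotientAlgebra.
Context {K : pzRingType} {A : pzAlgType K} (S : set A).

Definition quotalg_algc (a : K) : quotalg S := \pi_(quotalg S) (algc a : A).

Fact quotalg_algc_additive : zmod_morphism quotalg_algc.
Proof.
move=> a b; apply: (addIr (quotalg_algc b)).
by rewrite subrK -quotalg_piD -rmorphD subrK.
Qed.

Fact quotalg_algc_monoid : monoid_morphism quotalg_algc.
Proof.
split=> [|a b]; first by rewrite /quotalg_algc rmorph1.
by rewrite /quotalg_algc rmorphM quotalg_piM.
Qed.

HB.instance Definition _ :=
  GRing.isZmodMorphism.Build K (quotalg S) quotalg_algc quotalg_algc_additive.
HB.instance Definition _ :=
  GRing.isMonoidMorphism.Build K (quotalg S) quotalg_algc quotalg_algc_monoid.

Fact quotalg_algc_central a (x : quotalg S) :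
  quotalg_algc a * x = x * quotalg_algc a.
Proof.
elim/quotW: x => u; rewrite /quotalg_algc.
by rewrite -[LHS]quotalg_piM -[RHS]quotalg_piM algc_central.
Qed.

HB.instance Definition _ := PzRing_isPzAlgebra.Build K (quotalg S)
  quotalg_algc_central.

End QuotientAlgebra.

Section Centre.
Context {K : pzRingType} (A : pzAlgType K).

Definition central : {pred A} := fun z => `[< forall a : A, z * a = a * z >].

Lemma central_closed : subring_closed central.
Proof.
split=> [|x y /asboolP hx /asboolP hy|x y /asboolP hx /asboolP hy];
  apply/asboolP => a.
- by rewrite mul1r mulr1.
- by rewrite mulrBl mulrBr hx hy.
- by rewrite -mulrA hy mulrA hx mulrA.
Qed.

HB.instance Definition _ := GRing.isSubringClosed.Build A central central_closed.

Record centre : Type := Centre { centre_val : A; _ : centre_val \in central }.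

HB.instance Definition _ := [isSub for centre_val].
HB.instance Definition _ := [Choice of centre by <:].
HB.instance Definition _ := [SubChoice_isSubZmodule of centre by <:].
HB.instance Definition _ :=
  GRing.SubZmodule_isSubPzRing.Build A _ centre central_closed.

Fact algc_in_central (a : K) : (algc a : A) \in central.
Proof. by apply/asboolP => x; rewrite algc_central. Qed.

Definition centre_algc (a : K) : centre := Centre (algc_in_central a).

Fact centre_algc_additive : zmod_morphism centre_algc.
Proof. by move=> a b; apply: val_inj; rewrite /= rmorphB. Qed.

Fact centre_algc_monoid : monoid_morphism centre_algc.
Proof.
by split=> [|a b]; apply: val_inj; rewrite /= (rmorph1, rmorphM).
Qed.

HB.instance Definition _ :=
  GRing.isZmodMorphism.Build K centre centre_algc centre_algc_additive.
HB.instance Definition _ :=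
  GRing.isMonoidMorphism.Build K centre centre_algc centre_algc_monoid.

Fact centre_algc_central a (x : centre) : centre_algc a * x = x * centre_algc a.
Proof. by apply: val_inj; rewrite /= algc_central. Qed.

HB.instance Definition _ := PzRing_isPzAlgebra.Build K centre
  centre_algc_central.

End Centre.

Definition freealg (K : comNzRingType) (I : choiceType) : Type :=
  {malg K[{fmonom I}]}.

Section FreeAlgebra.
Context (K : comNzRingType) (I : choiceType).

HB.instance Definition _ := GRing.NzRing.on (freealg K I).
HB.instance Definition _ := GRing.Lalgebra.on (freealg K I).

Definition freegen (i : I) : freealg K I := mkmalgU (fmu i) 1.

Definition freealg_algc (a : K) : freealg K I := malgC a.

HB.instance Definition _ := GRing.RMorphism.copy freealg_algc
  (malgC : K -> {malg K[{fmonom I}]}).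

Fact freealg_algc_central (a : K) (x : freealg K I) :
  freealg_algc a * x = x * freealg_algc a.
Proof.
rewrite /freealg_algc [LHS]fgmulUg [RHS]fgmulgU.
by apply: eq_bigr => k _; rewrite mul1m mulm1 mulrC.
Qed.

HB.instance Definition _ := PzRing_isPzAlgebra.Build K (freealg K I)
  freealg_algc_central.

End FreeAlgebra.

Section Lie.
Context {K : fieldType} {g : lmodType K} (br : g -> g -> g).

Definition is_lie_bracket : Prop :=
  [/\ forall a u v w, br (a *: u + v) w = a *: br u w + br v w,
      forall a u v w, br w (a *: u + v) = a *: br w u + br w v,
      forall u, br u u = 0 &
      forall u v w, br u (br v w) + br v (br w u) + br w (br u v) = 0].

Definition simple_lie : Prop :=
  [/\ is_lie_bracket, exists u v, br u v <> 0 &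
      forall I : set g, is_submod I -> (forall u v, I v -> I (br u v)) ->
      I = [set 0] \/ I = setT].

(* Isomorphism with the Lie subalgebra L of gl_n(K), given as a set. *)
Definition lie_iso_mx n (L : set 'M[K]_n) : Prop :=
  exists f : {linear g -> 'M[K]_n},
    [/\ injective f, range f = L &
        forall u v, f (br u v) = f u *m f v - f v *m f u].

(* br is generated by Chevalley generators e_i, f_i, h_i that satisfy the     *)
(* Chevalley-Serre relations of the Cartan matrix A, where                    *)
(* A i j = <alpha_j, alpha_i^vee>; for a simple Lie algebra over an           *)
(* algebraically closed field of characteristic 0, this says that its root    *)
(* system has Cartan matrix A.                                                *)
Definition has_cartan_type r (A : 'M[int]_r) : Prop :=
  exists e f h : 'I_r -> g,
    (forall i j, br (h i) (h j) = 0) /\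
    (forall i j, br (e i) (f j) = if i == j then h i else 0) /\
    (forall i j, br (h i) (e j) = (A i j)%:~R *: e j) /\
    (forall i j, br (h i) (f j) = - ((A i j)%:~R *: f j)) /\
    (forall i j, i != j -> iter `|1 - A i j|%N (br (e i)) (e j) = 0) /\
    (forall i j, i != j -> iter `|1 - A i j|%N (br (f i)) (f j) = 0) /\
    (forall P : set g, is_submod P -> (forall u v, P u -> P v -> P (br u v)) ->
       (forall i, P (e i) /\ P (f i)) -> P = setT).

End Lie.

Definition sl_mx (K : fieldType) n : set 'M[K]_n := [set A | \tr A = 0].

Definition sp4_mx (K : fieldType) : set 'M[K]_4 :=
  let J : 'M[K]_(2 + 2) := block_mx 0 1%:M (- 1%:M) 0 in
  [set A | A^T *m J + J *m A = 0].

Arguments sl_mx K n : clear implicits.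
Arguments sp4_mx K : clear implicits.

Definition cartan_A2 : 'M[int]_2 := \matrix_(i, j) (if i == j then 2 else -1).

Definition cartan_B2 : 'M[int]_2 :=
  \matrix_(i, j) (if i == j then 2 else if i == 0 then -2 else -1).

Section Cherednik.
Context {R : realType}.
Local Notation C := R[i].

(* V = 'cV[C]_2 and V^* = 'rV[C]_2, in the bases (x, y) and (X, Y). *)
Definition pairing (u : 'cV[C]_2) (U : 'rV[C]_2) : C := (U *m u) 0 0.

Context (d : nat) (zeta : C).

Definition s_mx (i : nat) : 'M[C]_2 :=
  \matrix_(k, l) (if (k == 0) && (l == 1) then zeta ^+ i
                  else if (k == 1) && (l == 0) then zeta ^- i else 0).

(* alpha_i^vee = zeta^i x - y and alpha_i = X - zeta^i Y. *)
Definition alphav (i : nat) : 'cV[C]_2 :=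
  \col_k (if k == 0 then zeta ^+ i else -1).
Definition alpha (i : nat) : 'rV[C]_2 :=
  \row_k (if k == 0 then 1 else - zeta ^+ i).

Inductive in_W : 'M[C]_2 -> Prop :=
| in_W_s0 : in_W (s_mx 0)
| in_W_s1 : in_W (s_mx 1)
| in_W_1 : in_W 1%:M
| in_W_mul w1 w2 : in_W w1 -> in_W w2 -> in_W (w1 *m w2)
| in_W_inv w : in_W w -> in_W (invmx w).

Definition dihedral : Type := {w : 'M[C]_2 | `[< in_W w >]}.
Definition dih1 : dihedral := exist _ 1%:M (asboolT in_W_1).
Definition dihM (w1 w2 : dihedral) : dihedral :=
  exist _ (sval w1 *m sval w2)
    (asboolT (in_W_mul (asboolW (svalP w1)) (asboolW (svalP w2)))).

Lemma in_W_s i : in_W (s_mx i).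
Proof.
have step j : s_mx j.+2 = s_mx j.+1 *m s_mx j *m s_mx j.+1.
  have e1 (z : C) : z ^+ j.+2 = z ^+ j.+1 * z ^- j * z ^+ j.+1.
    have [->|z0] := eqVneq z 0; first by rewrite !expr0n mul0r mul0r.
    by rewrite exprS -[in RHS]exprVn [z ^+ j.+1]exprS exprVn mulfK ?expf_neq0.
  have e2 : zeta ^- j.+2 = zeta ^- j.+1 * zeta ^+ j * zeta ^- j.+1.
    by have := e1 zeta^-1; rewrite !exprVn invrK.
  apply/matrixP => k l.
  rewrite !(mxE, big_ord_recl, big_ord0) /=.
  case: k => -[|[|//]] hk; case: l => -[|[|//]] hl;
    by rewrite -!val_eqE /= ?(mul0r, mulr0, add0r, addr0) // (e1, e2).
elim/ltn_ind: i => -[_|[_|i IH]]; [exact: in_W_s0 | exact: in_W_s1 |].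
rewrite step; apply: in_W_mul; last exact: IH.
by apply: in_W_mul; apply: IH; rewrite // ltnW.
Qed.

Definition dih_s (i : nat) : dihedral := exist _ (s_mx i) (asboolT (in_W_s i)).

Definition reflection : Type := {r : dihedral | exists i, r = dih_s i}.
Definition ref_s (i : nat) : reflection :=
  exist _ (dih_s i) (ex_intro _ i erefl).

Definition ref_conj (r r' : reflection) : Prop :=
  exists w : dihedral, sval w *m sval (sval r) = sval (sval r') *m sval w.

(* The parameter space: functions on Ref(W) constant on conjugacy classes. *)
Definition is_param (c : reflection -> C) : Prop :=
  forall r r', ref_conj r r' -> c r = c r'.

Record rep : Type := Rep {
  rep_dim : nat ;
  rep_mx : dihedral -> 'M[C]_rep_dim ;
  rep_mx1 : rep_mx dih1 = 1%:M ;
  rep_mxM : forall w1 w2, rep_mx (dihM w1 w2) = rep_mx w1 *m rep_mx w2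
}.

Definition rep_irr (E : rep) : Prop :=
  (0 < rep_dim E)%N /\
  forall U : {vspace 'cV[C]_(rep_dim E)},
    (forall w u, u \in U -> rep_mx E w *m u \in U) -> U = 0%VS \/ U = fullv.

Definition rep_char (E : rep) (w : dihedral) : C := \tr (rep_mx E w).

Definition Irr : Type :=
  {chi : dihedral -> C | exists E : rep, rep_irr E /\ rep_char E = chi}.

Definition irr_rep (chi : Irr) : rep := sval (cid (svalP chi)).

(* Generators: T, the C_r (r in Ref(W)), the bases (x, y) of V and (X, Y) of  *)
(* V^*, and the elements of W.                                                *)
Inductive gen : Type :=
| GenT
| GenC of reflection
| GenV of 'I_2
| GenVd of 'I_2
| GenW of dihedral.

HB.instance Definition _ := gen_eqMixin gen.
HB.instance Definition _ := gen_choiceMixin gen.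

Local Notation F := (freealg C gen).

Definition f_gen (g : gen) : F := freegen C g.
Definition f_V (u : 'cV[C]_2) : F := \sum_k algc (u k 0) * f_gen (GenV k).
Definition f_Vd (U : 'rV[C]_2) : F := \sum_k algc (U 0 k) * f_gen (GenVd k).

(* Elements of the free algebra set to 0, for the relations with              *)
(* [u, U] = tau <u, U> - 2 sum_i C_i ... s_i.                                 *)
Inductive cher_rel (tau : F) : set F :=
| RelT a : cher_rel tau (f_gen GenT * a - a * f_gen GenT)
| RelC r a : cher_rel tau (f_gen (GenC r) * a - a * f_gen (GenC r))
| RelCconj r r' : ref_conj r r' ->
    cher_rel tau (f_gen (GenC r) - f_gen (GenC r'))
| RelW1 : cher_rel tau (f_gen (GenW dih1) - 1)
| RelWM w1 w2 : cher_rel tau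
    (f_gen (GenW (dihM w1 w2)) - f_gen (GenW w1) * f_gen (GenW w2))
| RelWV w u : cher_rel tau
    (f_gen (GenW w) * f_V u - f_V (sval w *m u) * f_gen (GenW w))
| RelWVd w U : cher_rel tau
    (f_gen (GenW w) * f_Vd U - f_Vd (U *m invmx (sval w)) * f_gen (GenW w))
| RelVV u u' : cher_rel tau (f_V u * f_V u' - f_V u' * f_V u)
| RelVdVd U U' : cher_rel tau (f_Vd U * f_Vd U' - f_Vd U' * f_Vd U)
| RelVVd u U : cher_rel tau
    (f_V u * f_Vd U - f_Vd U * f_V u
     - (tau * algc (pairing u U)
        - 2%:R * \sum_(i < d)
            f_gen (GenC (ref_s i))
            * algc (pairing u (alpha i) * pairing (alphav i) U
                    / pairing (alphav i) (alpha i))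
            * f_gen (GenW (dih_s i)))).

(* The algebra over C[calC][T], and its specialisation at T = 0. *)
Definition Ht : Type := quotalg (cher_rel (f_gen GenT)).
Definition H : Type := quotalg (cher_rel 0 `|` [set f_gen GenT]).
HB.instance Definition _ := PzAlgebra.on Ht.
HB.instance Definition _ := PzAlgebra.on H.
HB.instance Definition _ := Quotient.copy Ht (quotalg (cher_rel (f_gen GenT))).
HB.instance Definition _ :=
  Quotient.copy H (quotalg (cher_rel 0 `|` [set f_gen GenT])).

Definition H_gen (g : gen) : H := \pi_H (f_gen g).
Definition Ht_T : Ht := \pi_Ht (f_gen GenT).

(* The reduction modulo T; independent of the representative of h. *)
Definition Ht_to_H (h : Ht) : H := \pi_H (repr h).

Definition Z : Type := centre H.
HB.instance Definition _ := PzAlgebra.on Z.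

(* The image in H of T^-1 [zt, zt'] for lifts zt, zt' of z, z'. *)
Definition poisson (z z' : Z) : Z :=
  xget 0 [set w : Z | exists zt zt' wt : Ht,
    [/\ Ht_to_H zt = centre_val z, Ht_to_H zt' = centre_val z',
        Ht_T * wt = zt * zt' - zt' * zt & Ht_to_H wt = centre_val w]].

Context (c : reflection -> C).

Definition Hc : Type :=
  quotalg [set a : H | exists r, a = H_gen (GenC r) - algc (c r)].
HB.instance Definition _ := PzAlgebra.on Hc.
HB.instance Definition _ := Quotient.copy Hc
  (quotalg [set a : H | exists r, a = H_gen (GenC r) - algc (c r)]).

Definition Zc : Type :=
  quotalg [set z : Z | exists r, centre_val z = H_gen (GenC r) - algc (c r)].
HB.instance Definition _ := PzAlgebra.on Zc.
HB.instance Definition _ := Quotient.copy Zc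
  (quotalg [set z : Z | exists r, centre_val z = H_gen (GenC r) - algc (c r)]).

(* p (A x), where x is the column of the variables. *)
Definition mp_subst (A : 'M[C]_2) (p : mpoly 2 C) : mpoly 2 C :=
  comp_mpoly [tuple \sum_l A k l *: 'X_l | k < 2] p.

(* W sends a linear form U in V^* to U o w^-1, and a vector u of V to w u.    *)
Definition inv_Vd (p : mpoly 2 C) : Prop :=
  forall w : dihedral, mp_subst (invmx (sval w)) p = p.
Definition inv_V (p : mpoly 2 C) : Prop :=
  forall w : dihedral, mp_subst (sval w)^T p = p.

(* p(X, Y) and p(x, y), for p in C[V] and C[V^*] respectively. *)
Definition f_polyVd (p : mpoly 2 C) : F :=
  mmap (algc : C -> F) (fun k => f_gen (GenVd k)) p.
Definition f_polyV (p : mpoly 2 C) : F :=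
  mmap (algc : C -> F) (fun k => f_gen (GenV k)) p.

Definition Hc_coinv : set Hc :=
  [set a | exists p : mpoly 2 C, mcoeff 0%MM p = 0 /\
     (inv_Vd p /\ a = \pi_Hc (\pi_H (f_polyVd p)) \/
      inv_V p /\ a = \pi_Hc (\pi_H (f_polyV p)))].

Definition Hbar : Type := quotalg Hc_coinv.
HB.instance Definition _ := PzAlgebra.on Hbar.
HB.instance Definition _ := Quotient.copy Hbar (quotalg Hc_coinv).

Definition to_Hbar (h : H) : Hbar := \pi_Hbar (\pi_Hc h).

(* The tensor product of Hbar and E over the subalgebra generated by V and W, *)
(* where V acts by 0 on E: Hbar (x)_C E is free over Hbar on the basis (e_j)  *)
(* of E, and it suffices to impose hb (x) e = h (x) be for b in V or W.       *)
Section BabyVerma.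
Context (E : rep).

Definition verma_e (j : 'I_(rep_dim E)) : 'cV[Hbar]_(rep_dim E) := delta_mx j 0.

Inductive verma_rel : set 'cV[Hbar]_(rep_dim E) :=
| VermaV u j : verma_rel (to_Hbar (\pi_H (f_V u)) *: verma_e j)
| VermaW w j : verma_rel
    (to_Hbar (H_gen (GenW w)) *: verma_e j
     - \sum_k (algc (rep_mx E w k j) : Hbar) *: verma_e k).

Definition baby_verma : Type := quotmod verma_rel.
HB.instance Definition _ := GRing.Lmodule.on baby_verma.

(* A submodule with simple quotient; it is unique. *)
Definition verma_max : set baby_verma :=
  xget setT [set N : set baby_verma |
    is_submod N /\ simple_module (quotmod N : lmodType Hbar)].

Definition simple_L : Type := quotmod verma_max.
HB.instance Definition _ := GRing.Lmodule.on simple_L.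

End BabyVerma.

Definition acts_by (E : rep) (om : {linear asmod Z -> C^o}) : Prop :=
  forall (z : Z) (m : simple_L E),
    to_Hbar (centre_val z) *: m = (algc (om z) : Hbar) *: m.

(* Omega_chi^c; the fallback value is never used. *)
Definition Omega (chi : Irr) : {linear asmod Z -> C^o} :=
  if pselect (exists om, acts_by (irr_rep chi) om) is left e
  then sval (cid e) else \0.

Definition is_family (fam : set Irr) : Prop :=
  exists chi, fam = [set chi' | forall z : Z, Omega chi' z = Omega chi z].

(* In a family all Omega_chi coincide, so this is ker Omega_chi in Z_c for    *)
(* each chi in it.                                                            *)
Definition fam_max (fam : set Irr) : {pred asmod Zc} := fun u =>
  `[< exists2 z : Z, \pi_Zc z = u & forall chi, fam chi -> Omega chi z = 0 >].

Lemma fam_max_closed fam : submod_closed (fam_max fam).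
Proof.
split.
  apply/asboolP; exists 0; last by move=> chi _; rewrite linear0.
  by apply: (addrI (\pi_Zc 0)); rewrite -quotalg_piD !addr0.
move=> a u v /asboolP[z <- hz] /asboolP[z' <- hz']; apply/asboolP.
exists (algc a * z + z'); first by rewrite quotalg_piD quotalg_piM.
move=> chi hchi; have := linearP (Omega chi) a z z'.
by rewrite hz // hz' // scaler0 addr0.
Qed.

HB.instance Definition _ fam := GRing.isSubmodClosed.Build _ _
  (fam_max fam) (fam_max_closed fam).

(* The bracket induced on Z_c; independent of the representatives. *)
Definition poisson_c (u v : Zc) : Zc := \pi_Zc (poisson (repr u) (repr v)).

Definition cuspidal (fam : set Irr) : Prop :=
  forall u v, u \in fam_max fam -> v \in fam_max fam ->
    poisson_c u v \in fam_max fam.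

Section LieOfFamily.
Context (fam : set Irr).

Record fam_ideal : Type :=
  FamIdeal { fam_ideal_val : asmod Zc; _ : fam_ideal_val \in fam_max fam }.

HB.instance Definition _ := [isSub for fam_ideal_val].
HB.instance Definition _ := [Choice of fam_ideal by <:].
HB.instance Definition _ := [SubChoice_isSubLmodule of fam_ideal by <:].

Definition Lie : Type :=
  quotmod [set x : fam_ideal | exists a b : fam_ideal,
    val x = (val a : Zc) * (val b : Zc)].
HB.instance Definition _ := GRing.Lmodule.on Lie.
HB.instance Definition _ := Quotient.copy Lie
  (quotmod [set x : fam_ideal | exists a b : fam_ideal,
    val x = (val a : Zc) * (val b : Zc)]).

(* For a cuspidal family, insubd does not use its fallback value, and the     *)
(* result does not depend on the representatives.                             *)
Definition lie_br (u v : Lie) : Lie :=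
  \pi_Lie (insubd (0 : fam_ideal) (poisson_c (val (repr u)) (val (repr v)))).

End LieOfFamily.

End Cherednik.

Arguments lie_br {R} d {zeta} c fam.

(* Main.v *)
(* The maximal ideal m of a cuspidal family is generated modulo m^2 by         *)

(* Write $\mathfrak m$ for the maximal ideal of the cuspidal family and $\mathfrak g=\mathfrak
   m/\mathfrak m^2$. The plan is to find explicit generators of $Z$, to read off from them that
   $\mathfrak g$ is spanned by $d+4$ classes on which an $\mathfrak{sl}_2$ acts, and to recognise
   $\mathfrak g$ by its decomposition under this $\mathfrak{sl}_2$: $V(2)\oplus V(4)$ for
   $\mathfrak{sl}_3$ and $V(2)\oplus V(6)$ for $\mathfrak{sp}_4$, where the $\mathfrak{sl}_2$ is the
   principal one.

   The algebra and its centre. Inducing a module $E$ from the subalgebra generated by $V$, $W$, $T$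
   and the $C_r$ gives $\mathbb C[X,Y]\otimes E$ with Dunkl operators ([vop_cmod]). The regular
   choice of $E$ yields the PBW theorem ([reg_lift_act]). Hence $T$ is not a zero divisor
   ([Ht_torsion_free]), the Poisson bracket can be computed from arbitrary lifts ([poissonE]), and
   the centre acts faithfully on $\mathbf He$, $e$ the trivial idempotent ([H_triv_faithful]).
   Filtering $\mathbf He$ by degree reduces the determination of $Z$ to polynomial invariants of $W$
   on $V\oplus V^*$; therefore $Z$ is generated by the $C_r$, $q=xy$, $Q=XY$, $eu$ and the polarised
   power sums $a_0,\dots,a_d$ ([centre_generated]).

   The bracket. The elements $q$, $Q$ and $a_0$ vanish in the restricted algebra, so they lie in
   $\mathfrak m$. Cuspidality puts $eu=\{q,Q\}$ in $\mathfrak m$, and then all $a_i$, because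
   $\{Q,a_i\}=-(i+1)a_{i+1}$. So $\mathfrak g$ is spanned by the classes of these elements
   ([Lie_gen]), with $a_i$ of weight $2i-d$ for $eu$. Weights and Jacobi identities give
   $[a_4,a_1]=kQ$ for $d=4$ and $[a_6,a_3]=ka_6$ for $d=6$, and express every other bracket by $k$
   ([A2_conclusion], [B2_conclusion]). If $k\ne0$, simple root vectors are found among the elements
   of weight $2$. The Serre relations then give a family spanning $\mathfrak g$, and comparison with
   matrices gives both independence and simplicity ([typeA2], [typeB2]).

   The scalar $k$ is nonzero. This is tested on $\mathbb C[X,Y]\otimes V$, the standard module at
   $c$ attached to the reflection representation. Elements of $\mathfrak m$ map it into a submodule
   spanned by monomials, so some matrix coefficient vanishes on $\mathfrak m^2$ ([gam_detect]). The
   coefficient of the relevant bracket, computed by a verified calculator on lists of monomials, is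
   $16(p^2+n^2)$ for $d=4$ and $12pn$ for $d=6$, where $p$ and $n$ are $d/2$ times $a+b$ and
   $a-b$. *)
(* q = xy, Q = XY, eu = {q, Q} and the coefficients a_0, ..., a_d of s^i in    *)
(* (x + sY)^d + (y + sX)^d, and {q, Q, eu} acts on span(a_i) as sl_2 on its    *)
(* irreducible module of dimension d + 1. The sl_2-weights and the Jacobi      *)
(* identity then determine the whole bracket from {a_4, a_1} for d = 4 and     *)
(* from {a_6, a_3} for d = 6, and it suffices to see that these classes are    *)
(* nonzero in m/m^2. This is detected on C[X, Y] (x) V, the standard module of *)
(* H_c for the reflection representation: the elements of m raise a filtration *)
(* of it, so that a suitable matrix coefficient vanishes on m^2. Chevalley     *)
(* generators are then eigenvectors of a_2 (d = 4) or a_3 (d = 6), and the     *)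
(* Serre relations give the isomorphism and the simplicity.                    *)
Require Import Defs.

From mathcomp Require Import all_boot all_order all_algebra.
From mathcomp Require Import ring.
Set Implicit Arguments.
Unset Strict Implicit.
Unset Printing Implicit Defensive.
Import GRing.Theory.
Local Open Scope ring_scope.

(** * Equalities between linear combinations, by reflection *)

Module LinearTacticsPart.

Section LinearExpressions.
Context {K : pzRingType} {V : lmodType K}.

Inductive lexp : Type :=
| LVar of nat | LZero | LAdd of lexp & lexp | LOpp of lexp
| LScale of K & lexp | LMuln of lexp & nat.

Fixpoint leval (env : seq V) (e : lexp) : V :=
  match e with
  | LVar n => env`_n
  | LZero => 0
  | LAdd a b => leval env a + leval env b
  | LOpp a => - leval env a
  | LScale c a => c *: leval env a
  | LMuln a n => leval env a *+ n
  end.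

Fixpoint lcoef (e : lexp) (i : nat) : K :=
  match e with
  | LVar n => if n == i then 1 else 0
  | LZero => 0
  | LAdd a b => lcoef a i + lcoef b i
  | LOpp a => - lcoef a i
  | LScale c a => c * lcoef a i
  | LMuln a n => lcoef a i *+ n
  end.

Lemma levalE env e : leval env e = \sum_(i < size env) lcoef e i *: env`_i.
Proof.
elim: e => [n||a IHa b IHb|a IHa|c a IHa|a IHa n] /=.
- have [lt|ge] := ltnP n (size env); last first.
    rewrite nth_default // big1 // => i _.
    by rewrite gtn_eqF ?scale0r // (leq_trans (ltn_ord i)).
  rewrite (bigD1 (Ordinal lt)) //= eqxx scale1r big1 ?addr0 // => i.
  by rewrite -val_eqE /= eq_sym => /negPf ->; rewrite scale0r.
- by rewrite big1 // => i _; rewrite scale0r.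
- by rewrite IHa IHb -big_split; apply: eq_bigr => i _; rewrite scalerDl.
- by rewrite IHa -sumrN; apply: eq_bigr => i _; rewrite scaleNr.
- by rewrite IHa scaler_sumr; apply: eq_bigr => i _; rewrite scalerA.
- by rewrite IHa -sumrMnl; apply: eq_bigr => i _; rewrite scalerMnl.
Qed.

Fixpoint all_lt (n : nat) (P : nat -> Prop) : Prop :=
  if n is n'.+1 then P n' /\ all_lt n' P else True.

(** Comparing coefficients is sufficient whether or not the atoms are independent. What remains are
    scalar identities, which [ring] or [field] can settle. *)
Lemma leval_eq env e1 e2 :
  all_lt (size env) (fun i => lcoef e1 i = lcoef e2 i) ->
  leval env e1 = leval env e2.
Proof.
move=> h; rewrite !levalE; apply: eq_bigr => i _; congr (_ *: _).
elim: (size env) h i => [|n IH] /= h; first by case.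
by move=> i; case: h => h1 h2; have := ltn_ord i; rewrite ltnS leq_eqVlt =>
  /orP[/eqP ->|lt] //; exact: (IH h2 (Ordinal lt)).
Qed.

End LinearExpressions.

(* Atoms are compared up to conversion, since structure instances may differ. *)
Ltac lm_unify x y := match goal with _ => unify x y end.

Ltac lm_add x l :=
  match l with
  | nil => constr:(x :: l)
  | ?y :: _ => let _ := lm_unify x y in l
  | ?y :: ?t => let t' := lm_add x t in constr:(y :: t')
  end.

Ltac lm_atoms e l :=
  lazymatch e with
  | (?a + ?b)%R => let l1 := lm_atoms a l in lm_atoms b l1
  | (- ?a)%R => lm_atoms a l
  | (?c *: ?a)%R => lm_atoms a l
  | (?a *+ ?n)%R => lm_atoms a l
  | 0%R => l
  | _ => lm_add e l
  end.

Ltac lm_index x l :=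
  match l with
  | ?y :: _ => let _ := lm_unify x y in constr:(0%N)
  | _ :: ?t => let n := lm_index x t in constr:(S n)
  end.

Ltac lm_quote K e l :=
  lazymatch e with
  | (?a + ?b)%R => let a' := lm_quote K a l in let b' := lm_quote K b l in
                   constr:(@LAdd K a' b')
  | (- ?a)%R => let a' := lm_quote K a l in constr:(@LOpp K a')
  | (?c *: ?a)%R => let a' := lm_quote K a l in constr:(@LScale K c a')
  | (?a *+ ?n)%R => let a' := lm_quote K a l in constr:(@LMuln K a' n)
  | 0%R => constr:(@LZero K)
  | _ => let n := lm_index e l in constr:(@LVar K n)
  end.

(* Proves an equality between linear combinations of the same vectors. *)
Ltac lin_comb_over K V tac :=
  lazymatch goal with |- ?a = ?b =>
    let T := constr:(GRing.Lmodule.sort V) in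
    let l0 := lm_atoms a (@nil T) in
    let l := lm_atoms b l0 in
    let ea := lm_quote K a l in
    let eb := lm_quote K b l in
    change (@leval K V l ea = @leval K V l eb);
    apply: leval_eq; rewrite /=; repeat split; tac
  end.

Tactic Notation "lin_comb" constr(K) constr(V) := lin_comb_over K V ltac:(ring).

Tactic Notation "lin_comb" constr(K) constr(V) "by" tactic3(t) := lin_comb_over K V t.

(* Equalities in an abelian group A. *)
Tactic Notation "zmod_eq" constr(A) := lin_comb_over int (zmodule A) ltac:(by []).

End LinearTacticsPart.
Export LinearTacticsPart.

From HB Require Import structures.
From mathcomp Require Import all_boot all_order all_algebra.
From mathcomp Require Import complex finmap monalg.
From mathcomp Require Import boolp classical_sets reals.
Set Implicit Arguments.
Unset Strict Implicit.
Unset Printing Implicit Defensive.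
Import GRing.Theory.
Local Open Scope ring_scope.
Local Open Scope complex_scope.

(** * Free modules, and polynomials with coefficients in a free module *)

Module FreeModulesPart.

HB.lock Definition lext {K : comNzRingType} {B : choiceType} {N : lmodType K}
  (f : B -> N) (g : {malg K[B]}) : N := \sum_(k <- msupp g) g@_k *: f k.

Section LinearExtension.
Context {K : comNzRingType} {B : choiceType} {N : lmodType K}.

Lemma lextEw (f : B -> N) (g : {malg K[B]}) (D : {fset B}) :
  (msupp g `<=` D)%fset -> lext f g = \sum_(k <- D) g@_k *: f k.
Proof.
move=> sD; rewrite lext.unlock (big_fsetIDcond _ (mem (msupp g))) /=.
rewrite [X in _ = X](big_fsetIDcond _ (mem (msupp g))) /=.
rewrite [X in _ = _ + X]big1_fset ?addr0; last first.
  by move=> k; rewrite !inE /= => /andP[_ /mcoeff_outdom ->]; rewrite scale0r.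
rewrite [X in _ + X = _]big1_fset ?addr0; last first.
  by move=> k; rewrite !inE /= => /andP[-> ].
apply: eq_fbigl => k; rewrite !inE /=.
by case: (boolP (k \in msupp g)) => [/(fsubsetP sD) ->|]; rewrite ?andbF.
Qed.

Fact lext_linear (f : B -> N) : linear (lext f).
Proof.
move=> a u v; pose D := (msupp u `|` msupp v)%fset.
have su : (msupp u `<=` D)%fset by apply: fsubsetUl.
have sv : (msupp v `<=` D)%fset by apply: fsubsetUr.
have sw : (msupp (a *: u + v) `<=` D)%fset.
  apply: fsubset_trans (msuppD_le _ _) _; rewrite fsubUset sv andbT.
  exact: fsubset_trans (msuppZ_le _ _) su.
rewrite (lextEw f sw) (lextEw f su) (lextEw f sv) scaler_sumr -big_split.
by apply: eq_bigr => k _; rewrite mcoeffD mcoeffZ scalerDl scalerA.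
Qed.

HB.instance Definition _ (f : B -> N) := GRing.isLinear.Build K {malg K[B]} N _ (lext f)
  (lext_linear f).

Lemma lextUz (f : B -> N) a k : lext f << a *g k >> = a *: f k.
Proof. by rewrite (lextEw f (msuppU_le (k := k) (x := a))) big_seq_fset1 mcoeffUU. Qed.

Lemma lextU (f : B -> N) k : lext f << k >> = f k.
Proof. by rewrite lextUz scale1r. Qed.

End LinearExtension.

Lemma malg_decomp {K : comNzRingType} {B : choiceType} (g : {malg K[B]}) :
  g = \sum_(k <- msupp g) g@_k *: << k >>.
Proof.
rewrite {1}(monalgE g); apply: eq_bigr => k _.
by apply/malgP => k'; rewrite mcoeffZ !mcoeffU mulrnAr mulr1.
Qed.

Lemma malg_ind {K : comNzRingType} {B : choiceType} (P : {malg K[B]} -> Prop) :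
  P 0 -> (forall a u v, P u -> P v -> P (a *: u + v)) ->
  (forall k, P << k >>) -> forall g, P g.
Proof.
move=> P0 PD PU g; rewrite (malg_decomp g).
apply: (big_ind P P0) => [u v hu hv|k _].
  by have := PD 1 u v hu hv; rewrite scale1r.
by have := PD g@_k _ _ (PU k) P0; rewrite addr0.
Qed.

Lemma malg_eq {K : comNzRingType} {B : choiceType} {N : lmodType K}
    (f g : {linear {malg K[B]} -> N}) :
  (forall k, f << k >> = g << k >>) -> forall m, f m = g m.
Proof.
move=> h; apply: (malg_ind (P := fun m => f m = g m)).
- by rewrite !linear0.
- by move=> a u v hu hv; rewrite !linearP hu hv.
- exact: h.
Qed.

(* The free module on B, made opaque: unification must not unfold it. *)
Record freemod (K : comNzRingType) (B : choiceType) := FreeMod {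
  fm_mod : lmodType K;
  fm_b : B -> fm_mod;
  fm_ext : forall N : lmodType K, (B -> N) -> {linear fm_mod -> N};
  fm_extE : forall (N : lmodType K) (f : B -> N) k, fm_ext f (fm_b k) = f k;
  fm_ind : forall P : fm_mod -> Prop, P 0 ->
    (forall a u v, P u -> P v -> P (a *: u + v)) ->
    (forall k, P (fm_b k)) -> forall g, P g
}.

Lemma freemod_exists (K : comNzRingType) (B : choiceType) : freemod K B.
Proof.
pose F : lmodType K := {malg K[B]}.
apply: (@FreeMod K B F (fun k => << k >>) (fun N f => @lext K B N f)).
- by move=> N f k; exact: lextU.
- exact: (@malg_ind K B).
Qed.

Definition fmod (K : comNzRingType) (B : choiceType) : lmodType K :=
  fm_mod (freemod_exists K B).

Section FreeModule.
Context {K : comNzRingType} {B : choiceType}.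

Definition fb (k : B) : fmod K B := fm_b (freemod_exists K B) k.
Definition flext {N : lmodType K} (f : B -> N) : {linear fmod K B -> N} :=
  fm_ext (freemod_exists K B) f.

Lemma flextU {N : lmodType K} (f : B -> N) k : flext f (fb k) = f k.
Proof. exact: fm_extE. Qed.

Lemma fmod_ind (P : fmod K B -> Prop) : P 0 ->
  (forall a u v, P u -> P v -> P (a *: u + v)) ->
  (forall k, P (fb k)) -> forall g, P g.
Proof. exact: fm_ind. Qed.

Lemma fmod_eq {N : lmodType K} (f g : {linear fmod K B -> N}) :
  (forall k, f (fb k) = g (fb k)) -> forall m, f m = g m.
Proof.
move=> h; apply: (fmod_ind (P := fun m => f m = g m)).
- by rewrite !linear0.
- by move=> a u v hu hv; rewrite !linearP hu hv.
- exact: h.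
Qed.

End FreeModule.

(* [pmod] is the module of polynomials in two variables with coefficients in  *)
(* the free module on J; [fb (a, b, j)] is the monomial X^a Y^b (x) e_j.      *)
Notation pidx J := (nat * nat * J)%type.
Notation pmod K J := (fmod K (pidx J)).

Section PolyModule.
Context {K : comNzRingType} {J : choiceType}.
Local Notation E := (fmod K J).
Local Notation M := (pmod K J).

Definition pinj (a b : nat) : {linear E -> M} := flext (fun j => fb (a, b, j)).
Definition pX : {linear M -> M} := flext (fun k => fb (k.1.1.+1, k.1.2, k.2)).
Definition pY : {linear M -> M} := flext (fun k => fb (k.1.1, k.1.2.+1, k.2)).
Definition pcmap (f : E -> E) : {linear M -> M} :=
  flext (fun k => pinj k.1.1 k.1.2 (f (fb k.2))).

Lemma pX_D u v : pX (u + v) = pX u + pX v. Proof. exact: linearD. Qed.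
Lemma pY_D u v : pY (u + v) = pY u + pY v. Proof. exact: linearD. Qed.
Lemma pX_B u v : pX (u - v) = pX u - pX v. Proof. exact: linearB. Qed.
Lemma pY_B u v : pY (u - v) = pY u - pY v. Proof. exact: linearB. Qed.
Lemma pX_Z a u : pX (a *: u) = a *: pX u. Proof. exact: linearZ_LR. Qed.
Lemma pY_Z a u : pY (a *: u) = a *: pY u. Proof. exact: linearZ_LR. Qed.
Lemma pcmap_D f u v : pcmap f (u + v) = pcmap f u + pcmap f v. Proof. exact: linearD. Qed.
Lemma pcmap_B f u v : pcmap f (u - v) = pcmap f u - pcmap f v. Proof. exact: linearB. Qed.
Lemma pcmap_Z f a u : pcmap f (a *: u) = a *: pcmap f u. Proof. exact: linearZ_LR. Qed.

Lemma pXU a b j : pX (fb (a, b, j)) = fb (a.+1, b, j).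
Proof. exact: flextU. Qed.
Lemma pYU a b j : pY (fb (a, b, j)) = fb (a, b.+1, j).
Proof. exact: flextU. Qed.
Lemma pinjU a b j : pinj a b (fb j) = fb (a, b, j).
Proof. exact: flextU. Qed.

Lemma pmod_ind (P : M -> Prop) :
  P 0 -> (forall a u v, P u -> P v -> P (a *: u + v)) ->
  (forall j, P (pinj 0 0 (fb j))) ->
  (forall m, P m -> P (pX m)) -> (forall m, P m -> P (pY m)) -> forall m, P m.
Proof.
move=> P0 PD PJ PX PY; apply: fmod_ind => // -[[a b] j].
elim: a => [|a IH]; last by rewrite -pXU; apply: PX.
by elim: b => [|b IH]; [rewrite -pinjU | rewrite -pYU; apply: PY].
Qed.

Lemma pmod_eq {N : lmodType K} (f g : {linear M -> N}) :
  (forall j, f (pinj 0 0 (fb j)) = g (pinj 0 0 (fb j))) ->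
  (forall m, f m = g m -> f (pX m) = g (pX m)) ->
  (forall m, f m = g m -> f (pY m) = g (pY m)) -> forall m, f m = g m.
Proof.
move=> hJ hX hY; apply: (pmod_ind (P := fun m => f m = g m)).
- by rewrite !linear0.
- by move=> a u v hu hv; rewrite !linearP hu hv.
- exact: hJ.
- exact: hX.
- exact: hY.
Qed.

Lemma pXY m : pX (pY m) = pY (pX m).
Proof.
apply: (fmod_eq (f := pX \o pY) (g := pY \o pX)) => -[[a b] j] /=.
by rewrite pXU !pYU pXU.
Qed.

Lemma pX_inj a b e : pX (pinj a b e) = pinj a.+1 b e.
Proof.
apply: (fmod_eq (f := pX \o pinj a b) (g := pinj a.+1 b)) => j /=.
by rewrite !pinjU pXU.
Qed.

Lemma pY_inj a b e : pY (pinj a b e) = pinj a b.+1 e.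
Proof.
apply: (fmod_eq (f := pY \o pinj a b) (g := pinj a b.+1)) => j /=.
by rewrite !pinjU pYU.
Qed.

Lemma pcmapU f a b j : pcmap f (fb (a, b, j)) = pinj a b (f (fb j)).
Proof. exact: flextU. Qed.

Lemma pcmapX f m : pcmap f (pX m) = pX (pcmap f m).
Proof.
apply: (fmod_eq (f := pcmap f \o pX) (g := pX \o pcmap f)) => -[[a b] j] /=.
by rewrite pXU !pcmapU pX_inj.
Qed.

Lemma pcmapY f m : pcmap f (pY m) = pY (pcmap f m).
Proof.
apply: (fmod_eq (f := pcmap f \o pY) (g := pY \o pcmap f)) => -[[a b] j] /=.
by rewrite pYU !pcmapU pY_inj.
Qed.

Lemma pcmap_inj (f : {linear E -> E}) a b e : pcmap f (pinj a b e) = pinj a b (f e).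
Proof.
apply: (fmod_eq (f := pcmap f \o pinj a b) (g := pinj a b \o f)) => j /=.
by rewrite pinjU pcmapU.
Qed.

Section Recursion.
Context {N : lmodType K} (f0 : J -> N).
Context (QX QY : {linear N -> N}) (CX CY : {linear M -> N}).

Fixpoint prec_Y (b : nat) (j : J) : N :=
  if b is b'.+1 then QY (prec_Y b' j) + CY (fb (0, b', j)) else f0 j.
Fixpoint prec_XY (a b : nat) (j : J) : N :=
  if a is a'.+1 then QX (prec_XY a' b j) + CX (fb (a', b, j)) else prec_Y b j.
(** An operator known on the degree 0 part is continued to all polynomials by its rule for passing a
    variable: [QX], [QY] are the main terms and [CX], [CY] the commutator corrections. The action of
    W, the Dunkl operators and the maps out of induced modules are all of this form. *)
Definition prec : {linear M -> N} := flext (fun k => prec_XY k.1.1 k.1.2 k.2).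

Lemma prec0 j : prec (pinj 0 0 (fb j)) = f0 j.
Proof. by rewrite pinjU; exact: flextU. Qed.

Lemma precX m : prec (pX m) = QX (prec m) + CX m.
Proof.
apply: (fmod_eq (f := prec \o pX) (g := (QX \o prec) \+ CX)) => -[[a b] j] /=.
by rewrite pXU /prec !flextU.
Qed.

Hypothesis QC : forall n, QX (QY n) = QY (QX n).
Hypothesis QCC : forall m, QX (CY m) + CX (pY m) = QY (CX m) + CY (pX m).

(** The rule for Y is built in only on pure powers of Y. The hypotheses [QC] and [QCC] say that
    passing X and Y in either order gives the same result, and this propagates the rule by induction
    on the exponent of X. *)
Lemma precY m : prec (pY m) = QY (prec m) + CY m.
Proof.
apply: (fmod_eq (f := prec \o pY) (g := (QY \o prec) \+ CY)) => -[[a b] j] /=.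
elim: a => [|a IH]; first by rewrite pYU /prec !flextU.
by rewrite -pXU -pXY !precX IH !linearD -!addrA QCC QC.
Qed.

End Recursion.

End PolyModule.

End FreeModulesPart.
Export FreeModulesPart.

(** * Modules over the Cherednik algebra as families of operators *)

Module ModuleActionsPart.

Section Operators.
Context {R : realType} (d : nat) {zeta : R[i]}.
Local Notation C := R[i].
Local Notation gen := (gen zeta).
Local Notation F := (freealg C gen).

Notation gx := (GenV zeta 0).
Notation gy := (GenV zeta 1).
Notation gX := (GenVd zeta 0).
Notation gY := (GenVd zeta 1).

(** All reflection terms in the commutators of x, y with X, Y are, up to sign, of this form with k
    equal to 0, 1 or -1, the last one being written [d.-1]. Below, $\sigma_k$ denotes this
    operator. *)
Definition sigma {N : lmodType C} (op : gen -> {linear N -> N}) (k : nat) (m : N) : N :=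
  \sum_(i < d) zeta ^+ (i * k) *: op (GenC (ref_s zeta i)) (op (GenW (dih_s zeta i)) m).

Lemma sigma_linear {N : lmodType C} (op : gen -> {linear N -> N}) k :
  linear (sigma op k).
Proof.
move=> a u v; rewrite scaler_sumr -big_split; apply: eq_bigr => i _.
by rewrite (linearP (op (GenW _))) (linearP (op (GenC _))) scalerDr !scalerA mulrC.
Qed.

HB.instance Definition _ N op k :=
  GRing.isLinear.Build C N N _ (@sigma N op k) (@sigma_linear N op k).

(* Modules over the subalgebra generated by T, the C_r, V and W. *)
Record bmod {N : lmodType C} (op : gen -> {linear N -> N}) : Prop := Bmod {
  bmT : forall g m, op (GenT zeta) (op g m) = op g (op (GenT zeta) m);
  bmC : forall r g m, op (GenC r) (op g m) = op g (op (GenC r) m);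
  bmCconj : forall r r', ref_conj r r' -> forall m, op (GenC r) m = op (GenC r') m;
  bmW1 : forall m, op (GenW (dih1 zeta)) m = m;
  bmWM : forall w1 w2 m, op (GenW (dihM w1 w2)) m = op (GenW w1) (op (GenW w2) m);
  bmWx : forall w m, op (GenW w) (op gx m) =
    sval w 0 0 *: op gx (op (GenW w) m) + sval w 1 0 *: op gy (op (GenW w) m);
  bmWy : forall w m, op (GenW w) (op gy m) =
    sval w 0 1 *: op gx (op (GenW w) m) + sval w 1 1 *: op gy (op (GenW w) m);
  bmxy : forall m, op gx (op gy m) = op gy (op gx m)
}.

(** The remaining relations of the presentation, written on the bases. Because
    [pairing (alphav i) (alpha i)] is $2\zeta^i$, the relation for $[u,U]$ becomes
    $[x,X]=[y,Y]=T-\sigma_0$, $[x,Y]=\sigma_{-1}$ and $[y,X]=\sigma_1$. *)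
Record cmod {N : lmodType C} (op : gen -> {linear N -> N}) : Prop := Cmod {
  cm_bmod : bmod op;
  cmWX : forall w m, op (GenW w) (op gX m) =
    invmx (sval w) 0 0 *: op gX (op (GenW w) m) +
    invmx (sval w) 0 1 *: op gY (op (GenW w) m);
  cmWY : forall w m, op (GenW w) (op gY m) =
    invmx (sval w) 1 0 *: op gX (op (GenW w) m) +
    invmx (sval w) 1 1 *: op gY (op (GenW w) m);
  cmXY : forall m, op gX (op gY m) = op gY (op gX m);
  cmxX : forall m, op gx (op gX m) =
    op gX (op gx m) + (op (GenT zeta) m - sigma op 0 m);
  cmxY : forall m, op gx (op gY m) = op gY (op gx m) + sigma op d.-1 m;
  cmyX : forall m, op gy (op gX m) = op gX (op gy m) + sigma op 1 m;
  cmyY : forall m, op gy (op gY m) =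
    op gY (op gy m) + (op (GenT zeta) m - sigma op 0 m)
}.

Section Act.
Context {N : lmodType C} (op : gen -> {linear N -> N}).

Definition act (a : F) (m : N) : N :=
  lext (fun k : fmonom gen => foldr (fun g v => op g v) m k) a.

Definition actl m (a : {malg C[fmonom gen]}) : N := act a m.

Fact actl_linear m : linear (actl m).
Proof. by move=> a u v; rewrite /actl /act linearP. Qed.

HB.instance Definition _ m := GRing.isLinear.Build C {malg C[fmonom gen]} N _ (actl m)
  (actl_linear m).

Lemma act_gen g m : act (f_gen g) m = op g m.
Proof. by rewrite /act /f_gen lextU fmU. Qed.

Lemma act_algc a m : act (algc a) m = a *: m.
Proof.
have := lextUz (fun k : fmonom gen => foldr (fun g v => op g v) m k) a (mone : fmonom gen).
by rewrite fm1; exact.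
Qed.

Lemma act_linear a : linear (act a).
Proof.
move=> c u v.
pose f1 := actl (c *: u + v).
apply: (malg_eq (f := f1) (g := (c \*: actl u) \+ actl v)) => k.
rewrite /= /actl /act !lextU.
case: k => s /=; elim: s => [|g s IH] /=; first by [].
by rewrite IH linearP.
Qed.

HB.instance Definition _ a := GRing.isLinear.Build C N N _ (act a) (act_linear a).

Lemma actD a b m : act (a + b) m = act a m + act b m.
Proof. exact: (linearD (actl m) a b). Qed.
Lemma actB a b m : act (a - b) m = act a m - act b m.
Proof. exact: (linearB (actl m) a b). Qed.
Lemma act0 m : act 0 m = 0.
Proof. exact: (linear0 (actl m)). Qed.
Lemma act_sum (I : Type) (s : seq I) (P : pred I) (G : I -> F) m :
  act (\sum_(i <- s | P i) G i) m = \sum_(i <- s | P i) act (G i) m.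
Proof. exact: (linear_sum (actl m)). Qed.

Lemma actP c (u v : {malg C[fmonom gen]}) m :
  act (c *: u + v) m = c *: act u m + act v m.
Proof. exact: (linearP (actl m) c u v). Qed.

Lemma actZ c (u : {malg C[fmonom gen]}) m : act (c *: u) m = c *: act u m.
Proof. exact: (linearZ_LR (actl m)). Qed.

Lemma actM a b m : act (a * b) m = act a (act b m).
Proof.
pose A := {malg C[fmonom gen]}.
have h k : forall b : A, act (<< k >> * b : A) m = act << k >> (act b m).
  apply: (malg_ind (P := fun b : A => act (<< k >> * b : A) m = act << k >> (act b m))).
  - by rewrite mulr0 !act0 linear0.
  - move=> c u v hu hv.
    rewrite mulrDr -mul_malgC.
    have -> : << k >> * (c%:MP * u) = c *: (<< k >> * u) :> A.
      rewrite mulrA -(freealg_algc_central c (<< k >> : F)) -mulrA.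
      exact: mul_malgC.
    rewrite mul_malgC actD hv actZ hu (actP c u).
    exact/esym/(linearP (act << k >>)).
  move=> k'; rewrite [X in act X m]malgM_def fgmulUU mulr1 /act !lextU fmM.
  by rewrite foldr_cat.
apply: (malg_ind (P := fun a : A => act (a * b : A) m = act a (act b m))).
- by rewrite mul0r !act0.
- move=> c u v hu hv; rewrite (mulrDl (c *: u) v b) -(scalerAl c u b).
  by rewrite actD hv actZ hu (actP c u).
- by move=> k; exact: h.
Qed.

Lemma act1 m : act 1 m = m.
Proof.
have e : (algc 1 : F) = 1 := rmorph1 (@algc C F).
by have := act_algc 1 m; rewrite e scale1r.
Qed.

Lemma act_fV u m : act (f_V zeta u) m = u 0 0 *: op gx m + u 1 0 *: op gy m.
Proof.
have e (k : 'I_2) : act (algc (u k 0) * f_gen (GenV zeta k)) m = u k 0 *: op (GenV zeta k) m.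
  by rewrite actM act_algc act_gen.
rewrite /f_V act_sum (eq_bigr _ (fun k _ => e k)) !big_ord_recl big_ord0 addr0.
by rewrite (_ : lift ord0 ord0 = 1) //; apply: val_inj.
Qed.

Lemma act_fVd U m : act (f_Vd zeta U) m = U 0 0 *: op gX m + U 0 1 *: op gY m.
Proof.
have e (k : 'I_2) : act (algc (U 0 k) * f_gen (GenVd zeta k)) m = U 0 k *: op (GenVd zeta k) m.
  by rewrite actM act_algc act_gen.
rewrite /f_Vd act_sum (eq_bigr _ (fun k _ => e k)) !big_ord_recl big_ord0 addr0.
by rewrite (_ : lift ord0 ord0 = 1) //; apply: val_inj.
Qed.

End Act.
End Operators.

End ModuleActionsPart.
Export ModuleActionsPart.

From HB Require Import structures.
From mathcomp Require Import all_boot all_order all_algebra.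
From mathcomp Require Import generic_quotient.
From mathcomp Require Import complex finmap monalg ring.
From mathcomp Require Import boolp classical_sets reals.
Set Implicit Arguments.
Unset Strict Implicit.
Unset Printing Implicit Defensive.
Import GRing.Theory Num.Theory.
Local Open Scope ring_scope.
Local Open Scope complex_scope.
Local Open Scope quotient_scope.

(** * Equivalence of the operator relations with the presentation *)

Module PresentationsPart.

(** Modules over an algebra are also needed as vector spaces over the ground field; the alias
    carries the second structure. *)
Definition res {K : pzRingType} {A : pzAlgType K} (M : lmodType A) : Type := M.

Section Restriction.
Context {K : pzRingType} {A : pzAlgType K} (M : lmodType A).
HB.instance Definition _ := GRing.Zmodule.on (res M).
Definition res_scale (a : K) (x : res M) : res M := (algc a : A) *: (x : M).
Fact res_scaleA a b x : res_scale a (res_scale b x) = res_scale (a * b) x.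
Proof. by rewrite /res_scale scalerA rmorphM. Qed.
Fact res_scale1 : left_id 1 res_scale.
Proof. by move=> x; rewrite /res_scale rmorph1 scale1r. Qed.
Fact res_scaleDr : right_distributive res_scale +%R.
Proof. by move=> a x y; exact: scalerDr. Qed.
Fact res_scaleDl x : {morph res_scale^~ x : a b / a + b}.
Proof. by move=> a b; rewrite /res_scale rmorphD; exact: scalerDl. Qed.
HB.instance Definition _ := GRing.Zmodule_isLmodule.Build K (res M)
  res_scaleA res_scale1 res_scaleDr res_scaleDl.

Definition resmul (a : A) (x : res M) : res M := a *: (x : M).
Fact resmul_linear a : linear (resmul a).
Proof.
move=> c u v; transitivity ((a * algc c) *: (u : M) + a *: (v : M)).
  by rewrite -scalerA -scalerDr.
by rewrite -algc_central -scalerA.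
Qed.
HB.instance Definition _ a := GRing.isLinear.Build K (res M) (res M) _ (resmul a)
  (resmul_linear a).
End Restriction.

Section Relations.
Context {R : realType} {d : nat} {zeta : R[i]}.
Local Notation C := R[i].
Local Notation gen := (gen zeta).
Local Notation F := (freealg C gen).
Notation gx := (GenV zeta 0).
Notation gy := (GenV zeta 1).
Notation gX := (GenVd zeta 0).
Notation gY := (GenVd zeta 1).
Notation gT := (GenT zeta).

Lemma pairingE (u : 'cV[C]_2) (U : 'rV[C]_2) :
  pairing u U = U 0 0 * u 0 0 + U 0 1 * u 1 0.
Proof.
rewrite /pairing mxE !big_ord_recl big_ord0 addr0.
by rewrite (_ : lift ord0 ord0 = 1) //; apply: val_inj.
Qed.

Section AbstractAction.
Context {A : pzAlgType C} {N : lmodType C}.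

(* An action of an arbitrary algebra: keeping A abstract prevents unification *)
(* from unfolding the product of the free algebra. *)
Record isact (f : A -> N -> N) : Prop := IsAct {
  iaD : forall a b m, f (a + b) m = f a m + f b m;
  iaM : forall a b m, f (a * b) m = f a (f b m);
  iaC : forall a m, f (algc a) m = a *: m;
  iaL : forall a, linear (f a)
}.

Context (f : A -> N -> N) (hf : isact f).

Lemma ia0 m : f 0 m = 0.
Proof. by apply: (addrI (f 0 m)); rewrite -(iaD hf) !addr0. Qed.
Lemma iaN a m : f (- a) m = - f a m.
Proof. by apply: (addrI (f a m)); rewrite -(iaD hf) !subrr ia0. Qed.
Lemma iaB a b m : f (a - b) m = f a m - f b m.
Proof. by rewrite (iaD hf) iaN. Qed.
Lemma ia1 m : f 1 m = m.
Proof. by rewrite -(rmorph1 (@algc C A)) (iaC hf) scale1r. Qed.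
Lemma ia_sum (I : Type) (s : seq I) (P : pred I) (G : I -> A) m :
  f (\sum_(i <- s | P i) G i) m = \sum_(i <- s | P i) f (G i) m.
Proof. by apply: (big_morph (f^~ m)) => [a b|]; rewrite ?ia0 ?(iaD hf). Qed.
Lemma iaMn a m n : f (a *+ n) m = f a m *+ n.
Proof. by elim: n => [|n IH]; rewrite ?mulr0n ?ia0 // !mulrS (iaD hf) IH. Qed.
Lemma iaL0 a : f a 0 = 0.
Proof. by have := iaL hf a (-1) 0 0; rewrite scaler0 addr0 scaleN1r addNr. Qed.
Lemma iaLD a u v : f a (u + v) = f a u + f a v.
Proof. by have := iaL hf a 1 u v; rewrite !scale1r. Qed.
Lemma iaLZ a c u : f a (c *: u) = c *: f a u.
Proof. by have := iaL hf a c u 0; rewrite !addr0 iaL0 addr0. Qed.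
Lemma iaX a n m : f (a ^+ n) m = iter n (f a) m.
Proof. by elim: n m => [|n IH] m; rewrite ?expr0 ?ia1 // exprS (iaM hf) IH. Qed.

End AbstractAction.

Hypothesis hz : d.-primitive_root zeta.

Lemma zeta_unit : zeta != 0.
Proof.
apply/eqP => z0; have := prim_expr_order hz.
by rewrite z0 expr0n gtn_eqF ?(prim_order_gt0 hz) // => /eqP; rewrite eq_sym oner_eq0.
Qed.

Lemma zeta_inv i : zeta ^+ (i * d.-1) = (zeta ^+ i)^-1.
Proof.
apply: (mulfI (expf_neq0 i zeta_unit)); rewrite -exprD -mulnS divff ?expf_neq0 ?zeta_unit //.
by rewrite prednK ?(prim_order_gt0 hz) // mulnC exprM (prim_expr_order hz) expr1n.
Qed.

(** The denominator is $2\zeta^i$ and the factor 2 of the presentation cancels against it. Sorting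
    the product by powers of $\zeta^i$ leaves exponents 0, 1 and -1, hence the three sums
    $\sigma_0$, $\sigma_1$, $\sigma_{-1}$. *)
Lemma relVVd_coef (u : 'cV[C]_2) (U : 'rV[C]_2) i :
  (pairing u (alpha zeta i) * pairing (alphav zeta i) U
    / pairing (alphav zeta i) (alpha zeta i)) *+ 2 =
  (u 0 0 * U 0 0 + u 1 0 * U 0 1) - u 1 0 * U 0 0 * zeta ^+ (i * 1)
  - u 0 0 * U 0 1 * zeta ^+ (i * d.-1).
Proof.
rewrite zeta_inv muln1 !pairingE !mxE /= -mulr_natr.
have z0 : zeta ^+ i != 0 by rewrite expf_neq0 ?zeta_unit.
have z2 : zeta ^+ i *+ 2 != 0 by rewrite mulrn_eq0.
have -> : 1 * zeta ^+ i + - zeta ^+ i * -1 = zeta ^+ i *+ 2 by ring.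
by field; rewrite z0.
Qed.

Lemma mulmx2E m n (P : 'M[C]_(m, 2)) (Q : 'M[C]_(2, n)) i j :
  (P *m Q) i j = P i 0 * Q 0 j + P i 1 * Q 1 j.
Proof.
rewrite !mxE !big_ord_recl big_ord0 addr0.
by rewrite (_ : lift ord0 ord0 = 1) //; apply: val_inj.
Qed.

Section RelationEvaluation.
Context {A : pzAlgType C} {N : lmodType C} (f : A -> N -> N) (hf : isact f).
Context (g : gen -> A) (op : gen -> {linear N -> N}).
Hypothesis hg : forall h m, f (g h) m = op h m.
Let fV (u : 'cV[C]_2) : A := \sum_k algc (u k 0) * g (GenV zeta k).
Let fVd (U : 'rV[C]_2) : A := \sum_k algc (U 0 k) * g (GenVd zeta k).

Lemma ia_fV (u : 'cV[C]_2) m : f (fV u) m = u 0 0 *: op gx m + u 1 0 *: op gy m.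
Proof.
rewrite (ia_sum hf) !big_ord_recl big_ord0 addr0 !(iaM hf) !(iaC hf) !hg.
by rewrite (_ : lift ord0 ord0 = 1) //; apply: val_inj.
Qed.

Lemma ia_fVd (U : 'rV[C]_2) m : f (fVd U) m = U 0 0 *: op gX m + U 0 1 *: op gY m.
Proof.
rewrite (ia_sum hf) !big_ord_recl big_ord0 addr0 !(iaM hf) !(iaC hf) !hg.
by rewrite (_ : lift ord0 ord0 = 1) //; apply: val_inj.
Qed.

Lemma ia_comm a b m : f (a * b - b * a) m = f a (f b m) - f b (f a m).
Proof. by rewrite (iaB hf) !(iaM hf). Qed.

Lemma ia_relCconj h h' m : f (g h - g h') m = op h m - op h' m.
Proof. by rewrite (iaB hf) !hg. Qed.

Lemma ia_relW1 h m : f (g h - 1) m = op h m - m.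
Proof. by rewrite (iaB hf) (ia1 hf) hg. Qed.

Lemma ia_relWM h h1 h2 m : f (g h - g h1 * g h2) m = op h m - op h1 (op h2 m).
Proof. by rewrite (iaB hf) (iaM hf) !hg. Qed.

Lemma ia_relVV u u' m : f (fV u * fV u' - fV u' * fV u) m =
  (u 0 0 * u' 1 0 - u' 0 0 * u 1 0) *: (op gx (op gy m) - op gy (op gx m)).
Proof.
rewrite ia_comm !ia_fV !(linearD (op _)) !(linearZ_LR (op _)).
lin_comb C N.
Qed.

Lemma ia_relVdVd U U' m : f (fVd U * fVd U' - fVd U' * fVd U) m =
  (U 0 0 * U' 0 1 - U' 0 0 * U 0 1) *: (op gX (op gY m) - op gY (op gX m)).
Proof.
rewrite ia_comm !ia_fVd !(linearD (op _)) !(linearZ_LR (op _)).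
lin_comb C N.
Qed.

Lemma ia_relVVd tau (u : 'cV[C]_2) (U : 'rV[C]_2) m :
  f (fV u * fVd U - fVd U * fV u - (tau * algc (pairing u U) - 2%:R *
    \sum_(i < d) g (GenC (ref_s zeta i)) *
       algc (pairing u (alpha zeta i) * pairing (alphav zeta i) U /
             pairing (alphav zeta i) (alpha zeta i)) *
       g (GenW (dih_s zeta i)))) m =
  (u 0 0 * U 0 0) *: (op gx (op gX m) - op gX (op gx m)) +
  (u 0 0 * U 0 1) *: (op gx (op gY m) - op gY (op gx m)) +
  (u 1 0 * U 0 0) *: (op gy (op gX m) - op gX (op gy m)) +
  (u 1 0 * U 0 1) *: (op gy (op gY m) - op gY (op gy m)) -
  ((pairing u U) *: f tau m -
   ((u 0 0 * U 0 0 + u 1 0 * U 0 1) *: sigma d op 0 m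
    - (u 1 0 * U 0 0) *: sigma d op 1 m - (u 0 0 * U 0 1) *: sigma d op d.-1 m)).
Proof.
set fu := fV u; set fU := fVd U; set s := \sum_(i < d) _.
rewrite !(iaB hf) !(iaM hf) (iaC hf) (iaLZ hf); congr (_ - (_ - _)).
  rewrite !ia_fV !ia_fVd !(linearD (op _)) !(linearZ_LR (op _)).
  lin_comb C N.
rewrite -[2]/(1 *+ 2) (iaMn hf) (ia1 hf) (ia_sum hf) -sumrMnl.
rewrite /sigma !scaler_sumr -!sumrB; apply: eq_bigr => i _.
rewrite !(iaM hf) (iaC hf) (iaLZ hf) !hg scalerMnl relVVd_coef.
rewrite !scalerA -!scalerBl muln0 expr0 mulr1.
by congr (_ *: _); ring.
Qed.

Lemma ia_relVVdT (u : 'cV[C]_2) (U : 'rV[C]_2) m :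
  f (fV u * fVd U - fVd U * fV u - (g gT * algc (pairing u U) - 2%:R *
    \sum_(i < d) g (GenC (ref_s zeta i)) *
       algc (pairing u (alpha zeta i) * pairing (alphav zeta i) U /
             pairing (alphav zeta i) (alpha zeta i)) *
       g (GenW (dih_s zeta i)))) m =
  (u 0 0 * U 0 0) *: (op gx (op gX m) - op gX (op gx m)) +
  (u 0 0 * U 0 1) *: (op gx (op gY m) - op gY (op gx m)) +
  (u 1 0 * U 0 0) *: (op gy (op gX m) - op gX (op gy m)) +
  (u 1 0 * U 0 1) *: (op gy (op gY m) - op gY (op gy m)) -
  ((pairing u U) *: op gT m -
   ((u 0 0 * U 0 0 + u 1 0 * U 0 1) *: sigma d op 0 m
    - (u 1 0 * U 0 0) *: sigma d op 1 m - (u 0 0 * U 0 1) *: sigma d op d.-1 m)).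
Proof. by rewrite ia_relVVd hg. Qed.

Lemma ia_relWV (w : dihedral zeta) (u : 'cV[C]_2) m :
  f (g (GenW w) * fV u - fV (sval w *m u) * g (GenW w)) m =
  u 0 0 *: (op (GenW w) (op gx m) -
    (sval w 0 0 *: op gx (op (GenW w) m) + sval w 1 0 *: op gy (op (GenW w) m))) +
  u 1 0 *: (op (GenW w) (op gy m) -
    (sval w 0 1 *: op gx (op (GenW w) m) + sval w 1 1 *: op gy (op (GenW w) m))).
Proof.
rewrite (iaB hf) !(iaM hf) !ia_fV !hg (linearD (op _)) !(linearZ_LR (op _)) !mulmx2E.
lin_comb C N.
Qed.

Lemma ia_relWVd (w : dihedral zeta) (U : 'rV[C]_2) m :
  f (g (GenW w) * fVd U - fVd (U *m invmx (sval w)) * g (GenW w)) m =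
  U 0 0 *: (op (GenW w) (op gX m) - (invmx (sval w) 0 0 *: op gX (op (GenW w) m) +
    invmx (sval w) 0 1 *: op gY (op (GenW w) m))) +
  U 0 1 *: (op (GenW w) (op gY m) - (invmx (sval w) 1 0 *: op gX (op (GenW w) m) +
    invmx (sval w) 1 1 *: op gY (op (GenW w) m))).
Proof.
rewrite (iaB hf) !(iaM hf) !ia_fVd !hg (linearD (op _)) !(linearZ_LR (op _)) !mulmx2E.
lin_comb C N.
Qed.

End RelationEvaluation.

Lemma act_isact {N : lmodType C} (op : gen -> {linear N -> N}) :
  isact (A := F) (act op).
Proof.
split.
- exact: (@actD R zeta N op).
- exact: (@actM R zeta N op).
- exact: (@act_algc R zeta N op).
- exact: (@act_linear R zeta N op).
Qed.

Section Acts.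
Context {N : lmodType C} (op : gen -> {linear N -> N}).
Let hact := act_isact op.
Let hgen := @act_gen R zeta N op.

Lemma act_commute g a m (hg : forall h m, op g (op h m) = op h (op g m)) :
  act op (f_gen g) (act op a m) = act op a (act op (f_gen g) m).
Proof.
rewrite !hgen.
apply: (malg_ind (P := fun a => op g (act op a m) = act op a (op g m))).
- by rewrite !act0 linear0.
- by move=> c u w hu hw; rewrite !actP linearP hu hw.
- case=> s; rewrite /act !lextU /=.
  by elim: s => [|h s IH] //=; rewrite hg IH.
Qed.

(** The element [tau] only has to act as T does, so the lemma covers the relations with parameter T
    as well as those with parameter 0 on modules where T acts by zero. *)
Lemma act_rel tau a m : cmod d op -> (forall m, act op tau m = op gT m) ->
  cher_rel d tau a -> act op a m = 0.
Proof.
move=> cm htau; have bm := cm_bmod cm; case.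
- move=> b; apply: etrans (ia_comm hact _ _ _) _.
  by rewrite (act_commute b m (bmT bm)) subrr.
- move=> r b; apply: etrans (ia_comm hact _ _ _) _.
  by rewrite (act_commute b m (bmC bm r)) subrr.
- move=> r r' h; apply: etrans (ia_relCconj hact hgen _ _ _) _.
  by rewrite (bmCconj bm h) subrr.
- by apply: etrans (ia_relW1 hact hgen _ _) _; rewrite (bmW1 bm) subrr.
- move=> w1 w2; apply: etrans (ia_relWM hact hgen _ _ _ _) _.
  by rewrite (bmWM bm) subrr.
- move=> w u; apply: etrans (ia_relWV hact hgen _ _ _) _.
  by rewrite (bmWx bm) (bmWy bm) !subrr !scaler0 addr0.
- move=> w U; apply: etrans (ia_relWVd hact hgen _ _ _) _.
  by rewrite (cmWX cm) (cmWY cm) !subrr !scaler0 addr0.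
- move=> u u'; apply: etrans (ia_relVV hact hgen _ _ _) _.
  by rewrite (bmxy bm) subrr scaler0.
- move=> U U'; apply: etrans (ia_relVdVd hact hgen _ _ _) _.
  by rewrite (cmXY cm) subrr scaler0.
- move=> u U; apply: etrans (ia_relVVd hact hgen _ _ _ _) _.
  rewrite htau (cmxX cm) (cmxY cm) (cmyX cm) (cmyY cm) pairingE.
  lin_comb C N.
Qed.

Lemma act_ideal : is_ideal (fun a => forall m, act op a m = 0).
Proof.
split.
- exact: (ia0 hact).
- by move=> x y hx hy m; apply: etrans (iaB hact _ _ _) _; rewrite hx hy subrr.
- by move=> a x hx m; apply: etrans (iaM hact _ _ _) _; rewrite hx linear0.
- by move=> a x hx m; apply: etrans (iaM hact _ _ _) _; rewrite hx.
Qed.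

End Acts.

Section AlgebraActions.
Context {A : pzAlgType C} (psi : {rmorphism F -> A}).
Hypothesis psiC : forall a, psi (algc a) = algc a.
Hypothesis psi0 : forall a, cher_rel d (f_gen gT) a -> psi a = 0.
Context (M : lmodType A).

Definition psi_op (g : gen) : {linear res M -> res M} := resmul (M := M) (psi (f_gen g)).

Definition psi_act (a : F) (m : res M) : res M := resmul (psi a) m.

Lemma psi_isact : isact (A := F) psi_act.
Proof.
split.
- move=> a b m; rewrite /psi_act rmorphD; exact: (@scalerDl A M m).
- move=> a b m; rewrite /psi_act rmorphM; exact/esym/(@scalerA A M).
- by move=> a m; rewrite /psi_act psiC.
- by move=> a; exact: resmul_linear.
Qed.

Let hgen g (m : res M) : psi_act (f_gen g) m = psi_op g m.
Proof. by []. Qed.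

Lemma psi_rel a : cher_rel d (f_gen gT) a -> forall m, psi_act a m = 0.
Proof. move=> /psi0 h m; rewrite /psi_act h; exact: (@scale0r A M). Qed.

(** Converse of [act_rel]: the relations hold for all u and U, and evaluating them at basis vectors
    isolates each coordinate relation. *)
Lemma psi_cmod : cmod d psi_op.
Proof.
have hf := psi_isact.
pose ux : 'cV[C]_2 := \col_k (if k == 0 then 1 else 0).
pose uy : 'cV[C]_2 := \col_k (if k == 0 then 0 else 1).
pose UX : 'rV[C]_2 := \row_k (if k == 0 then 1 else 0).
pose UY : 'rV[C]_2 := \row_k (if k == 0 then 0 else 1).
have e := (mxE, eqxx, scale1r, scale0r, addr0, add0r, mulr1, mulr0, mul0r, subr0).
split; first split.
- move=> g m; apply: subr0_eq; have := psi_rel (RelT d (f_gen gT) (f_gen g)) m.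
  by move=> <-; rewrite (ia_comm hf).
- move=> r g m; apply: subr0_eq; have := psi_rel (RelC d (f_gen gT) r (f_gen g)) m.
  by move=> <-; rewrite (ia_comm hf).
- move=> r r' h m; apply: subr0_eq; have := psi_rel (RelCconj d (f_gen gT) h) m.
  by rewrite (ia_relCconj hf hgen).
- move=> m; apply: subr0_eq; have := psi_rel (RelW1 d (f_gen gT)) m.
  by rewrite (ia_relW1 hf hgen).
- move=> w1 w2 m; apply: subr0_eq; have := psi_rel (RelWM d (f_gen gT) w1 w2) m.
  by rewrite (ia_relWM hf hgen).
- move=> w m; apply: subr0_eq; have := psi_rel (RelWV d (f_gen gT) w ux) m.
  by rewrite (ia_relWV hf hgen) !e.
- move=> w m; apply: subr0_eq; have := psi_rel (RelWV d (f_gen gT) w uy) m.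
  by rewrite (ia_relWV hf hgen) !e.
- move=> m; apply: subr0_eq; have := psi_rel (RelVV d (f_gen gT) ux uy) m.
  by rewrite (ia_relVV hf hgen) !e.
- move=> w m; apply: subr0_eq; have := psi_rel (RelWVd d (f_gen gT) w UX) m.
  by rewrite (ia_relWVd hf hgen) !e.
- move=> w m; apply: subr0_eq; have := psi_rel (RelWVd d (f_gen gT) w UY) m.
  by rewrite (ia_relWVd hf hgen) !e.
- move=> m; apply: subr0_eq; have := psi_rel (RelVdVd d (f_gen gT) UX UY) m.
  by rewrite (ia_relVdVd hf hgen) !e.
- move=> m; have := psi_rel (RelVVd d (f_gen gT) ux UX) m.
  rewrite (ia_relVVdT hf hgen) pairingE !e => h; apply: subr0_eq; rewrite -h.
  lin_comb C (res M).
- move=> m; have := psi_rel (RelVVd d (f_gen gT) ux UY) m.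
  rewrite (ia_relVVdT hf hgen) pairingE !e => h; apply: subr0_eq; rewrite -h.
  lin_comb C (res M).
- move=> m; have := psi_rel (RelVVd d (f_gen gT) uy UX) m.
  rewrite (ia_relVVdT hf hgen) pairingE !e => h; apply: subr0_eq; rewrite -h.
  lin_comb C (res M).
- move=> m; have := psi_rel (RelVVd d (f_gen gT) uy UY) m.
  rewrite (ia_relVVdT hf hgen) pairingE !e => h; apply: subr0_eq; rewrite -h.
  lin_comb C (res M).
Qed.

End AlgebraActions.
End Relations.

End PresentationsPart.
Export PresentationsPart.

From HB Require Import structures.
From mathcomp Require Import all_boot all_order all_algebra.
From mathcomp Require Import generic_quotient.
From mathcomp Require Import complex finmap monalg ring zify.
From mathcomp Require Import boolp classical_sets reals.
Set Implicit Arguments.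
Unset Strict Implicit.
Unset Printing Implicit Defensive.
Import GRing.Theory Num.Theory.
Local Open Scope ring_scope.
Local Open Scope complex_scope.
Local Open Scope quotient_scope.

(** * Elements of the dihedral group and commutation rules for the reflection sums *)

Module DihedralActionPart.

Section PeriodicSums.
Context {V : zmodType} {d : nat} (f : nat -> V).
Hypothesis fd : forall i, f (i + d)%N = f i.

Lemma periodM i q : f (i + q * d)%N = f i.
Proof. by elim: q => [|q IH]; rewrite ?addn0 // mulSnr addnA fd IH. Qed.

Lemma period_mod i j : (i %% d = j %% d)%N -> f i = f j.
Proof.
by move=> e; rewrite (divn_eq i d) (divn_eq j d) ![(_ * d + _)%N]addnC !periodM e.
Qed.

(** Modulo d the map [g] is injective, hence a permutation of the residues. *)
Lemma sum_period_perm (g : nat -> nat) :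
  (forall i j, i < d -> j < d -> g i %% d = g j %% d -> i = j)%N ->
  \sum_(i < d) f (g i) = \sum_(i < d) f i.
Proof.
move=> inj; have lt (i : 'I_d) : (g i %% d < d)%N.
  by apply: ltn_pmod; exact: leq_ltn_trans (leq0n i) (ltn_ord i).
pose h i := Ordinal (lt i).
have hinj : injective h.
  by move=> i j /(congr1 val) /= e; apply: val_inj; exact: (inj _ _ (ltn_ord i) (ltn_ord j)).
rewrite [RHS](reindex_inj hinj); apply: eq_bigr => i _.
by apply: period_mod; rewrite modn_mod.
Qed.

End PeriodicSums.

Section DihedralElements.
Context {R : realType} {d : nat} {zeta : R[i]}.
Hypothesis hz : d.-primitive_root zeta.
Local Notation C := R[i].
Local Notation s_mx := (s_mx zeta).
Local Notation dih_s := (dih_s zeta).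
Let zu := zeta_unit hz.

Lemma dihedral_eq (w w' : dihedral zeta) : sval w = sval w' -> w = w'.
Proof. by case: w w' => [w p] [w' p'] /= e; case: w' / e p' => p'; congr exist; apply: Prop_irrelevance. Qed.

Lemma s_mxE i : (s_mx i 0 0 = 0) * (s_mx i 0 1 = zeta ^+ i) *
  (s_mx i 1 0 = (zeta ^+ i)^-1) * (s_mx i 1 1 = 0).
Proof. by rewrite !mxE. Qed.

Lemma mx2P (P Q : 'M[C]_2) : P 0 0 = Q 0 0 -> P 0 1 = Q 0 1 ->
  P 1 0 = Q 1 0 -> P 1 1 = Q 1 1 -> P = Q.
Proof.
move=> h00 h01 h10 h11; apply/matrixP => i j.
have e (k : 'I_2) : k = 0 \/ k = 1.
  by case: k => -[|[|//]] hk; [left|right]; apply: val_inj.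
by case: (e i) => ->; case: (e j) => ->.
Qed.

Lemma s_mxK i : s_mx i *m s_mx i = 1%:M.
Proof.
apply: mx2P; rewrite mulmx2E !s_mxE !mxE /= ?mul0r ?mulr0 ?addr0 ?add0r //.
  by rewrite divff ?expf_neq0.
by rewrite mulVf ?expf_neq0.
Qed.

Lemma s_mx_unit i : s_mx i \in unitmx.
Proof. by case: (mulmx1_unit (s_mxK i)). Qed.

Lemma invmx_s i : invmx (s_mx i) = s_mx i.
Proof. by rewrite -[LHS]mulmx1 -(s_mxK i) mulmxA mulVmx ?s_mx_unit // mul1mx. Qed.

Lemma invmx_mul (A B : 'M[C]_2) : A \in unitmx -> B \in unitmx ->
  invmx (A *m B) = invmx B *m invmx A.
Proof.
move=> uA uB; have u : A *m B \in unitmx by rewrite unitmx_mul uA.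
rewrite -[RHS](mulKmx u) -[in RHS]mulmxA (mulmxA B) mulmxV // mul1mx mulmxV //.
by rewrite mulmx1.
Qed.

Lemma dih_s_period i j : (i = j %[mod d])%N -> dih_s i = dih_s j.
Proof.
move=> e; apply: dihedral_eq; apply: mx2P => /=; rewrite !s_mxE //.
  by apply/eqP; rewrite (eq_prim_root_expr hz) e.
by congr (_^-1); apply/eqP; rewrite (eq_prim_root_expr hz) e.
Qed.

Lemma ref_s_eq i j : dih_s i = dih_s j -> ref_s zeta i = ref_s zeta j.
Proof.
move=> e; rewrite /ref_s; move: (ex_intro _ i _) (ex_intro _ j _) => /=.
by rewrite e => p q; congr exist; apply: Prop_irrelevance.
Qed.

(* Both products are the rotation diag (zeta^(i-j), zeta^(j-i)). *)
Lemma dih_ss i j k l : (i + l = j + k %[mod d])%N ->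
  dihM (dih_s i) (dih_s j) = dihM (dih_s k) (dih_s l).
Proof.
move=> e; have ez : zeta ^+ i * zeta ^+ l = zeta ^+ j * zeta ^+ k.
  by rewrite -!exprD; apply/eqP; rewrite (eq_prim_root_expr hz) e.
have u a : zeta ^+ a != 0 by rewrite expf_neq0.
apply: dihedral_eq; apply: mx2P => /=; rewrite !mulmx2E !s_mxE ?mul0r ?mulr0 ?addr0 ?add0r //.
  by apply/eqP; rewrite eqr_div // ez mulrC.
by rewrite mulrC [RHS]mulrC; apply/eqP; rewrite eqr_div // -ez mulrC.
Qed.

Lemma dihM_s0K w : dihM (dihM w (dih_s 0)) (dih_s 0) = w.
Proof. by apply: dihedral_eq => /=; rewrite -mulmxA s_mxK mulmx1. Qed.

(** The product $s_is_j$ depends only on $i-j$, so it equals $s_{i-j}s_0$. This makes the set of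
    reflections $s_j$ and rotations $s_js_0$ closed under products and inverses. *)
Lemma dihedral_shape w : exists j, w = dih_s j \/ w = dihM (dih_s j) (dih_s 0).
Proof.
pose P (m : 'M[C]_2) := exists j, m = s_mx j \/ m = s_mx j *m s_mx 0.
suff h m : in_W zeta m -> P m.
  by case: (h _ (asboolW (svalP w))) => j [] e; exists j; [left|right]; apply: dihedral_eq.
have ss i j k l (e : (i + l = j + k %[mod d])%N) : s_mx i *m s_mx j = s_mx k *m s_mx l.
  by have /(congr1 sval) := dih_ss e.
have d0 := prim_order_gt0 hz.
have ssM i j : exists k, s_mx i *m s_mx j = s_mx k *m s_mx 0.
  by exists (i + j * d.-1)%N; apply: ss; rewrite addn0 addnCA -mulnS prednK // -modnDmr modnMl addn0.
have sss i j : exists k, s_mx i *m s_mx 0 *m s_mx j = s_mx k.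
  by exists (i + j)%N; rewrite (ss i 0 (i + j)%N j)%N ?add0n // -mulmxA s_mxK mulmx1.
elim.
- by exists 0%N; left.
- by exists 1%N; left.
- by exists 0%N; right; rewrite s_mxK.
- move=> w1 w2 _ [i [->|->]] _ [j [->|->]].
  + by have [k e] := ssM i j; exists k; right.
  + by rewrite mulmxA; have [k ->] := ssM i j; rewrite -mulmxA s_mxK mulmx1; exists k; left.
  + by have [k e] := sss i j; exists k; left.
  + by rewrite mulmxA; have [k ->] := sss i j; exists k; right.
- move=> w1 _ [i [->|->]]; first by exists i; left; rewrite invmx_s.
  have [k e] := ssM 0%N i; exists k; right; rewrite -e.
  have h : s_mx 0 *m s_mx i *m (s_mx i *m s_mx 0) = 1%:M.
    by rewrite mulmxA -(mulmxA (s_mx 0)) s_mxK mulmx1 s_mxK.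
  have [_ ui] := mulmx1_unit h.
  by rewrite -[LHS]mul1mx -h -(mulmxA (s_mx 0 *m s_mx i)) mulmxV // mulmx1.
Qed.

Lemma dihedral_unit (w : dihedral zeta) : sval w \in unitmx.
Proof.
have [j [->|->]] := dihedral_shape w; first exact: s_mx_unit.
by rewrite /= unitmx_mul !s_mx_unit.
Qed.

Lemma ref_conj_sym r r' : ref_conj (zeta := zeta) r r' -> ref_conj r' r.
Proof.
case=> w e; have u := dihedral_unit w.
exists (exist _ (invmx (sval w)) (asboolT (in_W_inv (asboolW (svalP w))))) => /=.
by rewrite -[LHS]mulmx1 -(mulmxV u) mulmxA -(mulmxA (invmx _)) -e mulmxA mulVmx // mul1mx.
Qed.

Lemma ref_conj_trans r1 r2 r3 : ref_conj (zeta := zeta) r1 r2 -> ref_conj r2 r3 -> ref_conj r1 r3.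
Proof.
by move=> [w e] [w' e']; exists (dihM w' w) => /=; rewrite -mulmxA e mulmxA e' mulmxA.
Qed.

(** Conjugation by $s_k$ works: $s_ks_i$ and $s_js_k$ are the rotations of index $k-i$ and $j-k$. *)
Lemma ref_conj_s i j k : (i + j = 2 * k %[mod d])%N ->
  ref_conj (ref_s zeta i) (ref_s zeta j).
Proof.
move=> e; exists (dih_s k).
have h : (k + k = i + j %[mod d])%N by rewrite addnn -mul2n e.
exact: (congr1 sval (dih_ss h)).
Qed.

End DihedralElements.

Section SigmaRules.
Context {R : realType} {d : nat} {zeta : R[i]}.
Hypothesis hz : d.-primitive_root zeta.
Local Notation C := R[i].
Local Notation gen := (gen zeta).
Local Notation s_mx := (s_mx zeta).
Local Notation dih_s := (dih_s zeta).
Let zu := zeta_unit hz.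
Let d0 := prim_order_gt0 hz.

Context {N : lmodType C} (op : gen -> {linear N -> N}).
Hypothesis hC : forall r g m, op (GenC r) (op g m) = op g (op (GenC r) m).
Hypothesis hCconj : forall r r', ref_conj r r' -> forall m, op (GenC r) m = op (GenC r') m.
Hypothesis hWM : forall w1 w2 m, op (GenW (dihM w1 w2)) m = op (GenW w1) (op (GenW w2) m).
Hypothesis hWx : forall w m, op (GenW w) (op (GenV zeta 0) m) =
  sval w 0 0 *: op (GenV zeta 0) (op (GenW w) m) +
  sval w 1 0 *: op (GenV zeta 1) (op (GenW w) m).
Hypothesis hWy : forall w m, op (GenW w) (op (GenV zeta 1) m) =
  sval w 0 1 *: op (GenV zeta 0) (op (GenW w) m) +
  sval w 1 1 *: op (GenV zeta 1) (op (GenW w) m).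
Hypothesis hWX : forall w m, op (GenW w) (op (GenVd zeta 0) m) =
  invmx (sval w) 0 0 *: op (GenVd zeta 0) (op (GenW w) m) +
  invmx (sval w) 0 1 *: op (GenVd zeta 1) (op (GenW w) m).
Hypothesis hWY : forall w m, op (GenW w) (op (GenVd zeta 1) m) =
  invmx (sval w) 1 0 *: op (GenVd zeta 0) (op (GenW w) m) +
  invmx (sval w) 1 1 *: op (GenVd zeta 1) (op (GenW w) m).
Notation X := (op (GenVd zeta 0)).
Notation Y := (op (GenVd zeta 1)).
Notation x := (op (GenV zeta 0)).
Notation y := (op (GenV zeta 1)).
Notation w_ g := (op (GenW g)).
Local Notation sg := (sigma d op).

Lemma sg_mod k l m : (k = l %[mod d])%N -> sg k m = sg l m.
Proof.
move=> e; apply: eq_bigr => i _; congr (_ *: _); apply/eqP.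
by rewrite (eq_prim_root_expr hz) -modnMmr e modnMmr.
Qed.

Lemma s_x i m : w_ (dih_s i) (x m) = zeta ^+ (i * d.-1) *: y (w_ (dih_s i) m).
Proof. by rewrite hWx /= !s_mxE scale0r add0r zeta_inv. Qed.

Lemma s_y i m : w_ (dih_s i) (y m) = zeta ^+ i *: x (w_ (dih_s i) m).
Proof. by rewrite hWy /= !s_mxE scale0r addr0. Qed.

Lemma sg_x k m : sg k (x m) = y (sg (k + d.-1) m).
Proof.
rewrite linear_sum; apply: eq_bigr => i _.
by rewrite s_x !(linearZ_LR (op _)) hC scalerA -exprD -mulnDr.
Qed.

Lemma sg_y k m : sg k (y m) = x (sg k.+1 m).
Proof.
rewrite linear_sum; apply: eq_bigr => i _.
by rewrite s_y !(linearZ_LR (op _)) hC scalerA -exprD -mulnSr.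
Qed.

Lemma s_X i m : w_ (dih_s i) (X m) = zeta ^+ i *: Y (w_ (dih_s i) m).
Proof. by rewrite hWX /= (invmx_s hz) !s_mxE scale0r add0r. Qed.

Lemma s_Y i m : w_ (dih_s i) (Y m) = zeta ^+ (i * d.-1) *: X (w_ (dih_s i) m).
Proof. by rewrite hWY /= (invmx_s hz) !s_mxE scale0r addr0 zeta_inv. Qed.

Lemma sg_X k m : sg k (X m) = Y (sg k.+1 m).
Proof.
rewrite linear_sum; apply: eq_bigr => i _.
by rewrite s_X !(linearZ_LR (op _)) hC scalerA -exprD -mulnSr.
Qed.

Lemma sg_Y k m : sg k (Y m) = X (sg (k + d.-1) m).
Proof.
rewrite linear_sum; apply: eq_bigr => i _.
by rewrite s_Y !(linearZ_LR (op _)) hC scalerA -exprD -mulnDr.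
Qed.

(** Conjugation by $s_j$ turns $s_i$ into $s_{2j-i}$ and $C_i=C_{2j-i}$. The substitution of $2j-i$
    for $i$ then changes $\zeta^{ik}$ into $\zeta^{2jk}\zeta^{-ik}$; again -1 is represented by
    [d.-1]. *)
Lemma sg_s j k m : w_ (dih_s j) (sg k m) =
  zeta ^+ (2 * j * k) *: sg (k * d.-1) (w_ (dih_s j) m).
Proof.
pose f i := zeta ^+ (i * (k * d.-1)) *:
  op (GenC (ref_s zeta i)) (w_ (dih_s i) (w_ (dih_s j) m)).
have fd i : f (i + d)%N = f i.
  have e : dih_s (i + d) = dih_s i by apply: (dih_s_period hz); rewrite modnDr.
  rewrite /f e (ref_s_eq e); congr (_ *: _); apply/eqP.
  by rewrite (eq_prim_root_expr hz) mulnDl -modnDmr modnMr addn0.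
have <- : \sum_(i < d) f (2 * j + i * d.-1)%N = sg (k * d.-1) (w_ (dih_s j) m).
  apply: (sum_period_perm fd (g := fun i => 2 * j + i * d.-1)%N).
  move=> i i' li li' /eqP; rewrite eqn_modDl => /eqP h.
  have : (i * d.-1 + i + i' = i' * d.-1 + i' + i %[mod d])%N.
    by rewrite -!addnA [(i' + i)%N]addnC -modnDml h modnDml.
  rewrite -!mulnSr prednK // -modnDml modnMl -[in RHS]modnDml modnMl !add0n.
  by rewrite !modn_small.
rewrite /sigma linear_sum scaler_sumr; apply: eq_bigr => i _.
have e : (2 * j + i * d.-1 + i = 2 * j %[mod d])%N.
  by rewrite -addnA -mulnSr prednK // -modnDmr modnMl addn0.
rewrite (linearZ_LR (op _)) -hC /f -!hWM scalerA; congr (_ *: _).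
  rewrite -exprD; apply/eqP; rewrite (eq_prim_root_expr hz).
  rewrite -(eqn_modDr (i * k * d.-1)) -mulnS.
  have -> : (2 * j * k + (2 * j + i * d.-1) * (k * d.-1) + i * k * d.-1 =
    (2 * j * k + i * k * d.-1) * d.-1.+1)%N by move: d.-1 => q; ring.
  by rewrite prednK // !modnMl.
rewrite (hCconj (ref_conj_s hz (_ : (i + (2 * j + i * d.-1) = 2 * j %[mod d])%N))).
  congr (op _ (op (GenW _) _)); apply: (dih_ss hz).
  by rewrite addnn -mul2n addnC e.
by rewrite addnC.
Qed.

End SigmaRules.

End DihedralActionPart.
Export DihedralActionPart.

(** * Induced modules with Dunkl operators, and their universal property *)

Module VermaModulePart.

Section Verma.
Context {R : realType} {d : nat} {zeta : R[i]}.
Hypothesis hz : d.-primitive_root zeta.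
Local Notation C := R[i].
Local Notation gen := (gen zeta).
Local Notation dih_s := (dih_s zeta).
Notation gx := (GenV zeta 0).
Notation gy := (GenV zeta 1).
Notation gX := (GenVd zeta 0).
Notation gY := (GenVd zeta 1).
Notation gT := (GenT zeta).
Let zu := zeta_unit hz.
Let d0 := prim_order_gt0 hz.

Context {J : choiceType}.
Local Notation E := (fmod C J).
Local Notation M := (pmod C J).
Context (opE : gen -> {linear E -> E}) (bmE : bmod opE).

Definition vlin (a b : C) : {linear M -> M} := (a \*: pX) \+ (b \*: pY).

Lemma vlinE a b m : vlin a b m = a *: pX m + b *: pY m.
Proof. by []. Qed.

Definition vW (w : dihedral zeta) : {linear M -> M} :=
  prec (fun j => pinj 0 0 (opE (GenW w) (fb j)))
    (vlin (invmx (sval w) 0 0) (invmx (sval w) 0 1))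
    (vlin (invmx (sval w) 1 0) (invmx (sval w) 1 1)) \0 \0.

(** The Dunkl operators are corrections by reflection sums, which involve only the C_r and W. So
    these actions are set up first, with x and y acting by zero; this already is a [bmod]. *)
Definition vop0 (g : gen) : {linear M -> M} :=
  match g with
  | GenV k => \0
  | GenVd k => if k == 0 then (pX ) else pY
  | GenW w => vW w
  | _ => pcmap (opE g)
  end.

Local Notation sg := (sigma d vop0).
Definition vsg (k : nat) : {linear M -> M} := sg k.
Definition vTs : {linear M -> M} := vop0 gT \- vsg 0.

(** The action of x on E together with the prescribed commutators with X and Y determines x on the
    induced module; likewise for y. These are the Dunkl operators. *)
Definition vx : {linear M -> M} :=
  prec (fun j => pinj 0 0 (opE gx (fb j))) pX pY vTs (vsg d.-1).
Definition vy : {linear M -> M} :=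
  prec (fun j => pinj 0 0 (opE gy (fb j))) pX pY (vsg 1) vTs.

Definition vop (g : gen) : {linear M -> M} :=
  match g with
  | GenV k => if k == 0 then vx else vy
  | _ => vop0 g
  end.

Lemma vsgE k m : vsg k m = sg k m. Proof. by []. Qed.

Lemma vTsE m : vTs m = vop0 gT m - sg 0 m. Proof. by []. Qed.

Lemma vlinC a b a' b' m : vlin a b (vlin a' b' m) = vlin a' b' (vlin a b m).
Proof.
rewrite !vlinE !pX_D !pY_D !pX_Z !pY_Z pXY.
lin_comb C M.
Qed.

Lemma vWX w m : vW w (pX m) =
  invmx (sval w) 0 0 *: pX (vW w m) + invmx (sval w) 0 1 *: pY (vW w m).
Proof. by rewrite /vW precX addr0. Qed.

Lemma vWY w m : vW w (pY m) =
  invmx (sval w) 1 0 *: pX (vW w m) + invmx (sval w) 1 1 *: pY (vW w m).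
Proof.
rewrite /vW precY ?addr0 //; first by move=> n; exact: vlinC.
by move=> n /=; rewrite !linear0.
Qed.

Lemma vW_inj w e : vW w (pinj 0 0 e) = pinj 0 0 (opE (GenW w) e).
Proof.
apply: (fmod_eq (f := vW w \o pinj 0 0) (g := pinj 0 0 \o opE (GenW w))) => j /=.
exact: prec0.
Qed.

Section Commuting.
Context (f : {linear E -> E}).
Hypothesis hf : forall g e, f (opE g e) = opE g (f e).

Lemma pcmap_vop0 g m : pcmap f (vop0 g m) = vop0 g (pcmap f m).
Proof.
have hp g' : (forall e, f (opE g' e) = opE g' (f e)) ->
    pcmap f (pcmap (opE g') m) = pcmap (opE g') (pcmap f m).
  move=> h.
  apply: (pmod_eq (f := pcmap f \o pcmap (opE g')) (g := pcmap (opE g') \o pcmap f)) => /=.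
  - by move=> j; rewrite !pcmap_inj h.
  - by move=> n h'; rewrite !pcmapX h'.
  - by move=> n h'; rewrite !pcmapY h'.
case: g => [|r|k|k|w] /=; try exact: hp.
- exact: linear0.
- by case: ifP => _; rewrite (pcmapX, pcmapY).
apply: (pmod_eq (f := pcmap f \o vW w) (g := vW w \o pcmap f)) => /=.
- by move=> j; rewrite vW_inj !pcmap_inj vW_inj hf.
- by move=> n h; rewrite pcmapX !vWX pcmap_D !pcmap_Z pcmapX pcmapY h.
- by move=> n h; rewrite pcmapY !vWY pcmap_D !pcmap_Z pcmapX pcmapY h.
Qed.

Lemma pcmap_sg k m : pcmap f (sg k m) = sg k (pcmap f m).
Proof.
rewrite linear_sum; apply: eq_bigr => i _.
by rewrite pcmap_Z !pcmap_vop0.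
Qed.

End Commuting.

Lemma vop0_bmod : bmod vop0.
Proof.
split.
- by move=> g m; apply: pcmap_vop0; exact: (bmT bmE).
- by move=> r g m; apply: pcmap_vop0; exact: (bmC bmE).
- move=> r r' h m.
  apply: (fmod_eq (f := pcmap (opE (GenC r))) (g := pcmap (opE (GenC r')))) => -[[a b] j].
  by rewrite !pcmapU (bmCconj bmE h).
- apply: (pmod_eq (f := vW _) (g := idfun)) => /=.
  + by move=> j; rewrite vW_inj (bmW1 bmE).
  + by move=> n h; rewrite vWX h /= invmx1 !mxE /= scale1r scale0r addr0.
  + by move=> n h; rewrite vWY h /= invmx1 !mxE /= scale1r scale0r add0r.
- move=> w1 w2; apply: (pmod_eq (f := vW _) (g := vW _ \o vW _)) => /=.
  + by move=> j; rewrite !vW_inj (bmWM bmE).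
  + move=> n h; rewrite !vWX (linearD (vW w1)) !(linearZ_LR (vW w1)) vWX vWY h /=.
    rewrite invmx_mul ?(dihedral_unit hz) // !mulmx2E.
    lin_comb C M.
  + move=> n h; rewrite !vWY (linearD (vW w1)) !(linearZ_LR (vW w1)) vWX vWY h /=.
    rewrite invmx_mul ?(dihedral_unit hz) // !mulmx2E.
    lin_comb C M.
- by move=> w m /=; rewrite linear0 !scaler0 addr0.
- by move=> w m /=; rewrite linear0 !scaler0 addr0.
- by [].
Qed.

Let bm0 := vop0_bmod.
Let vsg_X k m : sg k (pX m) = pY (sg k.+1 m).
Proof. exact: (sg_X hz (bmC bm0) vWX). Qed.
Let vsg_Y k m : sg k (pY m) = pX (sg (k + d.-1) m).
Proof. exact: (sg_Y hz (bmC bm0) vWY). Qed.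
Let vsg_mod := @sg_mod R d zeta hz M vop0.
Let dmod : (d.-1.+1 = 0 %[mod d])%N.
Proof. by rewrite prednK // modnn mod0n. Qed.

Lemma vxX m : vx (pX m) = pX (vx m) + (vop0 gT m - sg 0 m).
Proof. exact: precX. Qed.

Lemma vxY m : vx (pY m) = pY (vx m) + sg d.-1 m.
Proof.
apply: precY; first exact: pXY.
move=> n; rewrite !vsgE !vTsE (vsg_X d.-1) (vsg_Y 0) add0n (vsg_mod _ dmod) /= pcmapY.
rewrite pY_B.
lin_comb C M.
Qed.

Lemma vyX m : vy (pX m) = pX (vy m) + sg 1 m.
Proof. exact: precX. Qed.

Lemma vyY m : vy (pY m) = pY (vy m) + (vop0 gT m - sg 0 m).
Proof.
apply: precY; first exact: pXY.
move=> n; rewrite !vsgE !vTsE (vsg_X 0) (vsg_Y 1) add1n (vsg_mod _ dmod) /= pcmapX.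
rewrite pX_B.
lin_comb C M.
Qed.

Lemma vx_inj e : vx (pinj 0 0 e) = pinj 0 0 (opE gx e).
Proof.
apply: (fmod_eq (f := vx \o pinj 0 0) (g := pinj 0 0 \o opE gx)) => j /=.
exact: prec0.
Qed.

Lemma vy_inj e : vy (pinj 0 0 e) = pinj 0 0 (opE gy e).
Proof.
apply: (fmod_eq (f := vy \o pinj 0 0) (g := pinj 0 0 \o opE gy)) => j /=.
exact: prec0.
Qed.

Lemma pcmap_vop (f : {linear E -> E}) (hf : forall g e, f (opE g e) = opE g (f e)) g m :
  pcmap f (vop g m) = vop g (pcmap f m).
Proof.
case: g => [|r|k|k|w]; try exact: (pcmap_vop0 hf).
rewrite /=; case: ifP => _.
- apply: (pmod_eq (f := pcmap f \o vx) (g := vx \o pcmap f)) => /=.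
  + by move=> j; rewrite vx_inj !pcmap_inj vx_inj hf.
  + move=> n h; rewrite pcmapX !vxX pcmap_D pcmap_B pcmapX h (pcmap_sg hf).
    by rewrite (pcmap_vop0 hf).
  + by move=> n h; rewrite pcmapY !vxY pcmap_D pcmapY h (pcmap_sg hf).
- apply: (pmod_eq (f := pcmap f \o vy) (g := vy \o pcmap f)) => /=.
  + by move=> j; rewrite vy_inj !pcmap_inj vy_inj hf.
  + by move=> n h; rewrite pcmapX !vyX pcmap_D pcmapX h (pcmap_sg hf).
  + move=> n h; rewrite pcmapY !vyY pcmap_D pcmap_B pcmapY h (pcmap_sg hf).
    by rewrite (pcmap_vop0 hf).
Qed.

Let vsg_s j k m : vW (dih_s j) (sg k m) =
  zeta ^+ (2 * j * k) *: sg (k * d.-1) (vW (dih_s j) m).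
Proof. exact: (sg_s hz (bmC bm0) (bmCconj bm0) (bmWM bm0)). Qed.

Let vW_T w m : vW w (vop0 gT m) = vop0 gT (vW w m).
Proof. by rewrite -[vW w]/(vop0 (GenW w)) (bmT bm0). Qed.

Lemma vWs_X j m : vW (dih_s j) (pX m) = zeta ^+ j *: pY (vW (dih_s j) m).
Proof. by rewrite vWX (invmx_s hz) !s_mxE scale0r add0r. Qed.

Lemma vWs_Y j m : vW (dih_s j) (pY m) = zeta ^- j *: pX (vW (dih_s j) m).
Proof. by rewrite vWY (invmx_s hz) !s_mxE scale0r addr0. Qed.

Let zV j : zeta ^+ j * zeta ^- j = 1.
Proof. by rewrite divff ?expf_neq0. Qed.

Let dm1 : (d.-1 * d.-1 = 1 %[mod d])%N.
Proof.
apply/eqP; rewrite -(eqn_modDr d.-1) -mulnSr add1n prednK //.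
by rewrite modnMl modnn.
Qed.

Lemma vW_s_xy j m :
  vW (dih_s j) (vx m) = zeta ^- j *: vy (vW (dih_s j) m) /\
  vW (dih_s j) (vy m) = zeta ^+ j *: vx (vW (dih_s j) m).
Proof.
have zj : zeta ^+ j != 0 by rewrite expf_neq0.
have z2 : zeta ^+ (2 * j * 1) = zeta ^+ j * zeta ^+ j.
  by rewrite muln1 -exprD addnn mul2n.
have z2' : zeta ^+ (2 * j * d.-1) = zeta ^- j * zeta ^- j.
  by rewrite (zeta_inv hz) mul2n -addnn exprD invfM.
split.
- apply: (pmod_eq (f := vW (dih_s j) \o vx) (g := (zeta ^- j) \*: (vy \o vW (dih_s j)))) => /=.
  + move=> i; rewrite vx_inj !vW_inj vy_inj (bmWx bmE) /= !s_mxE scale0r add0r.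
    by rewrite (linearZ_LR (pinj 0 0)).
  + move=> n; move=> h; rewrite vxX (linearD (vW (dih_s j))) (linearB (vW (dih_s j))) !vWs_X vW_T vsg_s h.
    rewrite (linearZ_LR vy) vyY muln0 expr0 mul0n pY_Z.
    lin_comb C M by (by field).
  + move=> n h; rewrite vxY (linearD (vW (dih_s j))) !vWs_Y vsg_s h (linearZ_LR vy) vyX.
    rewrite (vsg_mod _ dm1) z2' pX_Z.
    lin_comb C M.
- apply: (pmod_eq (f := vW (dih_s j) \o vy) (g := (zeta ^+ j) \*: (vx \o vW (dih_s j)))) => /=.
  + move=> i; rewrite vy_inj !vW_inj vx_inj (bmWy bmE) /= !s_mxE scale0r addr0.
    by rewrite (linearZ_LR (pinj 0 0)).
  + move=> n h; rewrite vyX (linearD (vW (dih_s j))) !vWs_X vsg_s h (linearZ_LR vx) vxY.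
    rewrite mul1n z2 pY_Z.
    lin_comb C M.
  + move=> n h; rewrite vyY (linearD (vW (dih_s j))) (linearB (vW (dih_s j))) !vWs_Y vW_T vsg_s h.
    rewrite (linearZ_LR vx) vxX muln0 expr0 mul0n pX_Z.
    lin_comb C M by (by field).
Qed.

(** Every rotation is a product of two reflections, for which the rule is [vW_s_xy]. *)
Lemma vW_xy w m :
  vW w (vx m) = sval w 0 0 *: vx (vW w m) + sval w 1 0 *: vy (vW w m) /\
  vW w (vy m) = sval w 0 1 *: vx (vW w m) + sval w 1 1 *: vy (vW w m).
Proof.
have hs j n : let w := dih_s j in
    vW w (vx n) = sval w 0 0 *: vx (vW w n) + sval w 1 0 *: vy (vW w n) /\
    vW w (vy n) = sval w 0 1 *: vx (vW w n) + sval w 1 1 *: vy (vW w n).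
  by have [e1 e2] := vW_s_xy j n; rewrite /= e1 e2 !s_mxE !scale0r add0r addr0.
have [j [->|->]] := dihedral_shape hz w; first exact: hs.
have e n : vW (dihM (dih_s j) (dih_s 0)) n = vW (dih_s j) (vW (dih_s 0) n).
  exact: (bmWM bm0).
have [e1 e2] := hs 0%N m; have [e3 e4] := hs j (vW (dih_s 0) m).
rewrite !e e1 e2 !(linearD (vW (dih_s j))) !(linearZ_LR (vW (dih_s j))) e3 e4.
by rewrite /= !mulmx2E; split; lin_comb C M.
Qed.

Lemma vop_sg k m : sigma d vop k m = sg k m. Proof. by []. Qed.

Let vsg_x k m : sg k (vx m) = vy (sg (k + d.-1) m).
Proof.
apply: (sg_x hz (op := vop)); last by move=> w n; have [] := vW_xy w n.
by move=> r g n; apply: pcmap_vop; exact: (bmC bmE).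
Qed.

Let vsg_y k m : sg k (vy m) = vx (sg k.+1 m).
Proof.
apply: (sg_y (op := vop)); last by move=> w n; have [] := vW_xy w n.
by move=> r g n; apply: pcmap_vop; exact: (bmC bmE).
Qed.

Let vT_xy m : vop0 gT (vx m) = vx (vop0 gT m) /\ vop0 gT (vy m) = vy (vop0 gT m).
Proof.
have h g := @pcmap_vop (opE gT) (bmT bmE) g m.
by split; [exact: (h gx) | exact: (h gy)].
Qed.

(** Commutation of the Dunkl operators. By $\sigma_0y=x\sigma_1$ and $\sigma_1x=y\sigma_0$ the
    reflection terms cancel when $xy$ and $yx$ pass X, and similarly for Y. So both orders obey the
    same recursion. *)
Lemma vxy m : vx (vy m) = vy (vx m).
Proof.
have T n := (vT_xy n).1; have T' n := (vT_xy n).2.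
apply: (pmod_eq (f := vx \o vy) (g := vy \o vx)) => /=.
- by move=> j; rewrite vy_inj !vx_inj vy_inj (bmxy bmE).
- move=> n h; rewrite vyX vxX (linearD vx) (linearD vy) (linearB vy) vxX vyX h.
  rewrite T' vsg_y vsg_x add1n (vsg_mod _ dmod).
  lin_comb C M.
- move=> n h; rewrite vyY vxY (linearD vx) (linearD vy) (linearB vx) vxY vyY h.
  rewrite T vsg_y vsg_x add0n (vsg_mod _ dmod).
  lin_comb C M.
Qed.

Lemma vop_cmod : cmod d vop.
Proof.
split; first split.
- by move=> g m; apply: pcmap_vop; exact: (bmT bmE).
- by move=> r g m; apply: pcmap_vop; exact: (bmC bmE).
- exact: (bmCconj bm0).
- exact: (bmW1 bm0).
- exact: (bmWM bm0).
- by move=> w m; have [] := vW_xy w m.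
- by move=> w m; have [] := vW_xy w m.
- exact: vxy.
- exact: vWX.
- exact: vWY.
- exact: pXY.
- exact: vxX.
- exact: vxY.
- exact: vyX.
- exact: vyY.
Qed.

Lemma vop_inj g e : (forall k, g <> GenVd zeta k) ->
  vop g (pinj 0 0 e) = pinj 0 0 (opE g e).
Proof.
case: g => [|r|k|k|w] h; try exact: pcmap_inj; last exact: vW_inj.
- have [->|->] : k = 0 \/ k = 1.
    by case: k {h} => -[|[|//]] hk; [left|right]; apply: val_inj.
  + exact: vx_inj.
  + exact: vy_inj.
- by case: (h k).
Qed.

Section Universal.
Context {N : lmodType C} (opN : gen -> {linear N -> N}) (cmN : cmod d opN).
Context (phi : {linear E -> N}).
Hypothesis hphi : forall g e, (forall k, g <> GenVd zeta k) -> phi (opE g e) = opN g (phi e).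

(** Frobenius reciprocity: a map on E compatible with all generators except X and Y extends to the
    induced module by letting X and Y act on the target. *)
Definition vlift : {linear M -> N} :=
  prec (fun j => phi (fb j)) (opN gX) (opN gY) \0 \0.

Lemma vlift_inj e : vlift (pinj 0 0 e) = phi e.
Proof.
apply: (fmod_eq (f := vlift \o pinj 0 0) (g := phi)) => j /=.
exact: prec0.
Qed.

Lemma vliftX m : vlift (pX m) = opN gX (vlift m).
Proof. by rewrite /vlift precX addr0. Qed.

Lemma vliftY m : vlift (pY m) = opN gY (vlift m).
Proof.
rewrite /vlift precY ?addr0 //; first exact: (cmXY cmN).
by move=> n /=; rewrite !linear0.
Qed.

Lemma vlift_W w m : vlift (vW w m) = opN (GenW w) (vlift m).
Proof.
apply: (pmod_eq (f := vlift \o vW w) (g := opN (GenW w) \o vlift)) => /=.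
- by move=> j; rewrite vW_inj !vlift_inj hphi.
- move=> n h; rewrite vWX (linearD vlift) !(linearZ_LR vlift) !vliftX !vliftY h.
  by rewrite (cmWX cmN).
- move=> n h; rewrite vWY (linearD vlift) !(linearZ_LR vlift) !vliftX !vliftY h.
  by rewrite (cmWY cmN).
Qed.

Lemma vlift_central g m : (forall h n, opN g (opN h n) = opN h (opN g n)) ->
  (forall k, g <> GenVd zeta k) -> vlift (pcmap (opE g) m) = opN g (vlift m).
Proof.
move=> hg hk.
apply: (pmod_eq (f := vlift \o pcmap (opE g)) (g := opN g \o vlift)) => /=.
- by move=> j; rewrite pcmap_inj !vlift_inj hphi.
- by move=> n h; rewrite pcmapX !vliftX h hg.
- by move=> n h; rewrite pcmapY !vliftY h hg.
Qed.

Lemma vlift_sg k m : vlift (sg k m) = sigma d opN k (vlift m).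
Proof.
rewrite linear_sum; apply: eq_bigr => i _.
rewrite (linearZ_LR vlift) -vlift_W -vlift_central //.
exact: (bmC (cm_bmod cmN)).
Qed.

Lemma vlift_op g m : vlift (vop g m) = opN g (vlift m).
Proof.
have bmN := cm_bmod cmN.
have hT n : vlift (vop0 gT n) = opN gT (vlift n).
  by apply: vlift_central => //; exact: (bmT bmN).
case: g => [|r|k|k|w].
- exact: hT.
- by apply: vlift_central => //; exact: (bmC bmN).
- have [->|->] : k = 0 \/ k = 1.
    by case: k => -[|[|//]] hk; [left|right]; apply: val_inj.
  + apply: (pmod_eq (f := vlift \o vx) (g := opN gx \o vlift)) => /=.
    * by move=> j; rewrite vx_inj !vlift_inj hphi.
    * move=> n h; rewrite vxX (linearD vlift) (linearB vlift) !vliftX h.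
      by rewrite (cmxX cmN) hT vlift_sg.
    * by move=> n h; rewrite vxY (linearD vlift) !vliftY h (cmxY cmN) vlift_sg.
  + apply: (pmod_eq (f := vlift \o vy) (g := opN gy \o vlift)) => /=.
    * by move=> j; rewrite vy_inj !vlift_inj hphi.
    * by move=> n h; rewrite vyX (linearD vlift) !vliftX h (cmyX cmN) vlift_sg.
    * move=> n h; rewrite vyY (linearD vlift) (linearB vlift) !vliftY h.
      by rewrite (cmyY cmN) hT vlift_sg.
- have [->|->] : k = 0 \/ k = 1.
    by case: k => -[|[|//]] hk; [left|right]; apply: val_inj.
  + exact: vliftX.
  + exact: vliftY.
- exact: vlift_W.
Qed.

End Universal.

End Verma.

End VermaModulePart.
Export VermaModulePart.

(** * The modules to induce from, built on a set with an action of W *)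

Module BaseModulePart.

Section BaseModule.
Context {R : realType} {d : nat} {zeta : R[i]}.
Hypothesis hz : d.-primitive_root zeta.
Local Notation C := R[i].
Local Notation gen := (gen zeta).
Notation gx := (GenV zeta 0).
Notation gy := (GenV zeta 1).
Notation gT := (GenT zeta).

Context {G : choiceType} (actG : dihedral zeta -> G -> G) (theta : bool).
Hypothesis actG1 : forall g, actG (dih1 zeta) g = g.
Hypothesis actGM : forall w1 w2 g, actG (dihM w1 w2) g = actG w1 (actG w2 g).

(* The basis element (l, m, n, g) stands for T^l C_0^m C_1^n g. *)
Notation bidx := (nat * nat * nat * G)%type.
Local Notation B := (fmod C bidx).
Local Notation E := (pmod C bidx).

Definition bshift (l m n : nat) : {linear B -> B} :=
  flext (fun k => fb (k.1.1.1 + l, k.1.1.2 + m, k.1.2 + n, k.2)%N).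
(** The flag [theta] selects whether T acts freely, as needed for [Ht], or by zero, as needed for
    [H]. *)
Definition bT : {linear B -> B} := if theta then bshift 1 0 0 else \0.
(** Every reflection is conjugate to $s_0$ or $s_1$. Testing conjugacy, rather than the parity of an
    index, makes this constant on classes also when the two classes coincide. *)
Definition bC (r : reflection zeta) : {linear B -> B} :=
  if `[< ref_conj r (ref_s zeta 0) >] then bshift 0 1 0 else bshift 0 0 1.
Definition bW (w : dihedral zeta) : {linear B -> B} :=
  flext (fun k => fb (k.1, actG w k.2)).

Lemma bshiftU l m n l' m' n' g :
  bshift l m n (fb (l', m', n', g)) = fb (l' + l, m' + m, n' + n, g)%N.
Proof. exact: flextU. Qed.

Lemma bWU w l m n g : bW w (fb (l, m, n, g)) = fb (l, m, n, actG w g).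
Proof. exact: flextU. Qed.

Lemma bshiftC l m n l' m' n' e :
  bshift l m n (bshift l' m' n' e) = bshift l' m' n' (bshift l m n e).
Proof.
apply: (fmod_eq (f := bshift _ _ _ \o bshift _ _ _) (g := bshift _ _ _ \o bshift _ _ _)).
move=> -[[[a b] c] g] /=; rewrite !bshiftU.
by rewrite ![(_ + l' + _)%N]addnAC ![(_ + m' + _)%N]addnAC ![(_ + n' + _)%N]addnAC.
Qed.

Lemma bshiftW l m n w e : bshift l m n (bW w e) = bW w (bshift l m n e).
Proof.
apply: (fmod_eq (f := bshift _ _ _ \o bW w) (g := bW w \o bshift _ _ _)).
by move=> -[[[a b] c] g] /=; rewrite bshiftU !bWU bshiftU.
Qed.

Definition eW (w : dihedral zeta) : {linear E -> E} :=
  prec (fun j => pinj 0 0 (bW w (fb j)))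
    (vlin (sval w 0 0) (sval w 1 0)) (vlin (sval w 0 1) (sval w 1 1)) \0 \0.

Definition base_op (g : gen) : {linear E -> E} :=
  match g with
  | GenT => pcmap bT
  | GenC r => pcmap (bC r)
  | GenV k => if k == 0 then (pX : {linear E -> E}) else pY
  | GenVd k => \0
  | GenW w => eW w
  end.

Lemma eWX w m : eW w (pX m) = sval w 0 0 *: pX (eW w m) + sval w 1 0 *: pY (eW w m).
Proof. by rewrite /eW precX addr0. Qed.

Lemma eWY w m : eW w (pY m) = sval w 0 1 *: pX (eW w m) + sval w 1 1 *: pY (eW w m).
Proof.
rewrite /eW precY ?addr0 //; first by move=> n; exact: vlinC.
by move=> n /=; rewrite !linear0.
Qed.

Lemma eW_inj w e : eW w (pinj 0 0 e) = pinj 0 0 (bW w e).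
Proof.
apply: (fmod_eq (f := eW w \o pinj 0 0) (g := pinj 0 0 \o bW w)) => j /=.
exact: prec0.
Qed.

Lemma pcmap_base (f : {linear B -> B}) (hW : forall w e, f (bW w e) = bW w (f e))
  (hS : forall l m n e, f (bshift l m n e) = bshift l m n (f e)) g m :
  pcmap f (base_op g m) = base_op g (pcmap f m).
Proof.
have hp (f' : {linear B -> B}) : (forall e, f (f' e) = f' (f e)) ->
    pcmap f (pcmap f' m) = pcmap f' (pcmap f m).
  move=> h.
  apply: (pmod_eq (f := pcmap f \o pcmap f') (g := pcmap f' \o pcmap f)) => /=.
  - by move=> j; rewrite !pcmap_inj h.
  - by move=> n h'; rewrite !pcmapX h'.
  - by move=> n h'; rewrite !pcmapY h'.
case: g => [|r|k|k|w] /=.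
- by apply: hp => e; rewrite /bT; case: theta => //=; rewrite linear0.
- by apply: hp => e; rewrite /bC; case: ifP => _; exact: hS.
- by case: ifP => _; rewrite (pcmapX, pcmapY).
- exact: linear0.
apply: (pmod_eq (f := pcmap f \o eW w) (g := eW w \o pcmap f)) => /=.
- by move=> j; rewrite eW_inj !pcmap_inj eW_inj hW.
- by move=> n h; rewrite pcmapX !eWX pcmap_D !pcmap_Z pcmapX pcmapY h.
- by move=> n h; rewrite pcmapY !eWY pcmap_D !pcmap_Z pcmapX pcmapY h.
Qed.

Lemma pcmap_ext (f g : {linear B -> B}) m : (forall e, f e = g e) -> pcmap f m = pcmap g m.
Proof. by move=> h; apply: fmod_eq => -[[a b] j]; rewrite !pcmapU h. Qed.

Lemma base_bmod : bmod base_op.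
Proof.
split.
- move=> g m; apply: pcmap_base => [w e|l k n e]; rewrite /bT; case: theta => /=;
    by rewrite ?linear0 // (bshiftW, bshiftC).
- move=> r g m; apply: pcmap_base => [w e|l k n e]; rewrite /bC; case: ifP => _;
    by rewrite (bshiftW, bshiftC).
- move=> r r' h m /=; apply: pcmap_ext => e; rewrite /bC.
  rewrite (_ : `[< ref_conj r _ >] = `[< ref_conj r' (ref_s zeta 0) >]) //.
  apply: asbool_equiv_eq; split => h'.
    exact: (ref_conj_trans (ref_conj_sym hz h) h').
  exact: (ref_conj_trans h h').
- apply: (pmod_eq (f := eW _) (g := idfun)) => /=.
  + by move=> [[[a b] c] g]; rewrite eW_inj bWU actG1.
  + by move=> n h; rewrite eWX h /= !mxE /= scale1r scale0r addr0.
  + by move=> n h; rewrite eWY h /= !mxE /= scale1r scale0r add0r.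
- move=> w1 w2; apply: (pmod_eq (f := eW _) (g := eW _ \o eW _)) => /=.
  + by move=> [[[a b] c] g]; rewrite !eW_inj !bWU actGM.
  + move=> n h; rewrite eWX [eW w2 (pX n)]eWX (linearD (eW w1)) !(linearZ_LR (eW w1)).
    rewrite eWX eWY h /= !mulmx2E.
    lin_comb C E.
  + move=> n h; rewrite eWY [eW w2 (pY n)]eWY (linearD (eW w1)) !(linearZ_LR (eW w1)).
    rewrite eWX eWY h /= !mulmx2E.
    lin_comb C E.
- exact: eWX.
- exact: eWY.
- exact: pXY.
Qed.

Section Lift.
Context {N : lmodType C} (opN : gen -> {linear N -> N}) (cmN : cmod d opN).
Context (f0 : G -> N).
Hypothesis hf0 : forall w g, f0 (actG w g) = opN (GenW w) (f0 g).
Hypothesis hT : theta = false -> forall n, opN gT n = 0.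
Let bmN := cm_bmod cmN.
Notation c0 := (opN (GenC (ref_s zeta 0))).
Notation c1 := (opN (GenC (ref_s zeta 1))).

Hypothesis conj01 : forall r : reflection zeta,
  ref_conj r (ref_s zeta 0) \/ ref_conj r (ref_s zeta 1).

Definition blift : {linear B -> N} :=
  flext (fun k => iter k.1.1.1 (opN gT) (iter k.1.1.2 c0 (iter k.1.2 c1 (f0 k.2)))).

Lemma bliftU l m n g : blift (fb (l, m, n, g)) =
  iter l (opN gT) (iter m c0 (iter n c1 (f0 g))).
Proof. exact: flextU. Qed.

Lemma iter_comm (f h : N -> N) n v : (forall v, f (h v) = h (f v)) ->
  f (iter n h v) = iter n h (f v).
Proof. by move=> e; elim: n => //= n <-. Qed.

Definition elift : {linear E -> N} :=
  prec (fun j => blift (fb j)) (opN gx) (opN gy) \0 \0.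

Lemma elift_inj e : elift (pinj 0 0 e) = blift e.
Proof.
apply: (fmod_eq (f := elift \o pinj 0 0) (g := blift)) => j /=.
exact: prec0.
Qed.

Lemma eliftX m : elift (pX m) = opN gx (elift m).
Proof. by rewrite /elift precX addr0. Qed.

Lemma eliftY m : elift (pY m) = opN gy (elift m).
Proof.
rewrite /elift precY ?addr0 //; first exact: (bmxy bmN).
by move=> n /=; rewrite !linear0.
Qed.

Lemma elift_pcmap (f : {linear B -> B}) g m :
  (forall h n, opN g (opN h n) = opN h (opN g n)) ->
  (forall e, blift (f e) = opN g (blift e)) ->
  elift (pcmap f m) = opN g (elift m).
Proof.
move=> hg hf; apply: (pmod_eq (f := elift \o pcmap f) (g := opN g \o elift)) => /=.
- by move=> j; rewrite pcmap_inj !elift_inj hf.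
- by move=> n h; rewrite pcmapX !eliftX h hg.
- by move=> n h; rewrite pcmapY !eliftY h hg.
Qed.

Lemma elift_op g e : (forall k, g <> GenVd zeta k) ->
  elift (base_op g e) = opN g (elift e).
Proof.
case: g => [|r|k|k|w] hk.
- apply: elift_pcmap; first exact: (bmT bmN).
  move=> b; rewrite /bT; case: (boolP theta) => [_|/negbTE th]; last first.
    by rewrite linear0 (hT th).
  apply: (fmod_eq (f := blift \o bshift 1 0 0) (g := opN gT \o blift)) => /=.
  by move=> -[[[l m] n] g]; rewrite bshiftU !bliftU addn1 !addn0.
- apply: elift_pcmap; first exact: (bmC bmN).
  move=> b; rewrite /bC; case: asboolP => h.
    rewrite (bmCconj bmN h).
    apply: (fmod_eq (f := blift \o bshift 0 1 0) (g := c0 \o blift)) => /=.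
    move=> -[[[l m] n] g]; rewrite bshiftU !bliftU addn1 !addn0 iterS.
    by rewrite (iter_comm (f := c0) l) // => v; rewrite (bmT bmN).
  have h1 : ref_conj r (ref_s zeta 1) by case: (conj01 r).
  rewrite (bmCconj bmN h1).
  apply: (fmod_eq (f := blift \o bshift 0 0 1) (g := c1 \o blift)) => /=.
  move=> -[[[l m] n] g]; rewrite bshiftU !bliftU addn1 !addn0 iterS.
  rewrite (iter_comm (f := c1) l) => [|v]; last by rewrite (bmT bmN).
  by rewrite (iter_comm (f := c1) m) // => v; rewrite (bmC bmN).
- have [->|->] : k = 0 \/ k = 1.
    by case: k {hk} => -[|[|//]] h; [left|right]; apply: val_inj.
  + exact: eliftX.
  + exact: eliftY.
- by case: (hk k).
apply: (pmod_eq (f := elift \o eW w) (g := opN (GenW w) \o elift)) => /=.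
- move=> j; rewrite eW_inj !elift_inj; case: j => -[[l m] n] g.
  rewrite bWU !bliftU hf0.
  rewrite (iter_comm (f := opN (GenW w)) l) => [|v]; last by rewrite (bmT bmN).
  rewrite (iter_comm (f := opN (GenW w)) m) => [|v]; last by rewrite (bmC bmN).
  by rewrite (iter_comm (f := opN (GenW w)) n) // => v; rewrite (bmC bmN).
- move=> n h; rewrite eWX (linearD elift) !(linearZ_LR elift) !eliftX !eliftY h.
  by rewrite (bmWx bmN).
- move=> n h; rewrite eWY (linearD elift) !(linearZ_LR elift) !eliftX !eliftY h.
  by rewrite (bmWy bmN).
Qed.

(** Universal property of the twofold induction: an equivariant map from the W-set G to a module N
    over the algebra extends to all monomials. With G = W it maps onto the algebra itself, with G a
    point it maps to the submodule generated by an invariant vector. *)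
Definition pbw_lift : {linear pmod C (pidx bidx) -> N} := vlift opN elift.

Lemma pbw_lift_op g m : pbw_lift (vop (d := d) base_op g m) = opN g (pbw_lift m).
Proof. exact: (vlift_op hz base_bmod cmN elift_op). Qed.

Lemma pbw_lift1 g : pbw_lift (pinj 0 0 (pinj 0 0 (fb (0%N, 0%N, 0%N, g)))) = f0 g.
Proof. by rewrite /pbw_lift vlift_inj elift_inj bliftU. Qed.

End Lift.
End BaseModule.

End BaseModulePart.
Export BaseModulePart.

(** * Quotient morphisms, and the reduction of [Ht] to [H] modulo T *)

Module FaithfulModulePart.

Section QuotientMorphism.
Context {K : pzRingType} {A : pzAlgType K} (S : set A).

Definition qpi (a : A) : quotalg S := \pi_(quotalg S) a.

Fact qpi_additive : zmod_morphism qpi.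
Proof.
move=> a b; apply: (addIr (qpi b)).
by rewrite subrK -[LHS]quotalg_piD subrK.
Qed.

Fact qpi_monoid : monoid_morphism qpi.
Proof. by split=> [|a b] //; exact: quotalg_piM. Qed.

HB.instance Definition _ := GRing.isZmodMorphism.Build A (quotalg S) qpi qpi_additive.
HB.instance Definition _ := GRing.isMonoidMorphism.Build A (quotalg S) qpi qpi_monoid.

Lemma qpi_eq0 a : qpi a = 0 <-> a \in ideal_span S.
Proof.
rewrite -(rmorph0 qpi); split=> [/quotalg_eqP|h]; first by rewrite subr0.
by apply/quotalg_eqP; rewrite subr0.
Qed.

Lemma qpi_surj (x : quotalg S) : exists a, qpi a = x.
Proof. by exists (repr x); exact: reprK. Qed.

Lemma qpi_algc a : qpi (algc a) = algc a.
Proof. by []. Qed.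

End QuotientMorphism.

Section IdealSpan.
Context {A : pzRingType}.

Lemma mem_ideal_span (S : set A) x : S x -> x \in ideal_span S.
Proof. by move=> Sx; apply/asboolP => P _; apply. Qed.

Lemma ideal_span_min (S P : set A) : is_ideal P -> (forall x, S x -> P x) ->
  forall x, x \in ideal_span S -> P x.
Proof. by move=> iP SP x /asboolP; apply. Qed.

Lemma ideal_span_ideal (S : set A) : is_ideal (fun x => x \in ideal_span S).
Proof.
split; first exact: rpred0.
- by move=> x y hx hy; exact: rpredB.
- by move=> a x; exact: ideal_spanMl.
- by move=> a x; exact: ideal_spanMr.
Qed.

Lemma ker_ideal (B : pzRingType) (f : {rmorphism A -> B}) : is_ideal (fun x => f x = 0).
Proof.
split; first exact: rmorph0.
- by move=> x y hx hy; rewrite rmorphB hx hy subrr.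
- by move=> a x hx; rewrite rmorphM hx mulr0.
- by move=> a x hx; rewrite rmorphM hx mul0r.
Qed.

Lemma principal_ideal (B : pzRingType) (f : {rmorphism A -> B}) (t : B) :
  (forall h, t * h = h * t) -> is_ideal (fun a => exists k, f a = t * k).
Proof.
move=> tC; split; first by exists 0; rewrite rmorph0 mulr0.
- by move=> x y [k e] [k' e']; exists (k - k'); rewrite rmorphB e e' mulrBr.
- by move=> b x [k e]; exists (f b * k); rewrite rmorphM e !mulrA tC.
- by move=> b x [k e]; exists (k * f b); rewrite rmorphM e mulrA.
Qed.

Lemma ideal_comm_split (P : set A) (c t p s : A) : is_ideal P -> P t ->
  P (c - (t * p - s)) <-> P (c - (0 * p - s)).
Proof.
case=> P0 PB PMl PMr Pt; have Ptp : P (t * p) by exact: PMr.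
have -> : c - (t * p - s) = (c - (0 * p - s)) - t * p.
  by rewrite mul0r sub0r !opprK opprB addrA.
split=> h; last exact: PB.
by have := PB _ _ h (PB _ _ P0 Ptp); rewrite sub0r opprK subrK.
Qed.

End IdealSpan.

Section HtH.
Context {R : realType} {d : nat} {zeta : R[i]}.
Hypothesis hz : d.-primitive_root zeta.
Local Notation C := R[i].
Local Notation gen := (gen zeta).
Local Notation F := (freealg C gen).
Local Notation Ht := (Ht d zeta).
Local Notation H := (H d zeta).
Notation gT := (GenT zeta).

Definition psiT : {rmorphism F -> Ht} := qpi (A := F) (cher_rel d (f_gen gT)).
Definition psiH : {rmorphism F -> H} :=
  qpi (A := F) (cher_rel d 0 `|` [set f_gen gT])%classic.

Lemma psiT_surj h : exists a, psiT a = h.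
Proof. exact: qpi_surj. Qed.
Lemma psiH_surj h : exists a, psiH a = h.
Proof. exact: qpi_surj. Qed.

Lemma psiT_rel a : cher_rel d (f_gen gT) a -> psiT a = 0.
Proof. by move=> h; apply/qpi_eq0; exact: mem_ideal_span. Qed.

Lemma psiH_T : psiH (f_gen gT) = 0.
Proof. by apply/qpi_eq0; apply: mem_ideal_span; right. Qed.

Lemma psiH_rel0 a : cher_rel d 0 a -> psiH a = 0.
Proof. by move=> h; apply/qpi_eq0; apply: mem_ideal_span; left. Qed.

(* The relations for tau and for 0 differ by multiples of tau. *)
Lemma cher_rel_split tau (P : set F) : is_ideal P -> P tau ->
  (forall a, cher_rel d tau a -> P a) <-> (forall a, cher_rel d 0 a -> P a).
Proof.
move=> iP Pt; split=> h a.
- case.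
  + by move=> b; exact: (h _ (RelT d tau b)).
  + by move=> r b; exact: (h _ (RelC d tau r b)).
  + by move=> r r' e; exact: (h _ (RelCconj d tau e)).
  + exact: (h _ (RelW1 d tau)).
  + by move=> w1 w2; exact: (h _ (RelWM d tau w1 w2)).
  + by move=> w u; exact: (h _ (RelWV d tau w u)).
  + by move=> w U; exact: (h _ (RelWVd d tau w U)).
  + by move=> u u'; exact: (h _ (RelVV d tau u u')).
  + by move=> U U'; exact: (h _ (RelVdVd d tau U U')).
  + by move=> u U; exact: (ideal_comm_split _ _ _ iP Pt).1 (h _ (RelVVd d tau u U)).
- case.
  + by move=> b; exact: (h _ (RelT d 0 b)).
  + by move=> r b; exact: (h _ (RelC d 0 r b)).
  + by move=> r r' e; exact: (h _ (RelCconj d 0 e)).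
  + exact: (h _ (RelW1 d 0)).
  + by move=> w1 w2; exact: (h _ (RelWM d 0 w1 w2)).
  + by move=> w u; exact: (h _ (RelWV d 0 w u)).
  + by move=> w U; exact: (h _ (RelWVd d 0 w U)).
  + by move=> u u'; exact: (h _ (RelVV d 0 u u')).
  + by move=> U U'; exact: (h _ (RelVdVd d 0 U U')).
  + by move=> u U; exact: (ideal_comm_split _ _ _ iP Pt).2 (h _ (RelVVd d 0 u U)).
Qed.

Lemma psiH_rel a : cher_rel d (f_gen gT) a -> psiH a = 0.
Proof.
move: a; apply/(cher_rel_split (ker_ideal psiH)); first exact: psiH_T.
exact: psiH_rel0.
Qed.

Lemma psiT_H a b : psiT a = psiT b -> psiH a = psiH b.
Proof.
move=> h; apply: subr0_eq; rewrite -rmorphB.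
have : psiT (a - b) = 0 by rewrite rmorphB h subrr.
move=> /qpi_eq0; move: (a - b); apply: ideal_span_min; first exact: (ker_ideal psiH).
exact: psiH_rel.
Qed.

Lemma Ht_to_H_psi a : Ht_to_H (psiT a) = psiH a.
Proof. by apply: psiT_H; exact: reprK. Qed.

Lemma Ht_to_H_additive : zmod_morphism (@Ht_to_H R d zeta).
Proof.
move=> x y; have [a <-] := psiT_surj x; have [b <-] := psiT_surj y.
by rewrite -rmorphB !Ht_to_H_psi rmorphB.
Qed.

Lemma Ht_to_H_monoid : monoid_morphism (@Ht_to_H R d zeta).
Proof.
split=> [|x y]; first by rewrite -(rmorph1 psiT) Ht_to_H_psi rmorph1.
have [a <-] := psiT_surj x; have [b <-] := psiT_surj y.
by rewrite -rmorphM !Ht_to_H_psi rmorphM.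
Qed.

HB.instance Definition _ := GRing.isZmodMorphism.Build Ht H (@Ht_to_H R d zeta) Ht_to_H_additive.
HB.instance Definition _ := GRing.isMonoidMorphism.Build Ht H (@Ht_to_H R d zeta) Ht_to_H_monoid.

Lemma Ht_to_H_surj (h : H) : exists k : Ht, Ht_to_H k = h.
Proof. by have [a <-] := psiH_surj h; exists (psiT a); exact: Ht_to_H_psi. Qed.

Lemma Ht_T_comm (h : Ht) : Ht_T d zeta * h = h * Ht_T d zeta.
Proof.
have [a <-] := psiT_surj h; apply: subr0_eq.
rewrite -[Ht_T d zeta]/(psiT (f_gen gT)) -!rmorphM -rmorphB.
exact: psiT_rel (RelT d _ a).
Qed.

Lemma Ht_to_H_T : Ht_to_H (Ht_T d zeta) = 0.
Proof. by rewrite -[Ht_T d zeta]/(psiT (f_gen gT)) Ht_to_H_psi psiH_T. Qed.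

(** The elements that become multiples of T in [Ht] form an ideal. It contains T and, by
    [cher_rel_split], the relations with parameter 0, that is, all relations that define [H]. *)
Lemma Ht_to_H_ker (h : Ht) : Ht_to_H h = 0 -> exists k, h = Ht_T d zeta * k.
Proof.
have [a <-] := psiT_surj h; rewrite Ht_to_H_psi => /qpi_eq0.
pose P (a : F) := exists k, psiT a = Ht_T d zeta * k.
have iP : is_ideal P := principal_ideal psiT Ht_T_comm.
have PT : P (f_gen gT) by exists 1; rewrite mulr1.
apply: (ideal_span_min iP) => x [|->] //.
move: x; apply/(cher_rel_split iP PT) => x hx.
by exists 0; rewrite psiT_rel // mulr0.
Qed.

Definition opT : gen -> {linear res (Ht^o) -> res (Ht^o)} := psi_op psiT Ht^o.
Definition opH : gen -> {linear res (H^o) -> res (H^o)} := psi_op psiH H^o.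

Lemma opT_cmod : cmod d opT.
Proof. exact: (psi_cmod hz _ psiT_rel). Qed.
Lemma opH_cmod : cmod d opH.
Proof. exact: (psi_cmod hz _ psiH_rel). Qed.

End HtH.

End FaithfulModulePart.
Export FaithfulModulePart.

(** * PBW theorem, absence of T-torsion, and faithfulness of the centre on the trivial induced
    module *)

Module TorsionFreePart.

Lemma iter_commute {T : Type} (f h : T -> T) n v :
  (forall v, f (h v) = h (f v)) -> f (iter n h v) = iter n h (f v).
Proof. by move=> e; elim: n => //= n <-. Qed.

Lemma geom_root (K : idomainType) (w : K) n : w ^+ n = 1 -> w != 1 ->
  \sum_(i < n) w ^+ i = 0.
Proof.
move=> wn w1; have := subrX1 w n; rewrite wn subrr => /esym/eqP.
by rewrite mulf_eq0 subr_eq0 (negbTE w1) => /eqP.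
Qed.

Section PolyInjectivity.
Context {K : comNzRingType} {J : choiceType}.
Local Notation M := (pmod K J).

(** A left inverse of X that commutes with Y and is locally nilpotent. *)
Definition pXl : {linear M -> M} :=
  flext (fun k => if k.1.1 is a.+1 then fb (a, k.1.2, k.2) else 0).

Lemma pXlK m : pXl (pX m) = m.
Proof.
apply: (fmod_eq (f := pXl \o pX) (g := idfun)) => -[[a b] j] /=.
by rewrite pXU [LHS]flextU.
Qed.

Lemma pXlY m : pXl (pY m) = pY (pXl m).
Proof.
apply: (fmod_eq (f := pXl \o pY) (g := pY \o pXl)) => -[[a b] j] /=.
rewrite pYU /pXl !flextU; case: a => [|a] /=; first by rewrite linear0.
by rewrite pYU.
Qed.

Lemma pXl_nilp m : exists n, iter n pXl m = 0.
Proof.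
have it0 n : iter n pXl 0 = 0 by elim: n => //= n ->; rewrite linear0.
have itl n : forall a u v, iter n pXl (a *: u + v) = a *: iter n pXl u + iter n pXl v.
  by elim: n => //= n IH a u v; rewrite IH linearP.
move: m; apply: fmod_ind; first by exists 0%N.
- move=> a u v [n hn] [k hk]; exists (n + k)%N.
  by rewrite itl [in iter _ _ u]addnC !iterD hn hk !it0 scaler0 addr0.
- case=> -[a b] j; exists a.+1; elim: a => [|a IH]; rewrite iterSr /pXl flextU //.
Qed.

Lemma pX_injective (u v : M) : pX u = pX v -> u = v.
Proof. by move=> e; rewrite -(pXlK u) e pXlK. Qed.

(** With L the left inverse of $X^n$, the equation gives $m=Y^nLm$, hence $m=Y^{nk}L^km$ for all k,
    and L is locally nilpotent. *)
Lemma pYX_inj n (m : M) : (0 < n)%N -> iter n (@pY K J) m = iter n (@pX K J) m -> m = 0.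
Proof.
move=> n0 e; pose L (u : M) := iter n pXl u; pose Q (u : M) := iter n (@pY K J) u.
have LX (u : M) : L (iter n (@pX K J) u) = u.
  rewrite /L; elim: {e L Q n0} n u => // n IH u.
  by rewrite iterSr [iter n.+1 (@pX K J) u]iterS pXlK IH.
have LQ (u : M) : L (Q u) = Q (L u).
  rewrite /L /Q; apply: iter_commute => v; apply/esym; apply: iter_commute => w.
  by rewrite pXlY.
have mE : m = Q (L m) by rewrite -LQ /Q e LX.
have mk k : m = iter k Q (iter k L m).
  elim: k => // k IH; rewrite iterS [iter k.+1 L m]iterSr.
  rewrite {1}mE; congr Q.
  have -> : iter k L (L m) = L (iter k L m) by rewrite -iterSr iterS.
  rewrite -(iter_commute (f := L) (h := Q)) //; congr L; exact: IH.
have [k hk] := pXl_nilp m.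
have it0 (f : {linear M -> M}) i : iter i f 0 = 0 by elim: i => //= i ->; rewrite linear0.
have Q0 i : iter i Q 0 = 0 by elim: i => //= i ->; rewrite /Q it0.
have : iter k L m = 0.
  have -> : iter k L m = iter (k * n) pXl m.
    by elim: k {hk} => // k IH; rewrite mulSn iterD iterS IH.
  by rewrite -{1}(prednK n0) mulnS addnC iterD hk it0.
by move=> h; rewrite (mk k) h Q0.
Qed.

Lemma pcmap_comp (f g : {linear fmod K J -> fmod K J}) m :
  pcmap f (pcmap g m) = pcmap (f \o g) m.
Proof.
apply: (fmod_eq (f := pcmap f \o pcmap g) (g := pcmap (f \o g))) => -[[a b] j] /=.
by rewrite !pcmapU pcmap_inj.
Qed.

Lemma pcmap_ind0 (f : fmod K J -> fmod K J) m : (forall e, f e = 0) -> pcmap f m = 0.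
Proof.
move=> h; apply: (fmod_eq (f := pcmap f) (g := \0)) => -[[a b] j] /=.
by rewrite pcmapU h linear0.
Qed.

Lemma pcmap_id (f : fmod K J -> fmod K J) m : (forall e, f e = e) -> pcmap f m = m.
Proof.
move=> h; apply: (fmod_eq (f := pcmap f) (g := idfun)) => -[[a b] j] /=.
by rewrite pcmapU h pinjU.
Qed.

End PolyInjectivity.

Section ActionTransfer.
Context {R : realType} {d : nat} {zeta : R[i]}.
Hypothesis hz : d.-primitive_root zeta.
Local Notation C := R[i].
Local Notation gen := (gen zeta).
Local Notation F := (freealg C gen).
Notation gT := (GenT zeta).

Lemma act_morph {N N' : lmodType C} (op : gen -> {linear N -> N})
    (op' : gen -> {linear N' -> N'}) (f : {linear N -> N'}) a m :
  (forall g m, f (op g m) = op' g (f m)) -> f (act op a m) = act op' a (f m).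
Proof.
move=> h; move: a.
apply: (malg_ind (P := fun a => f (act op a m) = act op' a (f m))).
- by rewrite !act0 linear0.
- by move=> c u v hu hv; rewrite !actP linearP hu hv.
- by case=> s; rewrite /act !lextU /=; elim: s => //= g s IH; rewrite h IH.
Qed.

Lemma act_psi {A : pzAlgType C} (psi : {rmorphism F -> A})
    (psiC : forall a, psi (algc a) = algc a) (M : lmodType A) a (m : res M) :
  act (psi_op psi M) a m = psi_act psi a m.
Proof.
move: a.
apply: (malg_ind (P := fun a => act (psi_op psi M) a m = psi_act psi a m)).
- by rewrite act0; apply/esym; exact: (ia0 (psi_isact psiC M)).
- move=> c u v hu hv; rewrite actP hu hv; apply/esym.
  rewrite -mul_malgC; apply: etrans (iaD (psi_isact psiC M) _ _ _) _.
  congr (_ + _); apply: etrans (iaM (psi_isact psiC M) _ _ _) _.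
  exact: (iaC (psi_isact psiC M)).
- case=> s; rewrite /act !lextU /=.
  elim: s => [|g s IH] /=.
    have -> : (<< FMonom [::] >> : F) = 1 by congr mkmalgU; exact/esym/fmoneE.
    by apply/esym; exact: (ia1 (psi_isact psiC M)).
  rewrite IH; apply/esym.
  have -> : (<< FMonom (g :: s) >> : F) = f_gen g * << FMonom s >>.
    rewrite /f_gen /freegen [in RHS]malgM_def fgmulUU mulr1; congr mkmalgU.
    by apply/esym; apply: etrans (fmmulE _ _) _; rewrite fmU.
  exact: (iaM (psi_isact psiC M)).
Qed.

Section Cmod.
Context {N : lmodType C} (op : gen -> {linear N -> N}) (cm : cmod d op).

Lemma act_psiT a b m : psiT (d := d) a = psiT b -> act op a m = act op b m.
Proof.
move=> h; apply: subr0_eq; rewrite -actB.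
have : psiT (d := d) (a - b) = 0 by rewrite rmorphB h subrr.
move=> /qpi_eq0 hab; move: m; move: (a - b) hab.
apply: ideal_span_min; first exact: act_ideal.
by move=> x hx m; apply: (act_rel hz _ cm _ hx) => n; exact: act_gen.
Qed.

Hypothesis hT : forall m, op gT m = 0.

Lemma act_psiH a b m : psiH (d := d) a = psiH b -> act op a m = act op b m.
Proof.
move=> h; apply: subr0_eq; rewrite -actB.
have : psiH (d := d) (a - b) = 0 by rewrite rmorphB h subrr.
move=> /qpi_eq0 hab; move: m; move: (a - b) hab.
apply: ideal_span_min; first exact: act_ideal.
move=> x [hx|->] m; last by rewrite act_gen hT.
by apply: (act_rel hz _ cm _ hx) => n; rewrite act0 hT.
Qed.

End Cmod.

Lemma ref_conj01 (r : reflection zeta) :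
  ref_conj r (ref_s zeta 0) \/ ref_conj r (ref_s zeta 1).
Proof.
have [i ->] : exists i, r = ref_s zeta i.
  have [i e] := svalP r; exists i; move: (ref_s zeta i) (erefl : dih_s zeta i = sval (ref_s zeta i)).
  move=> r'; rewrite -e; case: r r' {e} => [w h] [w' h'] /= e.
  by case: w' / e h' => h'; congr exist; exact: Prop_irrelevance.
rewrite -(odd_double_half i) -mul2n; case: (odd i); [right|left].
  by apply: (ref_conj_s hz (k := (i./2).+1)); rewrite addnAC -mulnS.
by apply: (ref_conj_s hz (k := i./2)); rewrite add0n addn0.
Qed.

Lemma cmod_s_X {N : lmodType C} (op : gen -> {linear N -> N}) (cm : cmod d op) k n m :
  op (GenW (dih_s zeta k)) (iter n (op (GenVd zeta 0)) m) =
  zeta ^+ (k * n) *: iter n (op (GenVd zeta 1)) (op (GenW (dih_s zeta k)) m).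
Proof.
elim: n => [|n IH]; first by rewrite muln0 scale1r.
rewrite !iterS (s_X hz (cmWX cm)) IH (linearZ_LR (op _)) scalerA -exprD.
by rewrite mulnS.
Qed.

Lemma cmod_s_Y {N : lmodType C} (op : gen -> {linear N -> N}) (cm : cmod d op) k n m :
  op (GenW (dih_s zeta k)) (iter n (op (GenVd zeta 1)) m) =
  zeta ^- (k * n) *: iter n (op (GenVd zeta 0)) (op (GenW (dih_s zeta k)) m).
Proof.
elim: n => [|n IH]; first by rewrite muln0 expr0 invr1 scale1r.
rewrite !iterS (s_Y hz (cmWY cm)) IH (linearZ_LR (op _)) scalerA zeta_inv //.
by rewrite -invfM -exprD mulnS.
Qed.

End ActionTransfer.

Section GroupSum.
Context {R : realType} {d : nat} {zeta : R[i]}.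
Hypothesis hz : d.-primitive_root zeta.
Local Notation C := R[i].
Local Notation gen := (gen zeta).
Notation gX := (GenVd zeta 0).
Notation gY := (GenVd zeta 1).
Let d0 := prim_order_gt0 hz.
Context {N : lmodType C} (op : gen -> {linear N -> N}) (cmN : cmod d op).
Let bmN := cm_bmod cmN.
Notation rot k := (dihM (dih_s zeta k) (dih_s zeta 0)).
Notation sk k := (dih_s zeta k).
Notation X := (op gX).
Notation Y := (op gY).

Definition Wsum (m : N) : N := \sum_(k < d) (op (GenW (rot k)) m + op (GenW (sk k)) m).

Lemma WsumE w m : op (GenW w) (Wsum m) = Wsum m.
Proof.
pose f k : N := op (GenW (rot k)) m + op (GenW (sk k)) m.
have fd k : f (k + d)%N = f k.
  by rewrite /f (dih_s_period hz (_ : k + d = k %[mod d])%N) // modnDr.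
have hs j : op (GenW (sk j)) (Wsum m) = Wsum m.
  (* Left multiplication by $s_j$ exchanges the two kinds of elements: $s_k$ becomes the rotation of
     index $j-k$ and the rotation of index k becomes $s_{j-k}$. So the sum is permuted by k going to
     $j-k$. *)
  rewrite -[RHS](sum_period_perm fd (g := fun k => j + k * d.-1)%N); last first.
    move=> i i' li li' /eqP; rewrite eqn_modDl => /eqP h.
    have : (i * d.-1 + i + i' = i' * d.-1 + i' + i %[mod d])%N.
      by rewrite -!addnA [(i' + i)%N]addnC -modnDml h modnDml.
    rewrite -!mulnSr prednK // -modnDml modnMl -[in RHS]modnDml modnMl !add0n.
    by rewrite !modn_small.
  rewrite linear_sum; apply: eq_bigr => k _.
  have e : dihM (sk j) (sk k) = rot (j + k * d.-1)%N.
    apply: (dih_ss hz); rewrite addn0 addnCA -mulnS prednK //.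
    by rewrite -modnDmr modnMl addn0.
  have e1 v : op (GenW (sk j)) (op (GenW (sk k)) v) = op (GenW (rot (j + k * d.-1)%N)) v.
    by rewrite -(bmWM bmN) e.
  rewrite (linearD (op _)) (bmWM bmN (sk k)) !e1 addrC; congr (_ + _).
  by rewrite -(bmWM bmN) (dihM_s0K hz).
have [j [->|->]] := dihedral_shape hz w; first exact: hs.
by rewrite (bmWM bmN) !hs.
Qed.

Lemma rot_X k n m : op (GenW (rot k)) (iter n (op gX) m) =
  (zeta ^- k) ^+ n *: iter n (op gX) (op (GenW (rot k)) m).
Proof.
rewrite !(bmWM bmN) (cmod_s_X hz cmN) mul0n expr0 scale1r (cmod_s_Y hz cmN).
by rewrite -exprVn exprM exprVn.
Qed.

Lemma iter_linearD (f : {linear N -> N}) n u v : iter n f (u + v) = iter n f u + iter n f v.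
Proof. by elim: n => //= n ->; rewrite linearD. Qed.
Lemma iter_linearZ (f : {linear N -> N}) n a u : iter n f (a *: u) = a *: iter n f u.
Proof. by elim: n => //= n ->; rewrite (linearZ_LR f). Qed.
Lemma iter_linear_sum (f : {linear N -> N}) n (I : Type) (r : seq I) (G : I -> N) :
  iter n f (\sum_(i <- r) G i) = \sum_(i <- r) iter n f (G i).
Proof. by elim: n => //= n ->; rewrite linear_sum. Qed.

Definition rot_fourier n m : N := \sum_(k < d) (zeta ^- k) ^+ n *: op (GenW (rot k)) m.
Definition s_fourier n m : N := \sum_(k < d) zeta ^+ (k * n) *: op (GenW (sk k)) m.

(** Rotations rescale X and reflections turn it into Y, so in the average of $X^nm$ the two halves
    of the group are told apart by a power of X and a power of Y. The exponent n is the Fourier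
    variable. *)
Lemma Wsum_X n m :
  Wsum (iter n X m) = iter n X (rot_fourier n m) + iter n Y (s_fourier n m).
Proof.
rewrite !iter_linear_sum -big_split; apply: eq_bigr => k _.
by rewrite !iter_linearZ rot_X (cmod_s_X hz cmN).
Qed.

Lemma zeta_invX k : (zeta ^- k) ^+ d = 1.
Proof. by rewrite exprVn -exprM mulnC exprM (prim_expr_order hz) expr1n invr1. Qed.

Lemma fourier_period n m :
  rot_fourier (n + d) m = rot_fourier n m /\ s_fourier (n + d) m = s_fourier n m.
Proof.
split; apply: eq_bigr => k _; congr (_ *: _).
  by rewrite exprD zeta_invX mulr1.
by apply/eqP; rewrite (eq_prim_root_expr hz) mulnDr -modnDmr modnMl addn0.
Qed.

Lemma sum_rot_fourier m : \sum_(n < d) rot_fourier n m = d%:R *: m.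
Proof.
rewrite exchange_big /=.
under eq_bigr => k _ do rewrite -scaler_suml.
pose f k := (\sum_(i < d) (zeta ^- k) ^+ i) *: op (GenW (rot k)) m.
have h k : (1 <= k < d)%N -> f k = 0.
  case/andP=> k0 kd; rewrite /f geom_root ?scale0r ?zeta_invX //.
  by rewrite invr_eq1 -(prim_order_dvd hz) gtnNdvd.
rewrite -(big_mkord xpredT f) big_ltn // (eq_big_nat _ _ h) big1 // addr0 /f.
have -> : rot 0 = dih1 zeta by apply: dihedral_eq; exact: (s_mxK hz).
rewrite (bmW1 bmN); congr (_ *: _).
under eq_bigr do rewrite expr0 invr1 expr1n.
by rewrite sumr_const card_ord.
Qed.

Context (U : {linear N -> N}).
Hypothesis hU : forall g m, U (op g m) = op g (U m).
Hypothesis tors : forall n m,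
  iter d Y (iter n X m) = iter d X (iter n X m) -> m = 0.
Hypothesis U0 : forall m, U (Wsum m) = 0.

(* Y^d eps X^n - eps X^(n+d) involves only rotations, which are then separated *)
(* by Fourier inversion over n. *)
Lemma central_faithful m : U m = 0.
Proof.
have hUi g n v : U (iter n (op g) v) = iter n (op g) (U v).
  by apply: iter_commute => w; rewrite hU.
have h n : U (rot_fourier n m) = 0.
  apply: (tors (n := n)); have [e1 e2] := fourier_period n m.
  have := U0 (iter n X m); have := U0 (iter (d + n) X m).
  rewrite !Wsum_X addnC e1 e2 ![(n + d)%N]addnC !iterD.
  rewrite !(linearD U) !hUi => h1 h2.
  have := congr1 (iter d Y) h2; rewrite iter_linearD.
  have -> : iter d Y 0 = 0 by elim: {1}d => //= k ->; rewrite linear0.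
  by rewrite -h1 => /addIr.
have := congr1 U (sum_rot_fourier m); rewrite linear_sum big1 => [|n _]; last exact: h.
move=> /esym; rewrite (linearZ_LR U) => e.
have dn0 : d%:R != 0 :> C by rewrite pnatr_eq0 -lt0n.
by rewrite -[LHS]scale1r -(mulVf dn0) -scalerA e scaler0.
Qed.

End GroupSum.

Lemma iter_transfer {R : realType} {F A : pzAlgType R[i]} (psi : {rmorphism F -> A})
    {N : lmodType R[i]} (f : F -> N -> N) (hf : isact f) v
    (hk : forall b b', psi b = psi b' -> f b v = f b' v) x y a n k :
  psi y ^+ k * (psi x ^+ n * psi a) = psi x ^+ k * (psi x ^+ n * psi a) ->
  iter k (f y) (iter n (f x) (f a v)) = iter k (f x) (iter n (f x) (f a v)).
Proof.
rewrite -!rmorphXn -!rmorphM => /hk.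
by rewrite !(iaM hf) !(iaX hf).
Qed.

Section PBW.
Context {R : realType} {d : nat} {zeta : R[i]}.
Hypothesis hz : d.-primitive_root zeta.
Local Notation C := R[i].
Local Notation gen := (gen zeta).
Local Notation F := (freealg C gen).
Local Notation Ht := (Ht d zeta).
Local Notation H := (H d zeta).
Notation gT := (GenT zeta).
Notation gX := (GenVd zeta 0).
Notation gY := (GenVd zeta 1).
Let d0 := prim_order_gt0 hz.
Let G : choiceType := {classic dihedral zeta}.

Definition regG (w : dihedral zeta) (g : G) : G := dihM w g.

Lemma regG1 g : regG (dih1 zeta) g = g.
Proof. by apply: dihedral_eq; rewrite /= mul1mx. Qed.
Lemma regGM w1 w2 g : regG (dihM w1 w2) g = regG w1 (regG w2 g).
Proof. by apply: dihedral_eq; rewrite /= mulmxA. Qed.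

Local Notation B := (nat * nat * nat * G)%type.

Section Regular.
Context (theta : bool).
Local Notation M := (pmod C (pidx B)).

Definition reg_op : gen -> {linear M -> M} := vop (d := d) (base_op regG theta).
Definition reg1 : M := pinj 0 0 (pinj 0 0 (fb (0%N, 0%N, 0%N, dih1 zeta : G))).

Lemma reg_cmod : cmod d reg_op.
Proof. by apply: (vop_cmod hz); exact: (base_bmod hz _ regG1 regGM). Qed.

Context {A : pzAlgType C} (psi : {rmorphism F -> A}).
Hypothesis psiC : forall a, psi (algc a) = algc a.
Hypothesis psi0 : forall a, cher_rel d (f_gen gT) a -> psi a = 0.
Hypothesis psiT0 : theta = false -> psi (f_gen gT) = 0.

Definition reg_lift : {linear M -> res (A^o)} :=
  pbw_lift (psi_op psi A^o) (fun w : G => psi (f_gen (GenW w))).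

Let cmA : cmod d (psi_op psi A^o).
Proof. exact: (psi_cmod hz psiC psi0). Qed.

(** The PBW theorem in the form used here. The value of a in the algebra is recovered from its
    action on [reg1], a vector of a module with an explicit monomial basis. So a vanishes in the
    algebra as soon as it kills [reg1]. *)
Lemma reg_lift_act a : reg_lift (act reg_op a reg1) = psi a.
Proof.
rewrite (act_morph (op' := psi_op psi A^o)).
  rewrite (act_psi psiC) /reg_lift pbw_lift1.
  have e1 : psi (f_gen (GenW (dih1 zeta))) = 1.
    by apply: subr0_eq; rewrite -(rmorph1 psi) -rmorphB; exact: psi0 (RelW1 d _).
  by rewrite /psi_act /resmul e1; exact: mulr1.
move=> g m; rewrite /reg_lift (pbw_lift_op hz regG1 regGM cmA) //.
- move=> w g'; have := psi0 (RelWM d (f_gen gT) w g').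
  by rewrite rmorphB rmorphM => /subr0_eq.
- by move=> /psiT0 e n; rewrite /psi_op /resmul /= e; exact: (@scale0r A A^o).
- exact: (ref_conj01 hz).
Qed.

End Regular.

(** In the PBW model T shifts one exponent of the monomial basis, and the shift has a left
    inverse. *)
Theorem Ht_torsion_free (h : Ht) : Ht_T d zeta * h = 0 -> h = 0.
Proof.
have [a <-] := psiT_surj h => h0.
have lf := @reg_lift_act true Ht (@psiT R d zeta) (fun a => erefl) (@psiT_rel R d zeta).
have hT b : pcmap (pcmap (bT true)) b = 0 -> b = 0 :> pmod C (pidx B).
  pose L : {linear fmod C B -> fmod C B} :=
    flext (fun k => if k.1.1.1 is l.+1 then fb (l, k.1.1.2, k.1.2, k.2) else 0).
  move=> e; rewrite -(@pcmap_id _ _ (pcmap L \o pcmap (bT true)) b).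
    by rewrite -pcmap_comp e linear0.
  move=> e' /=; rewrite pcmap_comp; apply: pcmap_id => e'' /=.
  apply: (fmod_eq (f := L \o bT true) (g := idfun)) => -[[[l m] n] g] /=.
  by rewrite /bT bshiftU /L flextU /= addn1 !addn0.
have : act (reg_op true) (f_gen gT * a) (reg1) = 0.
  rewrite -[RHS](act0 (reg_op true) reg1); apply: (act_psiT hz (reg_cmod true)).
  by rewrite rmorphM rmorph0.
rewrite actM act_gen => /hT e.
by rewrite -(lf (fun e => False_ind _ (notF (esym e)))) e linear0.
Qed.

Let regH_T m : reg_op false gT m = 0.
Proof. by apply: pcmap_ind0 => e; exact: pcmap_ind0. Qed.

Definition triv_op : gen -> {linear pmod C (pidx (nat * nat * nat * unit)%type) ->
    pmod C (pidx (nat * nat * nat * unit)%type)} :=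
  vop (d := d) (base_op (fun _ (g : unit) => g) false).
Definition triv1 : pmod C (pidx (nat * nat * nat * unit)%type) :=
  pinj 0 0 (pinj 0 0 (fb (0%N, 0%N, 0%N, tt))).

Lemma triv_cmod : cmod d triv_op.
Proof. by apply: (vop_cmod hz); apply: (base_bmod hz). Qed.

Lemma triv_T m : triv_op gT m = 0.
Proof. by apply: pcmap_ind0 => e; exact: pcmap_ind0. Qed.

Lemma triv_W w : triv_op (GenW w) triv1 = triv1.
Proof. by rewrite /triv_op /triv1 /= vW_inj /= eW_inj bWU. Qed.

Section Faithful.
Context {A : pzAlgType C} (psi : {rmorphism F -> A}).
Hypothesis psiC : forall a, psi (algc a) = algc a.
Hypothesis psi0 : forall a, cher_rel d (f_gen gT) a -> psi a = 0.
Hypothesis psiT0 : psi (f_gen gT) = 0.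
Hypothesis psi_surj : forall h, exists a, psi a = h.
Hypothesis psi_act : forall a b, psi a = psi b ->
  act (reg_op false) a reg1 = act (reg_op false) b reg1.
Let op : gen -> {linear res (A^o) -> res (A^o)} := psi_op psi A^o.
Let cmA : cmod d op.
Proof. exact: (psi_cmod hz psiC psi0). Qed.

Lemma psi_reg_inj a : act (reg_op false) a reg1 = 0 -> psi a = 0.
Proof.
by move=> e; rewrite -(reg_lift_act psiC psi0 (theta := false) (fun _ => psiT0)) e linear0.
Qed.

Lemma psi_op_iter (g : gen) k (v : A) : iter k (op g) v = psi (f_gen g) ^+ k * v.
Proof.
elim: k => [|k IH]; first by rewrite expr0 mul1r.
by rewrite iterS IH exprS -mulrA.
Qed.

(** Transported from the PBW model, where $Y^d-X^d$ is injective by [pYX_inj] and X is injective. *)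
Lemma psi_torsion n (h : A) :
  iter d (op gY) (iter n (op gX) h) = iter d (op gX) (iter n (op gX) h) -> h = 0.
Proof.
have [a <-] := psi_surj h; rewrite !psi_op_iter => e.
have := iter_transfer (act_isact (reg_op false)) psi_act e.
have itE g k m : iter k (act (reg_op false) (f_gen g)) m = iter k (reg_op false g) m.
  by elim: k => //= k ->; rewrite act_gen.
rewrite !itE => /(pYX_inj d0) e3; apply: psi_reg_inj; move: e3.
have inj : injective (fun m : pmod C (pidx B) => pX m) by exact: pX_injective.
elim: n {e} => //= n IH e; apply: IH; apply: inj.
by rewrite linear0.
Qed.

(* The centre acts faithfully on H e, for e the trivial idempotent. *)
Lemma psi_triv_faithful a : (forall h, psi a * h = h * psi a) ->
  act triv_op a triv1 = 0 -> psi a = 0.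
Proof.
move=> hcen h0.
pose U : {linear res (A^o) -> res (A^o)} := resmul (psi a).
have UE m : U m = psi a * m :> A by [].
suff e : U (1 : A) = 0 by rewrite -[LHS]mulr1 -UE.
apply: (central_faithful hz cmA (U := U)).
- move=> g m; rewrite !UE.
  have gE v : op g v = psi (f_gen g) * v :> A by [].
  by rewrite !gE !mulrA hcen.
- exact: psi_torsion.
(* The sum over the orbit of m is invariant, so the trivial induced module maps to A with [triv1]
   going to this sum. As a kills [triv1], it kills the sum. *)
move=> m; pose phi : {linear _ -> _} := pbw_lift op (fun _ : unit => Wsum (d := d) op m).
have e : phi triv1 = Wsum (d := d) op m by exact: pbw_lift1.
rewrite -e; transitivity (act op a (phi triv1)).
  by apply/esym; exact: (act_psi psiC).
rewrite -(act_morph (op := triv_op)); first by rewrite h0 linear0.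
move=> g v; apply: (pbw_lift_op hz _ _ cmA) => //.
- by move=> w g'; rewrite (WsumE hz cmA).
- move=> _ n; have TE u : op gT u = psi (f_gen gT) * u :> A by [].
  by rewrite TE psiT0 mul0r.
- exact: (ref_conj01 hz).
Qed.

End Faithful.

Theorem H_triv_faithful a : (forall h, psiH (d := d) a * h = h * psiH a) ->
  act triv_op a triv1 = 0 -> psiH (d := d) a = 0.
Proof.
apply: psi_triv_faithful.
- by [].
- exact: psiH_rel.
- exact: psiH_T.
- exact: psiH_surj.
- by move=> b b' e; exact: (act_psiH hz (reg_cmod false) regH_T).
Qed.

End PBW.

End TorsionFreePart.
Export TorsionFreePart.

(** * The Poisson bracket on the centre of an algebra with a deformation *)

Module AbstractPoissonPart.

Definition comm {A : pzRingType} (a b : A) : A := a * b - b * a.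

Section Commutators.
Context {A : pzRingType}.
Implicit Types a b c : A.

Lemma comm_xx a : comm a a = 0. Proof. exact: subrr. Qed.
Lemma commC a b : comm a b = - comm b a. Proof. by rewrite /comm opprB. Qed.
Lemma commDl a b c : comm (a + b) c = comm a c + comm b c.
Proof. by rewrite /comm mulrDl mulrDr opprD addrACA. Qed.
Lemma commMl a b c : comm (a * b) c = a * comm b c + comm a c * b.
Proof. by rewrite /comm mulrBr mulrBl !mulrA addrA subrK. Qed.
Lemma commMr a b c : comm c (a * b) = a * comm c b + comm c a * b.
Proof. by rewrite commC commMl opprD -mulrN -mulNr -(commC c a) -(commC c b). Qed.
Lemma commBr a b c : comm c (a - b) = comm c a - comm c b.
Proof. rewrite /comm mulrBr mulrBl; zmod_eq A. Qed.
Lemma commDr a b c : comm c (a + b) = comm c a + comm c b.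
Proof. by rewrite commC commDl opprD -(commC c a) -(commC c b). Qed.
Lemma comm0 c : comm c 0 = 0. Proof. by rewrite /comm mulr0 mul0r subrr. Qed.
Lemma comm_jacobi a b c : comm (comm a b) c = comm a (comm b c) - comm b (comm a c).
Proof.
rewrite /comm !mulrBl !mulrBr !mulrA; zmod_eq A.
Qed.

End Commutators.

Section AbstractPoisson.
Context {K : pzRingType} {A B : pzAlgType K} (phi : {rmorphism A -> B}) (t : A).
Hypothesis phiC : forall a, phi (algc a) = algc a.
Hypothesis tC : forall a, t * a = a * t.
Hypothesis phit : phi t = 0.
Hypothesis phi_surj : forall b, exists a, phi a = b.
Hypothesis phi_ker : forall a, phi a = 0 -> exists k, a = t * k.
Hypothesis tors : forall a, t * a = 0 -> a = 0.

Lemma tmul_inj a b : t * a = t * b -> a = b.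
Proof. by move=> e; apply: subr0_eq; apply: tors; rewrite mulrBr e subrr. Qed.

Lemma comm_tl a b : comm (t * a) b = t * comm a b.
Proof. by rewrite /comm mulrBr !mulrA (tC b). Qed.
Lemma comm_tr a b : comm a (t * b) = t * comm a b.
Proof. by rewrite commC comm_tl -mulrN -(commC a b). Qed.

Lemma central_lift (z : centre B) zt h : phi zt = centre_val z ->
  exists k, comm zt h = t * k.
Proof.
move=> e; apply: phi_ker; rewrite rmorphB !rmorphM e.
by case: z {e} => z /= /asboolP ->; rewrite subrr.
Qed.

(** Two lifts differ by a multiple of t, say $tk$, which changes the quotient of the commutator by
    $[k,\tilde z']$. This is again a multiple of t, since $\tilde z'$ lifts a central element. *)
Lemma bracket_uniq (z z' : centre B) zt zt' wt zt2 zt2' wt2 :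
  phi zt = centre_val z -> phi zt' = centre_val z' -> t * wt = comm zt zt' ->
  phi zt2 = centre_val z -> phi zt2' = centre_val z' -> t * wt2 = comm zt2 zt2' ->
  phi wt = phi wt2.
Proof.
move=> e1 e2 e3 f1 f2 f3.
have [k ek] : exists k, zt - zt2 = t * k by apply: phi_ker; rewrite rmorphB e1 f1 subrr.
have [l el] : exists l, zt' - zt2' = t * l by apply: phi_ker; rewrite rmorphB e2 f2 subrr.
have [p ep] := central_lift k e2; have [q eq] := central_lift l f1.
have : t * (wt - wt2) = t * (comm k zt' + comm zt2 l).
  rewrite mulrBr e3 f3 mulrDr -comm_tl -comm_tr -ek -el.
  rewrite /comm !mulrBl !mulrBr; zmod_eq A.
move=> /tmul_inj e; apply: subr0_eq; rewrite -rmorphB e rmorphD.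
rewrite [comm k _]commC rmorphN ep eq !rmorphM phit !mul0r oppr0 addr0 //.
Qed.

(** By the Jacobi identity $t[w,h]=[\tilde z,[\tilde z',h]]-[\tilde z',[\tilde z,h]]$, and every
    commutator with a lift of a central element yields a factor t. So the right side is divisible by
    $t^2$. *)
Lemma bracket_central (z z' : centre B) zt zt' wt :
  phi zt = centre_val z -> phi zt' = centre_val z' -> t * wt = comm zt zt' ->
  phi wt \in central (A := B).
Proof.
move=> e1 e2 e3; apply/asboolP => b; have [h <-] := phi_surj b.
apply: subr0_eq; rewrite -!rmorphM -rmorphB -/(comm _ _).
have [k ek] := central_lift h e2; have [l el] := central_lift h e1.
have [p ep] := central_lift k e1; have [q eq] := central_lift l e2.
have : t * comm wt h = t * (t * (p - q)).
  by rewrite -comm_tl e3 comm_jacobi ek el !comm_tr ep eq !mulrBr.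
by move=> /tmul_inj ->; rewrite rmorphM phit mul0r.
Qed.

Context (pois : centre B -> centre B -> centre B).
Hypothesis poisE : forall (z z' : centre B) zt zt' wt,
  phi zt = centre_val z -> phi zt' = centre_val z' -> t * wt = comm zt zt' ->
  centre_val (pois z z') = phi wt.

Lemma lift_exists (z : centre B) : exists zt, phi zt = centre_val z.
Proof. exact: phi_surj. Qed.

(** Applied to scalars and to the elements $C_r-c_r$. The latter shows that the bracket descends to
    the specialised centre. *)
Lemma pois_casimir z zt z' : phi zt = centre_val z -> (forall a, zt * a = a * zt) ->
  pois z z' = 0.
Proof.
move=> e hc; have [zt' e'] := lift_exists z'; apply: val_inj.
by rewrite /= (poisE (wt := 0) e e') ?rmorph0 // mulr0 /comm hc subrr.
Qed.

Lemma poisC z z' : pois z z' = - pois z' z.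
Proof.
have [zt e] := lift_exists z; have [zt' e'] := lift_exists z'.
have [k ek] := central_lift zt' e; apply: val_inj => /=.
rewrite (poisE e e' (esym ek)) (poisE (wt := - k) e' e) ?rmorphN ?opprK //.
by rewrite mulrN -ek -commC.
Qed.

Lemma pois_xx z : pois z z = 0.
Proof.
have [zt e] := lift_exists z; apply: val_inj.
by rewrite /= (poisE (wt := 0) e e) ?rmorph0 // mulr0 comm_xx.
Qed.

Lemma poisDl u v z : pois (u + v) z = pois u z + pois v z.
Proof.
have [ut eu] := lift_exists u; have [vt ev] := lift_exists v; have [zt ez] := lift_exists z.
have [k ek] := central_lift zt eu; have [l el] := central_lift zt ev; apply: val_inj => /=.
rewrite (poisE eu ez (esym ek)) (poisE ev ez (esym el)) -rmorphD.
apply: (poisE (zt := ut + vt) _ ez); first by rewrite rmorphD eu ev.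
by rewrite mulrDr -ek -el commDl.
Qed.

Lemma poisMl u v z : pois (u * v) z = u * pois v z + pois u z * v.
Proof.
have [ut eu] := lift_exists u; have [vt ev] := lift_exists v; have [zt ez] := lift_exists z.
have [k ek] := central_lift zt eu; have [l el] := central_lift zt ev; apply: val_inj => /=.
rewrite (poisE eu ez (esym ek)) (poisE ev ez (esym el)) -eu -ev -!rmorphM -rmorphD.
apply: (poisE (zt := ut * vt) _ ez); first by rewrite rmorphM eu ev.
by rewrite commMl el ek mulrDr !mulrA (tC ut).
Qed.

Lemma pois_algc a z : pois (algc a) z = 0.
Proof. by apply: (pois_casimir (zt := algc a)) => [|b]; [exact: phiC | exact: algc_central]. Qed.

Lemma poisDr u v z : pois z (u + v) = pois z u + pois z v.
Proof. by rewrite poisC poisDl opprD -(poisC z u) -(poisC z v). Qed.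
Lemma poisMr u v z : pois z (u * v) = u * pois z v + pois z u * v.
Proof. by rewrite poisC poisMl opprD -mulrN -mulNr -(poisC z u) -(poisC z v). Qed.
Lemma poisZl a u z : pois (algc a * u) z = algc a * pois u z.
Proof. by rewrite poisMl pois_algc mul0r addr0. Qed.
Lemma poisZr a u z : pois z (algc a * u) = algc a * pois z u.
Proof. by rewrite poisC poisZl -mulrN -poisC. Qed.
Lemma poisNl u z : pois (- u) z = - pois u z.
Proof.
have p0 : pois 0 z = 0 by have := poisMl 0 0 z; rewrite mulr0 !mul0r mulr0 addr0.
by apply: (addrI (pois u z)); rewrite -poisDl !subrr.
Qed.

Lemma pois_jacobi u v w : pois (pois u v) w = pois u (pois v w) - pois v (pois u w).
Proof.
have [ut eu] := lift_exists u; have [vt ev] := lift_exists v; have [wt ew] := lift_exists w.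
have [k ek] := central_lift vt eu; have [l el] := central_lift wt ev.
have [m em] := central_lift wt eu.
have euv := poisE eu ev (esym ek); have evw := poisE ev ew (esym el).
have euw := poisE eu ew (esym em).
have [p ep] := central_lift l eu; have [q eq] := central_lift m ev.
apply: val_inj => /=.
rewrite (poisE eu (esym evw) (esym ep)) (poisE ev (esym euw) (esym eq)) -rmorphB.
apply: (poisE (esym euv) ew); apply: tmul_inj.
by rewrite -[RHS]comm_tl -ek comm_jacobi el em !comm_tr ep eq !mulrBr.
Qed.

End AbstractPoisson.

End AbstractPoissonPart.
Export AbstractPoissonPart.

(** * Commutators in the algebra, and their symmetries *)

Module DunklRelationsPart.

(* [pw u v m i] is the coefficient of s^i in (u + s v)^m. *)
Section Shuffles.
Context {A : pzRingType}.

Fixpoint pw (u v : A) (m i : nat) : A :=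
  match m, i with
  | 0, 0 => 1
  | 0, _ => 0
  | m'.+1, 0 => u * pw u v m' 0
  | m'.+1, i'.+1 => u * pw u v m' i + v * pw u v m' i'
  end.

(* The image of [pw u v m i] under the derivation with u |-> u', v |-> v'. *)
Fixpoint pwd (u v u' v' : A) (m i : nat) : A :=
  match m, i with
  | 0, _ => 0
  | m'.+1, 0 => u * pwd u v u' v' m' 0 + u' * pw u v m' 0
  | m'.+1, i'.+1 => u * pwd u v u' v' m' i + u' * pw u v m' i +
                    (v * pwd u v u' v' m' i' + v' * pw u v m' i')
  end.

Lemma pw_gt u v m i : (m < i)%N -> pw u v m i = 0.
Proof.
elim: m i => [|m IH] [|i] //= lt; rewrite !IH ?mulr0 ?addr0 //.
exact: ltnW.
Qed.

Lemma pw0 u v m : pw u v m 0 = u ^+ m.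
Proof. by elim: m => //= m ->; rewrite exprS. Qed.

Lemma pwmm u v m : pw u v m m = v ^+ m.
Proof. by elim: m => //= m IH; rewrite pw_gt // mulr0 add0r IH exprS. Qed.

Lemma comm_pw (t c u v u' v' : A) : (forall a, t * a = a * t) ->
  comm c u = t * u' -> comm c v = t * v' ->
  forall m i, comm c (pw u v m i) = t * pwd u v u' v' m i.
Proof.
move=> tC hu hv; elim=> [|m IH] [|i] /=.
- by rewrite /comm mulr1 mul1r subrr mulr0.
- by rewrite comm0 mulr0.
- by rewrite commMr IH hu mulrDr !mulrA (tC u).
- by rewrite commDr !commMr !IH hu hv !mulrDr !mulrA (tC u) (tC v).
Qed.

Lemma pwSS u v m i : pw u v m.+1 i.+1 = u * pw u v m i.+1 + v * pw u v m i.
Proof. by []. Qed.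

Lemma pwdSS u v u' v' m i : pwd u v u' v' m.+1 i.+1 =
  u * pwd u v u' v' m i.+1 + u' * pw u v m i.+1 +
  (v * pwd u v u' v' m i + v' * pw u v m i).
Proof. by []. Qed.

Lemma pwdS0 u v u' v' m : pwd u v u' v' m.+1 0 = u * pwd u v u' v' m 0 + u' * pw u v m 0.
Proof. by []. Qed.

(** The coefficient of $s^i$ is the sum of the words with i letters v. Replacing one u by v produces
    each word with i+1 letters v exactly i+1 times; u and v need not commute. *)
Lemma pwd_lower u v m i : pwd u v (- v) 0 m i = - (pw u v m i.+1 *+ i.+1).
Proof.
elim: m i => [|m IH] [|i]; try by rewrite mul0rn oppr0.
  by rewrite pwdS0 IH pwSS !mulr1n mulrN mulNr -opprD.
rewrite pwdSS !IH mul0r addr0 pwSS mulrnDl -!mulrnAr !mulrN mulNr.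
set p := pw u v m i.+2 *+ i.+2; set r := pw u v m i.+1.
have -> : r *+ i.+2 = r + r *+ i.+1 by exact: mulrS.
by rewrite (mulrDr v) !opprD -addrA.
Qed.

(** Replacing one v by u produces each word with i letters v once for each of its $m-i$ letters
    u. *)
Lemma pwd_raise u v m i : pwd u v 0 u m i.+1 = pw u v m i *+ (m - i).
Proof.
have h0 k : pwd u v 0 u k 0 = 0.
  by elim: k => // k IH; rewrite pwdS0 IH mulr0 mul0r addr0.
elim: m i => [|m IH] i; first by rewrite sub0n mulr0n.
rewrite pwdSS IH mul0r addr0; case: i => [|i].
  by rewrite h0 mulr0 add0r !subn0 !pw0 exprS mulrnAr mulrSr.
rewrite IH subSS pwSS mulrnDl -!mulrnAr.
have [le|gt] := leqP i m; last first.
  by rewrite !(@pw_gt u v m) ?mul0rn ?mulr0 ?addr0 // ltnW.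
have -> : pw u v m i.+1 *+ (m - i.+1) = pw u v m i.+1 *+ (m - i) - pw u v m i.+1.
  have [lt|ge] := ltnP i m; last by rewrite pw_gt // !mul0rn subr0.
  by rewrite -(subnSK lt) mulrSr addrK.
rewrite mulrBr; zmod_eq A.
Qed.

Lemma pwd_raise0 u v m : pwd u v 0 u m 0 = 0.
Proof. by elim: m => //= k ->; rewrite mulr0 mul0r addr0. Qed.

End Shuffles.

(** The relations with the reflection sums as ring elements. The list is stable under two
    symmetries, so each commutator formula has to be computed only once. *)
Record dunkl_rel {A : pzRingType} (d : nat) (x y X Y t : A) (rsg : nat -> A) : Prop := DunklRel {
  tC : forall a : A, t * a = a * t;
  rxy : x * y = y * x;
  rXY : X * Y = Y * X;
  rxX : x * X = X * x + (t - rsg 0);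
  rxY : x * Y = Y * x + rsg d.-1;
  ryX : y * X = X * y + rsg 1;
  ryY : y * Y = Y * y + (t - rsg 0);
  rsg_x : forall k, rsg k * x = y * rsg (k + d.-1)%N;
  rsg_y : forall k, rsg k * y = x * rsg k.+1;
  rsg_X : forall k, rsg k * X = Y * rsg k.+1;
  rsg_Y : forall k, rsg k * Y = X * rsg (k + d.-1)%N;
  rsg_mod : forall k l, (k = l %[mod d])%N -> rsg k = rsg l }.

Section DunklRel.
Context {A : pzRingType} (d : nat).
Hypothesis d0 : (0 < d)%N.

Let mod_eq a b m n : (a + m * d = b + n * d)%N -> (a = b %[mod d])%N.
Proof. by move=> e; rewrite -(modnMDl m a) addnC e addnC modnMDl. Qed.
Let mod_pred2 l : (l + d.-1 * d.-1 = l.+1 %[mod d])%N.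
Proof. by apply: (mod_eq (m := 1) (n := d.-1)); case: d d0 => //= e _; lia. Qed.

(** Exchanging the two coordinates inverts $\zeta$ and hence sends $\sigma_k$ to $\sigma_{-k}$. *)
Lemma dunkl_swap (x y X Y t : A) rsg : dunkl_rel d x y X Y t rsg ->
  dunkl_rel d y x Y X t (fun k => rsg (k * d.-1)%N).
Proof.
move=> r; have md := rsg_mod r; split.
- exact: tC r.
- exact: esym (rxy r).
- exact: esym (rXY r).
- exact: ryY r.
- by rewrite (ryX r); congr (_ + _); apply: md; exact: esym (mod_pred2 0).
- by rewrite mul1n; exact: rxY r.
- exact: rxX r.
- by move=> k; rewrite (rsg_y r) mulnDl; congr (_ * _); apply: md; rewrite mod_pred2.
- by move=> k; rewrite (rsg_x r) mulSn addnC.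
- by move=> k; rewrite (rsg_Y r) mulSn addnC.
- by move=> k; rewrite (rsg_X r) mulnDl; congr (_ * _); apply: md; rewrite mod_pred2.
- by move=> k l e; apply: md; rewrite -modnMml e modnMml.
Qed.

(** Exchanging $V$ and $V^*$ reverses the commutators $[u,U]$, which changes the signs of t and of
    the reflection sums. *)
Lemma dunkl_dual (x y X Y t : A) rsg : dunkl_rel d x y X Y t rsg ->
  dunkl_rel d X Y x y (- t) (fun k => - rsg (k * d.-1)%N).
Proof.
move=> r; have md := rsg_mod r; split.
- by move=> a; rewrite mulNr mulrN (tC r).
- exact: rXY r.
- exact: rxy r.
- rewrite (rxX r) mul0n; zmod_eq A.
- rewrite (ryX r) -addrA (_ : rsg (d.-1 * d.-1)%N = rsg 1) ?subrr ?addr0 //.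
  by apply: md; exact: mod_pred2 0.
- by rewrite (rxY r) mul1n -addrA subrr addr0.
- rewrite (ryY r) mul0n; zmod_eq A.
- move=> k; rewrite mulNr mulrN (rsg_X r) mulnDl; congr (- (_ * _)); apply: md.
  by rewrite mod_pred2.
- by move=> k; rewrite mulNr mulrN (rsg_Y r) mulSn addnC.
- by move=> k; rewrite mulNr mulrN (rsg_x r) mulSn addnC.
- move=> k; rewrite mulNr mulrN (rsg_y r) mulnDl; congr (- (_ * _)); apply: md.
  by rewrite mod_pred2.
- by move=> k l e; congr (- _); apply: md; rewrite -modnMml e modnMml.
Qed.

Context (x y X Y t : A) (rsg : nat -> A) (rr : dunkl_rel d x y X Y t rsg).
Local Notation tC := (tC rr).
Local Notation rxy := (rxy rr).
Local Notation rXY := (rXY rr).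
Local Notation rxX := (rxX rr).
Local Notation rxY := (rxY rr).
Local Notation ryX := (ryX rr).
Local Notation ryY := (ryY rr).
Local Notation rsg_x := (rsg_x rr).
Local Notation rsg_y := (rsg_y rr).
Local Notation rsg_X := (rsg_X rr).
Local Notation rsg_Y := (rsg_Y rr).
Local Notation rsg_mod := (rsg_mod rr).

Let sgd : rsg d.-1.+1 = rsg 0.
Proof. by apply: rsg_mod; rewrite prednK // modnn mod0n. Qed.
Let sg1d : rsg (1 + d.-1) = rsg 0.
Proof. by rewrite add1n sgd. Qed.

Notation q := (x * y).
Notation Q := (X * Y).

(** The reflection parts of $[x,X]$ and $[x,Y]$ cancel because $\sigma_0Y=X\sigma_{-1}$. *)
Lemma comm_Qx : comm Q x = - (t * Y).
Proof.
rewrite /comm -mulrA (_ : Y * x = x * Y - rsg d.-1); last by rewrite rxY addrK.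
rewrite mulrBr mulrA (_ : X * x = x * X - (t - rsg 0)); last by rewrite rxX addrK.
rewrite mulrBl !mulrBl -(rsg_Y 0) -mulrA; zmod_eq A.
Qed.

Lemma comm_Qy : comm Q y = - (t * X).
Proof.
rewrite /comm rXY -mulrA (_ : X * y = y * X - rsg 1); last by rewrite ryX addrK.
rewrite mulrBr mulrA (_ : Y * y = y * Y - (t - rsg 0)); last by rewrite ryY addrK.
rewrite !mulrBl -(rsg_X 0) -mulrA -rXY; zmod_eq A.
Qed.

Lemma comm_qX : comm q X = t * y.
Proof.
rewrite /comm -mulrA ryX mulrDr [x * (X * y)]mulrA rxX mulrDl [(t - _) * _]mulrBl rsg_y -!mulrA; zmod_eq A.
Qed.

Lemma comm_qY : comm q Y = t * x.
Proof.
rewrite /comm rxy -mulrA rxY mulrDr [y * (Y * x)]mulrA ryY mulrDl [(t - _) * _]mulrBl rsg_x add0n -!mulrA.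
zmod_eq A.
Qed.

Lemma comm_xX n : comm x (X ^+ n) = t * X ^+ n.-1 *+ n -
  \sum_(k < n) X ^+ (n.-1 - k) * Y ^+ k * rsg k.
Proof.
elim: n => [|n IH]; first by rewrite big_ord0 mulr0n subr0 expr0 /comm mulr1 mul1r subrr.
have sX k : rsg 0 * X ^+ k = Y ^+ k * rsg k.
  elim: k => [|k IHk]; first by rewrite !expr0 mulr1 mul1r.
  by rewrite exprSr mulrA IHk -mulrA rsg_X mulrA -exprSr.
rewrite exprS commMr IH {1}/comm rxX [X * x + _ - _]addrC addKr mulrBl sX.
rewrite big_ord_recr /= subnn expr0 mul1r mulrBr mulr_sumr.
have -> : \sum_(k < n) X * (X ^+ (n.-1 - k) * Y ^+ k * rsg k) =
    \sum_(k < n) X ^+ (n - k) * Y ^+ k * rsg k.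
  apply: eq_bigr => k _; rewrite !mulrA -exprS; congr (X ^+ _ * _ * _).
  by have := ltn_ord k; lia.
have -> : X * (t * X ^+ n.-1 *+ n) = t * X ^+ n *+ n.
  case: n {IH} => [|n]; first by rewrite !mulr0n mulr0.
  by rewrite mulrnAr mulrA -tC -mulrA -exprS.
rewrite mulrS; set a := _ *+ n; zmod_eq A.
Qed.

Lemma comm_xY n : comm x (Y ^+ n) =
  \sum_(k < n) Y ^+ (n.-1 - k) * X ^+ k * rsg (k.+1 * d.-1).
Proof.
have sY k : rsg d.-1 * Y ^+ k = X ^+ k * rsg (k.+1 * d.-1).
  elim: k => [|k IHk]; first by rewrite !expr0 mulr1 mul1r mul1n.
  by rewrite exprSr mulrA IHk -mulrA rsg_Y mulrA -exprSr addnC -mulSn.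
elim: n => [|n IH]; first by rewrite big_ord0 expr0 /comm mulr1 mul1r subrr.
rewrite exprS commMr IH {1}/comm rxY [Y * x + _]addrC addrK sY.
rewrite big_ord_recr /= subnn expr0 mul1r mulr_sumr; congr (_ + _).
apply: eq_bigr => k _; rewrite !mulrA -exprS; congr (Y ^+ _ * _ * _).
by have := ltn_ord k; lia.
Qed.

Lemma swap_reflect n (G : nat -> A) : (0 < n)%N ->
  \sum_(k < n) G k = \sum_(k < n) G (n.-1 - k)%N.
Proof.
move=> n0; rewrite (reindex_inj rev_ord_inj); apply: eq_bigr => k _ /=.
by congr G; have := ltn_ord k; lia.
Qed.

(** After reversing the order of summation, the reflection terms of $[x,Y^d]$ become
    $X^{d-1-k}Y^k\sigma_{k-d}$. As $\sigma$ has period d they cancel those of $[x,X^d]$. *)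
Lemma comm_xR : comm x (X ^+ d + Y ^+ d) = t * X ^+ d.-1 *+ d.
Proof.
rewrite commDr comm_xX comm_xY -addrA -[RHS]addr0; congr (_ + _).
rewrite [X in _ + X](swap_reflect (fun k => Y ^+ (d.-1 - k) * X ^+ k * rsg (k.+1 * d.-1))) //.
rewrite -sumrN -big_split big1 // => k _ /=; have kd := ltn_ord k.
apply/eqP; rewrite addrC subr_eq0; apply/eqP.
have -> : (d.-1 - (d.-1 - k) = k)%N by lia.
have -> : Y ^+ k * X ^+ (d.-1 - k) = X ^+ (d.-1 - k) * Y ^+ k.
  by apply: commrX; apply/commr_sym/commrX; exact: rXY.
congr (_ * _); apply: rsg_mod; apply/eqP.
rewrite -(eqn_modDr (d.-1 - k).+1) -mulnSr prednK // modnMl.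
by have -> : (k + (d.-1 - k).+1 = d)%N; [lia | rewrite modnn].
Qed.

End DunklRel.

Section RingRelations.
Context {R : realType} {d : nat} {zeta : R[i]}.
Hypothesis hz : d.-primitive_root zeta.
Local Notation C := R[i].
Local Notation gen := (gen zeta).
Local Notation F := (freealg C gen).
Let d0 := prim_order_gt0 hz.

Context {A : pzAlgType C} (psi : {rmorphism F -> A}).
Hypothesis psiC : forall a, psi (algc a) = algc a.
Hypothesis psi0 : forall a, cher_rel d (f_gen (GenT zeta)) a -> psi a = 0.
Let op : gen -> {linear res (A^o) -> res (A^o)} := psi_op psi A^o.
Let cmA : cmod d op.
Proof. exact: (psi_cmod hz psiC psi0). Qed.
Let bmA := cm_bmod cmA.

Notation x := (psi (f_gen (GenV zeta 0))).
Notation y := (psi (f_gen (GenV zeta 1))).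
Notation X := (psi (f_gen (GenVd zeta 0))).
Notation Y := (psi (f_gen (GenVd zeta 1))).
Notation t := (psi (f_gen (GenT zeta))).
Notation w_ w := (psi (f_gen (GenW w))).

Definition rsg (k : nat) : A := sigma d op k (1 : A).

Let opE g v : op g v = psi (f_gen g) * v :> A. Proof. by []. Qed.
Let scE a (v : res (A^o)) : a *: v = algc a * v :> A. Proof. by []. Qed.

Lemma t_central (a : F) : t * psi a = psi a * t.
Proof. by apply: subr0_eq; rewrite -!rmorphM -rmorphB; exact: psi0 (RelT d _ a). Qed.
Lemma C_central r (a : F) : psi (f_gen (GenC r)) * psi a = psi a * psi (f_gen (GenC r)).
Proof. by apply: subr0_eq; rewrite -!rmorphM -rmorphB; exact: psi0 (RelC d _ r a). Qed.

Hypothesis tA : forall a : A, t * a = a * t.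

Lemma sg_op k (v : A) : sigma d op k v = rsg k * v.
Proof.
rewrite /rsg /sigma mulr_suml; apply: eq_bigr => i _.
by rewrite !scE !opE !mulrA mulr1.
Qed.

Let hrxy : x * y = y * x.
Proof. by have e : x * (y * 1) = y * (x * 1) := bmxy bmA 1; move: e; rewrite !mulr1. Qed.
Let hrXY : X * Y = Y * X.
Proof. by have e : X * (Y * 1) = Y * (X * 1) := cmXY cmA 1; move: e; rewrite !mulr1. Qed.
Let hrxX : x * X = X * x + (t - rsg 0).
Proof.
have e : x * (X * 1) = X * (x * 1) + (t * 1 - rsg 0) := cmxX cmA 1.
by move: e; rewrite !mulr1.
Qed.
Let hrxY : x * Y = Y * x + rsg d.-1.
Proof.
have e : x * (Y * 1) = Y * (x * 1) + rsg d.-1 := cmxY cmA 1.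
by move: e; rewrite !mulr1.
Qed.
Let hryX : y * X = X * y + rsg 1.
Proof.
have e : y * (X * 1) = X * (y * 1) + rsg 1 := cmyX cmA 1.
by move: e; rewrite !mulr1.
Qed.
Let hryY : y * Y = Y * y + (t - rsg 0).
Proof.
have e : y * (Y * 1) = Y * (y * 1) + (t * 1 - rsg 0) := cmyY cmA 1.
by move: e; rewrite !mulr1.
Qed.
Let hrsg_x k : rsg k * x = y * rsg (k + d.-1).
Proof.
have e : sigma d op k (x * 1 : A) = y * rsg (k + d.-1) :=
  sg_x hz (bmC bmA) (bmWx bmA) k 1.
by move: e; rewrite sg_op mulr1.
Qed.
Let hrsg_y k : rsg k * y = x * rsg k.+1.
Proof.
have e : sigma d op k (y * 1 : A) = x * rsg k.+1 := sg_y (bmC bmA) (bmWy bmA) k 1.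
by move: e; rewrite sg_op mulr1.
Qed.
Let hrsg_X k : rsg k * X = Y * rsg k.+1.
Proof.
have e : sigma d op k (X * 1 : A) = Y * rsg k.+1 := sg_X hz (bmC bmA) (cmWX cmA) k 1.
by move: e; rewrite sg_op mulr1.
Qed.
Let hrsg_Y k : rsg k * Y = X * rsg (k + d.-1).
Proof.
have e : sigma d op k (Y * 1 : A) = X * rsg (k + d.-1) :=
  sg_Y hz (bmC bmA) (cmWY cmA) k 1.
by move: e; rewrite sg_op mulr1.
Qed.
Let hrsg_mod k l : (k = l %[mod d])%N -> rsg k = rsg l.
Proof. by move=> e; exact: (@sg_mod R d zeta hz _ op k l 1 e). Qed.

Lemma rs_x j : w_ (dih_s zeta j) * x = algc (zeta ^- j) * (y * w_ (dih_s zeta j)).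
Proof.
have e : w_ (dih_s zeta j) * (x * 1) =
  algc (zeta ^+ (j * d.-1)) * (y * (w_ (dih_s zeta j) * 1)) := s_x hz (bmWx bmA) j 1.
by move: e; rewrite !mulr1 zeta_inv.
Qed.
Lemma rs_y j : w_ (dih_s zeta j) * y = algc (zeta ^+ j) * (x * w_ (dih_s zeta j)).
Proof.
have e : w_ (dih_s zeta j) * (y * 1) =
  algc (zeta ^+ j) * (x * (w_ (dih_s zeta j) * 1)) := s_y (bmWy bmA) j 1.
by move: e; rewrite !mulr1.
Qed.
Lemma rs_X j : w_ (dih_s zeta j) * X = algc (zeta ^+ j) * (Y * w_ (dih_s zeta j)).
Proof.
have e : w_ (dih_s zeta j) * (X * 1) =
  algc (zeta ^+ j) * (Y * (w_ (dih_s zeta j) * 1)) := s_X hz (cmWX cmA) j 1.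
by move: e; rewrite !mulr1.
Qed.
Lemma rs_Y j : w_ (dih_s zeta j) * Y = algc (zeta ^- j) * (X * w_ (dih_s zeta j)).
Proof.
have e : w_ (dih_s zeta j) * (Y * 1) =
  algc (zeta ^+ (j * d.-1)) * (X * (w_ (dih_s zeta j) * 1)) := s_Y hz (cmWY cmA) j 1.
by move: e; rewrite !mulr1 zeta_inv.
Qed.

Lemma psi_dunkl : dunkl_rel d x y X Y t rsg.
Proof.
exact: (DunklRel tA hrxy hrXY hrxX hrxY hryX hryY hrsg_x hrsg_y hrsg_X hrsg_Y hrsg_mod).
Qed.

Lemma psi_commute h : (forall g, h * psi (f_gen g) = psi (f_gen g) * h) ->
  forall a, h * psi a = psi a * h.
Proof.
move=> hg a; have := act_morph (op := op) (op' := op) (f := resmul (M := A^o) h) a 1.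
rewrite !(act_psi psiC) => e.
have e2 : h * (psi a * 1) = psi a * (h * 1).
  apply: e => g m; rewrite -[LHS]/(h * (psi (f_gen g) * m)) mulrA hg -mulrA.
  by [].
by move: e2; rewrite !mulr1.
Qed.

End RingRelations.

End DunklRelationsPart.
Export DunklRelationsPart.

(** * Central elements, and computation of the Poisson bracket from lifts *)

Module CentralElementsPart.

Lemma pw_rmorph (A B : pzRingType) (f : {rmorphism A -> B}) u v m i :
  f (pw u v m i) = pw (f u) (f v) m i.
Proof.
elim: m i => [|m IH] [|i] /=; rewrite ?rmorph1 ?rmorph0 //.
  by rewrite rmorphM IH.
by rewrite rmorphD !rmorphM !IH.
Qed.

Section InvariantCommutators.
Context {A : pzRingType} (d : nat) (x y X Y t : A) (rsg : nat -> A).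
Hypothesis d0 : (0 < d)%N.
Hypothesis rr : dunkl_rel d x y X Y t rsg.

Lemma comm_yR : comm y (X ^+ d + Y ^+ d) = t * Y ^+ d.-1 *+ d.
Proof. by rewrite addrC; exact: (comm_xR d0 (dunkl_swap d0 rr)). Qed.
Lemma comm_Xr : comm X (x ^+ d + y ^+ d) = - t * x ^+ d.-1 *+ d.
Proof. exact: (comm_xR d0 (dunkl_dual d0 rr)). Qed.
Lemma comm_Yr : comm Y (x ^+ d + y ^+ d) = - t * y ^+ d.-1 *+ d.
Proof. by rewrite addrC; exact: (comm_xR d0 (dunkl_swap d0 (dunkl_dual d0 rr))). Qed.

Lemma comm_qQ : comm (x * y) (X * Y) = t * (X * x + y * Y).
Proof.
rewrite commMr (comm_qX rr) (comm_qY rr) mulrDr !mulrA; congr (_ * _ + _).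
by rewrite (tC rr).
Qed.
Lemma comm_euQ : comm (X * x + y * Y) (X * Y) = t * (X * Y + X * Y).
Proof.
have xQ : comm x (X * Y) = t * Y by rewrite commC (comm_Qx rr) opprK.
have yQ : comm y (X * Y) = t * X by rewrite commC (comm_Qy rr) opprK.
have cQX : comm X (X * Y) = 0 by rewrite /comm (rXY rr) mulrA (rXY rr) subrr.
have cQY : comm Y (X * Y) = 0 by rewrite /comm mulrA -(rXY rr) subrr.
rewrite commDl !commMl xQ yQ cQX cQY mulr0 mul0r addr0 add0r mulrDr !mulrA.
by rewrite (tC rr X).
Qed.
Lemma comm_euq : comm (X * x + y * Y) (x * y) = t * - (x * y + x * y).
Proof.
have xQ : comm X (x * y) = - (t * y) by rewrite commC (comm_qX rr).
have yQ : comm Y (x * y) = - (t * x) by rewrite commC (comm_qY rr).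
have cQX : comm x (x * y) = 0 by rewrite /comm (rxy rr) mulrA (rxy rr) subrr.
have cQY : comm y (x * y) = 0 by rewrite /comm mulrA -(rxy rr) subrr.
rewrite commDl !commMl xQ yQ cQX cQY mulr0 mul0r addr0 add0r !mulrN mulNr mulrDr opprD.
by rewrite (rxy rr); congr (- _ - _); rewrite !mulrA ?(tC rr).
Qed.

Lemma comm_qx : comm (x * y) x = 0.
Proof. by rewrite /comm -mulrA -(rxy rr) subrr. Qed.
Lemma comm_qy : comm (x * y) y = 0.
Proof. by rewrite /comm mulrA (rxy rr) subrr. Qed.
Lemma comm_QX : comm (X * Y) X = 0.
Proof. by rewrite /comm -mulrA -(rXY rr) subrr. Qed.
Lemma comm_QY : comm (X * Y) Y = 0.
Proof. by rewrite /comm mulrA (rXY rr) subrr. Qed.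
Lemma comm_rx n : comm (x ^+ n + y ^+ n) x = 0.
Proof.
have c : GRing.comm x (y ^+ n) by apply: commrX; exact: rxy rr.
by rewrite /comm mulrDl mulrDr -exprSr -exprS c subrr.
Qed.
Lemma comm_ry n : comm (x ^+ n + y ^+ n) y = 0.
Proof.
have c : GRing.comm y (x ^+ n) by apply: commrX; exact: esym (rxy rr).
by rewrite /comm mulrDl mulrDr -exprSr -exprS c subrr.
Qed.
Lemma comm_qX0 : t = 0 -> comm (x * y) X = 0.
Proof. by move=> t0; rewrite (comm_qX rr) t0 mul0r. Qed.
Lemma comm_qY0 : t = 0 -> comm (x * y) Y = 0.
Proof. by move=> t0; rewrite (comm_qY rr) t0 mul0r. Qed.
Lemma comm_Qx0 : t = 0 -> comm (X * Y) x = 0.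
Proof. by move=> t0; rewrite (comm_Qx rr) t0 mul0r oppr0. Qed.
Lemma comm_Qy0 : t = 0 -> comm (X * Y) y = 0.
Proof. by move=> t0; rewrite (comm_Qy rr) t0 mul0r oppr0. Qed.
Lemma comm_rX0 : t = 0 -> comm (x ^+ d + y ^+ d) X = 0.
Proof. by move=> t0; rewrite commC comm_Xr t0 oppr0 mul0r mul0rn oppr0. Qed.
Lemma comm_rY0 : t = 0 -> comm (x ^+ d + y ^+ d) Y = 0.
Proof. by move=> t0; rewrite commC comm_Yr t0 oppr0 mul0r mul0rn oppr0. Qed.

End InvariantCommutators.

Section ReflectionCommutes.
Context {K : pzRingType} {A : pzAlgType K} (s u v : A) (a b : K).
Hypothesis uv : u * v = v * u.
Hypothesis su : s * u = algc a * (v * s).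
Hypothesis sv : s * v = algc b * (u * s).

Let pull c (p w : A) : p * (algc c * w) = algc c * (p * w).
Proof. by rewrite mulrA -algc_central mulrA. Qed.

Lemma refl_mul : a * b = 1 -> s * (u * v) = u * v * s.
Proof.
move=> ab; rewrite mulrA su -(mulrA _ _ v) -(mulrA v) sv pull (mulrA (algc a)).
by rewrite -rmorphM ab rmorph1 mul1r mulrA uv.
Qed.

Lemma refl_exp n : s * u ^+ n = algc (a ^+ n) * (v ^+ n * s).
Proof.
elim: n => [|n IH]; first by rewrite !expr0 rmorph1 mulr1 !mul1r.
by rewrite !exprSr mulrA IH -(mulrA (algc _)) -(mulrA (v ^+ n) s) su pull (mulrA (algc _)) -rmorphM (mulrA (v ^+ n)).
Qed.
End ReflectionCommutes.

Lemma refl_power_sum (K : pzRingType) (A : pzAlgType K) (s u v : A) (a b : K) n :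
  s * u = algc a * (v * s) -> s * v = algc b * (u * s) ->
  a ^+ n = 1 -> b ^+ n = 1 -> s * (u ^+ n + v ^+ n) = (u ^+ n + v ^+ n) * s.
Proof.
move=> su sv an bn; rewrite mulrDr (refl_exp su) (refl_exp sv) an bn !rmorph1 !mul1r.
by rewrite mulrDl addrC.
Qed.

Lemma commutesM {K : pzRingType} {A : pzAlgType K} (h a b : A) :
  h * a = a * h -> h * b = b * h -> h * (a * b) = a * b * h.
Proof. by move=> ha hb; rewrite mulrA ha -!mulrA hb. Qed.

Lemma rmorph_power_sum {A B : pzRingType} (f : {rmorphism A -> B}) u v n :
  f (u ^+ n + v ^+ n) = f u ^+ n + f v ^+ n.
Proof. by rewrite rmorphD !rmorphXn. Qed.

Lemma ord2_cases (k : 'I_2) : k = 0 \/ k = 1.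
Proof. by case: k => [[|[|[]]]] // ?; [left|right]; apply: val_inj. Qed.

Section CentralElements.
Context {R : realType} {d : nat} {zeta : R[i]}.
Hypothesis hz : d.-primitive_root zeta.
Local Notation C := R[i].
Local Notation gen := (gen zeta).
Local Notation F := (freealg C gen).
Local Notation Ht := (Ht d zeta).
Local Notation H := (H d zeta).
Local Notation Z := (Z d zeta).
Local Notation psiT := (@psiT R d zeta).
Local Notation psiH := (@psiH R d zeta).
Notation gT := (GenT zeta).
Let d0 := prim_order_gt0 hz.

Definition fx : F := f_gen (GenV zeta 0).
Definition fy : F := f_gen (GenV zeta 1).
Definition fX : F := f_gen (GenVd zeta 0).
Definition fY : F := f_gen (GenVd zeta 1).
Definition fT : F := f_gen gT.
Definition fq : F := fx * fy.
Definition fQ : F := fX * fY.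
Definition feu : F := fX * fx + fy * fY.
(** Polarised power sums between $a_0=x^d+y^d$ and $a_d=X^d+Y^d$. *)
Definition fa (i : nat) : F := pw fx fY d i + pw fy fX d i.

Definition zF (a : F) : Z := insubd (0 : Z) (psiH a).
Lemma zFE a : psiH a \in central (A := H) -> centre_val (zF a) = psiH a.
Proof. exact: insubdK. Qed.

Lemma psiT_algc a : psiT (algc a) = algc a. Proof. by []. Qed.
Lemma psiH_algc a : psiH (algc a) = algc a. Proof. by []. Qed.

Lemma dunklT : dunkl_rel d (psiT fx) (psiT fy) (psiT fX) (psiT fY) (psiT fT) (rsg (d := d) psiT).
Proof. by apply: (psi_dunkl hz psiT_algc (psiT_rel (d := d))); exact: Ht_T_comm. Qed.
Lemma dunklH : dunkl_rel d (psiH fx) (psiH fy) (psiH fX) (psiH fY) 0 (rsg (d := d) psiH).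
Proof.
have := psi_dunkl hz psiH_algc (psiH_rel (d := d)); rewrite psiH_T; apply.
by move=> a; rewrite mul0r mulr0.
Qed.

Lemma central_psiH h :
  comm h (psiH fx) = 0 -> comm h (psiH fy) = 0 -> comm h (psiH fX) = 0 -> comm h (psiH fY) = 0 ->
  (forall j, h * psiH (f_gen (GenW (dih_s zeta j))) = psiH (f_gen (GenW (dih_s zeta j))) * h) ->
  h \in central (A := H).
Proof.
move=> /subr0_eq hx /subr0_eq hy /subr0_eq hX /subr0_eq hY hs; apply/asboolP => b.
have [a <-] := psiH_surj b; apply: (psi_commute psiH_algc) => {a}.
case=> [|r|k|k|w].
- by rewrite psiH_T mulr0 mul0r.
- have [e <-] := psiH_surj h; apply: esym; exact: (C_central (psiH_rel (d := d))).
- by have [->|->] := ord2_cases k; [exact: hx|exact: hy].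
- by have [->|->] := ord2_cases k; [exact: hX|exact: hY].
have [j [->|->]] := dihedral_shape hz w; first exact: hs.
have -> : psiH (f_gen (GenW (dihM (dih_s zeta j) (dih_s zeta 0)))) =
    psiH (f_gen (GenW (dih_s zeta j))) * psiH (f_gen (GenW (dih_s zeta 0))).
  apply: subr0_eq; have := psiH_rel (RelWM d (f_gen gT) (dih_s zeta j) (dih_s zeta 0)).
  by rewrite rmorphB rmorphM.
exact: (commutesM (hs j) (hs 0%N)).
Qed.

Let Cz j : (zeta ^- j) * (zeta ^+ j) = 1.
Proof. by rewrite mulVf // expf_neq0 // (zeta_unit hz). Qed.
Let zX j : (zeta ^+ j) ^+ d = 1.
Proof. by rewrite exprAC (prim_expr_order hz) expr1n. Qed.
Let zVX j : (zeta ^- j) ^+ d = 1.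
Proof. by rewrite exprVn zX invr1. Qed.

Local Notation sH j := (psiH (f_gen (GenW (dih_s zeta j)))).
Let sHx j : sH j * psiH fx = algc (zeta ^- j) * (psiH fy * sH j).
Proof. exact: (rs_x hz psiH_algc (psiH_rel (d := d))). Qed.
Let sHy j : sH j * psiH fy = algc (zeta ^+ j) * (psiH fx * sH j).
Proof. exact: (rs_y hz psiH_algc (psiH_rel (d := d))). Qed.
Let sHX j : sH j * psiH fX = algc (zeta ^+ j) * (psiH fY * sH j).
Proof. exact: (rs_X hz psiH_algc (psiH_rel (d := d))). Qed.
Let sHY j : sH j * psiH fY = algc (zeta ^- j) * (psiH fX * sH j).
Proof. exact: (rs_Y hz psiH_algc (psiH_rel (d := d))). Qed.

Lemma q_central : psiH fq \in central (A := H).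
Proof.
have -> : psiH fq = psiH fx * psiH fy := rmorphM psiH fx fy.
apply: central_psiH; first exact: (comm_qx dunklH).
- exact: (comm_qy dunklH).
- exact: (comm_qX0 dunklH).
- exact: (comm_qY0 dunklH).
- move=> j; apply: esym; exact: (refl_mul (rxy dunklH) (sHx j) (sHy j) (Cz j)).
Qed.

Lemma Q_central : psiH fQ \in central (A := H).
Proof.
have -> : psiH fQ = psiH fX * psiH fY := rmorphM psiH fX fY.
apply: central_psiH; first exact: (comm_Qx0 dunklH).
- exact: (comm_Qy0 dunklH).
- exact: (comm_QX dunklH).
- exact: (comm_QY dunklH).
- move=> j; apply: esym; apply: (refl_mul (rXY dunklH) (sHX j) (sHY j)).
  by rewrite mulrC Cz.
Qed.

Let fa0 : fa 0 = fx ^+ d + fy ^+ d. Proof. by rewrite /fa !pw0. Qed.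

Lemma a0_central : psiH (fa 0) \in central (A := H).
Proof.
have -> : psiH (fa 0) = psiH fx ^+ d + psiH fy ^+ d.
  by rewrite fa0; exact: rmorph_power_sum.
apply: central_psiH; first exact: (comm_rx dunklH).
- exact: (comm_ry dunklH).
- exact: (comm_rX0 d0 dunklH).
- exact: (comm_rY0 d0 dunklH).
- move=> j; apply: esym; exact: (refl_power_sum (sHx j) (sHy j) (zVX j) (zX j)).
Qed.

Let phi_surj := @Ht_to_H_surj R d zeta.
Let phi_ker := @Ht_to_H_ker R d zeta.
Let tors := Ht_torsion_free hz.
Let TC := @Ht_T_comm R d zeta.
Let phiT : Ht_to_H (Ht_T d zeta) = 0 := Ht_to_H_T.

Lemma lift_zF a : psiH a \in central (A := H) -> Ht_to_H (psiT a) = centre_val (zF a).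
Proof. by move=> ha; exact: etrans (Ht_to_H_psi a) (esym (zFE ha)). Qed.

Lemma bracket_psi_central a b w : psiH a \in central (A := H) -> psiH b \in central (A := H) ->
  psiT fT * psiT w = comm (psiT a) (psiT b) -> psiH w \in central (A := H).
Proof.
move=> ha hb e; rewrite -(Ht_to_H_psi w).
exact: (bracket_central TC phiT phi_surj phi_ker tors (lift_zF ha) (lift_zF hb) e).
Qed.

(** The lifts at hand show that the set defining the bracket is inhabited, and [bracket_uniq]
    identifies the chosen value with theirs. *)
Lemma poissonE (z z' : Z) zt zt' wt :
  Ht_to_H zt = centre_val z -> Ht_to_H zt' = centre_val z' ->
  Ht_T d zeta * wt = comm zt zt' -> centre_val (poisson z z') = Ht_to_H wt.
Proof.
move=> e1 e2 e3; rewrite /poisson; set P := (X in xget _ X).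
have w1 : Ht_to_H wt \in central (A := H).
  exact: (bracket_central TC phiT phi_surj phi_ker tors e1 e2 e3).
have : P (xget 0 P) by apply: (xgetPex 0); exists (Centre w1), zt, zt', wt; split.
case=> [zt2 [zt2' [wt2 [f1 f2 f3 f4]]]]; rewrite -f4.
exact: (bracket_uniq TC phiT phi_ker tors f1 f2 f3 e1 e2 e3).
Qed.

Lemma poisson_psi a b w : psiH a \in central (A := H) -> psiH b \in central (A := H) ->
  psiT fT * psiT w = comm (psiT a) (psiT b) -> poisson (zF a) (zF b) = zF w.
Proof.
move=> ha hb e; apply: val_inj.
apply: etrans (poissonE (lift_zF ha) (lift_zF hb) e) _.
exact: lift_zF (bracket_psi_central ha hb e).
Qed.

End CentralElements.

End CentralElementsPart.
Export CentralElementsPart.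

(** * Brackets of the sl_2-triple with the polarised power sums *)

Module CentralBracketsPart.

Section ShuffleCommutators.
Context {A : pzRingType} (d : nat) (x y X Y t : A) (rsg : nat -> A).
Hypothesis d0 : (0 < d)%N.
Hypothesis rr : dunkl_rel d x y X Y t rsg.
Let a i := pw x Y d i + pw y X d i.

Lemma comm_Qa i : comm (X * Y) (a i) = t * - (a i.+1 *+ i.+1).
Proof.
have Qx : comm (X * Y) x = t * - Y by rewrite (comm_Qx rr) mulrN.
have Qy : comm (X * Y) y = t * - X by rewrite (comm_Qy rr) mulrN.
have QX : comm (X * Y) X = t * 0 by rewrite (comm_QX rr) mulr0.
have QY : comm (X * Y) Y = t * 0 by rewrite (comm_QY rr) mulr0.
rewrite commDr (comm_pw (tC rr) Qx QY) (comm_pw (tC rr) Qy QX) !pwd_lower.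
by rewrite -mulrDr -opprD mulrnDl.
Qed.

Lemma comm_qa i : comm (x * y) (a i.+1) = t * (a i *+ (d - i)).
Proof.
have Qx : comm (x * y) x = t * 0 by rewrite (comm_qx rr) mulr0.
have Qy : comm (x * y) y = t * 0 by rewrite (comm_qy rr) mulr0.
rewrite commDr (comm_pw (tC rr) Qx (comm_qY rr)) (comm_pw (tC rr) Qy (comm_qX rr)).
by rewrite !pwd_raise -mulrDr mulrnDl.
Qed.

Lemma comm_qa0 : comm (x * y) (a 0) = t * 0.
Proof.
have Qx : comm (x * y) x = t * 0 by rewrite (comm_qx rr) mulr0.
have Qy : comm (x * y) y = t * 0 by rewrite (comm_qy rr) mulr0.
rewrite commDr (comm_pw (tC rr) Qx (comm_qY rr)) (comm_pw (tC rr) Qy (comm_qX rr)).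
by rewrite !pwd_raise0 mulr0 addr0.
Qed.

End ShuffleCommutators.

Lemma central_divn (R : realType) (A : pzAlgType R[i]) (b : A) n :
  - (b *+ n.+1) \in central (A := A) -> b \in central (A := A).
Proof.
move=> hb; have -> : b = - (algc (n.+1%:R^-1 : R[i]) * - (b *+ n.+1)).
  rewrite mulrN opprK -[b *+ _]mulr_natl mulrA -(rmorph_nat (algc : {rmorphism R[i] -> A})).
  by rewrite -rmorphM mulVf ?rmorph1 ?mul1r // pnatr_eq0.
have [_ cB cM] := central_closed A.
have c0 : 0 \in central (A := A) by rewrite -(subrr 1); apply: cB; case: (central_closed A).
by rewrite -sub0r; apply: cB => //; apply: cM => //; exact: algc_in_central.
Qed.

Lemma centre_val_mulrn (K : pzRingType) (A : pzAlgType K) (z : centre A) n :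
  centre_val (z *+ n) = centre_val z *+ n.
Proof. exact: (raddfMn (val : {additive centre A -> A})). Qed.

Section GeneratorBrackets.
Context {R : realType} {d : nat} {zeta : R[i]}.
Hypothesis hz : d.-primitive_root zeta.
Local Notation C := R[i].
Local Notation F := (freealg C (gen zeta)).
Local Notation H := (H d zeta).
Local Notation Z := (Z d zeta).
Local Notation psiT := (@psiT R d zeta).
Local Notation psiH := (@psiH R d zeta).
Local Notation zF := (@zF R d zeta).
Local Notation fT := (@fT R zeta).
Local Notation fx := (@fx R zeta).
Local Notation fy := (@fy R zeta).
Local Notation fX := (@fX R zeta).
Local Notation fY := (@fY R zeta).
Local Notation fq := (@fq R zeta).
Local Notation fQ := (@fQ R zeta).
Local Notation feu := (@feu R zeta).
Local Notation fa i := (@fa R d zeta i).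
Let d0 := prim_order_gt0 hz.

Lemma psi_fa (A : pzRingType) (psi : {rmorphism F -> A}) i :
  psi (fa i) = pw (psi fx) (psi fY) d i + pw (psi fy) (psi fX) d i.
Proof. by rewrite rmorphD !pw_rmorph. Qed.

Lemma rmorphNMn (A B : pzRingType) (f : {rmorphism A -> B}) a n : f (- (a *+ n)) = - (f a *+ n).
Proof. by rewrite rmorphN rmorphMn. Qed.

Lemma rmorph_dbl (A B : pzRingType) (f : {rmorphism A -> B}) a b :
  f (a * b + a * b) = f a * f b + f a * f b.
Proof. by rewrite rmorphD rmorphM. Qed.
Lemma rmorph_dblN (A B : pzRingType) (f : {rmorphism A -> B}) a b :
  f (- (a * b + a * b)) = - (f a * f b + f a * f b).
Proof. by rewrite rmorphN rmorphD rmorphM. Qed.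
Lemma rmorph_dot (A B : pzRingType) (f : {rmorphism A -> B}) a b c e :
  f (a * b + c * e) = f a * f b + f c * f e.
Proof. by rewrite rmorphD !rmorphM. Qed.

Let psiQ : psiT fQ = psiT fX * psiT fY := rmorphM psiT fX fY.
Let psiq : psiT fq = psiT fx * psiT fy := rmorphM psiT fx fy.

Lemma brk_eq (A : pzRingType) (t a b w a' b' w' : A) :
  a = a' -> b = b' -> w = w' -> comm a' b' = t * w' -> t * w = comm a b.
Proof. by move=> -> -> ->. Qed.

Let psieu : psiT feu = psiT fX * psiT fx + psiT fy * psiT fY.
Proof. exact: rmorph_dot. Qed.

Lemma brk_Qa i : psiT fT * psiT (- (fa i.+1 *+ i.+1)) = comm (psiT fQ) (psiT (fa i)).
Proof.
have w : psiT (- (fa i.+1 *+ i.+1)) = - ((pw (psiT fx) (psiT fY) d i.+1 +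
    pw (psiT fy) (psiT fX) d i.+1) *+ i.+1) by rewrite (rmorphNMn psiT) (psi_fa psiT).
exact: (brk_eq psiQ (psi_fa psiT i) w (comm_Qa (dunklT hz) i)).
Qed.

Lemma brk_qa i : psiT fT * psiT (fa i *+ (d - i)) = comm (psiT fq) (psiT (fa i.+1)).
Proof.
have w : psiT (fa i *+ (d - i)) = (pw (psiT fx) (psiT fY) d i +
    pw (psiT fy) (psiT fX) d i) *+ (d - i) by rewrite (rmorphMn psiT) (psi_fa psiT).
exact: (brk_eq psiq (psi_fa psiT i.+1) w (comm_qa (dunklT hz) i)).
Qed.

Lemma brk_qa0 : psiT fT * psiT 0 = comm (psiT fq) (psiT (fa 0)).
Proof. exact: (brk_eq psiq (psi_fa psiT 0) (rmorph0 psiT) (comm_qa0 (dunklT hz))). Qed.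

Lemma brk_qQ : psiT fT * psiT feu = comm (psiT fq) (psiT fQ).
Proof. exact: (brk_eq psiq psiQ psieu (comm_qQ (dunklT hz))). Qed.

Lemma brk_euQ : psiT fT * psiT (fQ + fQ) = comm (psiT feu) (psiT fQ).
Proof. exact: (brk_eq psieu psiQ (rmorph_dbl psiT _ _) (comm_euQ (dunklT hz))). Qed.

Lemma brk_euq : psiT fT * psiT (- (fq + fq)) = comm (psiT feu) (psiT fq).
Proof. exact: (brk_eq psieu psiq (rmorph_dblN psiT _ _) (comm_euq (dunklT hz))). Qed.

Let cq := q_central hz.
Let cQ := Q_central hz.

Lemma eu_central : psiH feu \in central (A := H).
Proof. exact: (bracket_psi_central hz cq cQ brk_qQ). Qed.

(** Only $a_0$ is checked directly. The bracket of central elements is central and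
    $\{Q,a_i\}=-(i+1)a_{i+1}$, where $i+1$ is invertible. *)
Lemma a_central i : psiH (fa i) \in central (A := H).
Proof.
elim: i => [|i IH]; first exact: (a0_central hz).
have := bracket_psi_central hz cQ IH (brk_Qa i); rewrite (rmorphNMn psiH).
exact: central_divn.
Qed.

Definition zq : Z := zF fq.
Definition zQ : Z := zF fQ.
Definition zeu : Z := zF feu.
Definition za i : Z := zF (fa i).

Lemma zF_morph a z : psiH a = centre_val z -> zF a = z :> Z.
Proof.
move=> e; have h : psiH a \in central (A := H) by rewrite e; exact: (valP z).
by apply: val_inj; exact: etrans (zFE h) e.
Qed.

Let z_a i : centre_val (za i) = psiH (fa i) := zFE (a_central i).
Let z_q : centre_val zq = psiH fq := zFE cq.
Let z_Q : centre_val zQ = psiH fQ := zFE cQ.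

Lemma poisson_Qa i : poisson zQ (za i) = - (za i.+1 *+ i.+1).
Proof.
apply: etrans (poisson_psi hz cQ (a_central i) (brk_Qa i)) _; apply: zF_morph.
rewrite (rmorphNMn psiH) -z_a; apply: esym.
exact: (rmorphNMn (val : {rmorphism Z -> H})).
Qed.

Lemma poisson_qa i : poisson zq (za i.+1) = za i *+ (d - i).
Proof.
apply: etrans (poisson_psi hz cq (a_central i.+1) (brk_qa i)) _; apply: zF_morph.
by rewrite (rmorphMn psiH) -z_a centre_val_mulrn.
Qed.

Lemma poisson_qa0 : poisson zq (za 0) = 0.
Proof.
apply: etrans (poisson_psi hz cq (a_central 0) brk_qa0) _; apply: zF_morph.
exact: (rmorph0 psiH).
Qed.

Lemma poisson_qQ : poisson zq zQ = zeu.
Proof. exact: (poisson_psi hz cq cQ brk_qQ). Qed.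

Lemma poisson_euQ : poisson zeu zQ = zQ + zQ.
Proof.
apply: etrans (poisson_psi hz eu_central cQ brk_euQ) _; apply: zF_morph.
by rewrite (rmorphD psiH) -z_Q.
Qed.

Lemma poisson_euq : poisson zeu zq = - (zq + zq).
Proof.
apply: etrans (poisson_psi hz eu_central cq brk_euq) _; apply: zF_morph.
by rewrite (rmorphN psiH) (rmorphD psiH) -z_q.
Qed.

End GeneratorBrackets.

End CentralBracketsPart.
Export CentralBracketsPart.

(** * Invariant vectors of the trivial induced module, by induction on the degree *)

Module CentreMonomialsPart.

Inductive in_zgen {R : realType} (d : nat) {zeta : R[i]} : freealg R[i] (gen zeta) -> Prop :=
| ZgenC c : in_zgen d (algc c)
| ZgenR r : in_zgen d (f_gen (GenC r))
| Zgenq : in_zgen d (fq (zeta := zeta))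
| ZgenQ : in_zgen d (fQ (zeta := zeta))
| Zgeneu : in_zgen d (feu (zeta := zeta))
| Zgena i : (i <= d)%N -> in_zgen d (fa (d := d) (zeta := zeta) i)
| ZgenD a b : in_zgen d a -> in_zgen d b -> in_zgen d (a + b)
| ZgenM a b : in_zgen d a -> in_zgen d b -> in_zgen d (a * b).

Section Monomials.
Context {R : realType} {d : nat} {zeta : R[i]}.
Hypothesis hz : d.-primitive_root zeta.
Local Notation C := R[i].
Local Notation gen := (gen zeta).
Local Notation F := (freealg C gen).
Let d0 := prim_order_gt0 hz.
Context {N : lmodType C} (op : gen -> {linear N -> N}) (cm : cmod d op).
Let bm := cm_bmod cm.
Context (mx my : {linear N -> N}) (e0 : N) (P0 : N -> Prop).
Notation X := (op (GenVd zeta 0)).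
Notation Y := (op (GenVd zeta 1)).
Notation x := (op (GenV zeta 0)).
Notation y := (op (GenV zeta 1)).
Notation sk k := (op (GenW (dih_s zeta k))).
Hypothesis opT0 : forall v, op (GenT zeta) v = 0.
Hypothesis e0W : forall w, op (GenW w) e0 = e0.
Hypothesis P0_e0 : P0 e0.
Hypothesis P0_C : forall r v, P0 v -> P0 (op (GenC r) v).
Hypothesis P0_W : forall w v, P0 v -> P0 (op (GenW w) v).
Hypothesis P0_x : forall v, P0 v -> P0 (mx v).
Hypothesis P0_y : forall v, P0 v -> P0 (my v).
Hypothesis P0_ex : forall v, P0 v -> x v = mx v.
Hypothesis P0_ey : forall v, P0 v -> y v = my v.
Hypothesis mxX : forall v, mx (X v) = X (mx v).
Hypothesis mxY : forall v, mx (Y v) = Y (mx v).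
Hypothesis myX : forall v, my (X v) = X (my v).
Hypothesis myY : forall v, my (Y v) = Y (my v).
Hypothesis mxy : forall v, mx (my v) = my (mx v).

Inductive cword : N -> Prop :=
| cword_e : cword e0
| cwordC r v : cword v -> cword (op (GenC r) v).

(** Here [mx] and [my] are the leading parts of x and y: they commute with X and Y and differ from x
    and y by operators that do not raise the degree. In terms of them the module is graded like the
    polynomials on $V\oplus V^*$. *)
Definition mon (a b i j : nat) (v : N) : N := iter a X (iter b Y (iter i mx (iter j my v))).

Inductive dlt (n : nat) : N -> Prop :=
| dlt0 : dlt n 0
| dltP c u v : dlt n u -> dlt n v -> dlt n (c *: u + v)
| dltM a b i j v : cword v -> (a + b + i + j < n)%N -> dlt n (mon a b i j v).

Lemma dltD n u v : dlt n u -> dlt n v -> dlt n (u + v).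
Proof. by move=> hu hv; rewrite -[u]scale1r; exact: dltP. Qed.
Lemma dltZ n c u : dlt n u -> dlt n (c *: u).
Proof. by move=> hu; rewrite -[_ *: u]addr0; apply: dltP => //; exact: dlt0. Qed.
Lemma dltB n u v : dlt n u -> dlt n v -> dlt n (u - v).
Proof. by move=> hu hv; rewrite -scaleN1r addrC; exact: dltP. Qed.
Lemma dltS m n v : (m <= n)%N -> dlt m v -> dlt n v.
Proof.
move=> le; elim=> [|c u w _ hu _ hw|a b i j w hw lt]; first exact: dlt0.
  exact: dltP.
by apply: dltM => //; exact: leq_trans le.
Qed.
Lemma dlt_0 v : dlt 0 v -> v = 0.
Proof. by elim=> // c u w _ -> _ ->; rewrite scaler0 addr0. Qed.

(* A linear map sending the monomials of degree m to degree < m + e does so everywhere. *)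
Lemma dlt_lin (f : {linear N -> N}) e :
  (forall a b i j v, cword v -> dlt (a + b + i + j + e).+1 (f (mon a b i j v))) ->
  forall n v, dlt n v -> dlt (n + e) (f v).
Proof.
move=> h n v; elim=> [|c u w _ hu _ hw|a b i j w hw lt].
- by rewrite linear0; exact: dlt0.
- by rewrite linearP; exact: dltP.
- by apply: dltS (h a b i j w hw); rewrite -addSn leq_add2r.
Qed.

Lemma cword_P0 v : cword v -> P0 v.
Proof. by elim=> // r u _; exact: P0_C. Qed.
Lemma cword_W w v : cword v -> op (GenW w) v = v.
Proof. by elim=> [|r u _ IH]; [exact: e0W | rewrite -(bmC bm) IH]. Qed.
Lemma P0_iterx i v : P0 v -> P0 (iter i mx v).
Proof. by move=> h; elim: i => //= i; exact: P0_x. Qed.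
Lemma P0_itery i v : P0 v -> P0 (iter i my v).
Proof. by move=> h; elim: i => //= i; exact: P0_y. Qed.

Lemma monX a b i j v : X (mon a b i j v) = mon a.+1 b i j v. Proof. by []. Qed.
Lemma monY a b i j v : Y (mon a b i j v) = mon a b.+1 i j v.
Proof. by rewrite /mon iterS (iter_comm (f := Y)) // => u; rewrite (cmXY cm). Qed.
Lemma monx a b i j v : mx (mon a b i j v) = mon a b i.+1 j v.
Proof. by rewrite /mon iterS (iter_comm (f := mx)) // (iter_comm (f := mx)). Qed.
Lemma mony a b i j v : my (mon a b i j v) = mon a b i j.+1 v.
Proof.
rewrite /mon iterS (iter_comm (f := my)) // (iter_comm (f := my)) //.
by rewrite (iter_comm (f := my)).
Qed.

Lemma s_iterx k i v : P0 v ->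
  sk k (iter i mx v) = zeta ^- (k * i) *: iter i my (sk k v).
Proof.
move=> hv; elim: i => [|i IH]; first by rewrite muln0 expr0 invr1 scale1r.
rewrite !iterS -(P0_ex (P0_iterx i hv)) (s_x hz (bmWx bm)) zeta_inv // IH (linearZ_LR (op _)).
by rewrite scalerA -invfM -exprD -mulnS (P0_ey (P0_itery i (P0_W _ hv))).
Qed.
Lemma s_itery k i v : P0 v ->
  sk k (iter i my v) = zeta ^+ (k * i) *: iter i mx (sk k v).
Proof.
move=> hv; elim: i => [|i IH]; first by rewrite muln0 expr0 scale1r.
rewrite !iterS -(P0_ey (P0_itery i hv)) (s_y (bmWy bm)) IH (linearZ_LR (op _)).
by rewrite scalerA -exprD -mulnS (P0_ex (P0_iterx i (P0_W _ hv))).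
Qed.

Lemma mon_s k a b i j v : cword v -> sk k (mon a b i j v) =
  (zeta ^+ (k * (a + j)) * zeta ^- (k * (b + i))) *: mon b a j i v.
Proof.
move=> hv; have p := cword_P0 hv.
rewrite /mon (cmod_s_X hz cm) (cmod_s_Y hz cm) (s_iterx _ _ (P0_itery _ p)).
rewrite (s_itery _ _ p) (cword_W _ hv) !(iter_linearZ mx, iter_linearZ my).
rewrite !(iter_linearZ X, iter_linearZ Y) !scalerA.
have -> : iter i my (iter j mx v) = iter j mx (iter i my v).
  by elim: i => //= i ->; rewrite (iter_comm (f := my)).
have -> u : iter a Y (iter b X u) = iter b X (iter a Y u).
  by elim: a {p hv} => //= a ->; rewrite (iter_comm (f := Y)) // => w; rewrite (cmXY cm).
congr (_ *: _); rewrite !mulnDr !exprD invfM mulrACA; ring.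
Qed.

Lemma dltX n v : dlt n v -> dlt n.+1 (X v).
Proof. by rewrite -(addn1 n); apply: dlt_lin => a b i j w hw; rewrite monX; apply: dltM => //; lia. Qed.
Lemma dltY n v : dlt n v -> dlt n.+1 (Y v).
Proof. by rewrite -(addn1 n); apply: dlt_lin => a b i j w hw; rewrite monY; apply: dltM => //; lia. Qed.
Lemma dltx n v : dlt n v -> dlt n.+1 (mx v).
Proof. by rewrite -(addn1 n); apply: dlt_lin => a b i j w hw; rewrite monx; apply: dltM => //; lia. Qed.
Lemma dlty n v : dlt n v -> dlt n.+1 (my v).
Proof. by rewrite -(addn1 n); apply: dlt_lin => a b i j w hw; rewrite mony; apply: dltM => //; lia. Qed.
Lemma dlts n k v : dlt n v -> dlt n (sk k v).
Proof.
rewrite -[in X in _ -> X](addn0 n); apply: dlt_lin => a b i j w hw.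
by rewrite mon_s //; apply: dltZ; apply: dltM => //; lia.
Qed.
Lemma monC r a b i j v : P0 v -> op (GenC r) (mon a b i j v) = mon a b i j (op (GenC r) v).
Proof.
move=> p; rewrite /mon (iter_comm (f := op (GenC r))); last by move=> u; rewrite (bmC bm).
rewrite (iter_comm (f := op (GenC r))); last by move=> u; rewrite (bmC bm).
have pj := P0_itery j p; congr (iter _ _ (iter _ _ _)).
have -> : op (GenC r) (iter i mx (iter j my v)) = iter i mx (op (GenC r) (iter j my v)).
  elim: i => //= i IH; rewrite -IH -(P0_ex (P0_iterx i pj)) (bmC bm).
  exact: P0_ex (P0_C r (P0_iterx i pj)).
congr (iter _ _ _); elim: j {pj} => //= j IH; rewrite -IH -(P0_ey (P0_itery j p)) (bmC bm).
exact: P0_ey (P0_C r (P0_itery j p)).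
Qed.
Lemma dltC n r v : dlt n v -> dlt n (op (GenC r) v).
Proof.
rewrite -[in X in _ -> X](addn0 n); apply: dlt_lin => a b i j w hw.
by rewrite (monC _ _ _ _ _ (cword_P0 hw)); apply: dltM; [exact: cwordC | lia].
Qed.
Lemma dltsg n k v : dlt n v -> dlt n (sigma d op k v).
Proof.
move=> h; rewrite /sigma; elim/big_ind: _ => [|u w hu hw|i _]; first exact: dlt0.
  exact: dltD.
by apply: dltZ; apply: dltC; exact: dlts.
Qed.

(** On the part without X and Y the two operators agree. Passing one X or Y produces a reflection
    sum applied to a monomial of degree one less. *)
Lemma dlt_difx n v : dlt n v -> dlt n (x v - mx v).
Proof.
pose f : {linear N -> N} := x \- mx.
rewrite -[in X in _ -> X](addn0 n) -[x v - mx v]/(f v); apply: dlt_lin => a b i j w hw.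
rewrite addn0 /f /=; have p := P0_iterx i (P0_itery j (cword_P0 hw)).
elim: a => [|a IH].
  elim: b => [|b IH]; first by rewrite /mon /= P0_ex // subrr; exact: dlt0.
  rewrite -monY (cmxY cm) mxY addrAC -linearB addrC; apply: dltD.
    by apply: dltsg; apply: dltM => //; lia.
  by rewrite add0n in IH *; exact: dltY.
rewrite -monX (cmxX cm) mxX opT0 sub0r addrAC -linearB addrC; apply: dltD.
  by rewrite -scaleN1r; apply: dltZ; apply: dltsg; apply: dltM => //; lia.
exact: dltX.
Qed.
Lemma dlt_dify n v : dlt n v -> dlt n (y v - my v).
Proof.
pose f : {linear N -> N} := y \- my.
rewrite -[in X in _ -> X](addn0 n) -[y v - my v]/(f v); apply: dlt_lin => a b i j w hw.
rewrite addn0 /f /=; have p := P0_iterx i (P0_itery j (cword_P0 hw)).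
elim: a => [|a IH].
  elim: b => [|b IH]; first by rewrite /mon /= P0_ey // subrr; exact: dlt0.
  rewrite -monY (cmyY cm) myY opT0 sub0r addrAC -linearB addrC; apply: dltD.
    by rewrite -scaleN1r; apply: dltZ; apply: dltsg; apply: dltM => //; lia.
  by rewrite add0n in IH *; exact: dltY.
rewrite -monX (cmyX cm) myX addrAC -linearB addrC; apply: dltD.
  by apply: dltsg; apply: dltM => //; lia.
exact: dltX.
Qed.

(** The map [phi] is the leading symbol of g, of degree e: on vectors of degree at most n the error
    has degree less than $n+e$. *)
Definition symb (g : F) (phi : N -> N) (e : nat) : Prop :=
  [/\ phi 0 = 0, forall n v, dlt n v -> dlt (n + e) (phi v) &
      forall n v, dlt n.+1 v -> dlt (n + e) (act op g v - phi v)].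

Lemma symb_act g phi e n v : symb g phi e -> dlt n v -> dlt (n + e) (act op g v).
Proof.
case=> _ h1 h2; case: n => [/dlt_0 ->|n hv]; first by rewrite linear0; exact: dlt0.
rewrite -[act op g v](subrK (phi v)); apply: dltD; last exact: h1.
by apply: dltS (h2 n v hv); rewrite leq_add2r.
Qed.

Lemma symbM g h phi chi e f : symb g phi e -> symb h chi f ->
  symb (g * h) (fun v => phi (chi v)) (e + f).
Proof.
move=> sg sh; have [p0 p1 p2] := sg; have [c0 c1 c2] := sh; split.
- by rewrite c0.
- by move=> n v hv; rewrite (_ : n + (e + f) = n + f + e)%N; [apply: p1; exact: c1 | lia].
move=> n v hv; rewrite actM (_ : n + (e + f) = n + f + e)%N; last by lia.
rewrite -[act op g _](subrK (act op g (chi v))) -addrA; apply: dltD; last first.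
  by apply: p2; rewrite -addSn; exact: c1.
by rewrite -(linearB (act op g)); apply: (symb_act sg); exact: c2.
Qed.

Lemma symbD g h phi chi e : symb g phi e -> symb h chi e ->
  symb (g + h) (fun v => phi v + chi v) e.
Proof.
move=> [p0 p1 p2] [c0 c1 c2]; split; first by rewrite p0 c0 addr0.
  by move=> n v hv; apply: dltD; [exact: p1 | exact: c1].
by move=> n v hv; rewrite actD opprD addrACA; apply: dltD; [exact: p2 | exact: c2].
Qed.

Lemma symb_x : symb (fx (zeta := zeta)) mx 1.
Proof.
split; first exact: linear0.
- by move=> n v; rewrite addn1; exact: dltx.
- by move=> n v; rewrite addn1 act_gen; exact: dlt_difx.
Qed.
Lemma symb_y : symb (fy (zeta := zeta)) my 1.
Proof.
split; first exact: linear0.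
- by move=> n v; rewrite addn1; exact: dlty.
- by move=> n v; rewrite addn1 act_gen; exact: dlt_dify.
Qed.
Lemma symb_X : symb (fX (zeta := zeta)) X 1.
Proof.
split; first exact: linear0.
- by move=> n v; rewrite addn1; exact: dltX.
- by move=> n v hv; rewrite act_gen subrr; exact: dlt0.
Qed.
Lemma symb_Y : symb (fY (zeta := zeta)) Y 1.
Proof.
split; first exact: linear0.
- by move=> n v; rewrite addn1; exact: dltY.
- by move=> n v hv; rewrite act_gen subrr; exact: dlt0.
Qed.

Fixpoint opw (f h : N -> N) (m i : nat) (v : N) : N :=
  match m, i with
  | 0, 0 => v
  | 0, _ => 0
  | m'.+1, 0 => f (opw f h m' 0 v)
  | m'.+1, i'.+1 => f (opw f h m' i v) + h (opw f h m' i' v)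
  end.

Lemma symb_pw g h phi chi m i : symb g phi 1 -> symb h chi 1 ->
  symb (pw g h m i) (opw phi chi m i) m.
Proof.
move=> sg sh; elim: m i => [|m IH] [|i] /=.
- split=> // n v hv; first by rewrite addn0.
  by rewrite act1 subrr; exact: dlt0.
- split=> // n v hv; first exact: dlt0.
  by rewrite act0 subrr; exact: dlt0.
- exact: (symbM sg (IH 0%N)).
- by apply: symbD; [exact: (symbM sg (IH i.+1)) | exact: (symbM sh (IH i))].
Qed.

Lemma opwE (f h : {linear N -> N}) m i v : (forall u, f (h u) = h (f u)) ->
  opw f h m i v = 'C(m, i)%:R *: iter (m - i) f (iter i h v).
Proof.
move=> fh; elim: m i => [|m IH] [|i] /=; rewrite ?bin0 ?scale1r ?bin0n ?scale0r //.
  by rewrite IH bin0 scale1r subn0.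
rewrite !IH !(linearZ_LR f) !(linearZ_LR h) binS natrD scalerDl subSS.
congr (_ + _); last by rewrite (iter_comm (f := h) (h := f)) // => u; rewrite fh.
have [lt|ge] := ltnP i m; last by rewrite bin_small ?scale0r // ltnS.
by rewrite -iterS -subSn // subSS.
Qed.

Definition msym (a b i j : nat) (v : N) : N := mon a b i j v + mon b a j i v.
Local Notation Ws := (Wsum (d := d) op).
Definition winv (v : N) : Prop := Ws v = (2 * d)%:R *: v.

Lemma Ws_lin c u v : Ws (c *: u + v) = c *: Ws u + Ws v.
Proof.
rewrite scaler_sumr -big_split; apply: eq_bigr => k _ /=.
rewrite !(linearP (op _)); lin_comb C N.
Qed.

Lemma Ws_D u v : Ws (u + v) = Ws u + Ws v.
Proof. by have := Ws_lin 1 u v; rewrite !scale1r. Qed.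
Lemma Ws_0 : Ws 0 = 0.
Proof. by apply: (addrI (Ws 0)); rewrite -Ws_D !addr0. Qed.
Lemma Ws_Z c u : Ws (c *: u) = c *: Ws u.
Proof. by have := Ws_lin c u 0; rewrite Ws_0 !addr0. Qed.
Lemma Ws_B u v : Ws (u - v) = Ws u - Ws v.
Proof. by rewrite Ws_D -scaleN1r Ws_Z scaleN1r. Qed.
Lemma Ws_act g v : (forall w u, op (GenW w) (act op g u) = act op g (op (GenW w) u)) ->
  Ws (act op g v) = act op g (Ws v).
Proof.
move=> h; rewrite /Wsum linear_sum; apply: eq_bigr => k _.
by rewrite (linearD (act op g)) !h.
Qed.

Let zu := zeta_unit hz.
Let zz n : zeta ^+ n != 0. Proof. by rewrite expf_neq0. Qed.

(** Rotations multiply the monomial by a power of a character that is trivial exactly under the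
    congruence, so their sum is d times the monomial or 0. Reflections do the same after exchanging
    the two coordinates. *)
Lemma Ws_mon a b i j v : cword v ->
  Ws (mon a b i j v) = if (a + j == b + i %[mod d])%N then d%:R *: msym a b i j v else 0.
Proof.
move=> hv; pose w := zeta ^+ (a + j) / zeta ^+ (b + i).
have wd : w ^+ d = 1 by rewrite exprMn exprVn !(exprAC _ _ d) (prim_expr_order hz) !expr1n divr1.
have wVd : w^-1 ^+ d = 1 by rewrite exprVn wd invr1.
have e : Ws (mon a b i j v) = (\sum_(k < d) w^-1 ^+ k) *: mon a b i j v +
    (\sum_(k < d) w ^+ k) *: mon b a j i v.
  rewrite !scaler_suml -big_split; apply: eq_bigr => k _.
  rewrite (bmWM bm) !(mon_s _ _ _ _ _ hv) !mul0n !expr0 invr1 mulr1 scale1r (mon_s _ _ _ _ _ hv).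
  congr (_ *: _ + _ *: _); rewrite /w ?invfM ?invrK exprMn exprVn -!exprM.
    by rewrite mulrC ![(k * _)%N]mulnC.
  by rewrite ![(k * _)%N]mulnC.
have w1 : (w == 1) = (a + j == b + i %[mod d])%N.
  by rewrite /w -(eq_prim_root_expr hz) (can2_eq (mulfVK _) (mulfK _)) ?mul1r.
have s1 : \sum_(k < d) (1 : C) ^+ k = d%:R.
  by rewrite (eq_bigr (fun=> 1)) ?sumr_const ?card_ord // => k _; rewrite expr1n.
rewrite e -w1; case: eqP => [->|/eqP nw]; first by rewrite invr1 s1 scalerDr.
rewrite !(geom_root wd nw) (geom_root wVd) ?scale0r ?addr0 //.
by apply: contraNneq nw => /(canRL invrK) ->; rewrite invr1.
Qed.

Lemma msymC a b i j v : msym b a j i v = msym a b i j v.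
Proof. exact: addrC. Qed.

Lemma msym_inv a b i j v : cword v -> (a + j = b + i %[mod d])%N -> winv (msym a b i j v).
Proof.
move=> hv e; rewrite /winv Ws_D !Ws_mon // e eqxx msymC.
by rewrite -mulr2n -scaler_nat scalerA -natrM.
Qed.

Lemma winvD u v : winv u -> winv v -> winv (u + v).
Proof. by rewrite /winv Ws_D => -> ->; rewrite scalerDr. Qed.
Lemma winvZ c v : winv v -> winv (c *: v).
Proof. by rewrite /winv Ws_Z => ->; rewrite !scalerA mulrC. Qed.

Definition cent1 (v : N) : Prop := exists2 a, in_zgen d a & act op a e0 = v.

Lemma cent1D u v : cent1 u -> cent1 v -> cent1 (u + v).
Proof. by move=> [a ha <-] [b hb <-]; exists (a + b); [exact: ZgenD | rewrite actD]. Qed.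
Lemma cent1_act g v : in_zgen d g -> cent1 v -> cent1 (act op g v).
Proof. by move=> hg [a ha <-]; exists (g * a); [exact: ZgenM | rewrite actM]. Qed.
Lemma cent1Z c v : cent1 v -> cent1 (c *: v).
Proof. by move=> h; rewrite -(act_algc op); apply: cent1_act => //; exact: ZgenC. Qed.
Lemma cent1_0 : cent1 0.
Proof.
by exists (algc 0); [exact: ZgenC | rewrite act_algc scale0r].
Qed.
Lemma cent1Z_inv c v : c != 0 -> cent1 (c *: v) -> cent1 v.
Proof. by move=> c0 /(cent1Z c^-1); rewrite scalerA mulVf // scale1r. Qed.
Lemma cent1_cword v : cword v -> cent1 v.
Proof.
elim=> [|r u _ h].
  by exists (algc 1); [exact: ZgenC | rewrite act_algc scale1r].
by rewrite -(act_gen op); apply: cent1_act => //; exact: ZgenR.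
Qed.

Let n2d : (2 * d)%:R != 0 :> C.
Proof. by rewrite pnatr_eq0 muln_eq0 negb_or /= -lt0n. Qed.

Hypothesis zgenW : forall g, in_zgen d g ->
  forall w v, op (GenW w) (act op g v) = act op g (op (GenW w) v).

Section Degree.
Context (D : nat) (IH : forall v, dlt D v -> cent1 (Ws v)).

(** The orbit sum u is $1/2d$ of its average and so lies in [cent1] by induction, hence so does
    $gu$. The error $gu-\phi(u)$ has smaller degree, and its average lies in [cent1] by induction as
    well. Since $gu$ and $\phi(u)$ are invariant, subtracting gives the result for $\phi(u)$. *)
Lemma cent1_step g phi e a b i j v : in_zgen d g -> symb g phi e -> (0 < e)%N ->
  cword v -> (a + j = b + i %[mod d])%N -> (a + b + i + j + e <= D)%N ->
  winv (phi (msym a b i j v)) -> cent1 (phi (msym a b i j v)).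
Proof.
move=> hg [_ _ sg] e0' hv cg le ip; set u := msym a b i j v.
have du : dlt (a + b + i + j).+1 u by apply: dltD; apply: dltM => //; lia.
have iu : winv u by exact: msym_inv.
have cu : cent1 u.
  by apply: (cent1Z_inv n2d); rewrite -iu; apply: IH; apply: dltS du; lia.
have cgu := cent1_act hg cu.
have : cent1 (Ws (act op g u - phi u)) by apply: IH; apply: dltS (sg _ _ du).
rewrite Ws_B (Ws_act _ (zgenW hg)) iu (linearZ_LR (act op g)) ip -scalerBr.
move=> /(cent1Z_inv n2d) /(cent1Z (-1)) /(cent1D cgu).
by rewrite scaleN1r opprB addrC subrK.
Qed.

Definition good (a b i j : nat) : Prop := forall v, cword v ->
  (a + j = b + i %[mod d])%N -> cent1 (msym a b i j v).

Lemma goodC a b i j : good b a j i -> good a b i j.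
Proof. by move=> h v hv e; rewrite -msymC; apply: h. Qed.

Let mod_tr p q p' q' m n k l k' l' :
  (p + m + k * d = p' + n + l * d)%N -> (q + m + k' * d = q' + n + l' * d)%N ->
  (p = q %[mod d])%N -> (p' = q' %[mod d])%N.
Proof.
move=> e1 e2 e; apply/eqP; rewrite -(eqn_modDr n).
rewrite -(modnMDl l) addnC -e1 addnC modnMDl -(modnMDl l' (q' + n)) [(l' * d + _)%N]addnC -e2.
by rewrite [(q + m + _)%N]addnC modnMDl eqn_modDr; apply/eqP.
Qed.

Lemma good_q a b i j : (a + b + i + j + 2 <= D)%N -> good a b i.+1 j.+1.
Proof.
move=> le v hv e.
have e' : (a + j = b + i %[mod d])%N.
  by apply: (@mod_tr _ _ _ _ 0 1 0 0 0 0) e; lia.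
have E : mx (my (msym a b i j v)) = msym a b i.+1 j.+1 v.
  by rewrite /msym !(linearD my, linearD mx) !(mony, monx).
rewrite -E; apply: (cent1_step (@Zgenq R d zeta) (symbM symb_x symb_y)) => //.
by rewrite E; exact: msym_inv.
Qed.

Lemma good_Q a b i j : (a + b + i + j + 2 <= D)%N -> good a.+1 b.+1 i j.
Proof.
move=> le v hv e.
have e' : (a + j = b + i %[mod d])%N.
  by apply: (@mod_tr _ _ _ _ 0 1 0 0 0 0) e; lia.
have E : X (Y (msym a b i j v)) = msym a.+1 b.+1 i j v.
  by rewrite /msym !(linearD Y, linearD X) !(monY, monX).
rewrite -E; apply: (cent1_step (@ZgenQ R d zeta) (symbM symb_X symb_Y)) => //.
by rewrite E; exact: msym_inv.
Qed.

Lemma cent1B u v : cent1 (u + v) -> cent1 v -> cent1 u.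
Proof. by move=> h /(cent1Z (-1)) /(cent1D h); rewrite scaleN1r addrK. Qed.

Lemma msym_eu a b i j v : X (mx (msym a b i j v)) + my (Y (msym a b i j v)) =
  msym a.+1 b i.+1 j v + msym a b.+1 i j.+1 v.
Proof.
rewrite /msym !(linearD mx, linearD Y, linearD X, linearD my) !(monx, monY, mony, monX).
by rewrite addrACA [RHS]addrACA [X in _ + X]addrC.
Qed.

Lemma cent1_eu a b i j v : (a + b + i + j + 2 <= D)%N -> cword v ->
  (a + j = b + i %[mod d])%N -> cent1 (msym a.+1 b i.+1 j v + msym a b.+1 i j.+1 v).
Proof.
move=> le hv e; rewrite -msym_eu.
have S := symbD (symbM symb_X symb_x) (symbM symb_y symb_Y).
apply: (cent1_step (@Zgeneu R d zeta) S) => //=.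
rewrite msym_eu; apply: winvD; apply: msym_inv => //;
  by apply: (@mod_tr _ _ _ _ 1 0 0 0 0 0) e; lia.
Qed.

(** The leading symbol of eu is $Xx+Yy$, so one factor $Xx$ can be traded for $Yy$. *)
Lemma good_eu a b i j : (a + b + i + j + 2 <= D)%N -> good a b.+1 i j.+1 ->
  good a.+1 b i.+1 j.
Proof.
move=> le h v hv e; have e' : (a + j = b + i %[mod d])%N.
  by apply: (@mod_tr _ _ _ _ 0 1 0 0 0 0) e; lia.
apply: (cent1B (cent1_eu le hv e')); apply: h => //.
by apply: (@mod_tr _ _ _ _ 1 0 0 0 0 0) e'; lia.
Qed.

Let half v : cent1 (v + v) -> cent1 v.
Proof.
rewrite -mulr2n -scaler_nat; apply: cent1Z_inv.
by rewrite pnatr_eq0.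
Qed.

(** Here both terms produced by eu are the same orbit sum, and division by 2 suffices. The base case
    [good_a0] for the power sums is of the same kind. *)
Lemma good_eu0 : (2 <= D)%N -> good 1 0 1 0.
Proof.
move=> le v hv _; apply: half; rewrite -{2}msymC.
by apply: (@cent1_eu 0 0 0 0).
Qed.

Lemma iter_monY n a b i j v : iter n Y (mon a b i j v) = mon a (b + n) i j v.
Proof. by elim: n => [|n IHn]; [rewrite addn0 | rewrite iterS IHn monY addnS]. Qed.
Lemma iter_monX n a b i j v : iter n X (mon a b i j v) = mon (a + n) b i j v.
Proof. by elim: n => [|n IHn]; [rewrite addn0 | rewrite iterS IHn monX addnS]. Qed.
Lemma iter_monx n a b i j v : iter n mx (mon a b i j v) = mon a b (i + n) j v.
Proof. by elim: n => [|n IHn]; [rewrite addn0 | rewrite iterS IHn monx addnS]. Qed.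
Lemma iter_mony n a b i j v : iter n my (mon a b i j v) = mon a b i (j + n) v.
Proof. by elim: n => [|n IHn]; [rewrite addn0 | rewrite iterS IHn mony addnS]. Qed.

Lemma msym_a t a b i j v :
  opw mx Y d t (msym a b i j v) + opw my X d t (msym a b i j v) =
  'C(d, t)%:R *: (msym a (b + t) (i + (d - t)) j v + msym (a + t) b i (j + (d - t)) v).
Proof.
rewrite !opwE // -scalerDr; congr (_ *: _).
rewrite /msym !(iter_linearD Y, iter_linearD X) !(iter_linearD mx, iter_linearD my).
rewrite !(iter_monY, iter_monX) !(iter_monx, iter_mony).
lin_comb C N.
Qed.

Lemma cent1_a t a b i j v : (t <= d)%N -> (a + b + i + j + d <= D)%N -> cword v ->
  (a + j = b + i %[mod d])%N ->
  cent1 (msym a (b + t) (i + (d - t)) j v + msym (a + t) b i (j + (d - t)) v).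
Proof.
move=> td le hv e; have c0 : 'C(d, t)%:R != 0 :> C by rewrite pnatr_eq0 -lt0n bin_gt0.
apply: (cent1Z_inv c0); rewrite -msym_a.
have S := symbD (symb_pw d t symb_x symb_Y) (symb_pw d t symb_y symb_X).
apply: (cent1_step (Zgena td) S) => //=.
rewrite msym_a; apply: winvZ; apply: winvD; apply: msym_inv => //.
  by apply: (@mod_tr _ _ _ _ 0 0 0 0 1 0) e; lia.
by apply: (@mod_tr _ _ _ _ 0 0 1 0 0 0) e; lia.
Qed.

(** The leading symbol of $a_t$ is, up to a binomial coefficient, $Y^tx^{d-t}+X^ty^{d-t}$, so the
    first monomial can be traded for the second. *)
Lemma good_a t a b i j : (t <= d)%N -> (a + b + i + j + d <= D)%N ->
  good (a + t) b i (j + (d - t)) -> good a (b + t) (i + (d - t)) j.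
Proof.
move=> td le h v hv e; have e' : (a + j = b + i %[mod d])%N.
  by apply: (@mod_tr _ _ _ _ 0 0 0 0 0 1) e; lia.
apply: (cent1B (cent1_a td le hv e')); apply: h => //.
by apply: (@mod_tr _ _ _ _ 0 0 1 0 0 0) e'; lia.
Qed.

Lemma good_a0 t : (t <= d)%N -> (d <= D)%N -> good 0 t (d - t) 0.
Proof.
move=> td le v hv _; apply: half; rewrite -{2}msymC.
by have := @cent1_a t 0 0 0 0 v td le hv erefl; rewrite !add0n.
Qed.

Lemma good0 : good 0 0 0 0.
Proof. by move=> v hv _; apply: cent1D; exact: cent1_cword. Qed.

Lemma good_q_div a b i j : (0 < i)%N -> (0 < j)%N -> (a + b + i + j <= D)%N -> good a b i j.
Proof. by case: i j => [|i] [|j] // _ _ le; apply: good_q; lia. Qed.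
Lemma good_Q_div a b i j : (0 < a)%N -> (0 < b)%N -> (a + b + i + j <= D)%N -> good a b i j.
Proof. by case: a b => [|a] [|b] // _ _ le; apply: good_Q; lia. Qed.
Lemma good_a_div t a b i j : (t <= d)%N -> (t <= b)%N -> (d - t <= i)%N ->
  (a + b + i + j <= D)%N ->
  good (a + t) (b - t) (i - (d - t)) (j + (d - t)) -> good a b i j.
Proof.
move=> td tb ti le h; have := @good_a t a (b - t) (i - (d - t)) j td.
by rewrite !subnK //; apply=> //; lia.
Qed.
Lemma good_a_base b i : (b + i = d)%N -> (d <= D)%N -> good 0 b i 0.
Proof.
move=> e le; have -> : i = (d - b)%N by lia.
by apply: good_a0 => //; lia.
Qed.

Lemma dvdn_ge n : (0 = n %[mod d])%N -> (0 < n)%N -> (d <= n)%N.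
Proof. by move=> e n0; apply: dvdn_leq => //; rewrite /dvdn -e mod0n. Qed.

(* The monomials X^a x^i. *)
Lemma good_aligned a i : (a + i <= D)%N -> good a 0 i 0.
Proof.
have dd := d0; case: (posnP a) => [->|a0]; case: (posnP i) => [->|i0] le.
- exact: good0.
- move=> v hv e; have le' := dvdn_ge e i0; move: v hv e.
  have [lt|gt] := ltnP d i; last by apply: good_a_base; lia.
  by apply: (@good_a_div 0); try lia; apply: good_q_div; lia.
- apply: goodC => v hv e; have le' : (d <= a)%N by apply: dvdn_ge a0; rewrite -[a]addn0.
  move: v hv e.
  have [lt|gt] := ltnP d a; last by apply: good_a_base; lia.
  by apply: (@good_a_div d); try lia; apply: good_Q_div; lia.
- case: a i a0 i0 le => [|[|a]] [|[|i]] // _ _ le.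
  + by apply: good_eu0; lia.
  + by apply: good_eu; [lia | apply: good_q; lia].
  + by apply: good_eu; [lia | apply: good_Q; lia].
  + by apply: good_eu; [lia | apply: good_Q; lia].
Qed.

(* The monomials Y^b x^i. *)
Lemma good_crossed b i : (b + i <= D)%N -> good 0 b i 0.
Proof.
have dd := d0; move=> le; case: (posnP (b + i)%N) => [|n0].
  by move=> /eqP; rewrite addn_eq0 => /andP[/eqP -> /eqP ->]; exact: good0.
move=> v hv e; have le' := dvdn_ge e n0; move: v hv e.
have [E|ne] := eqVneq (b + i)%N d; first by apply: good_a_base; lia.
have [ge|lt] := leqP d b.
  apply: (@good_a_div d); try lia; rewrite add0n subnn addn0 subn0.
  case: (posnP (b - d)%N) => [->|p]; first by apply: good_aligned; lia.
  by apply: good_Q_div; lia.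
by apply: (@good_a_div b); try lia; apply: good_q_div; lia.
Qed.

(** A monomial divisible by $xy$ or by $XY$ is settled by q or Q. Any other has at most one of x, y
    and at most one of X, Y, and so is of aligned or crossed type, up to the exchange of
    coordinates. *)
Lemma good_all a b i j : (a + b + i + j <= D)%N -> good a b i j.
Proof.
case: a b i j => [|a] [|b] [|i] [|j] le; try (by apply: good_q; lia);
  try (by apply: good_Q; lia); try (by apply: good_aligned; lia);
  try (by apply: good_crossed; lia); apply: goodC;
  try (by apply: good_aligned; lia); by apply: good_crossed; lia.
Qed.

Lemma cent1_next v : dlt D.+1 v -> cent1 (Ws v).
Proof.
elim=> [|c u w _ hu _ hw|a b i j w hw le].
- by rewrite Ws_0; exact: cent1_0.
- by rewrite Ws_lin; apply: cent1D => //; exact: cent1Z.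
rewrite Ws_mon //; case: eqP => [e|_]; last exact: cent1_0.
by apply: cent1Z; apply: good_all.
Qed.

End Degree.

Lemma cent1_Wsum D v : dlt D v -> cent1 (Ws v).
Proof.
elim: D v => [|D IH] v; last exact: cent1_next.
by move=> /dlt_0 ->; rewrite Ws_0; exact: cent1_0.
Qed.

Lemma dlt_op g n v : dlt n v -> dlt n.+1 (op g v).
Proof.
move=> h; have h1 : dlt n.+1 v by exact: dltS h.
case: g => [|r|k|k|w].
- by rewrite opT0; exact: dlt0.
- exact: dltC.
- have [->|->] := ord2_cases k.
    by rewrite -[x v](subrK (mx v)); apply: dltD; [exact: dlt_difx|exact: dltx].
  by rewrite -[y v](subrK (my v)); apply: dltD; [exact: dlt_dify|exact: dlty].
- by have [->|->] := ord2_cases k; [exact: dltX|exact: dltY].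
have [j [->|->]] := dihedral_shape hz w; first exact: dlts.
by rewrite (bmWM bm); do 2!apply: dlts.
Qed.

Lemma dlt_act (a : F) : exists n, dlt n (act op a e0).
Proof.
move: a; apply: (malg_ind (P := fun a => exists n, dlt n (act op a e0))).
- by exists 0%N; rewrite act0; exact: dlt0.
- move=> c u v [m hu] [n hv]; exists (m + n)%N; rewrite actP; apply: dltP.
    by apply: dltS hu; lia.
  by apply: dltS hv; lia.
case=> s; rewrite /act lextU /=; elim: s => [|g s [n IH]] /=.
  by exists 1%N; apply: (@dltM 1 0 0 0 0); [exact: cword_e|].
by exists n.+1; exact: dlt_op.
Qed.

Lemma cent1_inv a : (forall w, op (GenW w) (act op a e0) = act op a e0) -> cent1 (act op a e0).
Proof.
move=> h; have [n hn] := dlt_act a; apply: (cent1Z_inv n2d).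
suff <- : Ws (act op a e0) = (2 * d)%:R *: act op a e0 by exact: cent1_Wsum hn.
rewrite /Wsum (eq_bigr (fun=> (2%:R : C) *: act op a e0)) => [|k _].
  by rewrite sumr_const card_ord -scaler_nat scalerA -natrM mulnC.
by rewrite !h scaler_nat mulr2n.
Qed.

End Monomials.

End CentreMonomialsPart.
Export CentreMonomialsPart.

(** * Generators of the centre *)

Module CentreGeneratorsPart.

Section CentreGenerated.
Context {R : realType} {d : nat} {zeta : R[i]}.
Hypothesis hz : d.-primitive_root zeta.
Local Notation C := R[i].
Local Notation gen := (gen zeta).
Local Notation F := (freealg C gen).
Local Notation H := (H d zeta).
Local Notation Z := (Z d zeta).
Local Notation psiH := (@psiH R d zeta).
Local Notation zF := (@zF R d zeta).
Notation gx := (GenV zeta 0).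
Notation gy := (GenV zeta 1).

Lemma GenC_central r : psiH (f_gen (GenC r)) \in central (A := H).
Proof.
apply/asboolP => b; have [a <-] := psiH_surj b.
exact: (C_central (psiH_rel (d := d))).
Qed.

Lemma centralD {K : pzRingType} {A : pzAlgType K} (a b : A) :
  a \in central (A := A) -> b \in central (A := A) -> a + b \in central (A := A).
Proof. by move=> ha hb; exact: (valP (Centre ha + Centre hb)). Qed.
Lemma centralM {K : pzRingType} {A : pzAlgType K} (a b : A) :
  a \in central (A := A) -> b \in central (A := A) -> a * b \in central (A := A).
Proof. by move=> ha hb; exact: (valP (Centre ha * Centre hb)). Qed.

Lemma centralD_morph {K : pzRingType} {A : pzAlgType K} {B : pzRingType}
    (f : {rmorphism B -> A}) (a b : B) :
  f a \in central (A := A) -> f b \in central (A := A) -> f (a + b) \in central (A := A).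
Proof. by move=> ha hb; rewrite rmorphD; exact: centralD. Qed.
Lemma centralM_morph {K : pzRingType} {A : pzAlgType K} {B : pzRingType}
    (f : {rmorphism B -> A}) (a b : B) :
  f a \in central (A := A) -> f b \in central (A := A) -> f (a * b) \in central (A := A).
Proof. by move=> ha hb; rewrite rmorphM; exact: centralM. Qed.

Lemma comm_morph {K : pzRingType} {A : pzAlgType K} {B : pzRingType}
    (f : {rmorphism B -> A}) (a b : B) :
  (forall h : A, f a * h = h * f a) -> f (b * a) = f (a * b).
Proof. by move=> h; rewrite !rmorphM h. Qed.

Lemma zgen_central a : in_zgen d a -> psiH a \in central (A := H).
Proof.
elim=> [c|r||||i _|u v _ hu _ hv|u v _ hu _ hv].
- have -> : psiH (algc c) = algc c := psiH_algc c.
  exact: algc_in_central.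
- exact: GenC_central.
- exact: (q_central hz).
- exact: (Q_central hz).
- exact: (eu_central hz).
- exact: (a_central hz).
- exact: (@centralD_morph C H F psiH _ _ hu hv).
- exact: (@centralM_morph C H F psiH _ _ hu hv).
Qed.

Local Notation M := (pmod C (pidx (nat * nat * nat * unit)%type)).
Local Notation bop := (base_op (R := R) (zeta := zeta) (fun _ (g : unit) => g) false).
Let op := triv_op (d := d) (zeta := zeta) (R := R).
Let cm : cmod d op := triv_cmod hz.
Let P0 (v : M) : Prop := exists e, v = pinj 0 0 e.

Lemma psiH_act_commute a g v : psiH a \in central (A := H) ->
  op g (act op a v) = act op a (op g v).
Proof.
move=> /asboolP h; rewrite -!(act_gen op) -!actM.
apply: (act_psiH hz cm); first exact: triv_T.
exact: (@comm_morph C H F psiH _ _ h).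
Qed.

(** Centrality makes z applied to [triv1] invariant under W, so it equals b applied to [triv1] for
    some b in the span of the proposed generators. The difference is central and kills [triv1],
    hence vanishes by [H_triv_faithful]. *)
Theorem centre_generated (z : Z) : exists2 a, in_zgen d a & centre_val z = psiH a.
Proof.
have [a ea] := psiH_surj (centre_val z).
have ha : psiH a \in central (A := H) by rewrite ea; exact: (valP z).
have inv w : op (GenW w) (act op a triv1) = act op a triv1.
  by rewrite psiH_act_commute // triv_W.
have bb := base_bmod hz false (actG := fun _ (g : unit) => g) (fun g => erefl) (fun _ _ g => erefl).
have [|||||||||||||||b hb eb] := cent1_inv hz cm (mx := pcmap (bop gx)) (my := pcmap (bop gy))
  (e0 := triv1) (P0 := P0) _ _ _ _ _ _ _ _ _ _ _ _ _ _ _ inv.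
- exact: triv_T.
- exact: triv_W.
- by eexists.
- by move=> r v [e ->]; exists (bop (GenC r) e); exact: pcmap_inj.
- by move=> w v [e ->]; exists (bop (GenW w) e); exact: vW_inj.
- by move=> v [e ->]; exists (bop gx e); exact: pcmap_inj.
- by move=> v [e ->]; exists (bop gy e); exact: pcmap_inj.
- by move=> v [e ->]; rewrite pcmap_inj; exact: vx_inj.
- by move=> v [e ->]; rewrite pcmap_inj; exact: vy_inj.
- by move=> v; exact: pcmapX.
- by move=> v; exact: pcmapY.
- by move=> v; exact: pcmapX.
- by move=> v; exact: pcmapY.
- move=> v; rewrite !pcmap_comp; apply: (fmod_eq (f := pcmap _) (g := pcmap _)) => -[[m n] k].
  by rewrite !pcmapU; congr (pinj _ _ _); exact: (bmxy bb).
- by move=> g hg w v; apply: psiH_act_commute; exact: zgen_central.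
exists b => //; rewrite -ea; apply: subr0_eq; rewrite -(rmorphB psiH).
have hab : psiH (a - b) \in central (A := H).
  have -> : a - b = a + algc (-1) * b by rewrite (rmorphN algc) (rmorph1 algc) mulN1r.
  apply: (@centralD_morph C H F psiH _ _ ha); apply: (@centralM_morph C H F psiH); last exact: zgen_central.
  have -> : psiH (algc (-1)) = algc (-1) := psiH_algc _.
  exact: algc_in_central.
apply: (H_triv_faithful hz); first by apply/asboolP.
by rewrite actB eb subrr.
Qed.

End CentreGenerated.

End CentreGeneratorsPart.
Export CentreGeneratorsPart.

(** * Ideals under quotients, maximal submodules, and the lemma of Schur *)

Module SubmodulesPart.

Section ImageIdeal.
Context {A B : pzRingType} (f : {rmorphism A -> B}) (P : set A).
Hypothesis surj : forall b, exists a, f a = b.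
Hypothesis iP : is_ideal P.
Hypothesis kerP : forall a, f a = 0 -> P a.

Lemma ker_saturated u v : f u = f v -> P v -> P u.
Proof.
have [P0 PB _ _] := iP => e hv; have : P ((u - v) - (0 - v)).
  by apply: (PB _ _); [apply: kerP; rewrite rmorphB e subrr | exact: PB].
by rewrite sub0r opprK subrK.
Qed.

Definition image_set : set B := fun b => forall a, f a = b -> P a.

Lemma image_setP a : P a -> image_set (f a).
Proof. by move=> h u e; exact: ker_saturated h. Qed.

Lemma image_ideal : is_ideal image_set.
Proof.
have [P0 PB PMl PMr] := iP; split.
- exact: kerP.
- move=> b b' hb hb'; have [v ev] := surj b; have [w ew] := surj b'.
  rewrite -ev -ew -rmorphB; apply: image_setP.
  by apply: PB; [exact: hb | exact: hb'].
- move=> x b hb; have [v ev] := surj b; have [w ew] := surj x.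
  by rewrite -ev -ew -rmorphM; apply: image_setP; apply: PMl; exact: hb.
- move=> x b hb; have [v ev] := surj b; have [w ew] := surj x.
  by rewrite -ev -ew -rmorphM; apply: image_setP; apply: PMr; exact: hb.
Qed.

End ImageIdeal.

Lemma qpi_ker {K : pzRingType} {A : pzRingType} {B : pzAlgType K} (f : {rmorphism A -> B})
    (S : set B) (P : set A) :
  (forall b, exists a, f a = b) -> is_ideal P -> (forall a, f a = 0 -> P a) ->
  (forall a, S (f a) -> P a) -> forall a, qpi S (f a) = 0 -> P a.
Proof.
move=> surj iP kf hS a /qpi_eq0 h.
apply: (ideal_span_min (image_ideal surj iP kf)) h a erefl => b hb u e.
by apply: hS; rewrite e.
Qed.

Section QuotientModules.
Context {A : pzRingType} {M : lmodType A}.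

Lemma submod_span_min (S P : set M) u : is_submod P -> (forall v, S v -> P v) ->
  u \in submod_span S -> P u.
Proof. by move=> hP hS /asboolP; apply. Qed.

Lemma submod_span_id (S : set M) u : is_submod S -> (u \in submod_span S) = `[< S u >].
Proof.
move=> hS; apply/idP/asboolP; first exact: submod_span_min.
by move=> h; apply/asboolP => P _; apply.
Qed.

Lemma qmod_surj (S : set M) (x : quotmod S) : exists u, \pi_(quotmod S) u = x.
Proof. by exists (repr x); exact: reprK. Qed.

Lemma qmod_eq0 (S : set M) u : \pi_(quotmod S) u = 0 <-> u \in submod_span S.
Proof.
have -> : (0 : quotmod S) = \pi_(quotmod S) 0.
  by apply: (addrI (\pi_(quotmod S) 0)); rewrite -quotmod_piD !addr0.
by rewrite quotmod_eqP subr0.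
Qed.

Lemma qmod_piZ (S : set M) a u : \pi_(quotmod S) (a *: u) = a *: \pi_(quotmod S) u.
Proof. exact: quotmod_piZ. Qed.

Lemma submodD (P : set M) u v : is_submod P -> P u -> P v -> P (u + v).
Proof. by move=> [_ h] hu hv; rewrite -[u]scale1r; exact: h. Qed.
Lemma submodZ (P : set M) a u : is_submod P -> P u -> P (a *: u).
Proof. by move=> [h0 h] hu; rewrite -[a *: u]addr0; exact: h. Qed.

(** Zorn's lemma on proper submodules. The union of a chain stays proper because finitely many
    generators would all lie in one member of it. *)
Lemma maximal_submod n (g : 'I_n -> M) :
  (forall P : set M, is_submod P -> (forall i, P (g i)) -> P = setT) ->
  (exists m : M, m <> 0) ->
  exists N : set M, is_submod N /\ simple_module (quotmod N : lmodType A).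
Proof.
move=> gen [m0 m0P].
pose T := {P : set M | is_submod P /\ exists u, ~ P u}.
pose leT (P Q : T) := `[< forall u, sval P u -> sval Q u >].
have z : T.
  exists [set 0]%classic; split; last by exists m0.
  by split=> // a u v -> ->; rewrite scaler0 addr0.
have [||||t ht] := @Zorn T (fun P Q => leT P Q).
- by move=> P; apply/asboolP.
- by move=> P Q S /asboolP h1 /asboolP h2; apply/asboolP => u /h1 /h2.
- move=> [P hP] [Q hQ] /asboolP h1 /asboolP h2.
  have e : P = Q by apply/seteqP; split.
  by case: Q / e hQ h1 h2 => hQ _ _; congr exist; exact: Prop_irrelevance.
- move=> S tot; have [[s0 Ss0]|nS] := pselect (exists s, S s); last first.
    by exists z => s Ss; case: nS; exists s.
  pose U : set M := fun u => exists2 s, S s & sval s u.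
  have U0 s : S s -> forall u, sval s u -> U u by move=> Ss u hu; exists s.
  have sub : is_submod U.
    split; first by exists s0 => //; case: (svalP s0) => -[].
    move=> a u v [s Ss hu] [s' Ss' hv].
    case: (tot _ _ Ss Ss') => /asboolP h.
      by exists s' => //; case: (svalP s') => -[_ hs] _; apply: hs => //; exact: h.
    by exists s => //; case: (svalP s) => -[_ hs] _; apply: hs => //; exact: h.
  have proper : exists u, ~ U u.
    apply/existsNP => UT.
    have [s Ss hs] : exists2 s, S s & forall i : 'I_n, sval s (g i).
      have fin k : exists2 s, S s & forall i : 'I_n, (i < k)%N -> sval s (g i).
        elim: k => [|k [s Ss IH]]; first by exists s0.
        have [lt|ge] := ltnP k n; last first.
          by exists s => // i _; apply: IH; exact: leq_trans (ltn_ord i) ge.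
        have [s' Ss' hs'] := UT (g (Ordinal lt)).
        case: (tot _ _ Ss Ss') => /asboolP h.
          exists s' => // i; rewrite ltnS leq_eqVlt => /orP[/eqP e|]; last by move=> /IH /h.
          by have -> : i = Ordinal lt by apply: val_inj.
        exists s => // i; rewrite ltnS leq_eqVlt => /orP[/eqP e|]; last by move=> /IH.
        have -> : i = Ordinal lt by apply: val_inj.
        exact: h.
      by have [s Ss h] := fin n; exists s => // i; exact: h.
    case: (svalP s) => sm [u]; apply.
    by rewrite (gen (sval s) sm hs).
  by exists (exist _ U (conj sub proper)) => s Ss; apply/asboolP => u; exact: U0.
have [sm [u0 hu0]] := svalP t; exists (sval t); split=> //; split.
  exists (\pi_(quotmod (sval t)) u0); rewrite qmod_eq0 submod_span_id // => /asboolP.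
  exact: hu0.
move=> P hP; pose Q : set M := fun u => P (\pi_(quotmod (sval t)) u).
have Qs : is_submod Q.
  split; first by rewrite /Q (_ : \pi_(quotmod (sval t)) 0 = 0);
    [case: hP | apply/qmod_eq0; exact: rpred0].
  move=> a u v hu hv; rewrite /Q quotmod_piD qmod_piZ.
  by case: hP => _; apply.
have tQ u : sval t u -> Q u.
  move=> hu; rewrite /Q (_ : \pi_(quotmod (sval t)) u = 0); first by case: hP.
  by apply/qmod_eq0; rewrite submod_span_id //; apply/asboolP.
have [[u nQ]|/forallNP QT] := pselect (exists u, ~ Q u); last first.
  right; apply/seteqP; split=> // x _; have [u <-] := qmod_surj x.
  exact: contrapT (QT u).
left; have := ht (exist _ Q (conj Qs (ex_intro _ u nQ))).
move=> /(_ (asboolT tQ)) /(congr1 sval) /= e.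
apply/seteqP; split=> x; last by move=> ->; case: hP.
have [v <-] := qmod_surj x => hv; apply/qmod_eq0; rewrite submod_span_id //.
apply/asboolP; have : Q v by exact: hv.
by rewrite [X in X v]e.
Qed.

End QuotientModules.

Section Schur.
Context {R : realType} {A : pzAlgType R[i]} {L : lmodType A}.
Local Notation C := R[i].
Let N := res L.

Lemma span_dependent n (g : 'I_n -> N) (v : 'I_n.+1 -> N) :
  (forall m, exists a : 'I_n -> C, m = \sum_i a i *: g i) ->
  exists2 u : 'I_n.+1 -> C, exists k, u k != 0 & \sum_k u k *: v k = 0.
Proof.
move=> sp; pose a k := sval (cid (sp (v k))).
have ha k : v k = \sum_i a k i *: g i by exact: svalP (cid (sp (v k))).
pose m := \matrix_(k, i) a k i : 'M[C]_(n.+1, n).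
have : kermx m != 0.
  rewrite kermx_eq0 /row_free; apply: contraTneq (rank_leq_col m) => ->.
  by rewrite -ltnNge.
move=> /rowV0Pn[u /sub_kermxP um u0].
exists (fun k => u 0 k).
  by have /rV0Pn[k hk] := u0; exists k.
rewrite (eq_bigr (fun k => \sum_i (u 0 k * a k i) *: g i)) => [|k _]; last first.
  by rewrite ha scaler_sumr; apply: eq_bigr => i _; rewrite scalerA.
rewrite exchange_big /=; apply: big1 => i _; rewrite -scaler_suml.
have := congr1 (fun w : 'rV[C]_n => w 0 i) um; rewrite !mxE => e.
rewrite (_ : \sum_k _ = 0) ?scale0r // -[RHS]e.
by apply: eq_bigr => k _; rewrite mxE.
Qed.

(* A linear endomorphism of a nonzero finite-dimensional space has an eigenvector. *)
Lemma eigenvector n (g : 'I_n -> N) (f : {linear N -> N}) (m : N) :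
  (forall m, exists a : 'I_n -> C, m = \sum_i a i *: g i) -> m <> 0 ->
  exists2 u : N, u <> 0 & exists c, f u = c *: u.
Proof.
move=> sp m0.
(* The vectors $m,fm,\dots,f^nm$ are dependent, so a nonzero polynomial p satisfies $p(f)m=0$. Over
   the complex numbers p splits; multiplying its linear factors one at a time, the last product that
   does not kill m yields an eigenvector. *)
have [u [k uk] e] := span_dependent (fun k : 'I_n.+1 => iter k f m) sp.
pose p : {poly C} := \poly_(k < n.+1) u (inord k).
pose ev (q : {poly C}) : N := \sum_(k < size q) q`_k *: iter k f m.
have evE (q : {poly C}) K : (size q <= K)%N -> ev q = \sum_(k < K) q`_k *: iter k f m.
  move=> le; rewrite /ev (big_ord_widen _ (fun k => q`_k *: iter k f m) le) big_mkcond /=.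
  by apply: eq_bigr => i _; case: ifPn => //; rewrite -leqNgt => h; rewrite nth_default ?scale0r.
have p0 : p != 0.
  apply: contraNneq uk => e0; have := congr1 (fun q : {poly C} => q`_k) e0.
  by rewrite coef_poly ltn_ord coef0 inord_val => ->.
have evp : ev p = 0.
  rewrite (evE _ n.+1) ?size_poly // -[RHS]e; apply: eq_bigr => i _.
  by rewrite coef_poly ltn_ord inord_val.
have evX (q : {poly C}) c : ev (('X - c%:P) * q) = f (ev q) - c *: ev q.
  have le : (size (('X - c%:P) * q)%R <= (size q).+1)%N.
    have [->|q0] := eqVneq q 0; first by rewrite mulr0 size_poly0.
    by rewrite size_monicM ?monicXsubC // size_XsubC.
  rewrite (evE _ (size q).+1) // [X in f X]/ev linear_sum (evE q (size q).+1) ?leqnSn //.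
  rewrite scaler_sumr.
  have -> : \sum_(k < (size q).+1) (('X - c%:P) * q)`_k *: iter k f m =
      \sum_(k < (size q).+1) ('X * q)`_k *: iter k f m -
      \sum_(k < (size q).+1) c *: (q`_k *: iter k f m).
    rewrite -sumrB; apply: eq_bigr => i _.
    by rewrite mulrBl coefB mul_polyC coefZ scalerBl scalerA.
  congr (_ - _); rewrite big_ord_recl coefXM /= scale0r add0r.
  by apply: eq_bigr => i _; rewrite coefXM /= (linearZ_LR f).
have [r hr] := closed_field_poly_normal p.
have : exists2 q, ev q <> 0 & exists c, ev (('X - c%:P) * q) = 0.
  have lc0 : lead_coef p != 0 by rewrite lead_coef_eq0.
  have evZ c (q : {poly C}) : ev (c *: q) = c *: ev q.
    rewrite (evE (c *: q) (size q)) ?size_scale_leq // /ev scaler_sumr.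
    by apply: eq_bigr => i _; rewrite coefZ scalerA.
  have : ev (\prod_(z <- r) ('X - z%:P)) = 0.
    have := evp; rewrite hr evZ => /(congr1 (fun v => (lead_coef p)^-1 *: v)).
    by rewrite scalerA mulVf // scale1r scaler0.
  elim: r {hr} => [|z r IH].
    rewrite big_nil (evE 1 1) ?size_poly1 // big_ord1 coef1 /= scale1r => h.
    by case: m0.
  rewrite big_cons => h; have [h0|h0] := pselect (ev (\prod_(z <- r) ('X - z%:P)) = 0).
    exact: IH.
  by exists (\prod_(z <- r) ('X - z%:P)) => //; exists z.
move=> [q q0 [c hc]]; exists (ev q) => //; exists c.
by apply: subr0_eq; rewrite -evX.
Qed.

(** An eigenspace of a central element is a nonzero submodule, hence everything. *)
Lemma schur n (g : 'I_n -> N) (z : A) : simple_module L -> z \in central (A := A) ->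
  (forall m : N, exists a : 'I_n -> C, m = \sum_i a i *: g i) ->
  exists c : C, forall m : L, z *: m = (algc c : A) *: m.
Proof.
move=> [[m0 m0P] smp] /asboolP zc sp.
have [u u0 [c hu]] := eigenvector (resmul (M := L) z) sp m0P.
exists c; pose P : set L := fun m => z *: m = (algc c : A) *: m.
have hP : is_submod P.
  split; first by rewrite /P !scaler0.
  move=> a v w hv hw; rewrite /P !scalerDr !scalerA zc algc_central -!scalerA.
  by congr (_ + _); [congr (_ *: _); exact: hv | exact: hw].
case: (smp P hP) => e m; last by have : P m by rewrite e.
by have : P u := hu; rewrite e => u00; case: u0.
Qed.

End Schur.

End SubmodulesPart.
Export SubmodulesPart.

From HB Require Import structures.
From mathcomp Require Import all_boot all_order all_algebra.
From mathcomp Require Import generic_quotient.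
From mathcomp Require Import complex finmap monalg mpoly ring zify.
From mathcomp Require Import boolp classical_sets reals.
Set Implicit Arguments.
Unset Strict Implicit.
Unset Printing Implicit Defensive.
Import GRing.Theory Num.Theory.
Local Open Scope ring_scope.
Local Open Scope complex_scope.
Local Open Scope quotient_scope.

(** * Invariant polynomials and the ideal generated by uv and u^d + v^d *)

Module InvariantPolynomialsPart.

Section IdealPowerSums.
Context {B : pzRingType} (J : set B) (d : nat) (u v : B).
Hypothesis d0 : (0 < d)%N.
Hypothesis iJ : is_ideal J.
Hypothesis uv : u * v = v * u.
Hypothesis Juv : J (u * v).
Hypothesis Jd : J (u ^+ d + v ^+ d).

Let JMl a x : J x -> J (a * x). Proof. by case: iJ => _ _ h _; exact: h. Qed.
Let JMr a x : J x -> J (x * a). Proof. by case: iJ => _ _ _; apply. Qed.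
Let JB x y : J x -> J y -> J (x - y). Proof. by case: iJ => _ h _ _; exact: h. Qed.
Let JD x y : J x -> J y -> J (x + y).
Proof. by move=> hx hy; rewrite -[y]opprK; apply: (JB hx); rewrite -sub0r; apply: (JB _ hy); case: iJ. Qed.

Lemma ideal_mixed i j : (0 < i)%N -> (0 < j)%N -> J (u ^+ i * v ^+ j).
Proof.
case: i j => [|i] [|j] // _ _; rewrite exprSr exprS mulrA -(mulrA (u ^+ i)).
by apply: JMr; apply: JMl.
Qed.

(** The product of $u^d+v^d$ with the previous power sum differs from the next one by mixed terms,
    which are multiples of uv. *)
Lemma ideal_power_sum k : J (u ^+ (k.+1 * d) + v ^+ (k.+1 * d)).
Proof.
case: k => [|k]; first by rewrite mul1n.
have -> : u ^+ (k.+2 * d) + v ^+ (k.+2 * d) =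
   (u ^+ d + v ^+ d) * (u ^+ (k.+1 * d) + v ^+ (k.+1 * d)) -
   (u ^+ d * v ^+ (k.+1 * d) + u ^+ (k.+1 * d) * v ^+ d).
  have -> : u ^+ (k.+1 * d) * v ^+ d = v ^+ d * u ^+ (k.+1 * d).
    by apply: commrX; apply/commr_sym; apply: commrX.
  rewrite [(k.+2 * d)%N]mulSn mulrDl !mulrDr !exprD; zmod_eq B.
have kd : (0 < k.+1 * d)%N by rewrite muln_gt0.
by apply: JB; [exact: JMr | apply: JD; exact: ideal_mixed].
Qed.

Lemma ideal_sym_power i j : (i = j %[mod d])%N -> (0 < i + j)%N ->
  J (u ^+ i * v ^+ j + u ^+ j * v ^+ i).
Proof.
case: (posnP i) => [->|i0]; case: (posnP j) => [->|j0] //; last first.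
- by move=> _ _; apply: JD; exact: ideal_mixed.
all: rewrite !expr0 ?mulr1 ?mul1r ?mod0n => e _.
- have {e} : (d %| i)%N by rewrite /dvdn e.
  by case/dvdnP => -[|k] ek; [rewrite ek in i0 | rewrite ek; exact: ideal_power_sum].
- have {e} : (d %| j)%N by rewrite /dvdn -e.
  case/dvdnP => -[|k] ek; first by rewrite ek in j0.
  by rewrite ek addrC; exact: ideal_power_sum.
Qed.

End IdealPowerSums.

Section InvariantPolynomials.
Context {R : realType} {d : nat} {zeta : R[i]}.
Hypothesis hz : d.-primitive_root zeta.
Local Notation C := R[i].
Local Notation F := (freealg C (gen zeta)).
Let d0 := prim_order_gt0 hz.

Definition mswap (m : 'X_{1..2}) : 'X_{1..2} :=
  [multinom (if k == 0%R then m 1%R else m 0%R) | k < 2].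

Lemma mswap0 m : mswap m 0 = m 1. Proof. by rewrite /mswap mnmE. Qed.
Lemma mswap1 m : mswap m 1 = m 0. Proof. by rewrite /mswap mnmE. Qed.
Lemma mnm2P (m m' : 'X_{1..2}) : m 0 = m' 0 -> m 1 = m' 1 -> m = m'.
Proof. by move=> e0 e1; apply/mnmP => i; have [->|->] := ord2_cases i. Qed.
Lemma mswapK : involutive mswap.
Proof. by move=> m; apply: mnm2P; rewrite !(mswap0, mswap1). Qed.

Lemma mp_substE (A : 'M[C]_2) k : mp_subst A 'X_k = A k 0 *: 'X_0 + A k 1 *: 'X_1.
Proof.
rewrite /mp_subst comp_mpolyXU -tnth_nth tnth_mktuple !big_ord_recl big_ord0 addr0.
by congr (_ *: 'X_ _ + _ *: 'X_ _); try congr (A _ _); apply: val_inj.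
Qed.

Lemma mcoeff_antidiag (A : 'M[C]_2) (p : mpoly 2 C) m : A 0 0 = 0 -> A 1 1 = 0 ->
  (mp_subst A p)@_m = p@_(mswap m) * (A 0 1 ^+ m 1 * A 1 0 ^+ m 0).
Proof.
move=> a00 a11; rewrite /mp_subst comp_mpolyE raddf_sum /=.
have e (m' : 'X_{1..2}) : \prod_(i < 2) tnth [tuple \sum_l A k l *: 'X_l | k < 2] i ^+ m' i =
    (A 0 1 ^+ m' 0 * A 1 0 ^+ m' 1) *: 'X_[mswap m'] :> mpoly 2 C.
  have t k : tnth [tuple \sum_l A k l *: 'X_l | k < 2] k = A k 0 *: 'X_0 + A k 1 *: 'X_1 :> mpoly 2 C.
    rewrite tnth_mktuple !big_ord_recl big_ord0 addr0.
    by congr (_ *: 'X_ _ + _ *: 'X_ _); try congr (A _ _); apply: val_inj.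
  rewrite !big_ord_recl big_ord0 mulr1 !t.
  have -> : lift ord0 ord0 = 1 :> 'I_2 by apply: val_inj.
  rewrite a00 a11 !scale0r add0r addr0 !exprZn -scalerAl -scalerAr scalerA; congr (_ *: _).
  rewrite [RHS]mpolyXE_id !big_ord_recl big_ord0 mulr1 [RHS]mulrC.
  have -> : lift ord0 ord0 = 1 :> 'I_2 by apply: val_inj.
  by congr (_ ^+ _ * _ ^+ _); [rewrite -(mswap1 m') | rewrite -(mswap0 m')].
have [ms|nms] := boolP (mswap m \in msupp p).
  rewrite (bigD1_seq (mswap m)) ?msupp_uniq //= e !mcoeffZ mcoeffX mswapK eqxx mulr1.
  rewrite mswap0 mswap1 big1 ?addr0 // => m' ne; rewrite e !mcoeffZ mcoeffX.
  by rewrite -(inj_eq (inv_inj mswapK)) mswapK (negPf ne) !mulr0.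
rewrite (memN_msupp_eq0 nms) mul0r big_seq big1 // => m' hm'; rewrite e !mcoeffZ mcoeffX.
rewrite -(inj_eq (inv_inj mswapK)) mswapK; case: eqP => [em|_]; last by rewrite !mulr0.
by rewrite -em hm' in nms.
Qed.

(** Invariance in terms of coefficients: the reflection $s_0$ makes them symmetric, and a second
    antidiagonal matrix with entries $z$, $z^{-1}$, $z$ a primitive root, forces the congruence on
    the support. *)
Definition sym_poly (p : mpoly 2 C) : Prop := forall m,
  p@_(mswap m) = p@_m /\ (p@_m != 0 -> (m 0%R = m 1%R %[mod d])%N).

Lemma antidiag_sym (A A' : 'M[C]_2) (z : C) p :
  A 0 0 = 0 -> A 1 1 = 0 -> A' 0 0 = 0 -> A' 1 1 = 0 ->
  A 0 1 = 1 -> A 1 0 = 1 -> A' 0 1 = z -> A' 1 0 = z^-1 -> d.-primitive_root z ->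
  mp_subst A p = p -> mp_subst A' p = p -> sym_poly p.
Proof.
move=> a00 a11 b00 b11 a01 a10 b01 b10 pz hA hA' m.
have e : p@_(mswap m) = p@_m.
  by rewrite -[in RHS]hA mcoeff_antidiag // a01 a10 !expr1n !mulr1.
split=> // nz; have z0 : z != 0 := zeta_unit pz.
have := mcoeff_antidiag p m b00 b11; rewrite hA' e b01 b10 => /eqP.
rewrite -[X in X == _]mulr1 => /eqP /(mulfI nz); rewrite exprVn => h.
apply/eqP; rewrite -(eq_prim_root_expr pz); apply/eqP.
have zm : z ^+ m 0 != 0 by rewrite expf_neq0.
by apply: (mulIf (invr_neq0 zm)); rewrite -h divff.
Qed.

Lemma inv_Vd_sym p : inv_Vd zeta p -> sym_poly p.
Proof.
move=> h; apply: (antidiag_sym (A := invmx (s_mx zeta 0)) (A' := invmx (s_mx zeta 1)) _ _ _ _ _ _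
  _ _ hz (h (dih_s zeta 0)) (h (dih_s zeta 1)));
  by rewrite (invmx_s hz) s_mxE /= ?expr0 ?invr1 ?expr1.
Qed.

Lemma inv_V_sym p : inv_V zeta p -> sym_poly p.
Proof.
(* On $V$ the transposed matrices act, and it is the transpose of $s_{d-1}$ that has $\zeta$ in its
   upper right corner. *)
have e : zeta ^+ d.-1 = zeta^-1 by rewrite -[d.-1]mul1n (zeta_inv hz) expr1.
move=> h; apply: (antidiag_sym (A := (s_mx zeta 0)^T) (A' := (s_mx zeta d.-1)^T) _ _ _ _ _ _
  _ _ hz (h (dih_s zeta 0)) (h (dih_s zeta d.-1)));
  by rewrite mxE s_mxE /= ?expr0 ?invr1 // e ?invrK.
Qed.

Lemma rmorph_monomial2 {A : nzRingType} {B : pzRingType} (f : {rmorphism A -> B}) a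
    (h : 'I_2 -> A) (m : 'X_{1..2}) :
  f (a * \prod_(i < 2) h i ^+ m i) = f a * (f (h 0) ^+ m 0 * f (h 1) ^+ m 1).
Proof.
rewrite !big_ord_recl big_ord0 mulr1 !rmorphM !rmorphXn.
by have -> : lift ord0 ord0 = 1 :> 'I_2 by apply: val_inj.
Qed.

Lemma rmorph_mmap2 {B : pzAlgType C} (f : {rmorphism F -> B}) (h : 'I_2 -> F) (p : mpoly 2 C) :
  (forall c, f (algc c) = algc c) ->
  f (mmap (algc : C -> F) h p) =
  \sum_(m <- msupp p) algc p@_m * (f (h 0) ^+ m 0 * f (h 1) ^+ m 1).
Proof.
move=> fC; rewrite /mmap rmorph_sum; apply: eq_bigr => m _.
by apply: etrans (rmorph_monomial2 f _ _ _) _; congr (_ * _); exact: fC.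
Qed.

(* Twice p(u, v) is a combination of the u^i v^j + u^j v^i with i = j mod d. *)
Lemma ideal_sym_poly {B : pzAlgType C} (J : set B) (u v : B) p : is_ideal J ->
  u * v = v * u -> J (u * v) -> J (u ^+ d + v ^+ d) -> sym_poly p -> p@_0%MM = 0 ->
  J (\sum_(m <- msupp p) algc p@_m * (u ^+ m 0 * v ^+ m 1)).
Proof.
move=> iJ uv Juv Jd sp p0; set S := \sum_(m <- _) _.
have [J0 JB JMl _] := iJ.
have JD x y : J x -> J y -> J (x + y).
  by move=> hx hy; rewrite -[y]opprK; apply: (JB _ _ hx); rewrite -sub0r; apply: (JB _ _ _ hy).
have e : S = \sum_(m <- msupp p) algc p@_m * (u ^+ m 1 * v ^+ m 0).
  rewrite /S (perm_big (map mswap (msupp p))); last first.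
    apply: uniq_perm; [exact: msupp_uniq | by rewrite (map_inj_uniq (inv_inj mswapK)) msupp_uniq |].
    move=> m; apply/idP/mapP => [hm|[m' hm' ->]].
      by exists (mswap m); rewrite ?mswapK // mcoeff_msupp (sp m).1 -mcoeff_msupp.
    by rewrite mcoeff_msupp (sp m').1 -mcoeff_msupp.
  by rewrite big_map; apply: eq_bigr => m _; rewrite (sp m).1 mswap0 mswap1.
have JS : J (S + S).
  rewrite {2}e /S -big_split big_seq; apply: (big_ind J J0 JD) => m hm /=.
  rewrite -mulrDr; apply: JMl; apply: (ideal_sym_power d0 iJ uv Juv Jd).
    by apply: (sp m).2; rewrite -mcoeff_msupp.
  rewrite lt0n; apply: contraL hm; rewrite addn_eq0 => /andP[/eqP a /eqP b].
  have -> : m = 0%MM by apply: mnm2P; rewrite mnm0E.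
  by rewrite mcoeff_msupp p0 eqxx.
have -> : S = algc (2%:R^-1) * (S + S).
  rewrite -mulr2n -[S *+ 2]mulr_natl -(rmorph_nat (algc : {rmorphism C -> B})) mulrA -rmorphM.
  by rewrite mulVf ?pnatr_eq0 // rmorph1 mul1r.
exact: JMl.
Qed.

Definition mpXY : mpoly 2 C := 'X_0 * 'X_1.
Definition mpXYd : mpoly 2 C := 'X_0 ^+ d + 'X_1 ^+ d.

Lemma mp_substM (A : 'M[C]_2) p q : mp_subst A (p * q) = mp_subst A p * mp_subst A q.
Proof. exact: rmorphM. Qed.

Definition monomial_mx (A : 'M[C]_2) : Prop :=
  exists a b : C, [/\ a * b = 1, a ^+ d = 1, b ^+ d = 1 &
   [/\ A 0 0 = a, A 1 1 = b, A 0 1 = 0 & A 1 0 = 0] \/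
   [/\ A 0 0 = 0, A 1 1 = 0, A 0 1 = a & A 1 0 = b]].

Lemma monomial_inv A : monomial_mx A ->
  mp_subst A mpXY = mpXY /\ mp_subst A mpXYd = mpXYd.
Proof.
move=> [a [b [ab ad bd h]]].
have eXY : mp_subst A mpXY = (A 0 0 *: 'X_0 + A 0 1 *: 'X_1) * (A 1 0 *: 'X_0 + A 1 1 *: 'X_1).
  by rewrite mp_substM !mp_substE.
have ed : mp_subst A mpXYd =
    (A 0 0 *: 'X_0 + A 0 1 *: 'X_1) ^+ d + (A 1 0 *: 'X_0 + A 1 1 *: 'X_1) ^+ d.
  by rewrite -!mp_substE; exact: rmorph_power_sum.
rewrite eXY ed; case: h => -[-> -> -> ->]; rewrite !scale0r ?addr0 ?add0r !exprZn ad bd !scale1r.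
  rewrite -scalerAl -scalerAr scalerA ab scale1r; split; reflexivity.
rewrite -scalerAl -scalerAr scalerA ab scale1r; split; [exact: mulrC | exact: addrC].
Qed.

Lemma monomial_tr A : monomial_mx A -> monomial_mx A^T.
Proof.
move=> [a [b [ab ad bd h]]]; case: h => -[h1 h2 h3 h4].
  by exists a, b; split=> //; left; rewrite !mxE.
by exists b, a; split=> //; [rewrite mulrC | right; rewrite !mxE].
Qed.

Let zX j : (zeta ^+ j) ^+ d = 1.
Proof. by rewrite exprAC (prim_expr_order hz) expr1n. Qed.

Lemma monomial_s j : monomial_mx (s_mx zeta j).
Proof.
exists (zeta ^+ j), (zeta ^- j); split.
- by rewrite divff // expf_neq0 // (zeta_unit hz).
- exact: zX.
- by rewrite exprVn zX invr1.
by right; rewrite !s_mxE.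
Qed.

Lemma monomial_mul A B : monomial_mx A -> monomial_mx B -> monomial_mx (A *m B).
Proof.
move=> [a [b [ab ad bd h]]] [a' [b' [ab' ad' bd' h']]].
case: h => -[h1 h2 h3 h4]; case: h' => -[h1' h2' h3' h4'];
  [exists (a * a'), (b * b')|exists (a * a'), (b * b')|exists (a * b'), (b * a')|exists (a * b'), (b * a')];
  (split; [ (by rewrite mulrACA ab ab' mulr1) || (by rewrite mulrACA ab mul1r mulrC)
   | by rewrite exprMn ?ad ?ad' ?bd ?bd' mulr1 | by rewrite exprMn ?ad ?ad' ?bd ?bd' mulr1 | ]);
  rewrite !mulmx2E h1 h2 h3 h4 h1' h2' h3' h4' !(mul0r, mulr0, addr0, add0r);
  by [left|right].
Qed.

Lemma monomial_dih (w : dihedral zeta) : monomial_mx (sval w).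
Proof.
have [j [->|->]] := dihedral_shape hz w; first exact: monomial_s.
by apply: monomial_mul; exact: monomial_s.
Qed.
Lemma monomial_dih_inv (w : dihedral zeta) : monomial_mx (invmx (sval w)).
Proof.
have [j [->|->]] := dihedral_shape hz w; first by rewrite (invmx_s hz); exact: monomial_s.
rewrite /= (invmx_mul (s_mx_unit hz j) (s_mx_unit hz 0)) !(invmx_s hz).
by apply: monomial_mul; exact: monomial_s.
Qed.

Lemma inv_V_basic : inv_V zeta mpXY /\ inv_V zeta mpXYd.
Proof. by split=> w; have [h1 h2] := monomial_inv (monomial_tr (monomial_dih w)). Qed.
Lemma inv_Vd_basic : inv_Vd zeta mpXY /\ inv_Vd zeta mpXYd.
Proof. by split=> w; have [h1 h2] := monomial_inv (monomial_dih_inv w). Qed.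

Let mon2 (i j : nat) : 'X_{1..2} := ((U_(0%R) *+ i) + (U_(1%R) *+ j))%MM.
Let mon2_0 i j : mon2 i j 0 = i.
Proof. by rewrite /mon2 mnmDE !mulmnE !mnm1E /= mul1n mul0n addn0. Qed.
Let mon2_1 i j : mon2 i j 1 = j.
Proof. by rewrite /mon2 mnmDE !mulmnE !mnm1E /= mul1n mul0n add0n. Qed.

Lemma mpXYE : mpXY = 'X_[mon2 1 1].
Proof. by rewrite /mpXY -mpolyXD; congr 'X_[_]; apply: mnm2P; rewrite (mon2_0, mon2_1) mnmDE !mnm1E. Qed.
Lemma mpXYdE : mpXYd = 'X_[mon2 d 0] + 'X_[mon2 0 d].
Proof.
by rewrite /mpXYd !mpolyXn; congr ('X_[_] + 'X_[_]); apply: mnm2P;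
  rewrite (mon2_0, mon2_1) mulmnE !mnm1E /= ?mul1n ?mul0n.
Qed.

Lemma mon2_coef0 i j : (0 < i + j)%N -> ('X_[mon2 i j] : mpoly 2 C)@_0%MM = 0.
Proof.
move=> ij; rewrite mcoeffX; case: eqP => // e.
have e0 := congr1 (fun m : 'X_{1..2} => m 0) e; have e1 := congr1 (fun m : 'X_{1..2} => m 1) e.
by move: ij; rewrite -(mon2_0 i j) -{2}(mon2_1 i j) e0 e1 !mnm0E.
Qed.
Lemma mpXY0 : mpXY@_0%MM = 0.
Proof. by rewrite mpXYE mon2_coef0. Qed.
Lemma mpXYd0 : mpXYd@_0%MM = 0.
Proof. by rewrite mpXYdE mcoeffD !mon2_coef0 ?addr0 // addn0. Qed.

Lemma rmorph_mmap_mon2 {B : pzAlgType C} (f : {rmorphism F -> B}) (h : 'I_2 -> F) i j :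
  (forall c, f (algc c) = algc c) ->
  f (mmap (algc : C -> F) h 'X_[mon2 i j]) = f (h 0) ^+ i * f (h 1) ^+ j.
Proof.
move=> fC; apply: etrans (rmorph_mmap2 h _ fC) _; rewrite msuppX big_seq1 mcoeffX eqxx rmorph1 mul1r.
by rewrite mon2_0 mon2_1.
Qed.

Lemma rmorph_mpXY {B : pzAlgType C} (f : {rmorphism F -> B}) (h : 'I_2 -> F) :
  (forall c, f (algc c) = algc c) ->
  f (mmap (algc : C -> F) h mpXY) = f (h 0) * f (h 1).
Proof. move=> fC; rewrite mpXYE; exact: (rmorph_mmap_mon2 h 1 1 fC). Qed.

Lemma rmorph_mpXYd {B : pzAlgType C} (f : {rmorphism F -> B}) (h : 'I_2 -> F) :
  (forall c, f (algc c) = algc c) ->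
  f (mmap (algc : C -> F) h mpXYd) = f (h 0) ^+ d + f (h 1) ^+ d.
Proof.
move=> fC; rewrite mpXYdE mmapD rmorphD.
have e1 := rmorph_mmap_mon2 h d 0 fC; have e2 := rmorph_mmap_mon2 h 0 d fC.
by apply: etrans (congr2 (fun u v => u + v) e1 e2) _; rewrite !expr0 mulr1 mul1r.
Qed.

End InvariantPolynomials.

End InvariantPolynomialsPart.
Export InvariantPolynomialsPart.

(** * Standard modules at the parameter c *)

Module StandardModulesPart.

Lemma act_genX {R : realType} {zeta : R[i]} {N : lmodType R[i]}
    (op : gen zeta -> {linear N -> N}) g k m :
  act op (f_gen g ^+ k) m = iter k (op g) m.
Proof.
apply: etrans (iaX (act_isact op) _ _ _) _.
by elim: k => //= k ->; rewrite act_gen.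
Qed.

Lemma act_genXD {R : realType} {zeta : R[i]} {N : lmodType R[i]}
    (op : gen zeta -> {linear N -> N}) g h k m :
  act op (f_gen g ^+ k + f_gen h ^+ k) m = iter k (op g) m + iter k (op h) m.
Proof. by apply: etrans (actD _ _ _ _) _; congr (_ + _); exact: act_genX. Qed.

Section StandardModule.
Context {R : realType} {d : nat} {zeta : R[i]}.
Hypothesis hz : d.-primitive_root zeta.
Local Notation C := R[i].
Local Notation gen := (gen zeta).
Local Notation F := (freealg C gen).
Local Notation H := (H d zeta).
Local Notation psiH := (@psiH R d zeta).
Let d0 := prim_order_gt0 hz.
Context (c : reflection zeta -> C) (hc : is_param c) (E : rep zeta).
Local Notation n := (rep_dim E).
Local Notation B := (fmod C 'I_n).
Local Notation M := (pmod C 'I_n).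

Definition std_base (g : gen) : {linear B -> B} :=
  match g with
  | GenC r => c r \*: idfun
  | GenW w => flext (fun j => \sum_k rep_mx E w k j *: fb k)
  | _ => \0
  end.

Lemma std_baseW w j : std_base (GenW w) (fb j) = \sum_k rep_mx E w k j *: fb k.
Proof. exact: flextU. Qed.

Lemma std_bmod : bmod std_base.
Proof.
split.
- by move=> g m /=; rewrite linear0.
- by move=> r g m /=; rewrite (linearZ_LR (std_base g)).
- by move=> r r' h m /=; rewrite (hc h).
- apply: (fmod_eq (f := std_base _) (g := idfun)) => j.
  rewrite std_baseW rep_mx1 (bigD1 j) //= mxE eqxx scale1r big1 ?addr0 // => k nk.
  by rewrite mxE (negPf nk) scale0r.
- move=> w1 w2; apply: (fmod_eq (f := std_base _) (g := std_base _ \o std_base _)) => j.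
  apply: etrans (std_baseW _ j) (esym (etrans (congr1 (std_base (GenW w1)) (std_baseW w2 j)) _)).
  rewrite linear_sum.
  rewrite (eq_bigr (fun k => \sum_l (rep_mx E w2 k j * rep_mx E w1 l k) *: fb l)) => [|k _]; last first.
    by rewrite (linearZ_LR (std_base _)) std_baseW scaler_sumr; apply: eq_bigr => l _; rewrite scalerA.
  rewrite exchange_big; apply: eq_bigr => k _ /=.
  rewrite rep_mxM mxE scaler_suml; apply: eq_bigr => l _.
  by rewrite mulrC.
- by move=> w m /=; rewrite linear0 !scaler0 addr0.
- by move=> w m /=; rewrite linear0 !scaler0 addr0.
- by [].
Qed.

Definition std_op : gen -> {linear M -> M} := vop (d := d) std_base.
Definition std_e (j : 'I_n) : M := pinj 0 0 (fb j).

Lemma std_cmod : cmod d std_op.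
Proof. exact: (vop_cmod hz std_bmod). Qed.
Let cm := std_cmod.
Let bm := cm_bmod cm.

Lemma std_T m : std_op (GenT zeta) m = 0.
Proof. by apply: pcmap_ind0. Qed.
Lemma std_C r m : std_op (GenC r) m = c r *: m.
Proof.
apply: (fmod_eq (f := std_op (GenC r)) (g := c r \*: idfun)) => -[[a b] j] /=.
by rewrite pcmapU /= -pinjU (linearZ_LR (pinj a b)).
Qed.
Lemma std_x e : std_op (GenV zeta 0) (pinj 0 0 e) = 0.
Proof. by apply: etrans (vx_inj _ e) _; rewrite linear0. Qed.
Lemma std_y e : std_op (GenV zeta 1) (pinj 0 0 e) = 0.
Proof. by apply: etrans (vy_inj _ e) _; rewrite linear0. Qed.
Lemma std_W w e : std_op (GenW w) (pinj 0 0 e) = pinj 0 0 (std_base (GenW w) e).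
Proof. exact: vW_inj. Qed.

(* A submodule of [M] closed under the generators is closed under the algebra. *)
Lemma psiH_act_comm {N : lmodType C} (op : gen -> {linear N -> N}) (cmN : cmod d op)
    (T0 : forall v, op (GenT zeta) v = 0) a b m :
  psiH a \in central (A := H) -> act op b (act op a m) = act op a (act op b m).
Proof.
move=> /asboolP h; rewrite -!actM; apply: (act_psiH hz cmN T0).
exact: (@comm_morph C H F psiH _ _ h).
Qed.

Local Notation fq := (@fq R zeta).
Local Notation fQ := (@fQ R zeta).
Local Notation fr := (fx (zeta := zeta) ^+ d + fy (zeta := zeta) ^+ d).
Local Notation fR := (fX (zeta := zeta) ^+ d + fY (zeta := zeta) ^+ d).

Let fa0 : fa (d := d) (zeta := zeta) 0 = fr. Proof. by rewrite /fa !pw0. Qed.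
Let fad : fa (d := d) (zeta := zeta) d = fR.
Proof. by rewrite /fa !pwmm; exact: addrC. Qed.

Lemma r_central : psiH fr \in central (A := H).
Proof. exact: (eq_ind _ (fun a => psiH a \in central (A := H)) (a_central hz 0) _ fa0). Qed.
Lemma R_central : psiH fR \in central (A := H).
Proof. exact: (eq_ind _ (fun a => psiH a \in central (A := H)) (a_central hz d) _ fad). Qed.

Lemma std_act0 a : psiH a \in central (A := H) -> (forall j, act std_op a (std_e j) = 0) ->
  forall m, act std_op a m = 0.
Proof.
move=> ha h.
apply: (pmod_eq (f := act std_op a) (g := \0)) => [j|m /= e|m /= e]; first exact: h.
  rewrite -[pX m](act_gen std_op (GenVd zeta 0)) -(psiH_act_comm cm std_T) // e.
  by rewrite linear0.
rewrite -[pY m](act_gen std_op (GenVd zeta 1)) -(psiH_act_comm cm std_T) // e.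
by rewrite linear0.
Qed.

Lemma std_q m : act std_op fq m = 0.
Proof.
apply: std_act0; first exact: (q_central hz).
by move=> j; rewrite actM !act_gen std_y linear0.
Qed.

Lemma std_r m : act std_op fr m = 0.
Proof.
apply: std_act0; first exact: r_central.
move=> j; rewrite act_genXD -(prednK d0) !iterSr std_x std_y.
have it0 g k : iter k (std_op g) 0 = 0 by elim: k => //= k ->; exact: linear0.
by rewrite !it0 addr0.
Qed.

(** The quotient by this submodule is a model of the baby Verma module: q and $x^d+y^d$ already act
    by zero, and here the images of Q and $R=X^d+Y^d$ are divided out. *)
Definition std_N (m : M) : Prop := exists u v, m = act std_op fQ u + act std_op fR v.

Lemma std_N_lin a u v : std_N u -> std_N v -> std_N (a *: u + v).
Proof.
move=> [u1 [u2 ->]] [v1 [v2 ->]]; exists (a *: u1 + v1), (a *: u2 + v2).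
rewrite (linearP (act std_op fQ)) (linearP (act std_op fR)) scalerDr.
by rewrite addrACA.
Qed.
Lemma std_N0 : std_N 0.
Proof. by exists 0, 0; rewrite !linear0 addr0. Qed.
Lemma std_N_act a m : std_N m -> std_N (act std_op a m).
Proof.
move=> [u [v ->]]; exists (act std_op a u), (act std_op a v).
apply: etrans (linearD (act std_op a) _ _) _; congr (_ + _).
  exact: (psiH_act_comm cm std_T a u (Q_central hz)).
exact: (psiH_act_comm cm std_T a v R_central).
Qed.

(** Q and R produce only monomials of positive degree, so the coefficient at the constant term $e_j$
    tells them apart. *)
Lemma std_N_top j : ~ std_N (std_e j).
Proof.
move=> [u [v e]].
pose f : {linear M -> C^o} := flext (fun k => ((k == (0%N, 0%N, j))%:R : C^o)).
have fX0 m : f (pX m) = 0.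
  by apply: (fmod_eq (f := f \o pX) (g := \0)) => -[[a b] k] /=; rewrite pXU /f flextU.
have fY0 m : f (pY m) = 0.
  apply: (fmod_eq (f := f \o pY) (g := \0)) => -[[a b] k] /=; rewrite pYU /f flextU.
  by rewrite !xpair_eqE andbF.
have : f (std_e j) = 1 by rewrite /std_e pinjU /f flextU eqxx.
rewrite e (linearD f) actM act_gen fX0 add0r act_genXD (linearD f).
rewrite -(prednK d0) !iterS fX0 fY0 addr0.
by move=> /eqP; rewrite eq_sym oner_eq0.
Qed.

End StandardModule.

End StandardModulesPart.
Export StandardModulesPart.

(** * The kernel of the map to the restricted algebra *)

Module RestrictedAlgebraPart.

Section Coinvariants.
Context {R : realType} {d : nat} {zeta : R[i]}.
Hypothesis hz : d.-primitive_root zeta.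
Local Notation C := R[i].
Local Notation gen := (gen zeta).
Local Notation F := (freealg C gen).
Local Notation H := (H d zeta).
Local Notation psiH := (@psiH R d zeta).
Context (c : reflection zeta -> C).
Local Notation Hc := (Hc d c).
Local Notation Hbar := (Hbar d c).
Local Notation fq := (@fq R zeta).
Local Notation fQ := (@fQ R zeta).
Local Notation fx := (@fx R zeta).
Local Notation fy := (@fy R zeta).
Local Notation fX := (@fX R zeta).
Local Notation fY := (@fY R zeta).
Local Notation fr := (fx ^+ d + fy ^+ d).
Local Notation fR := (fX ^+ d + fY ^+ d).

Definition piC : {rmorphism H -> Hc} :=
  qpi (A := H) [set a : H | exists r, a = H_gen d (GenC r) - algc (c r)]%classic.
Definition piK : {rmorphism Hc -> Hbar} := qpi (A := Hc) (@Hc_coinv R d zeta c).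
Definition piF : {rmorphism F -> Hbar} := piK \o (piC \o psiH).

Lemma to_Hbar_psi a : to_Hbar c (psiH a) = piF a. Proof. by []. Qed.
Lemma piF_surj h : exists a, piF a = h.
Proof.
have [u <-] := qpi_surj h; have [v <-] := qpi_surj u; have [a <-] := psiH_surj v.
by exists a.
Qed.

(** Invariants without constant term lie in the ideal generated by uv and $u^d+v^d$, by
    [ideal_sym_poly]. This reduces the infinitely many coinvariant relations to four. *)
Lemma Hbar_ker (P : set F) : is_ideal P -> (forall a, psiH a = 0 -> P a) ->
  (forall r, P (f_gen (GenC r) - algc (c r))) -> P fq -> P fQ -> P fr -> P fR ->
  forall a, piF a = 0 -> P a.
Proof.
move=> iP kerP PC Pq PQ Pr PR.
have surjH : forall b, exists a, psiH a = b := @psiH_surj R d zeta.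
have kC a : piC (psiH a) = 0 -> P a.
  apply: (qpi_ker surjH iP kerP) => {}a [r e]; apply: (ker_saturated iP kerP) (PC r).
  by rewrite e rmorphB; congr (_ - _).
have surjC b : exists a, (piC \o psiH) a = b.
  have [u <-] := qpi_surj b; have [a <-] := psiH_surj u; by exists a.
have iH := image_ideal surjH iP kerP.
have inH a : P a -> image_set psiH P (psiH a) by exact: image_setP.
have dH := dunklH hz.
apply: (qpi_ker (f := piC \o psiH) surjC iP kC) => a [p [p0 h]].
have PK b : (piC \o psiH) a = (piC \o psiH) b -> P b -> P a by exact: ker_saturated.
case: h => -[ip /PK]; apply; apply: (_ : image_set psiH P _) erefl.
  have -> : psiH (f_polyVd zeta p) = _ := rmorph_mmap2 _ p (psiH_algc (d := d)).
  apply: (ideal_sym_poly hz iH (rXY dH)) => //; last exact: (inv_Vd_sym hz ip).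
    have -> : psiH fX * psiH fY = psiH fQ := esym (rmorphM psiH fX fY).
    exact: inH.
  have -> : psiH fX ^+ d + psiH fY ^+ d = psiH fR := esym (rmorph_power_sum psiH _ _ _).
  exact: inH.
have -> : psiH (f_polyV zeta p) = _ := rmorph_mmap2 _ p (psiH_algc (d := d)).
apply: (ideal_sym_poly hz iH (rxy dH)) => //; last exact: (inv_V_sym hz ip).
  have -> : psiH fx * psiH fy = psiH fq := esym (rmorphM psiH fx fy).
  exact: inH.
have -> : psiH fx ^+ d + psiH fy ^+ d = psiH fr := esym (rmorph_power_sum psiH _ _ _).
exact: inH.
Qed.

End Coinvariants.

End RestrictedAlgebraPart.
Export RestrictedAlgebraPart.

(** * Relations in the restricted algebra, and nonvanishing of baby Verma modules *)

Module RestrictedRelationsPart.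

Section DeltaColumns.
Context {A : pzRingType} {n : nat}.
Implicit Types (h : A) (k l : 'I_n).

Lemma scale_deltaE h k l : (h *: (delta_mx k 0 : 'cV[A]_n)) l 0 = if l == k then h else 0.
Proof. by rewrite !mxE eqxx andbT; case: eqP => _; rewrite ?mulr1 ?mulr0. Qed.

Lemma delta_sumE (a : 'I_n -> A) l : (\sum_k a k *: (delta_mx k 0 : 'cV[A]_n)) l 0 = a l.
Proof.
rewrite summxE (bigD1 l) //= scale_deltaE eqxx big1 ?addr0 // => k nk.
by rewrite scale_deltaE eq_sym (negPf nk).
Qed.

Lemma delta_subE h k (a : 'I_n -> A) l :
  (h *: (delta_mx k 0 : 'cV[A]_n) - \sum_k a k *: (delta_mx k 0 : 'cV[A]_n)) l 0 =
  (if l == k then h else 0) - a l.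
Proof. by rewrite mxE [X in _ + X]mxE delta_sumE scale_deltaE. Qed.

End DeltaColumns.

Lemma rmorph_if0 {A B : pzRingType} (f : {rmorphism A -> B}) (b : bool) (x : A) :
  f (if b then x else 0) = if b then f x else 0.
Proof. by case: b; rewrite ?rmorph0. Qed.

Lemma rmorph_if0B {A B : pzRingType} (f : {rmorphism A -> B}) (b : bool) (x y : A) :
  f ((if b then x else 0) - y) = (if b then f x else 0) - f y.
Proof. by rewrite rmorphB rmorph_if0. Qed.

Lemma sum_if0 {W : zmodType} {I : finType} (k : I) (x : W) :
  \sum_l (if l == k then x else 0) = x.
Proof. by rewrite -big_mkcond big_pred1_eq. Qed.

Section ActSums.
Context {R : realType} {zeta : R[i]} {N : lmodType R[i]} (op : gen zeta -> {linear N -> N}).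
Context {I : finType} (e : I -> N).
Local Notation F := (freealg R[i] (gen zeta)).

Lemma act_if (b : bool) (a : F) m : act op (if b then a else 0) m = if b then act op a m else 0.
Proof. by case: b; rewrite ?act0. Qed.

Lemma act_sum_if (a : F) k : \sum_l act op (if l == k then a else 0) (e l) = act op a (e k).
Proof.
rewrite -[RHS](sum_if0 k); apply: eq_bigr => l _; rewrite act_if.
by case: eqP => // ->.
Qed.

Lemma act_sum_ifB (a : F) k (s : I -> R[i]) :
  \sum_l act op ((if l == k then a else 0) - algc (s l)) (e l) =
  act op a (e k) - \sum_l s l *: e l.
Proof.
rewrite -(act_sum_if a) -sumrB; apply: eq_bigr => l _.
by rewrite actB act_algc.
Qed.

Lemma act_sumB (a : I -> F) k :
  \sum_l act op (a l - (if l == k then 1 else 0)) (e l) = \sum_l act op (a l) (e l) - e k.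
Proof.
rewrite -[X in _ - X](act1 op) -(act_sum_if 1) -sumrB; apply: eq_bigr => l _.
by rewrite actB.
Qed.
End ActSums.

Section BabyVerma.
Context {R : realType} {d : nat} {zeta : R[i]}.
Hypothesis hz : d.-primitive_root zeta.
Local Notation C := R[i].
Local Notation gen := (gen zeta).
Local Notation F := (freealg C gen).
Local Notation H := (H d zeta).
Local Notation Z := (Z d zeta).
Local Notation psiH := (@psiH R d zeta).
Let d0 := prim_order_gt0 hz.
Context (c : reflection zeta -> C) (hc : is_param c).
Local Notation Hc := (Hc d c).
Local Notation Hbar := (Hbar d c).
Local Notation fq := (@fq R zeta).
Local Notation fQ := (@fQ R zeta).
Local Notation fx := (@fx R zeta).
Local Notation fy := (@fy R zeta).
Local Notation fX := (@fX R zeta).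
Local Notation fY := (@fY R zeta).
Local Notation fr := (fx ^+ d + fy ^+ d).
Local Notation fR := (fX ^+ d + fY ^+ d).
Local Notation piF := (@piF R d zeta c).

Lemma piF_algc a : piF (algc a) = algc a. Proof. by []. Qed.

Lemma piF_rel a : cher_rel d (f_gen (GenT zeta)) a -> piF a = 0.
Proof.
move=> h; apply: etrans (congr1 (fun h => piK c (piC c h)) (psiH_rel h)) _.
by rewrite !rmorph0.
Qed.
Lemma piF_T : piF (f_gen (GenT zeta)) = 0.
Proof.
apply: etrans (congr1 (fun h => piK c (piC c h)) (psiH_T (d := d))) _.
by rewrite !rmorph0.
Qed.
Lemma piF_C r : piF (f_gen (GenC r)) = algc (c r).
Proof.
apply: subr0_eq.
have e : piC c (psiH (f_gen (GenC r)) - algc (c r)) = 0.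
  by apply/qpi_eq0; apply: mem_ideal_span; exists r.
apply: etrans (_ : piK c (piC c (psiH (f_gen (GenC r)) - algc (c r))) = 0).
  by rewrite !rmorphB; congr (_ - _).
by rewrite e rmorph0.
Qed.

Lemma coinv_Vd p : p@_0%MM = 0 -> inv_Vd zeta p -> piF (f_polyVd zeta p) = 0.
Proof. by move=> p0 ip; apply/qpi_eq0; apply: mem_ideal_span; exists p; split=> //; left. Qed.
Lemma coinv_V p : p@_0%MM = 0 -> inv_V zeta p -> piF (f_polyV zeta p) = 0.
Proof. by move=> p0 ip; apply/qpi_eq0; apply: mem_ideal_span; exists p; split=> //; right. Qed.

Lemma piF_Q : piF fQ = 0.
Proof.
have e := coinv_Vd mpXY0 (inv_Vd_basic hz).1.
apply: etrans e; apply: etrans (rmorphM piF fX fY) _.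
exact: esym (rmorph_mpXY _ piF_algc).
Qed.
Lemma piF_q : piF fq = 0.
Proof.
have e := coinv_V mpXY0 (inv_V_basic hz).1.
apply: etrans e; apply: etrans (rmorphM piF fx fy) _.
exact: esym (rmorph_mpXY _ piF_algc).
Qed.
Lemma piF_R : piF fR = 0.
Proof.
have e := coinv_Vd (mpXYd0 hz) (inv_Vd_basic hz).2.
apply: etrans e; apply: etrans (rmorph_power_sum piF fX fY d) _.
exact: esym (rmorph_mpXYd _ piF_algc).
Qed.
Lemma piF_r : piF fr = 0.
Proof.
have e := coinv_V (mpXYd0 hz) (inv_V_basic hz).2.
apply: etrans e; apply: etrans (rmorph_power_sum piF fx fy d) _.
exact: esym (rmorph_mpXYd _ piF_algc).
Qed.

Context (E : rep zeta) (E0 : (0 < rep_dim E)%N).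
Local Notation n := (rep_dim E).
Local Notation V := (baby_verma d c E).
Local Notation std_op := (std_op (d := d) c E).

Definition bv (j : 'I_n) : V := \pi_(baby_verma d c E) (verma_e d c j).

Let iN : is_ideal (fun a : F => forall m, std_N (d := d) c (act std_op a m)).
Proof.
split.
- by move=> m; rewrite act0; exact: std_N0.
- move=> a b ha hb m; rewrite actB -scaleN1r addrC; exact: std_N_lin.
- by move=> a b hb m; rewrite actM; exact: (std_N_act hz hc).
- by move=> a b hb m; rewrite actM.
Qed.

Lemma std_N_ker a : piF a = 0 -> forall m, std_N (d := d) c (act std_op a m).
Proof.
apply: (Hbar_ker hz iN).
- move=> b hb m; have -> : act std_op b m = act std_op 0 m.
    by apply: (act_psiH hz (std_cmod hz hc E) (std_T c (E := E))); rewrite hb rmorph0.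
  by rewrite act0; exact: std_N0.
- by move=> r m; rewrite actB act_gen act_algc std_C subrr; exact: std_N0.
- by move=> m; rewrite (std_q hz hc); exact: std_N0.
- by move=> m; exists m, 0; rewrite linear0 addr0.
- by move=> m; rewrite (std_r hz hc); exact: std_N0.
- by move=> m; exists 0, m; rewrite linear0 add0r.
Qed.

(** The defining relations of the baby Verma module hold in the standard module modulo [std_N]. If
    the class of $e_j$ were zero, then $1\otimes e_j$ would lie in [std_N], against [std_N_top]. *)
Lemma bv_neq0 j : bv j <> 0.
Proof.
move=> /qmod_eq0.
pose P (w : 'cV[Hbar]_n) := exists2 a : 'I_n -> F, (forall k, w k 0 = piF (a k)) &
  std_N (d := d) c (\sum_k act std_op (a k) (std_e k)).
have iP : is_submod P.
  split.
    exists (fun=> 0); first by move=> k; rewrite mxE rmorph0.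
    by rewrite big1 => [|k _]; [exact: std_N0 | rewrite act0].
  move=> h u v [a ha Na] [b hb Nb]; have [g <-] := piF_surj h.
  exists (fun k => g * a k + b k); first by move=> k; rewrite !mxE ha hb rmorphD rmorphM.
  have -> : \sum_k act std_op (g * a k + b k) (std_e k) =
      1 *: act std_op g (\sum_k act std_op (a k) (std_e k)) + \sum_k act std_op (b k) (std_e k).
    rewrite scale1r linear_sum -big_split; apply: eq_bigr => k _ /=.
    by rewrite actD actM.
  by apply: std_N_lin => //; exact: (std_N_act hz hc).
have relP w : verma_rel (d := d) (c := c) (E := E) w -> P w.
  case=> [u k|w' k].
    exists (fun l => if l == k then f_V zeta u else 0).
      move=> l; apply: etrans (scale_deltaE _ _ _) _; exact: esym (rmorph_if0 piF _ _).
    rewrite act_sum_if act_fV std_x std_y !scaler0 addr0; exact: std_N0.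
  exists (fun l => (if l == k then f_gen (GenW w') else 0) - algc (rep_mx E w' l k)).
    move=> l; apply: etrans (delta_subE _ _ _ _) _; exact: esym (rmorph_if0B piF _ _ _).
  rewrite act_sum_ifB.
  rewrite act_gen std_W std_baseW linear_sum.
  rewrite (eq_bigr (fun l => rep_mx E w' l k *: std_e l)) => [|l _]; last first.
    by rewrite (linearZ_LR (pinj 0 0)).
  by rewrite subrr; exact: std_N0.
move=> /(submod_span_min iP relP) [a ha Na].
apply: (std_N_top hz (c := c) (j := j)).
pose D := \sum_k act std_op (a k - (if k == j then 1 else 0)) (std_e k).
have ND : std_N (d := d) c D.
  rewrite /D; elim/big_ind: _ => [|u v hu hv|k _]; first exact: std_N0.
    by rewrite -[u]scale1r; exact: std_N_lin.
  apply: std_N_ker; apply: etrans (rmorphB piF _ _) _; rewrite -(ha k).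
  apply: etrans (congr2 (fun u v => u - v) (_ : _ = (if k == j then 1 else 0 : Hbar)) (rmorph_if0 piF _ _)) _.
    by have := scale_deltaE (1 : Hbar) j k; rewrite scale1r.
  by rewrite rmorph1 subrr.
have -> : std_e j = (-1) *: D + \sum_k act std_op (a k) (std_e k).
  by rewrite /D act_sumB scaleN1r opprB subrK.
exact: std_N_lin.
Qed.

End BabyVerma.

End RestrictedRelationsPart.
Export RestrictedRelationsPart.

(** * Finite dimension of the simple quotients; the centre acts by scalars *)

Module SimpleQuotientsPart.

Section FiniteSpan.
Context {R : realType} {d : nat} {zeta : R[i]}.
Hypothesis hz : d.-primitive_root zeta.
Local Notation C := R[i].
Local Notation gen := (gen zeta).
Let d0 := prim_order_gt0 hz.
Context {N : lmodType C} (op : gen -> {linear N -> N}) (cm : cmod d op).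
Let bm := cm_bmod cm.
Notation X := (op (GenVd zeta 0)).
Notation Y := (op (GenVd zeta 1)).
Notation x := (op (GenV zeta 0)).
Notation y := (op (GenV zeta 1)).
Context (c : reflection zeta -> C) (n : nat) (v : 'I_n -> N) (rho : dihedral zeta -> 'M[C]_n).
Hypothesis opT : forall m, op (GenT zeta) m = 0.
Hypothesis opC : forall r m, op (GenC r) m = c r *: m.
Hypothesis opQ : forall m, X (Y m) = 0.
Hypothesis opR : forall m, iter d X m + iter d Y m = 0.
Hypothesis vx : forall j, x (v j) = 0.
Hypothesis vy : forall j, y (v j) = 0.
Hypothesis vW : forall w j, op (GenW w) (v j) = \sum_k rho w k j *: v k.

Definition vmon (a b : nat) (j : 'I_n) : N := iter a X (iter b Y (v j)).

Inductive vspan : N -> Prop :=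
| vspan0 : vspan 0
| vspanP a u w : vspan u -> vspan w -> vspan (a *: u + w)
| vspanM a b j : vspan (vmon a b j).

Lemma vspanZ a u : vspan u -> vspan (a *: u).
Proof. by move=> h; rewrite -[_ *: u]addr0; apply: vspanP => //; exact: vspan0. Qed.
Lemma vspanD u w : vspan u -> vspan w -> vspan (u + w).
Proof. by move=> h; rewrite -[u]scale1r; exact: vspanP. Qed.

Lemma vspan_lin (f : {linear N -> N}) : (forall a b j, vspan (f (vmon a b j))) ->
  forall u, vspan u -> vspan (f u).
Proof.
move=> h u; elim=> [|a u' w _ hu _ hw|a b j] //; first by rewrite linear0; exact: vspan0.
by rewrite linearP; exact: vspanP.
Qed.

Lemma vmonX a b j : X (vmon a b j) = vmon a.+1 b j. Proof. by []. Qed.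
Lemma vmonY a b j : Y (vmon a b j) = vmon a b.+1 j.
Proof. by rewrite /vmon iterS (iter_comm (f := Y)) // => u; rewrite (cmXY cm). Qed.

Lemma vspanX u : vspan u -> vspan (X u).
Proof. by apply: vspan_lin => a b j; rewrite vmonX; exact: vspanM. Qed.
Lemma vspanY u : vspan u -> vspan (Y u).
Proof. by apply: vspan_lin => a b j; rewrite vmonY; exact: vspanM. Qed.
Lemma vspan_s k u : vspan u -> vspan (op (GenW (dih_s zeta k)) u).
Proof.
apply: vspan_lin => a b j; rewrite /vmon (cmod_s_X hz cm) (cmod_s_Y hz cm) vW.
apply: vspanZ; rewrite (iter_linearZ Y); apply: vspanZ.
have -> : iter a Y (iter b X (\sum_l rho (dih_s zeta k) l j *: v l)) =
    \sum_l rho (dih_s zeta k) l j *: vmon b a l.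
  rewrite iter_linear_sum iter_linear_sum; apply: eq_bigr => l _.
  rewrite !(iter_linearZ X, iter_linearZ Y); congr (_ *: _); rewrite /vmon.
  by elim: a => //= a ->; rewrite (iter_comm (f := Y)) // => u0; rewrite (cmXY cm).
elim/big_ind: _ => [|u0 w hu hw|l _]; [exact: vspan0 | exact: vspanD |].
by apply: vspanZ; exact: vspanM.
Qed.
Lemma vspan_sg k u : vspan u -> vspan (sigma d op k u).
Proof.
move=> h; rewrite /sigma; elim/big_ind: _ => [|u0 w hu hw|i _]; [exact: vspan0 | exact: vspanD |].
by rewrite opC; do 2!apply: vspanZ; exact: vspan_s.
Qed.

Lemma vspan_x u : vspan u -> vspan (x u).
Proof.
apply: vspan_lin => a b j; elim: a => [|a IH].
  elim: b => [|b IH]; first by rewrite /vmon /= vx; exact: vspan0.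
  rewrite -vmonY (cmxY cm); apply: vspanD; first exact: vspanY.
  by apply: vspan_sg; exact: vspanM.
rewrite -vmonX (cmxX cm) opT sub0r; apply: vspanD; first exact: vspanX.
by rewrite -scaleN1r; apply: vspanZ; apply: vspan_sg; exact: vspanM.
Qed.
Lemma vspan_y u : vspan u -> vspan (y u).
Proof.
apply: vspan_lin => a b j; elim: a => [|a IH].
  elim: b => [|b IH]; first by rewrite /vmon /= vy; exact: vspan0.
  rewrite -vmonY (cmyY cm) opT sub0r; apply: vspanD; first exact: vspanY.
  by rewrite -scaleN1r; apply: vspanZ; apply: vspan_sg; exact: vspanM.
rewrite -vmonX (cmyX cm); apply: vspanD; first exact: vspanX.
by apply: vspan_sg; exact: vspanM.
Qed.

Lemma vspan_op g u : vspan u -> vspan (op g u).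
Proof.
case: g => [|r|k|k|w] h.
- by rewrite opT; exact: vspan0.
- by rewrite opC; exact: vspanZ.
- by have [->|->] := ord2_cases k; [exact: vspan_x | exact: vspan_y].
- by have [->|->] := ord2_cases k; [exact: vspanX | exact: vspanY].
have [j [->|->]] := dihedral_shape hz w; first exact: vspan_s.
by rewrite (bmWM bm); do 2!apply: vspan_s.
Qed.

Lemma vspan_act a u : vspan u -> vspan (act op a u).
Proof.
move=> hu; move: a; apply: (malg_ind (P := fun a => vspan (act op a u))).
- by rewrite act0; exact: vspan0.
- by move=> k p q hp hq; rewrite actP; exact: vspanP.
case=> s; rewrite /act lextU /=; elim: s => [|g s IH] //=.
exact: vspan_op.
Qed.

(** From $XY=0$ and $X^d+Y^d=0$ follows $X^{d+1}=-XY^d=0$, and likewise for Y. *)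
Lemma vmon_big a b j : (d < a)%N || (d < b)%N -> vmon a b j = 0.
Proof.
have XY u : Y (X u) = 0 by rewrite -(cmXY cm) opQ.
have it0 (f : {linear N -> N}) k : iter k f 0 = 0 by elim: k => //= k ->; exact: linear0.
have Xd u : iter d.+1 X u = 0.
  have := congr1 X (opR u); rewrite linear0 (linearD X) -!iterS.
  by rewrite -{2}(prednK d0) [iter _.+1 Y u]iterS opQ addr0.
have Yd u : iter d.+1 Y u = 0.
  have := congr1 Y (opR u); rewrite linear0 (linearD Y) -!iterS.
  by rewrite -{1}(prednK d0) [iter _.+1 X u]iterS XY add0r.
rewrite /vmon => /orP[|] lt; first by rewrite -(subnK lt) iterD Xd it0.
by rewrite -(subnK lt) [iter _ Y _]iterD Yd !it0.
Qed.

Lemma vspan_finite u : vspan u -> exists a : 'I_d.+1 * 'I_d.+1 * 'I_n -> C,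
  u = \sum_t a t *: vmon t.1.1 t.1.2 t.2.
Proof.
elim=> [|a u1 u2 _ [a1 ->] _ [a2 ->]|a b j].
- by exists (fun=> 0); rewrite big1 // => t _; rewrite scale0r.
- exists (fun t => a * a1 t + a2 t); rewrite scaler_sumr -big_split; apply: eq_bigr => t _ /=.
  by rewrite scalerDl scalerA.
have [lt|] := boolP ((d < a)%N || (d < b)%N).
  exists (fun=> 0); rewrite vmon_big // big1 // => t _; exact: scale0r.
rewrite negb_or -!leqNgt => /andP[ha hb].
exists (fun t => (t == (inord a, inord b, j))%:R).
rewrite (bigD1 (inord a, inord b, j)) //= eqxx scale1r !inordK ?ltnS // big1 ?addr0 //.
by move=> t /negPf ->; rewrite scale0r.
Qed.

End FiniteSpan.

Lemma central_image {K : pzRingType} {A B : pzAlgType K} (f : {rmorphism A -> B}) a :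
  (forall b, exists a, f a = b) -> a \in central (A := A) -> f a \in central (A := B).
Proof.
move=> surj /asboolP h; apply/asboolP => b; have [u <-] := surj b.
by rewrite -!rmorphM h.
Qed.

Section SimpleQuotient.
Context {R : realType} {d : nat} {zeta : R[i]}.
Hypothesis hz : d.-primitive_root zeta.
Local Notation C := R[i].
Local Notation gen := (gen zeta).
Local Notation F := (freealg C gen).
Local Notation H := (H d zeta).
Local Notation Z := (Z d zeta).
Local Notation psiH := (@psiH R d zeta).
Let d0 := prim_order_gt0 hz.
Context (c : reflection zeta -> C) (hc : is_param c).
Local Notation Hbar := (Hbar d c).
Local Notation piF := (@piF R d zeta c).
Context (E : rep zeta) (E0 : (0 < rep_dim E)%N).
Local Notation n := (rep_dim E).
Local Notation V := (baby_verma d c E).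
Local Notation bv := (bv (d := d) c (E := E)).
Let op : gen -> {linear res V -> res V} := psi_op piF V.
Let cm : cmod d op.
Proof. exact: (psi_cmod hz (piF_algc c) (piF_rel c)). Qed.

Let opE g m : op g m = piF (f_gen g) *: m. Proof. by []. Qed.

Lemma bv_gen (P : set V) : is_submod P -> (forall j, P (bv j)) -> P = setT.
Proof.
move=> hP h; apply/seteqP; split=> // u _; have [w <-] := qmod_surj u.
have -> : w = \sum_k w k 0 *: verma_e d c k.
  apply/matrixP => i j; rewrite ord1; exact: (esym (delta_sumE (fun k => w k 0) i)).
elim/big_rec: _ => [|k u' _ hu].
  have -> : \pi_V 0 = 0 :> V := (qmod_eq0 _ _).2 (rpred0 _).
  exact: hP.1.
rewrite quotmod_piD qmod_piZ; apply: (submodD hP _ hu).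
exact: (submodZ _ hP (h k)).
Qed.

Let bv_V u j : piF (f_V zeta u) *: bv j = 0.
Proof.
rewrite /bv -qmod_piZ; apply/qmod_eq0; apply/asboolP => P _; apply.
have h := @VermaV R d zeta c E u j.
rewrite -(to_Hbar_psi c (f_V zeta u)).
exact h.
Qed.

Lemma bv_W w j : piF (f_gen (GenW w)) *: bv j = \sum_k (algc (rep_mx E w k j) : Hbar) *: bv k.
Proof.
apply: subr0_eq; rewrite /bv -qmod_piZ.
have -> : \sum_k (algc (rep_mx E w k j) : Hbar) *: (\pi_V (verma_e d c k) : V) =
    \pi_V (\sum_k (algc (rep_mx E w k j) : Hbar) *: verma_e d c k).
  elim/big_rec2: _ => [|k u u' _ ->]; first exact: esym ((qmod_eq0 _ _).2 (rpred0 _)).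
  by rewrite quotmod_piD qmod_piZ.
set a := (_ *: _); set b := \sum_k _.
have -> : (\pi_V a : V) - \pi_V b = \pi_V (a - b).
  apply: (addIr (\pi_V b : V)); rewrite -quotmod_piD !subrK //.
apply/qmod_eq0; apply/asboolP => P _; apply.
have h := @VermaW R d zeta c E w j.
rewrite /a -(to_Hbar_psi c (f_gen (GenW w))).
exact h.
Qed.

Lemma piF_scale a m : act op a m = piF a *: m.
Proof. exact: (act_psi (piF_algc c)). Qed.

Let opC0 r m : op (GenC r) m = c r *: m.
Proof. by rewrite opE piF_C. Qed.
Let opT0 m : op (GenT zeta) m = 0.
Proof. by rewrite opE piF_T scale0r. Qed.
Let opQ0 m : op (GenVd zeta 0) (op (GenVd zeta 1) m) = 0.
Proof. by have := piF_scale (fQ (zeta := zeta)) m; rewrite actM !act_gen (piF_Q hz) scale0r. Qed.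
Let opR0 m : iter d (op (GenVd zeta 0)) m + iter d (op (GenVd zeta 1)) m = 0.
Proof.
have e : piF (f_gen (GenVd zeta 0) ^+ d + f_gen (GenVd zeta 1) ^+ d) = 0 := piF_R hz c.
by rewrite -act_genXD piF_scale e scale0r.
Qed.
Let bvxy (u : 'cV[C]_2) j : u 0 0 *: op (GenV zeta 0) (bv j) + u 1 0 *: op (GenV zeta 1) (bv j) = 0.
Proof. exact: etrans (esym (act_fV op u (bv j))) (etrans (piF_scale _ _) (bv_V u j)). Qed.
Let bvx j : op (GenV zeta 0) (bv j) = 0.
Proof.
have [u u0 u1] : exists2 u : 'cV[C]_2, u 0 0 = 1 & u 1 0 = 0.
  by exists (\col_k (k == 0)%:R); rewrite mxE.
by have := bvxy u j; rewrite u0 u1 scale1r scale0r addr0.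
Qed.
Let bvy j : op (GenV zeta 1) (bv j) = 0.
Proof.
have [u u0 u1] : exists2 u : 'cV[C]_2, u 0 0 = 0 & u 1 0 = 1.
  by exists (\col_k (k == 1)%:R); rewrite mxE.
by have := bvxy u j; rewrite u0 u1 scale1r scale0r add0r.
Qed.

Lemma baby_verma_vspan (m : V) : vspan op (bv : 'I_n -> res V) m.
Proof.
have hP : is_submod (vspan op (bv : 'I_n -> res V) : set V).
  split; first exact: vspan0.
  move=> h u v hu hv; have [a <-] := piF_surj h.
  apply: (vspanD _ hv); have := vspan_act hz cm (c := c) (rho := rep_mx E) opT0 opC0 bvx bvy bv_W a hu.
  by rewrite piF_scale.
have e := bv_gen hP (fun j => vspanM op bv 0 0 j).
by have : setT m by []; rewrite -e.
Qed.

Lemma verma_max_simple : is_submod (@verma_max R d zeta c E) /\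
  simple_module (simple_L d c E : lmodType Hbar).
Proof.
have ex : exists N : set V, is_submod N /\ simple_module (quotmod N : lmodType Hbar).
  apply: (maximal_submod (g := bv)); first exact: bv_gen.
  by exists (bv (Ordinal E0)); exact: (bv_neq0 hz hc).
exact: (xgetPex setT ex).
Qed.

Local Notation L := (simple_L d c E : lmodType Hbar).

Lemma simple_L_finite : exists k (g : 'I_k -> res L),
  forall m : res L, exists a : 'I_k -> C, m = \sum_i a i *: g i.
Proof.
pose T : finType := ('I_d.+1 * 'I_d.+1 * 'I_n)%type.
pose g (t : T) : V := vmon op bv t.1.1 t.1.2 t.2.
exists #|T|, (fun i => \pi_(simple_L d c E) (g (enum_val i))) => m.
have [u <-] := qmod_surj m.
have [a e] := vspan_finite hz cm opQ0 opR0 (baby_verma_vspan u).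
exists (fun i => a (enum_val i)).
have -> : u = \sum_(t : T) (algc (a t) : Hbar) *: g t by exact: e.
rewrite (reindex (enum_val (A := T))) /=; last exact: (onW_bij _ (enum_val_bij T)).
elim/big_rec2: _ => [|i y1 y2 _ <-].
  exact: ((qmod_eq0 _ _).2 (rpred0 _)).
by rewrite quotmod_piD qmod_piZ.
Qed.

Lemma to_Hbar_central (z : Z) : to_Hbar c (centre_val z) \in central (A := Hbar).
Proof.
apply: (central_image (f := piK c \o piC c)); last exact: (valP z).
by move=> h; have [u <-] := qpi_surj h; have [v <-] := qpi_surj u; exists v.
Qed.

Lemma Z_acts_scalar (z : Z) : exists s : C, forall m : L,
  to_Hbar c (centre_val z) *: m = (algc s : Hbar) *: m.
Proof.
have [k [g sp]] := simple_L_finite.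
exact: (schur verma_max_simple.2 (to_Hbar_central z) sp).
Qed.

End SimpleQuotient.

End SimpleQuotientsPart.
Export SimpleQuotientsPart.

(** * Laws of the Poisson bracket, and the central characters *)

Module OmegaCharactersPart.

Lemma commute_subC {K : pzRingType} {A : pzAlgType K} (p h : A) a :
  p * h = h * p -> (p - algc a) * h = h * (p - algc a).
Proof. by move=> e; rewrite mulrBl mulrBr e algc_central. Qed.

Section PoissonLaws.
Context {R : realType} {d : nat} {zeta : R[i]}.
Hypothesis hz : d.-primitive_root zeta.
Local Notation Z := (Z d zeta).
Implicit Types u v z : Z.

Let pE := @poissonE R d zeta hz.
Let surj := @Ht_to_H_surj R d zeta.
Let ker := @Ht_to_H_ker R d zeta.
Let tors := Ht_torsion_free hz.
Let TC := @Ht_T_comm R d zeta.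

Lemma poissonDl u v z : poisson (u + v) z = poisson u z + poisson v z.
Proof. exact: (poisDl surj ker pE). Qed.
Lemma poissonDr u v z : poisson z (u + v) = poisson z u + poisson z v.
Proof. exact: (poisDr surj ker pE). Qed.
Lemma poissonC u v : poisson u v = - poisson v u.
Proof. exact: (poisC surj ker pE). Qed.
Lemma poisson_xx u : poisson u u = 0.
Proof. exact: (pois_xx surj pE). Qed.
Lemma poissonMl u v z : poisson (u * v) z = u * poisson v z + poisson u z * v.
Proof. exact: (poisMl TC surj ker pE). Qed.
Lemma poissonNl u z : poisson (- u) z = - poisson u z.
Proof. exact: (poisNl TC surj ker pE). Qed.
Lemma poisson_jacobi u v w :
  poisson (poisson u v) w = poisson u (poisson v w) - poisson v (poisson u w).
Proof. exact: (pois_jacobi TC surj ker tors pE). Qed.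
Lemma poisson_casimir z zt z' : Ht_to_H zt = centre_val z -> (forall a, zt * a = a * zt) ->
  poisson z z' = 0.
Proof. exact: (pois_casimir surj pE). Qed.
Lemma poisson_algcl a z : poisson (algc a) z = 0.
Proof. by apply: (poisson_casimir (zt := algc a)) => [|b]; [exact: Ht_to_H_psi | exact: algc_central]. Qed.
Lemma poissonZl a u z : poisson (algc a * u) z = algc a * poisson u z.
Proof. by rewrite poissonMl poisson_algcl mul0r addr0. Qed.

Lemma poisson_C r a z' (z : Z) : centre_val z = H_gen d (GenC r) - algc a -> poisson z z' = 0.
Proof.
move=> e; apply: (poisson_casimir (zt := psiT (f_gen (GenC r)) - algc a)).
  apply: etrans (rmorphB (@Ht_to_H R d zeta) _ _) _; rewrite e.
  by congr (_ - _); [exact: Ht_to_H_psi | exact: (Ht_to_H_psi (d := d) (algc a))].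
move=> h; have [b <-] := psiT_surj h.
exact: (commute_subC a (C_central (psiT_rel (d := d)) r b)).
Qed.

End PoissonLaws.

Section ScalarActions.
Context {K : fieldType} {A : pzAlgType K} {L : lmodType A}.

Lemma algc_act_inj (s t : K) : (exists m : L, m <> 0) ->
  (forall m : L, (algc s : A) *: m = (algc t : A) *: m) -> s = t.
Proof.
move=> [m m0] h; apply/eqP; apply: contraT; rewrite -subr_eq0 => st; case: m0.
have : (algc (s - t) : A) *: m = 0 by rewrite rmorphB scalerBl h subrr.
move=> /(congr1 (fun v => (algc (s - t)^-1 : A) *: v)).
by rewrite scalerA -rmorphM mulVf // rmorph1 scale1r scaler0.
Qed.

Lemma scalar_actM (h h' : A) (s s' : K) (m : L) :
  (forall m : L, h *: m = (algc s : A) *: m) -> (forall m : L, h' *: m = (algc s' : A) *: m) ->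
  (h * h') *: m = (algc (s * s') : A) *: m.
Proof. by move=> e e'; rewrite -scalerA e' e scalerA rmorphM. Qed.

Lemma scalar_actP (h h' : A) (a s s' : K) (m : L) :
  (forall m : L, h *: m = (algc s : A) *: m) -> (forall m : L, h' *: m = (algc s' : A) *: m) ->
  (algc a * h + h') *: m = (algc (a * s + s') : A) *: m.
Proof. by move=> e e'; rewrite scalerDl -scalerA e e' scalerA -rmorphM -scalerDl -rmorphD. Qed.

End ScalarActions.

Lemma rmorph_algcP {K : pzRingType} {A B : pzAlgType K} (f : {rmorphism A -> B}) a u v :
  (forall k, f (algc k) = algc k) -> f (algc a * u + v) = algc a * f u + f v.
Proof. by move=> h; rewrite rmorphD rmorphM h. Qed.

Section CentralCharacter.
Context {R : realType} {d : nat} {zeta : R[i]}.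
Hypothesis hz : d.-primitive_root zeta.
Local Notation C := R[i].
Local Notation Z := (Z d zeta).
Context (c : reflection zeta -> C) (hc : is_param c).
Local Notation Hbar := (Hbar d c).
Local Notation piF := (@piF R d zeta c).
Context (chi : Irr zeta).
Local Notation om := (Omega d c chi).

Definition piZ : {rmorphism Z -> Hbar} := piK c \o (piC c \o (val : {rmorphism Z -> H d zeta})).
Lemma piZ_algc a : piZ (algc a) = algc a.
Proof. by []. Qed.

Let E := irr_rep chi.
Let E0 : (0 < rep_dim E)%N.
Proof. by have [[h _] _] := svalP (cid (svalP chi)). Qed.

Lemma simple_L_algc_inj (s t : C) : (forall m : simple_L d c E, (algc s : Hbar) *: m = (algc t : Hbar) *: m) -> s = t.
Proof.
apply: algc_act_inj.
exact: (verma_max_simple hz hc E0).2.1.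
Qed.

(** The scalars by which the centre acts depend linearly on the central element because the simple
    module is nonzero, so that a scalar is determined by its action. *)
Lemma acts_by_exists : exists f : {linear asmod Z -> C^o}, acts_by c E f.
Proof.
pose f z : C := sval (cid (Z_acts_scalar hz hc E0 z)).
have hf z (m : simple_L d c E) : piZ z *: m = (algc (f z) : Hbar) *: m.
  exact: (svalP (cid (Z_acts_scalar hz hc E0 z)) m).
have lf0 a u v : f (algc a * u + v) = a * f u + f v.
  apply: simple_L_algc_inj => m; apply: etrans (esym (hf _ m)) _.
  have e : piZ (algc a * u + v) = algc a * piZ u + piZ v := rmorph_algcP a u v piZ_algc.
  have e2 := scalar_actP a m (hf u) (hf v).
  apply: etrans (congr1 (fun h : Hbar => h *: m) e) _.
  apply: etrans e2 _.
  by [].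
have lf : linear (f : asmod Z -> C^o) by move=> a u v; exact: lf0.
pose fl := GRing.isLinear.Build C (asmod Z) C^o _ f lf.
exists (HB.pack_for {linear asmod Z -> C^o} f fl) => z m.
exact: hf.
Qed.

Lemma Omega_acts : acts_by c E om.
Proof.
rewrite /Omega; case: pselect => [e|[]]; last exact: acts_by_exists.
exact: (svalP (cid e)).
Qed.

Lemma Omega_actsE z (m : simple_L d c E) : piZ z *: m = (algc (om z) : Hbar) *: m.
Proof. exact: (Omega_acts z m). Qed.

Lemma Omega_val z (s : C) : piZ z = algc s -> om z = s.
Proof.
move=> e; apply: simple_L_algc_inj => m; apply: etrans (esym (Omega_actsE z m)) _.
exact: (congr1 (fun h : Hbar => h *: m) e).
Qed.

Lemma Omega_mul u v : om (u * v) = om u * om v.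
Proof.
apply: simple_L_algc_inj => m; apply: etrans (esym (Omega_actsE (u * v) m)) _.
have e : piZ (u * v) = piZ u * piZ v := rmorphM piZ u v.
have e2 := scalar_actM m (Omega_actsE u) (Omega_actsE v).
apply: etrans (congr1 (fun h : Hbar => h *: m) e) _.
apply: etrans e2 _.
by [].
Qed.

Lemma Omega_algc a : om (algc a) = a.
Proof. exact: Omega_val (piZ_algc a). Qed.

Lemma Omega_psi a : psiH a \in central (A := H d zeta) -> piF a = 0 -> om (zF (d := d) a) = 0.
Proof.
move=> ha e; apply: Omega_val; apply: etrans (_ : piF a = _); last by rewrite rmorph0.
exact: (congr1 (fun h => piK c (piC c h)) (zFE ha)).
Qed.

Lemma Omega_C (z : Z) r : centre_val z = H_gen d (GenC r) - algc (c r) -> om z = 0.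
Proof.
move=> e; apply: Omega_val; apply: etrans (congr1 (fun h => piK c (piC c h)) e) _.
apply: etrans (_ : piF (f_gen (GenC r) - algc (c r)) = _).
  by congr (piK c (piC c _)); exact: esym (rmorphB psiH _ _).
apply: etrans (rmorphB piF _ _) _; rewrite piF_C subrr rmorph0.
by [].
Qed.

Lemma Omega_q : om (@zq R d zeta) = 0.
Proof. exact: (Omega_psi (q_central hz) (piF_q hz c)). Qed.
Lemma Omega_Q : om (@zQ R d zeta) = 0.
Proof. exact: (Omega_psi (Q_central hz) (piF_Q hz c)). Qed.
Lemma Omega_a0 : om (@za R d zeta 0) = 0.
Proof.
apply: (Omega_psi (a_central hz 0)); have e := piF_r hz c; apply: etrans e.
by congr (piF _); rewrite /fa !pw0.
Qed.

End CentralCharacter.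

End OmegaCharactersPart.
Export OmegaCharactersPart.

(** * The Lie algebra of a cuspidal family, computed with elements of the centre *)

Module LieInterfacePart.

Section LieInterface.
Context {R : realType} {d : nat} {zeta : R[i]}.
Hypothesis hz : d.-primitive_root zeta.
Local Notation C := R[i].
Local Notation H := (H d zeta).
Local Notation Z := (Z d zeta).
Context (c : reflection zeta -> C) (hc : is_param c).
Local Notation Zc := (Zc d c).
Context (fam : set (Irr zeta)) (chi0 : Irr zeta).
Hypothesis famE : fam = [set chi' | forall z : Z, Omega d c chi' z = Omega d c chi0 z]%classic.
Hypothesis hcusp : cuspidal d c fam.
Local Notation w := (Omega d c chi0).
Local Notation g := (Lie d c fam).
Implicit Types z : Z.

Definition pz : {rmorphism Z -> Zc} := qpi (A := Z)
  [set z : Z | exists r, centre_val z = H_gen d (GenC r) - algc (c r)]%classic.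

Lemma pz_surj u : exists z, pz z = u. Proof. exact: qpi_surj. Qed.
Lemma pz_algc a : pz (algc a) = algc a. Proof. by []. Qed.

Let wM := Omega_mul hz hc chi0.
Let wB u v : w (u - v) = w u - w v. Proof. exact: (linearB w). Qed.
Let wD u v : w (u + v) = w u + w v. Proof. exact: (linearD w). Qed.
Let w0 : w 0 = 0. Proof. exact: (linear0 w). Qed.

Lemma pz_w z : pz z = 0 -> w z = 0.
Proof.
move=> /qpi_eq0; move: z; apply: ideal_span_min => [|z [r e]]; last exact: (Omega_C hz hc chi0 e).
split; first exact: w0.
- by move=> u v hu hv; rewrite wB hu hv subrr.
- by move=> a u hu; rewrite wM hu mulr0.
- by move=> a u hu; rewrite wM hu mul0r.
Qed.

Lemma pz_eq_w u v : pz u = pz v -> w u = w v.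
Proof.
move=> e; apply: subr0_eq; rewrite -wB; apply: pz_w.
by rewrite (rmorphB pz) e subrr.
Qed.

(** The generators $C_r-c_r$ of the kernel are Casimirs, and the Leibniz rule extends this to the
    ideal. The induction needs both that z and that its brackets vanish in the quotient. *)
Lemma pz_pois_ker z : pz z = 0 -> forall z', pz (poisson z z') = 0.
Proof.
move=> e; suff [] : pz z = 0 /\ forall z', pz (poisson z z') = 0 by [].
move: e => /qpi_eq0; move: z.
apply: (ideal_span_min (P := fun z => pz z = 0 /\ forall z', pz (poisson z z') = 0)); last first.
  move=> z [r e]; split; first by apply/qpi_eq0; apply: mem_ideal_span; exists r.
  by move=> z'; rewrite (poisson_C hz z' e) rmorph0.
split.
- by split=> [|z']; rewrite ?rmorph0 // -(mulr0 0) (poissonMl hz) !mul0r mulr0 addr0 rmorph0.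
- move=> u v [hu hu'] [hv hv']; split=> [|z']; first by rewrite rmorphB hu hv subrr.
  by rewrite (poissonDl hz) (poissonNl hz) rmorphB hu' hv' subrr.
- move=> a u [hu hu']; split=> [|z']; first by rewrite rmorphM hu mulr0.
  by rewrite (poissonMl hz) rmorphD !rmorphM hu' hu !mulr0 addr0.
- move=> a u [hu hu']; split=> [|z']; first by rewrite rmorphM hu mul0r.
  by rewrite (poissonMl hz) rmorphD !rmorphM hu' hu !mul0r addr0.
Qed.

Lemma pz_pois u u' v v' : pz u = pz u' -> pz v = pz v' -> pz (poisson u v) = pz (poisson u' v').
Proof.
move=> eu ev; have k p q : pz p = pz q -> forall z', pz (poisson p z') = pz (poisson q z').
  move=> e z'; apply: subr0_eq; rewrite -(rmorphB pz) -(poissonNl hz) -(poissonDl hz).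
  by apply: pz_pois_ker; rewrite rmorphB e subrr.
by rewrite (k _ _ eu) (poissonC hz) rmorphN (k _ _ ev) -rmorphN -(poissonC hz).
Qed.

Lemma poisson_cE u v : poisson_c (pz u) (pz v) = pz (poisson u v).
Proof. by apply: pz_pois; exact: reprK. Qed.

Lemma fam_maxE z : (pz z \in fam_max fam) = (w z == 0).
Proof.
have fam0 : fam chi0 by rewrite famE.
apply/asboolP/eqP => [[z' e hz']|h].
  by rewrite -(pz_eq_w e); exact: hz'.
by exists z => // chi; rewrite famE => /(_ z) ->.
Qed.

Lemma K0_pois u v : w u = 0 -> w v = 0 -> w (poisson u v) = 0.
Proof.
move=> hu hv; apply/eqP; rewrite -fam_maxE -poisson_cE.
by apply: hcusp; rewrite fam_maxE ?hu ?hv.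
Qed.

Definition fi (u : asmod Zc) : fam_ideal d c fam := insubd (0 : fam_ideal d c fam) u.
(** The class of z in m/m^2, meaningful when z is killed by the central character. It allows
    brackets to be computed in Z instead of with representatives in nested quotients. *)
Definition gam z : g := \pi_(Lie d c fam) (fi (pz z)).

Lemma fiE u : u \in fam_max fam -> val (fi u) = u.
Proof. exact: insubdK. Qed.
Lemma fi_pz z : w z = 0 -> val (fi (pz z)) = pz z.
Proof. by move=> h; apply: fiE; rewrite fam_maxE h. Qed.
Lemma fi_val x : fi (val x) = x.
Proof. by apply: val_inj; rewrite fiE //; exact: (valP x). Qed.
Lemma fi_surj (x : fam_ideal d c fam) : exists2 z, w z = 0 & x = fi (pz z).
Proof.
have [z e] := pz_surj (val x); exists z; last by rewrite e fi_val.
by apply/eqP; rewrite -fam_maxE e; exact: (valP x).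
Qed.

Lemma gam_surj (x : g) : exists2 z, w z = 0 & gam z = x.
Proof.
have [u <-] := qmod_surj x; have [z hz' ->] := fi_surj u.
by exists z.
Qed.

Lemma pz_lin a u v : pz (algc a * u + v) = a *: (pz u : asmod Zc) + (pz v : asmod Zc).
Proof.
have e : pz (algc a * u + v) = algc a * pz u + pz v := rmorph_algcP a u v pz_algc.
exact: e.
Qed.

Let w_lin a u v : w (algc a * u + v) = a * w u + w v.
Proof. exact: (linearP w a u v). Qed.

Lemma fi_lin a (x y : fam_ideal d c fam) : val (a *: x + y) = a *: val x + val y.
Proof. exact: (linearP (val : {linear fam_ideal d c fam -> asmod Zc}) a x y). Qed.

Lemma gam_lin a u v : w u = 0 -> w v = 0 -> gam (algc a * u + v) = a *: gam u + gam v.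
Proof.
move=> hu hv; apply: etrans (_ : \pi_(Lie d c fam) (a *: fi (pz u) + fi (pz v)) = _).
  congr (\pi_(Lie d c fam) _); apply: val_inj.
  rewrite [LHS]fi_pz ?w_lin ?hu ?hv ?mulr0 ?addr0 //.
  apply: etrans (pz_lin a u v) _; apply: esym; apply: etrans (fi_lin _ _ _) _.
  by rewrite !fi_pz.
apply: etrans (quotmod_piD _ _ _) _; congr (_ + _).
exact: qmod_piZ.
Qed.

Lemma gam_ker z : pz z = 0 -> gam z = 0.
Proof.
move=> e; apply/qmod_eq0; rewrite (_ : fi (pz z) = 0) ?rpred0 //.
by apply: val_inj; rewrite fi_pz ?e // pz_w.
Qed.

Lemma gam_mul0 u v : w u = 0 -> w v = 0 -> gam (u * v) = 0.
Proof.
move=> hu hv; apply/qmod_eq0; apply/asboolP => P _; apply; exists (fi (pz u)), (fi (pz v)).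
rewrite !fi_pz ?wM ?hu ?mul0r //.
exact: (rmorphM pz).
Qed.

(* To compute modulo m^2 it suffices to test a predicate on Z stable under m^2 and the kernel. *)
Lemma gam_eq0_ind (Q : Z -> Prop) :
  (forall a u v, w u = 0 -> w v = 0 -> Q u -> Q v -> Q (algc a * u + v)) ->
  (forall u v, w u = 0 -> w v = 0 -> Q (u * v)) ->
  (forall u v, pz u = pz v -> Q u -> Q v) ->
  forall z, w z = 0 -> gam z = 0 -> Q z.
Proof.
move=> QP QM Qk z hz' /qmod_eq0.
pose P (x : fam_ideal d c fam) := exists2 u, w u = 0 /\ Q u & pz u = val x.
have iP : is_submod P.
  split.
    exists (0 * 0); last by rewrite mul0r rmorph0.
    by split; [rewrite mul0r w0 | apply: QM; exact: w0].
  move=> a x y [u [hu Qu] eu] [v [hv Qv] ev]; exists (algc a * u + v); last first.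
    by apply: etrans (pz_lin a u v) _; rewrite eu ev; exact: esym (fi_lin _ _ _).
  by split; [rewrite w_lin hu hv mulr0 addr0 | exact: QP].
have PM x : (exists a b : fam_ideal d c fam, val x = (val a : Zc) * (val b : Zc)) -> P x.
  move=> [a [b e]]; have [u hu ea] := fi_surj a; have [v hv eb] := fi_surj b.
  exists (u * v); first by split; [rewrite wM hu mul0r | exact: QM].
  by rewrite e ea eb !fi_pz //; exact: (rmorphM pz).
move=> /(submod_span_min iP PM) [u [hu Qu] eu].
by apply: (Qk u) Qu; rewrite eu fi_pz.
Qed.

Let gam_eq u v : w u = 0 -> w v = 0 -> gam u = gam v -> gam (algc (-1) * v + u) = 0.
Proof. by move=> hu hv e; rewrite gam_lin // e scaleN1r addNr. Qed.

Lemma gam_pz u v : pz u = pz v -> gam u = gam v.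
Proof. by move=> e; rewrite /gam e. Qed.

(** By cuspidality m is closed under the bracket, so the Leibniz rule gives $\{m^2,m\}\subset
    m^2$. *)
Lemma gam_poisl z z' : w z = 0 -> w z' = 0 -> gam z = 0 -> gam (poisson z z') = 0.
Proof.
move=> hz0 hz' e; apply: (gam_eq0_ind (Q := fun z => gam (poisson z z') = 0)) hz0 e.
- move=> a u v hu hv eu ev; rewrite (poissonDl hz) (poissonZl hz).
  by rewrite gam_lin ?K0_pois // eu ev scaler0 addr0.
- move=> u v hu hv; rewrite (poissonMl hz).
  have -> (p q : Z) : p + q = algc 1 * p + q by rewrite rmorph1 mul1r.
  by rewrite gam_lin ?wM ?hu ?hv ?mul0r ?mulr0 // !gam_mul0 ?K0_pois // scaler0 addr0.
- by move=> u v e <-; apply: gam_pz; exact: pz_pois.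
Qed.

(** The representatives used in the bracket of the quotient differ from u and v by elements of
    trivial class, and [gam_poisl] shows that these do not matter. *)
Lemma gam_br u v : w u = 0 -> w v = 0 -> lie_br d c fam (gam u) (gam v) = gam (poisson u v).
Proof.
move=> hu hv.
have key (x : g) z : w z = 0 -> gam z = x ->
    exists2 z', w z' = 0 /\ val (repr x) = pz z' & gam (algc (-1) * z + z') = 0.
  move=> hz' e; have [z1 h1 e1] := fi_surj (repr x).
  exists z1; first by split=> //; rewrite e1 fi_pz.
  apply: gam_eq => //; rewrite e /gam -e1; exact: reprK.
have [u' [hu' eu'] du] := key _ u hu erefl; have [v' [hv' ev'] dv] := key _ v hv erefl.
rewrite /lie_br eu' ev' poisson_cE -/(gam _).
have dif p p' q : w p = 0 -> w p' = 0 -> w q = 0 -> gam (algc (-1) * p + p') = 0 ->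
    gam (poisson p' q) = gam (poisson p q).
  move=> hp hp' hq e; have h0 : w (algc (-1) * p + p') = 0 by rewrite w_lin hp hp' mulr0 addr0.
  have := gam_poisl h0 hq e; rewrite (poissonDl hz) (poissonZl hz) gam_lin ?K0_pois // scaleN1r.
  by rewrite addrC => /subr0_eq.
have gamN p : w p = 0 -> gam (- p) = - gam p.
  move=> hp; have -> : - p = algc (-1) * p + 0 by rewrite rmorphN rmorph1 mulN1r addr0.
  by rewrite gam_lin // (gam_ker (rmorph0 pz)) addr0 scaleN1r.
rewrite (dif u u') // (poissonC hz) gamN ?K0_pois // (dif v v') // -gamN ?K0_pois //.
by rewrite -(poissonC hz).
Qed.

End LieInterface.

End LieInterfacePart.
Export LieInterfacePart.

(** * Action of the centre on standard modules, and a monomial filtration *)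

Module CentreActionsPart.

Lemma sub_algc_mul {K : comPzRingType} {A : pzAlgType K} (u v : A) (a b : K) :
  u * v - algc (a * b) = algc 1 * ((u - algc a) * (v - algc b)) +
    (algc a * (v - algc b) + algc b * (u - algc a)).
Proof.
rewrite rmorph1 mul1r !mulrBl !mulrBr -(algc_central b u) -!rmorphM (mulrC b a); zmod_eq A.
Qed.

Section CentreInduction.
Context {R : realType} {d : nat} {zeta : R[i]}.
Hypothesis hz : d.-primitive_root zeta.
Local Notation C := R[i].
Local Notation Z := (Z d zeta).
Local Notation psiH := (@psiH R d zeta).

Lemma centre_ind (T : Z -> Prop) : (forall a, T (algc a)) ->
  (forall r z, centre_val z = psiH (f_gen (GenC r)) -> T z) ->
  T (@zq R d zeta) -> T (@zQ R d zeta) -> T (@zeu R d zeta) ->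
  (forall i, (i <= d)%N -> T (@za R d zeta i)) ->
  (forall u v, T u -> T v -> T (u + v)) -> (forall u v, T u -> T v -> T (u * v)) ->
  forall z, T z.
Proof.
move=> Ta TC Tq TQ Te Ti TD TM z; have [b hb] := centre_generated hz z.
elim: hb z => [k|r||||i le|p q hp IHp hq IHq|p q hp IHp hq IHq] z e.
- by have -> : z = algc k by apply: val_inj.
- exact: TC e.
- by have -> : z = @zq R d zeta by apply: val_inj; exact: etrans e (esym (zFE (q_central hz))).
- by have -> : z = @zQ R d zeta by apply: val_inj; exact: etrans e (esym (zFE (Q_central hz))).
- by have -> : z = @zeu R d zeta by apply: val_inj; exact: etrans e (esym (zFE (eu_central hz))).
- have -> : z = @za R d zeta i by apply: val_inj; exact: etrans e (esym (zFE (a_central hz i))).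
  exact: Ti.
- have ep := zFE (zgen_central hz hp); have eq := zFE (zgen_central hz hq).
  have -> : z = zF p + zF q; last by apply: TD; [exact: IHp | exact: IHq].
  apply: val_inj; apply: etrans e _; apply: etrans (rmorphD psiH p q) _.
  exact: (congr2 (fun u v => u + v) (esym ep) (esym eq)).
- have ep := zFE (zgen_central hz hp); have eq := zFE (zgen_central hz hq).
  have -> : z = zF p * zF q; last by apply: TM; [exact: IHp | exact: IHq].
  apply: val_inj; apply: etrans e _; apply: etrans (rmorphM psiH p q) _.
  exact: (congr2 (fun u v => u * v) (esym ep) (esym eq)).
Qed.

End CentreInduction.

Section CentreAction.
Context {R : realType} {d : nat} {zeta : R[i]}.
Hypothesis hz : d.-primitive_root zeta.
Local Notation C := R[i].
Local Notation Z := (Z d zeta).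
Local Notation psiH := (@psiH R d zeta).
Context (c : reflection zeta -> C) (hc : is_param c) (E : rep zeta).
Local Notation n := (rep_dim E).
Local Notation M := (pmod C 'I_n).
Local Notation op := (std_op (d := d) c E).
Let cm := std_cmod hz hc E.
Implicit Types u v z : Z.

Definition zact z (m : M) : M := act op (sval (cid (psiH_surj (centre_val z)))) m.

Lemma zactE z a m : centre_val z = psiH a -> zact z m = act op a m.
Proof.
move=> e; apply: (act_psiH hz cm (std_T c (E := E))).
by rewrite (svalP (cid (psiH_surj (centre_val z)))) e.
Qed.

Lemma zact_zF a m : psiH a \in central (A := H d zeta) -> zact (zF a) m = act op a m.
Proof. by move=> ha; apply: zactE; exact: zFE. Qed.

Let lift z : exists a, centre_val z = psiH a.
Proof. by have [a e] := psiH_surj (centre_val z); exists a. Qed.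

Lemma zact_linear z : linear (zact z).
Proof. by have [a e] := lift z => k u v; rewrite !(zactE _ e) linearP. Qed.

Lemma zactD u v m : zact (u + v) m = zact u m + zact v m.
Proof.
have [a ea] := lift u; have [b eb] := lift v; rewrite (zactE _ ea) (zactE _ eb) -actD.
by apply: zactE; rewrite (rmorphD psiH) -ea -eb.
Qed.
Lemma zactM u v m : zact (u * v) m = zact u (zact v m).
Proof.
have [a ea] := lift u; have [b eb] := lift v; rewrite (zactE _ ea) (zactE _ eb) -actM.
by apply: zactE; rewrite (rmorphM psiH) -ea -eb.
Qed.
Lemma zact_algc k m : zact (algc k) m = k *: m.
Proof. by rewrite (zactE (a := algc k)) ?act_algc. Qed.
Lemma zactP k u v m : zact (algc k * u + v) m = k *: zact u m + zact v m.
Proof. by rewrite zactD zactM zact_algc. Qed.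
Lemma zactB u v m : zact (u - v) m = zact u m - zact v m.
Proof. by apply: (addIr (zact v m)); rewrite -zactD !subrK. Qed.
Lemma zact0 m : zact 0 m = 0.
Proof. by have := zactB 0 0 m; rewrite subr0 subrr. Qed.
Lemma psiH_act_commute_op {N : lmodType C} (op0 : gen zeta -> {linear N -> N}) (cm0 : cmod d op0)
    (T0 : forall n0 : N, op0 (GenT zeta) n0 = 0) a g m :
  psiH a \in central (A := H d zeta) -> op0 g (act op0 a m) = act op0 a (op0 g m).
Proof. by move=> ha; rewrite -!(act_gen op0); exact: (psiH_act_comm hz cm0 T0). Qed.
Lemma zact_op z g m : op g (zact z m) = zact z (op g m).
Proof.
have [a ea] := lift z; rewrite !(zactE _ ea).
apply: (psiH_act_commute_op cm (std_T c (E := E))).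
by rewrite -ea; exact: (valP z).
Qed.
Lemma zact_iter z g k m : iter k (op g) (zact z m) = zact z (iter k (op g) m).
Proof. by elim: k => //= k ->; rewrite zact_op. Qed.

Lemma zact_pz0 z m : pz c z = 0 -> zact z m = 0.
Proof.
move=> /qpi_eq0 h; move: m; move: z h.
apply: (ideal_span_min (P := fun z => forall m, zact z m = 0)) => [|z [r e] m].
  split=> [m|u v hu hv m|a u hu m|a u hu m].
  - exact: zact0.
  - by rewrite zactB hu hv subrr.
  - by rewrite zactM hu; have [b eb] := lift a; rewrite (zactE _ eb) linear0.
  - by rewrite zactM hu.
have -> : zact z m = act op (f_gen (GenC r) - algc (c r)) m.
  by apply: zactE; rewrite e (rmorphB psiH).
by rewrite actB act_gen act_algc std_C subrr.
Qed.

Lemma zact_pz u v m : pz c u = pz c v -> zact u m = zact v m.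
Proof.
move=> e; apply: subr0_eq; rewrite -zactB; apply: zact_pz0.
by rewrite (rmorphB (pz c)) e subrr.
Qed.

Section Filtration.
Context (chi0 : Irr zeta).
Local Notation w := (Omega d c chi0).
Context (ok : nat -> nat -> bool).
Hypothesis ok_up : forall a b a' b', ok a b -> ok (a + a') (b + b').

(** The span of the monomials with admissible exponents. By [ok_up] admissible exponents form an
    ideal, so this span is closed under multiplication by X and Y. *)
Inductive fil : M -> Prop :=
| fil0 : fil 0
| filP (k : C) (m1 m2 : M) : fil m1 -> fil m2 -> fil (k *: m1 + m2)
| filM a b j : ok a b -> fil (fb (a, b, j)).

Lemma filD (m1 m2 : M) : fil m1 -> fil m2 -> fil (m1 + m2).
Proof. by move=> h; rewrite -[m1]scale1r; exact: filP. Qed.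
Lemma filZ k (m1 : M) : fil m1 -> fil (k *: m1).
Proof. by move=> h; rewrite -[_ *: m1]addr0; apply: filP => //; exact: fil0. Qed.

Hypothesis wq : w (@zq R d zeta) = 0.
Hypothesis wQ : w (@zQ R d zeta) = 0.
Hypothesis weu : w (@zeu R d zeta) = 0.
Hypothesis wa : forall i, (i <= d)%N -> w (@za R d zeta i) = 0.
Hypothesis filq : forall j, fil (zact (@zq R d zeta) (std_e j)).
Hypothesis filQ : forall j, fil (zact (@zQ R d zeta) (std_e j)).
Hypothesis fileu : forall j, fil (zact (@zeu R d zeta) (std_e j)).
Hypothesis fila : forall i, (i <= d)%N -> forall j, fil (zact (@za R d zeta i) (std_e j)).

Lemma fbE a b j : fb (a, b, j) = iter a (op (GenVd zeta 0)) (iter b (op (GenVd zeta 1)) (std_e j)) :> M.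
Proof.
elim: a => [|a IH] /=; last by rewrite -IH; exact: esym (pXU _ _ _).
by elim: b => [|b IH] /=; [exact: esym (pinjU _ _ _) | rewrite -IH; exact: esym (pYU _ _ _)].
Qed.

Lemma iterXY_fb a b a' b' j : iter a (op (GenVd zeta 0)) (iter b (op (GenVd zeta 1)) (fb (a', b', j))) =
  fb (a' + a, b' + b, j)%N :> M.
Proof.
elim: b => [|b IH] /= in a *; first by rewrite addn0; elim: a => [|a IH] /=; rewrite ?addn0 // IH addnS; exact: pXU.
rewrite -(iter_comm (f := op (GenVd zeta 1)) (h := op (GenVd zeta 0))); last by move=> m; rewrite (cmXY cm).
by rewrite IH addnS; exact: pYU.
Qed.

Lemma fil_shift a b m : fil m -> fil (iter a (op (GenVd zeta 0)) (iter b (op (GenVd zeta 1)) m)).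
Proof.
elim=> [|k u v _ hu _ hv|a' b' j h].
- have it0 g k : iter k (op g) 0 = 0 by elim: k => //= k ->; exact: linear0.
  by rewrite !it0; exact: fil0.
- by rewrite iter_linearD iter_linearD !iter_linearZ; exact: filP.
- by rewrite iterXY_fb; apply: filM; exact: ok_up.
Qed.

Let fil_all z : (forall j, fil (zact z (std_e j))) -> forall m, fil (zact z m).
Proof.
move=> h m; apply: (fmod_ind (P := fun m => fil (zact z m))) => {m} [|k m1 m2 hu hv|[[a b] j]].
- by have [a e] := lift z; rewrite (zactE _ e) linear0; exact: fil0.
- by rewrite zact_linear; exact: filP.
by rewrite fbE -!zact_iter; apply: fil_shift.
Qed.

(** Proved for $u-\omega(u)$ with arbitrary central u, where $\omega$ is the central character, so
    that induction over the generators applies. For a product, [sub_algc_mul] writes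
    $uv-\omega(u)\omega(v)$ in terms of the two factors. *)
Lemma zact_fil z m : w z = 0 -> fil (zact z m).
Proof.
move=> hw; suff h u : forall m, fil (zact (u - algc (w u)) m).
  by have := h z m; rewrite hw zactB zact_algc scale0r subr0.
have wM := Omega_mul hz hc chi0; have wC := Omega_algc hz hc chi0.
have wD p q : w (p + q) = w p + w q by exact: (linearD w).
have zero (v : Z) : w v = 0 -> (forall j, fil (zact v (std_e j))) ->
    forall m, fil (zact (v - algc (w v)) m).
  by move=> hv hj m'; rewrite hv zactB zact_algc scale0r subr0; exact: fil_all.
move: u {m hw z}; apply: (centre_ind hz).
- by move=> a m; rewrite wC subrr zact0; exact: fil0.
- move=> r z e m; have wz : w z = c r.
    apply: subr0_eq; apply: etrans (_ : w (z - algc (c r)) = 0).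
      by rewrite (linearB w) wC.
    by apply: (Omega_C hz hc chi0 (r := r)); rewrite -[H_gen _ _]e.
  rewrite zactB zact_algc (zactE _ e) act_gen std_C wz subrr; exact: fil0.
- exact: zero.
- exact: zero.
- exact: zero.
- by move=> i le; apply: zero; [exact: wa | exact: fila].
- move=> u v hu hv m; rewrite wD rmorphD opprD addrACA zactD; exact: filD.
move=> u v hu hv m.
rewrite wM sub_algc_mul.
rewrite zactP scale1r zactM zactP (zactM (algc _)) zact_algc; apply: filD; first exact: hu.
apply: filP; first exact: hv.
apply: filZ; exact: hu.
Qed.

(** Each factor adds an admissible pair of exponents, since central elements commute with X and Y.
    The functional kills all monomials whose exponents are a sum of two such pairs. *)
Lemma zact_prod_vanish (lam : {linear M -> C^o}) :
  (forall a b a' b' j, ok a b -> ok a' b' -> lam (fb (a + a', b + b', j)%N) = 0) ->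
  forall u v m, w u = 0 -> w v = 0 -> lam (zact (u * v) m) = 0.
Proof.
move=> hl u v m hu hv; rewrite zactM; elim: (zact_fil m hv) => [|k m1 m2 _ h1 _ h2|a b j h].
- have [e he] := lift u; rewrite (zactE _ he) linear0; exact: linear0.
- by rewrite zact_linear linearP h1 h2 scaler0 addr0.
rewrite fbE -!zact_iter; elim: (zact_fil (std_e j) hu) => [|k m1 m2 _ h1 _ h2|a' b' j' h'].
- have it0 g k : iter k (op g) 0 = 0 by elim: k => //= k ->; exact: linear0.
  by rewrite !it0; exact: linear0.
- by rewrite iter_linearD iter_linearD !iter_linearZ linearP h1 h2 scaler0 addr0.
- by rewrite iterXY_fb; exact: hl.
Qed.

End Filtration.
End CentreAction.

End CentreActionsPart.
Export CentreActionsPart.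

(** * Spanning classes of m/m^2, and functionals on it *)

Module LieGeneratorsPart.

Lemma sub_algc_add {K : comPzRingType} {A : pzAlgType K} (u v : A) (a b : K) :
  u + v - algc (a + b) = algc 1 * (u - algc a) + (v - algc b).
Proof. by rewrite rmorph1 mul1r rmorphD opprD addrACA. Qed.

Lemma linear_mulrn_eq0 {K : numDomainType} {V : lmodType K} (w : {linear V -> K^o}) v n :
  w (- (v *+ n.+1)) = 0 -> w v = 0.
Proof.
by rewrite linearN linearMn => /eqP; rewrite oppr_eq0 mulrn_eq0 => /eqP.
Qed.

Section LieGenerators.
Context {R : realType} {d : nat} {zeta : R[i]}.
Hypothesis hz : d.-primitive_root zeta.
Local Notation C := R[i].
Local Notation Z := (Z d zeta).
Context (c : reflection zeta -> C) (hc : is_param c).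
Context (fam : set (Irr zeta)) (chi0 : Irr zeta).
Hypothesis famE : fam = [set chi' | forall z : Z, Omega d c chi' z = Omega d c chi0 z]%classic.
Hypothesis hcusp : cuspidal d c fam.
Local Notation w := (Omega d c chi0).
Local Notation g := (Lie d c fam).
Local Notation gam := (gam c fam).
Implicit Types z : Z.

Let wC := Omega_algc hz hc chi0.
Let wM := Omega_mul hz hc chi0.
Let wD (u v : Z) : w (u + v) = w u + w v. Proof. exact: (linearD w). Qed.
Let w1 (u : Z) : w (u - algc (w u)) = 0.
Proof. by apply: etrans (linearB w u (algc (w u))) _; rewrite wC subrr. Qed.

Lemma w_q : w (@zq R d zeta) = 0. Proof. exact: Omega_q. Qed.
Lemma w_Q : w (@zQ R d zeta) = 0. Proof. exact: Omega_Q. Qed.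
(** Cuspidality is what puts eu and the $a_i$ into m: starting from q, Q and $a_0$, which vanish in
    the restricted algebra, all of them are obtained by brackets. *)
Lemma w_eu : w (@zeu R d zeta) = 0.
Proof. by rewrite -(poisson_qQ hz); exact: (K0_pois hz hc famE hcusp w_q w_Q). Qed.
Lemma w_a i : w (@za R d zeta i) = 0.
Proof.
elim: i => [|i IH]; first exact: Omega_a0.
apply: (linear_mulrn_eq0 (w := w) (n := i)).
have e := K0_pois hz hc famE hcusp w_Q IH; rewrite (poisson_Qa hz) in e; exact: e.
Qed.

Lemma gam0 : gam (0 : Z) = 0.
Proof. by apply: (gam_ker hz hc famE); exact: rmorph0. Qed.
Lemma gamZ a z : w z = 0 -> gam (algc a * z) = a *: gam z.
Proof.
move=> hw; have := gam_lin hz hc famE a hw (linear0 w).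
by rewrite addr0 -[X in _ = _ + X]/(gam (0 : Z)) gam0 addr0.
Qed.
Lemma gamD u v : w u = 0 -> w v = 0 -> gam (u + v) = gam u + gam v.
Proof. by move=> hu hv; have := gam_lin hz hc famE 1 hu hv; rewrite rmorph1 mul1r scale1r. Qed.
Lemma gamN u : w u = 0 -> gam (- u) = - gam u.
Proof.
by move=> hu; have := gamZ (-1) hu; rewrite rmorphN rmorph1 mulN1r scaleN1r.
Qed.
Lemma gamMn u n : w u = 0 -> gam (u *+ n) = n%:R *: gam u.
Proof.
by move=> hu; have := gamZ n%:R hu; rewrite rmorph_nat mulr_natl.
Qed.

(** With $\omega$ the central character, modulo m^2 the element $uv-\omega(u)\omega(v)$ is congruent
    to $\omega(u)(v-\omega(v))+\omega(v)(u-\omega(u))$. So the classes of algebra generators of Z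
    already span. *)
Lemma Lie_gen (P : set g) : is_submod P -> P (gam (@zq R d zeta)) -> P (gam (@zQ R d zeta)) ->
  P (gam (@zeu R d zeta)) -> (forall i, (i <= d)%N -> P (gam (@za R d zeta i))) -> P = setT.
Proof.
move=> [P0 PP] Pq PQ Pe Pa.
have PD x y : P x -> P y -> P (x + y) by move=> hx hy; rewrite -[x]scale1r; exact: PP.
have PZ a x : P x -> P (a *: x) by move=> hx; have := PP a x 0 hx P0; rewrite addr0.
have zero (v : Z) : w v = 0 -> P (gam v) -> P (gam (v - algc (w v))).
  by move=> -> ; rewrite rmorph0 subr0.
have T z : P (gam (z - algc (w z))).
  move: z; apply: (centre_ind hz).
  - by move=> a; rewrite wC subrr gam0.
  - move=> r z e; have wz : w z = c r.
      apply: subr0_eq; apply: etrans (_ : w (z - algc (c r)) = 0).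
        by apply: esym; apply: etrans (linearB w _ _) _; rewrite wC.
      by apply: (Omega_C hz hc chi0 (r := r)); rewrite -[H_gen _ _]e.
    rewrite wz (gam_ker hz hc famE) //; apply/qpi_eq0; apply/asboolP => I hI; apply; exists r.
    by rewrite -[H_gen _ _]e.
  - by apply: zero; [exact: w_q | exact: Pq].
  - by apply: zero; [exact: w_Q | exact: PQ].
  - by apply: zero; [exact: w_eu | exact: Pe].
  - by move=> i hi; apply: zero; [exact: w_a | exact: Pa].
  - move=> u v hu hv; rewrite wD sub_algc_add (gam_lin hz hc famE 1 (w1 u) (w1 v)); exact: PP.
  - move=> u v hu hv; rewrite wM sub_algc_mul.
    have wm (a : C) (p : Z) : w p = 0 -> w (algc a * p) = 0 by move=> hp; rewrite wM hp mulr0.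
    have wp : w ((u - algc (w u)) * (v - algc (w v))) = 0 by rewrite wM w1 mul0r.
    have ws : w (algc (w u) * (v - algc (w v)) + algc (w v) * (u - algc (w u))) = 0.
      by rewrite wD !wm ?addr0 ?w1.
    rewrite (gam_lin hz hc famE 1 wp ws); apply: PP.
      by rewrite (gam_mul0 hz hc famE (w1 u) (w1 v)).
    rewrite gamD ?wm ?w1 //; apply: PD; rewrite gamZ ?w1 //; exact: PZ.
rewrite predeqE => x; split=> // _; have [z hw <-] := gam_surj hz hc famE x.
by have := T z; rewrite hw rmorph0 subr0.
Qed.

Context (E : rep zeta).
Local Notation M := (pmod C 'I_(rep_dim E)).

Lemma gam_functional (lam : {linear M -> C^o}) e :
  (forall u v : Z, w u = 0 -> w v = 0 -> lam (zact c (E := E) (u * v) e) = 0) ->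
  forall z, w z = 0 -> gam z = 0 -> lam (zact c (E := E) z e) = 0.
Proof.
move=> hl; apply: (gam_eq0_ind hz hc famE) => [a u v _ _ hu hv|u v hu hv|u v e'].
- by rewrite (zactP hz hc) linearP hu hv scaler0 addr0.
- exact: hl.
- by rewrite (zact_pz hz hc e e').
Qed.

End LieGenerators.

End LieGeneratorsPart.
Export LieGeneratorsPart.

(** * A verified calculator for the standard module of the reflection representation *)

Module EnginePart.

(** The tuple [(z, (k, l, (a, b, j)))] stands for $zp^kn^l\,X^aY^b\otimes e_j$, with p and n left as
    indeterminates. The boolean j is false for the basis vector x of V and true for y. All data are
    integers, so that lists can be evaluated by computation. *)
Definition mono : Type := int * (nat * nat * (nat * nat * bool)).
Section Engine.
Context (d : nat).
Fixpoint ins (t : mono) (l : seq mono) : seq mono :=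
  if l is t' :: l' then
    if t.2 == t'.2 then (t.1 + t'.1, t.2) :: l' else t' :: ins t l'
  else [:: t].
Definition norm (l : seq mono) : seq mono := [seq t <- foldr ins [::] l | t.1 != 0].
Definition lmap (f : nat -> nat -> bool -> seq mono) (l : seq mono) : seq mono :=
  norm (flatten [seq [seq (t.1 * u.1, (t.2.1.1 + u.2.1.1, t.2.1.2 + u.2.1.2, u.2.2)%N) | u <- f t.2.2.1.1 t.2.2.1.2 t.2.2.2] | t <- l]).
Definition unit_term a b j : seq mono := [:: (1, (0%N, 0%N, (a, b, j)))].
Definition gX (a b : nat) (j : bool) := unit_term a.+1 b j.
Definition gY (a b : nat) (j : bool) := unit_term a b.+1 j.
Definition gneg (l : seq mono) : seq mono := [seq (- t.1, t.2) | t <- l].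
(** Passing X raises the index of the reflection sum by one, passing Y lowers it, and on the vectors
    x and y of V it shifts by -1 and +1. The resulting number m is the index of a character sum of
    c, which is nonzero only for residues 0 and d/2. *)
Definition gsig (k a b : nat) (j : bool) : seq mono :=
  let m := ((k + a + d.-1 * b + (if j then 1 else d.-1)) %% d)%N in
  if m == 0%N then [:: (1, (1%N, 0%N, (b, a, ~~ j)))]
  else if m == d./2 then [:: (1, (0%N, 1%N, (b, a, ~~ j)))] else [::].
Fixpoint gx (a b : nat) (j : bool) : seq mono :=
  match a with
  | a'.+1 => lmap gX (gx a' b j) ++ gneg (gsig 0 a' b j)
  | 0 => (fix gx0 b := match b with
          | b'.+1 => lmap gY (gx0 b') ++ gsig d.-1 0 b' j
          | 0 => [::] end) b
  end.
Fixpoint gy (a b : nat) (j : bool) : seq mono :=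
  match a with
  | a'.+1 => lmap gX (gy a' b j) ++ gsig 1 a' b j
  | 0 => (fix gy0 b := match b with
          | b'.+1 => lmap gY (gy0 b') ++ gneg (gsig 0 0 b' j)
          | 0 => [::] end) b
  end.
Fixpoint lpw (u v : seq mono -> seq mono) (m i : nat) (l : seq mono) : seq mono :=
  match m, i with
  | 0, 0 => l
  | 0, _ => [::]
  | m'.+1, 0 => u (lpw u v m' 0 l)
  | m'.+1, i'.+1 => u (lpw u v m' i l) ++ v (lpw u v m' i' l)
  end.
Fixpoint lpwd (u v u' : seq mono -> seq mono) (m i : nat) (l : seq mono) : seq mono :=
  match m, i with
  | 0, _ => [::]
  | m'.+1, 0 => u (lpwd u v u' m' 0 l) ++ u' (lpw u v m' 0 l)
  | m'.+1, i'.+1 => u (lpwd u v u' m' i l) ++ u' (lpw u v m' i l) ++ v (lpwd u v u' m' i' l)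
  end.
Definition lX := lmap gX. Definition lY := lmap gY.
Definition lx := lmap gx. Definition ly := lmap gy.
Definition lXd (l : seq mono) := gneg (lmap (fun a b j => [:: (d%:Z, (0%N, 0%N, (a + d.-1, b, j)%N))]) l).
Definition lYd (l : seq mono) := gneg (lmap (fun a b j => [:: (d%:Z, (0%N, 0%N, (a, b + d.-1, j)%N))]) l).
Definition la i l := norm (lpw lx lY d i l ++ lpw ly lX d i l).
Definition lada i l := norm (lpwd lx lY lXd d i l ++ lpwd ly lX lYd d i l).
End Engine.
(** Used when a = b, where n = 0: terms containing n are then admissible whatever their degree. *)
Definition ok4 (t : mono) := (0 < t.2.1.2)%N || (2 <= t.2.2.1.1 + t.2.2.1.2)%N.
Definition ok6 (t : mono) := ((0 < t.2.2.1.1) && (0 < t.2.2.1.2))%N || (4 <= t.2.2.1.1 + t.2.2.1.2)%N.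

Section EngineSemantics.
Context {R : realType} {d : nat} {zeta : R[i]}.
Hypothesis hz : d.-primitive_root zeta.
Local Notation C := R[i].
Local Notation F := (freealg C (gen zeta)).
Context (c : reflection zeta -> C) (hc : is_param c).
Let d0 := prim_order_gt0 hz.

Definition nat_rep : rep zeta :=
  @Rep R zeta 2 (fun w => sval w) erefl (fun w1 w2 => erefl).

Local Notation M := (pmod C 'I_2).
Local Notation op := (std_op (d := d) c nat_rep).
Let cm : cmod d op := std_cmod hz hc nat_rep.
Let bm := cm_bmod cm.
Local Notation oX := (op (GenVd zeta 0)).
Local Notation oY := (op (GenVd zeta 1)).
Local Notation ox := (op (GenV zeta 0)).
Local Notation oy := (op (GenV zeta 1)).
Local Notation sg := (sigma d op).

Context (p n : C).
(** The parameter depends only on the parity of the index. So for even d this sum vanishes unless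
    $\zeta^m$ is 1 or -1; the values there are p and n. *)
Definition refl_sum m : C := \sum_(i < d) zeta ^+ (i * m) * c (ref_s zeta i).
Hypothesis sumE : forall m, refl_sum m =
  if (m %% d == 0)%N then p else if (m %% d == d./2)%N then n else 0.

Definition oj (j : bool) : 'I_2 := if j then 1%R else 0%R.
Definition mc (t : mono) : C := t.1%:~R * p ^+ t.2.1.1 * n ^+ t.2.1.2.
Definition mv (t : mono) : M := mc t *: fb (t.2.2.1.1, t.2.2.1.2, oj t.2.2.2).
Definition ev (l : seq mono) : M := \sum_(t <- l) mv t.

Lemma ev_cat l l' : ev (l ++ l') = ev l + ev l'. Proof. exact: big_cat. Qed.
Lemma ev_nil : ev [::] = 0. Proof. exact: big_nil. Qed.
Lemma mv1 pe ne a b j : mv (1, (pe, ne, (a, b, j))) = (p ^+ pe * n ^+ ne) *: fb (a, b, oj j).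
Proof. by rewrite /mv /mc /= mul1r. Qed.
Lemma ev_one a b j : ev (unit_term a b j) = fb (a, b, oj j).
Proof. by rewrite /ev big_seq1 mv1 !expr0 mul1r scale1r. Qed.
Lemma ev_neg l : ev (gneg l) = - ev l.
Proof.
rewrite /ev big_map -sumrN; apply: eq_bigr => t _.
by rewrite /mv /mc /= rmorphN !mulNr scaleNr.
Qed.
Lemma ev_ins t l : ev (ins t l) = mv t + ev l.
Proof.
elim: l => [|t' l IH] /=; first by rewrite /ev big_seq1 big_nil addr0.
case: eqP => e; rewrite /ev !big_cons -/(ev _).
  by rewrite addrA; congr (_ + _); rewrite /mv /mc /= e rmorphD !mulrDl scalerDl.
by rewrite -[X in _ + X = _]/(ev (ins t l)) IH addrCA.
Qed.
Lemma ev_norm l : ev (norm l) = ev l.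
Proof.
rewrite /norm /ev big_filter -/(ev _); apply: etrans (_ : ev (foldr ins [::] l) = _).
  rewrite /ev [RHS](bigID (fun t => t.1 != 0)) /= [X in _ + X]big1 ?addr0 // => t.
  by rewrite negbK => /eqP e; rewrite /mv /mc e !mul0r scale0r.
by elim: l => //= t l IH; rewrite ev_ins IH /ev big_cons.
Qed.
Lemma ev_lmap (G : {linear M -> M}) f : (forall a b j, G (fb (a, b, oj j)) = ev (f a b j)) ->
  forall l, G (ev l) = ev (lmap f l).
Proof.
move=> h l; rewrite ev_norm /ev big_flatten big_map (linear_sum G); apply: eq_bigr => t _.
rewrite big_map /mv (linearZ_LR G) h /ev scaler_sumr; apply: eq_bigr => u _.
rewrite /mv scalerA; congr (_ *: _); rewrite /mc /= rmorphM !exprD.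
by rewrite mulrACA [X in X * _ = _]mulrACA.
Qed.

Lemma oX_fb a b j : oX (fb (a, b, j)) = fb (a.+1, b, j). Proof. exact: pXU. Qed.
Lemma oY_fb a b j : oY (fb (a, b, j)) = fb (a, b.+1, j). Proof. exact: pYU. Qed.
Lemma ev_X l : oX (ev l) = ev (lX l).
Proof. by apply: ev_lmap => a b j; rewrite oX_fb ev_one. Qed.
Lemma ev_Y l : oY (ev l) = ev (lY l).
Proof. by apply: ev_lmap => a b j; rewrite oY_fb ev_one. Qed.

Lemma sg0 k j : sg k (fb (0%N, 0%N, oj j)) =
  refl_sum (k + if j then 1 else d.-1) *: fb (0%N, 0%N, oj (~~ j)).
Proof.
rewrite /sigma /refl_sum scaler_suml; apply: eq_bigr => i _.
have -> : fb (0%N, 0%N, oj j) = pinj 0 0 (fb (oj j)) :> M by rewrite pinjU.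
rewrite std_C std_W std_baseW /= !big_ord_recl big_ord0 addr0 /=.
have -> : lift ord0 ord0 = 1 :> 'I_2 by exact: val_inj.
have -> : ord0 = 0 :> 'I_2 by exact: val_inj.
rewrite (linearD (pinj 0 0)) !(linearZ_LR (pinj 0 0)) !pinjU.
case: j => /=; rewrite !s_mxE /= !scale0r ?addr0 ?add0r !scalerA; congr (_ *: _).
  by rewrite mulnDr muln1 exprD -!mulrA; congr (_ * _); rewrite mulrC.
rewrite mulnDr exprD -!mulrA; congr (_ * _); rewrite mulrC; congr (_ * _).
by rewrite -(zeta_inv hz).
Qed.

Lemma ev_gsig k a b j : sg k (fb (a, b, oj j)) = ev (gsig d k a b j).
Proof.
have sX k' m : sg k' (oX m) = oY (sg k'.+1 m) by exact: (sg_X hz (bmC bm) (cmWX cm)).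
have sY k' m : sg k' (oY m) = oX (sg (k' + d.-1) m) by exact: (sg_Y hz (bmC bm) (cmWY cm)).
elim: a k => [|a IH] k.
  elim: b k => [|b IH] k.
    rewrite sg0 sumE /gsig !addn0 muln0 addn0.
    case: ifP => _; first by rewrite /ev big_seq1 mv1 expr1 expr0 mulr1.
    by case: ifP => _; rewrite ?scale0r ?ev_nil // /ev big_seq1 mv1 expr1 expr0 mul1r.
  rewrite -oY_fb sY IH /gsig.
  have -> : (k + d.-1 + 0 + d.-1 * b = k + 0 + d.-1 * b.+1)%N by rewrite mulnS; lia.
  case: ifP => _; first by rewrite /ev !big_seq1 !mv1 (linearZ_LR oX) oX_fb.
  by case: ifP => _; rewrite ?ev_nil ?linear0 // /ev !big_seq1 !mv1 (linearZ_LR oX) oX_fb.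
rewrite -oX_fb sX IH /gsig addSnnS.
case: ifP => _; first by rewrite /ev !big_seq1 !mv1 (linearZ_LR oY) oY_fb.
by case: ifP => _; rewrite ?ev_nil ?linear0 // /ev !big_seq1 !mv1 (linearZ_LR oY) oY_fb.
Qed.

Let opT m : op (GenT zeta) m = 0. Proof. exact: std_T. Qed.
Let fb0 j : fb (0%N, 0%N, j) = pinj 0 0 (fb j) :> M. Proof. by rewrite pinjU. Qed.

Lemma ev_gx a b j : ox (fb (a, b, oj j)) = ev (gx d a b j).
Proof.
elim: a => [|a IH]; last first.
  by rewrite -oX_fb (cmxX cm) IH opT sub0r ev_gsig ev_X -ev_neg -ev_cat.
elim: b => [|b IH]; first by rewrite fb0 std_x ev_nil.
by rewrite -oY_fb (cmxY cm) IH ev_gsig ev_Y -ev_cat.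
Qed.
Lemma ev_gy a b j : oy (fb (a, b, oj j)) = ev (gy d a b j).
Proof.
elim: a => [|a IH]; last first.
  by rewrite -oX_fb (cmyX cm) IH ev_gsig ev_X -ev_cat.
elim: b => [|b IH]; first by rewrite fb0 std_y ev_nil.
by rewrite -oY_fb (cmyY cm) IH opT sub0r ev_gsig ev_Y -ev_neg -ev_cat.
Qed.

Definition sem (u : F) (U : seq mono -> seq mono) : Prop := forall l, act op u (ev l) = ev (U l).

Lemma sem_X : sem (fX (zeta := zeta)) lX. Proof. by move=> l; rewrite act_gen ev_X. Qed.
Lemma sem_Y : sem (fY (zeta := zeta)) lY. Proof. by move=> l; rewrite act_gen ev_Y. Qed.
Lemma sem_x : sem (fx (zeta := zeta)) (lx d).
Proof. by move=> l; rewrite act_gen; apply: ev_lmap => a b j; exact: ev_gx. Qed.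
Lemma sem_y : sem (fy (zeta := zeta)) (ly d).
Proof. by move=> l; rewrite act_gen; apply: ev_lmap => a b j; exact: ev_gy. Qed.

Lemma act_natmul (u : F) k m : act op (- (u *+ k)) m = - (k%:R *: act op u m).
Proof.
rewrite -(sub0r (u *+ k)) actB act0 sub0r; congr (- _); elim: k => [|k IH]; first by rewrite mulr0n act0 scale0r.
by rewrite mulrS actD IH -natr1 scalerDl scale1r addrC.
Qed.

Lemma itX_fb k a b j : iter k oX (fb (a, b, j)) = fb (a + k, b, j)%N.
Proof. by elim: k => [|k IH] /=; rewrite ?addn0 // IH oX_fb addnS. Qed.
Lemma sem_Xd : sem (- (fX (zeta := zeta) ^+ d.-1 *+ d)) (lXd d).
Proof.
move=> l; pose G : {linear M -> M} := d%:R \*: act op (f_gen (GenVd zeta 0) ^+ d.-1).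
have GE m : G m = d%:R *: iter d.-1 oX m.
  by rewrite -(act_genX op (GenVd zeta 0)).
have hG a b j : G (fb (a, b, oj j)) = ev [:: (d%:Z, (0%N, 0%N, (a + d.-1, b, j)%N))].
  by rewrite GE itX_fb /ev big_seq1 /mv /mc /= !expr0 !mulr1.
apply: etrans (act_natmul _ _ _) _; rewrite ev_neg -(ev_lmap hG); congr (- _).
Qed.
Lemma itY_fb k a b j : iter k oY (fb (a, b, j)) = fb (a, b + k, j)%N.
Proof. by elim: k => [|k IH] /=; rewrite ?addn0 // IH oY_fb addnS. Qed.
Lemma sem_Yd : sem (- (fY (zeta := zeta) ^+ d.-1 *+ d)) (lYd d).
Proof.
move=> l; pose G : {linear M -> M} := d%:R \*: act op (f_gen (GenVd zeta 1) ^+ d.-1).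
have GE m : G m = d%:R *: iter d.-1 oY m.
  by rewrite -(act_genX op (GenVd zeta 1)).
have hG a b j : G (fb (a, b, oj j)) = ev [:: (d%:Z, (0%N, 0%N, (a, b + d.-1, j)%N))].
  by rewrite GE itY_fb /ev big_seq1 /mv /mc /= !expr0 !mulr1.
apply: etrans (act_natmul _ _ _) _; rewrite ev_neg -(ev_lmap hG); congr (- _).
Qed.

Lemma semM u U v V : sem u U -> sem v V -> sem (u * v) (fun l => U (V l)).
Proof.
move=> hu hv l; apply: etrans (actM op u v (ev l)) _.
by apply: etrans (congr1 (act op u) (hv l)) _; exact: hu.
Qed.
Lemma semD u U v V : sem u U -> sem v V -> sem (u + v) (fun l => U l ++ V l).
Proof.
move=> hu hv l; apply: etrans (actD op u v (ev l)) _.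
by rewrite (hu l) (hv l) ev_cat.
Qed.
Lemma sem0M u : sem (0 * u) (fun=> [::]).
Proof.
move=> l; apply: etrans (actM op 0 u (ev l)) _.
by apply: etrans (act0 op _) _; rewrite ev_nil.
Qed.
Lemma sem_ext u U V : (forall l, ev (U l) = ev (V l)) -> sem u U -> sem u V.
Proof. by move=> e h l; rewrite -e; exact: h. Qed.

Section Words.
Context (u v u' : F) (U V U' : seq mono -> seq mono).
Hypothesis (hu : sem u U) (hv : sem v V) (hu' : sem u' U').

Lemma sem_pw m i : sem (pw u v m i) (lpw U V m i).
Proof.
elim: m i => [|m IH] [|i].
- by move=> l; exact: act1.
- by move=> l; apply: etrans (act0 op _) _; rewrite /= ev_nil.
- exact: (semM hu (IH 0%N)).
- exact: (semD (semM hu (IH i.+1)) (semM hv (IH i))).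
Qed.
Lemma sem_pwd m i : sem (pwd u v u' 0 m i) (lpwd U V U' m i).
Proof.
elim: m i => [|m IH] [|i].
- by move=> l; apply: etrans (act0 op _) _; rewrite /= ev_nil.
- by move=> l; apply: etrans (act0 op _) _; rewrite /= ev_nil.
- exact: (semD (semM hu (IH 0%N)) (semM hu' (sem_pw m 0))).
- have h := semD (semD (semM hu (IH i.+1)) (semM hu' (sem_pw m i.+1)))
    (semD (semM hv (IH i)) (sem0M (pw u v m i))).
  by apply: (sem_ext _ h) => l; rewrite !ev_cat ev_nil addr0 addrA.
Qed.
End Words.

(** A lift of $\{a_d,a_i\}$. Since $a_d=X^d+Y^d$, the commutator with it, divided by T, is the
    derivation that kills X, Y and sends x to $-dX^{d-1}$ and y to $-dY^{d-1}$. *)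
Definition word_ada i : F :=
  pwd (fx (zeta := zeta)) (fY (zeta := zeta)) (- (fX (zeta := zeta) ^+ d.-1 *+ d)) 0 d i +
  pwd (fy (zeta := zeta)) (fX (zeta := zeta)) (- (fY (zeta := zeta) ^+ d.-1 *+ d)) 0 d i.

Lemma sem_a i : sem (fa (d := d) (zeta := zeta) i) (la d i).
Proof.
have h := semD (sem_pw sem_x sem_Y d i) (sem_pw sem_y sem_X d i).
by apply: (sem_ext _ h) => l; rewrite ev_norm.
Qed.
Lemma sem_ada i : sem (word_ada i) (lada d i).
Proof.
have h := semD (sem_pwd sem_x sem_Y sem_Xd d i) (sem_pwd sem_y sem_X sem_Yd d i).
by apply: (sem_ext _ h) => l; rewrite ev_norm.
Qed.

Definition coefun a b j : {linear M -> C^o} := flext (fun k => ((k == (a, b, oj j))%:R : C^o)).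
Lemma coefunE a b j k : coefun a b j (fb k) = (k == (a, b, oj j))%:R. Proof. exact: flextU. Qed.

Lemma coefun_ev a b j l : coefun a b j (ev l) = \sum_(t <- [seq t <- l | t.2.2 == (a, b, j)]) mc t.
Proof.
rewrite /ev (linear_sum (coefun a b j)) big_filter [RHS]big_mkcond; apply: eq_bigr => -[z [e [[a' b'] j']]] _.
rewrite /mv (linearZ_LR (coefun a b j)) coefunE /= !xpair_eqE.
have -> : (oj j' == oj j) = (j' == j) by case: j; case: j'.
by case: (_ && _); rewrite ?scaler0 //; exact: mulr1.
Qed.

Lemma fil_ev (ok : nat -> nat -> bool) l :
  (forall t, t \in l -> mc t = 0 \/ ok t.2.2.1.1 t.2.2.1.2) -> fil (E := nat_rep) ok (ev l).
Proof.
elim: l => [|t l IH] h; first by rewrite ev_nil; exact: fil0.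
have hl : fil (E := nat_rep) ok (ev l) by apply: IH => t' ht; apply: h; rewrite inE ht orbT.
rewrite /ev big_cons -/(ev l); have [e|hk] := h t (mem_head _ _).
  by rewrite /mv e scale0r add0r.
by apply: filP => //; apply: filM.
Qed.

Lemma std_e_ev (j : 'I_2) : exists b, std_e (E := nat_rep) j = ev (unit_term 0 0 b).
Proof.
have [->|->] := ord2_cases j; [exists false | exists true]; rewrite ev_one; exact: pinjU.
Qed.

End EngineSemantics.

End EnginePart.
Export EnginePart.

(** * Recognising a Lie algebra from the action of its generators in coordinates *)

Module LieSpanPart.

Section LieBasics.
Context {K : fieldType} {g : lmodType K} (br : g -> g -> g).
Hypothesis hL : is_lie_bracket br.

Lemma brPl a u v w : br (a *: u + v) w = a *: br u w + br v w. Proof. by case: hL. Qed.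
Lemma brPr a u v w : br w (a *: u + v) = a *: br w u + br w v. Proof. by case: hL. Qed.
Lemma brxx u : br u u = 0. Proof. by case: hL. Qed.
Lemma brDl u v w : br (u + v) w = br u w + br v w.
Proof. by have := brPl 1 u v w; rewrite !scale1r. Qed.
Lemma brDr u v w : br w (u + v) = br w u + br w v.
Proof. by have := brPr 1 u v w; rewrite !scale1r. Qed.
Lemma br0l w : br 0 w = 0. Proof. by apply: (addIr (br 0 w)); rewrite -brDl !add0r. Qed.
Lemma br0r w : br w 0 = 0. Proof. by apply: (addIr (br w 0)); rewrite -brDr !add0r. Qed.
Lemma brZl a u w : br (a *: u) w = a *: br u w.
Proof. by have := brPl a u 0 w; rewrite br0l !addr0. Qed.
Lemma brZr a u w : br w (a *: u) = a *: br w u.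
Proof. by have := brPr a u 0 w; rewrite br0r !addr0. Qed.
Lemma brNl u w : br (- u) w = - br u w. Proof. by rewrite -scaleN1r brZl scaleN1r. Qed.
Lemma brNr u w : br w (- u) = - br w u. Proof. by rewrite -scaleN1r brZr scaleN1r. Qed.
Definition brE := (brDl, brDr, brZl, brZr, brNl, brNr, br0l, br0r).
Lemma brC u v : br u v = - br v u.
Proof.
apply/eqP; rewrite -addr_eq0; apply/eqP.
by have := brxx (u + v); rewrite !brE !brxx add0r addr0.
Qed.
Lemma jac u v w : br u (br v w) = br (br u v) w + br v (br u w).
Proof.
have [_ _ _ /(_ u v w) h] := hL.
by move: h; rewrite (brC w (br u v)) (brC w u) brNr => /eqP; rewrite subr_eq0 => /eqP <-; rewrite subrK.
Qed.
Lemma jacl u v w : br (br u v) w = br u (br v w) - br v (br u w).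
Proof. by rewrite jac addrK. Qed.

End LieBasics.

Section LieSpan.
Context {K : fieldType} {g : lmodType K} (br : g -> g -> g).
Hypothesis hL : is_lie_bracket br.
Context (N : nat) (vs : nat -> g) (gs : 'I_4 -> g).
Context (rm : 'I_4 -> (nat -> K) -> (nat -> K)) (gc : 'I_4 -> nat -> K).

(** In the coordinates given by the family [vs], [rm j] is the operator of bracketing with the
    generator [gs j], and [gc j] are the coordinates of that generator. Independence of [vs] is not
    assumed but derived. *)
Definition lcomb (c : nat -> K) : g := foldr (fun i s => c i *: vs i + s) 0 (iota 0 N).

Lemma lcomb_lin a c c' : lcomb (fun i => a * c i + c' i) = a *: lcomb c + lcomb c'.
Proof.
rewrite /lcomb; elim: iota => [|i s IH] /=; first by rewrite scaler0 addr0.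
by rewrite IH scalerDr scalerDl scalerA addrACA.
Qed.

Lemma lcomb_eq c c' : (forall i, (i < N)%N -> c i = c' i) -> lcomb c = lcomb c'.
Proof.
move=> h; rewrite /lcomb; have : {subset iota 0 N <= iota 0 N} by [].
elim: {1 3 4}(iota 0 N) => //= i s IH hs; rewrite IH => [|j hj]; last by apply: hs; rewrite inE hj orbT.
by rewrite h //; have := hs i; rewrite inE eqxx mem_iota => /(_ isT).
Qed.

Lemma lcomb0 c : (forall i, (i < N)%N -> c i = 0) -> lcomb c = 0.
Proof.
move=> h; rewrite (lcomb_eq (c' := fun=> 0)) // /lcomb.
by elim: iota => //= i s ->; rewrite scale0r addr0.
Qed.

Hypothesis rowE : forall j c, br (gs j) (lcomb c) = lcomb (rm j c).
Hypothesis gsE : forall j, gs j = lcomb (gc j).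
Hypothesis gen : forall P : set g, is_submod P -> (forall u v, P u -> P v -> P (br u v)) ->
  (forall j, P (gs j)) -> P = setT.

(** The elements of the span whose bracket preserves the span form a subalgebra that contains the
    generators. *)
Lemma lcomb_surj u : exists c, u = lcomb c.
Proof.
pose S u := exists c, u = lcomb c.
pose P u := S u /\ forall v, S v -> S (br u v).
have S0 : S 0 by exists (fun=> 0); rewrite lcomb0.
have SP a u1 v : S u1 -> S v -> S (a *: u1 + v).
  by move=> [c ->] [c' ->]; exists (fun i => a * c i + c' i); rewrite lcomb_lin.
suff /(congr1 (fun A => A u)) e : P = setT by have [] : P u by rewrite e.
apply: gen.
- split; first by split=> // v _; rewrite (br0l hL).
  move=> a u1 v [h1 h2] [h3 h4]; split=> [|x hx]; first exact: SP.
  by rewrite (brPl hL); apply: SP; [exact: h2 | exact: h4].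
- move=> u1 v [h1 h2] [h3 h4]; split=> [|x hx]; first exact: h2.
  rewrite (jacl hL) addrC -scaleN1r; apply: SP; [apply: (h4 _ _) | apply: (h2 _ _)].
    exact: h2.
  exact: h4.
- move=> j; split=> [|v [c ->]]; first by exists (gc j).
  by exists (rm j c); rewrite rowE.
Qed.

Context (t : g) (i0 : nat).
Hypothesis bot : forall I : set g, is_submod I -> (forall u v, I v -> I (br u v)) ->
  forall c, I (lcomb c) -> c i0 = 0 \/ I t.
Hypothesis reach : forall c, (forall l, foldr rm c l i0 = 0) -> forall i, (i < N)%N -> c i = 0.
Hypothesis top : forall I : set g, is_submod I -> (forall u v, I v -> I (br u v)) ->
  I t -> forall j, I (gs j).
Hypothesis nz : exists u : g, u <> 0.

Lemma ideal_dichotomy (I : set g) : is_submod I -> (forall u v, I v -> I (br u v)) ->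
  I = setT \/ forall c, I (lcomb c) -> forall i, (i < N)%N -> c i = 0.
Proof.
move=> sI iI; have [It|nIt] := pselect (I t).
  by left; apply: gen => // [u v _ hv|]; [exact: iI | exact: top].
right=> c hc; apply: reach => l.
have hl : I (lcomb (foldr rm c l)) by elim: l => //= j l IH; rewrite -rowE; exact: iI.
by have [] := bot sI iI hl.
Qed.

(** The dichotomy applied to the zero ideal of a nonzero algebra. *)
Lemma lcomb_indep c : lcomb c = 0 -> forall i, (i < N)%N -> c i = 0.
Proof.
have sI : is_submod ([set 0]%classic : set g).
  by split=> // a u v -> ->; rewrite scaler0 addr0.
have iI u v : ([set 0]%classic : set g) v -> ([set 0]%classic : set g) (br u v).
  by move=> ->; rewrite (br0r hL).
have [e|h] := ideal_dichotomy sI iI; last exact: h.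
by have [u hu] := nz; case: hu; have : ([set 0]%classic : set g) u by rewrite e.
Qed.

Lemma lie_simple : (exists u v, br u v <> 0) -> simple_lie br.
Proof.
move=> ne; split=> // I sI iI; have [->|h] := ideal_dichotomy sI iI; [by right | left].
rewrite predeqE => u; split=> [hu|->]; last by case: sI.
have [c e] := lcomb_surj u; rewrite e in hu *.
by rewrite /= lcomb0 //; exact: h.
Qed.

Context (n : nat) (th : (nat -> K) -> 'M[K]_n) (L : set 'M[K]_n).
Hypothesis th_eq : forall c c', (forall i, (i < N)%N -> c i = c' i) -> th c = th c'.
Hypothesis th_lin : forall a c c', th (fun i => a * c i + c' i) = a *: th c + th c'.
Hypothesis th_inj : forall c, th c = 0 -> forall i, (i < N)%N -> c i = 0.
Hypothesis th_row : forall j c, th (rm j c) = th (gc j) *m th c - th c *m th (gc j).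
Hypothesis th_range : forall A, L A <-> exists c, A = th c.

Let co u := sval (cid (lcomb_surj u)).
Let coE u : u = lcomb (co u). Proof. exact: (svalP (cid (lcomb_surj u))). Qed.
Let f u := th (co u).

Let f_lcomb c : f (lcomb c) = th c.
Proof.
apply: th_eq => i hi; apply/eqP; rewrite -subr_eq0 addrC -mulN1r; apply/eqP.
by apply: (lcomb_indep (c := fun i => -1 * c i + co (lcomb c) i)) hi; rewrite lcomb_lin -coE scaleN1r addNr.
Qed.
Let f_lin : linear f.
Proof. by move=> a u v; rewrite {1}(coE u) {1}(coE v) -lcomb_lin f_lcomb th_lin. Qed.

Lemma lie_iso : lie_iso_mx br L.
Proof.
pose fm := GRing.isLinear.Build K g 'M[K]_n _ f f_lin.
pose F : {linear g -> 'M[K]_n} := HB.pack f fm.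
have FP a u v : F (a *: u + v) = a *: F u + F v by exact: f_lin.
exists F; split.
- move=> u v e; apply/eqP; rewrite -subr_eq0; apply/eqP.
  have /th_inj h : th (co (u - v)) = 0 by rewrite -[LHS]/(F (u - v)) linearB e subrr.
  by rewrite (coE (u - v)) lcomb0.
- rewrite predeqE => A; split=> [[u _ <-]|/th_range [c ->]]; first by apply/th_range; exists (co u).
  by exists (lcomb c) => //; exact: f_lcomb.
(* The elements that F maps compatibly with brackets against everything form a subalgebra, by the
   Jacobi identity on both sides. So only the generators have to be compared. *)
pose P u := forall v, F (br u v) = F u *m F v - F v *m F u.
suff e : P = setT by move=> u; have : P u by rewrite e.
apply: gen.
- split=> [v|a u v hu hv x]; first by rewrite (br0l hL) linear0 mul0mx mulmx0 subrr.
  by rewrite (brPl hL) !FP hu hv mulmxDl mulmxDr -scalemxAl -scalemxAr scalerBr opprD addrACA.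
- move=> u v hu hv x; rewrite (jacl hL) linearB (hu (br v x)) (hv x) (hv (br u x)) (hu x) (hu v) !mulmxBr !mulmxBl !mulmxA.
  zmod_eq 'M[K]_n.
- move=> j v; rewrite (coE v) rowE gsE.
  by rewrite -![F _]/(f _) !f_lcomb th_row.
Qed.

End LieSpan.

End LieSpanPart.
Export LieSpanPart.

(** * Chevalley generators of type A_2 and matrices of trace zero *)

Module TypeA2Part.

Definition mk {K : pzSemiRingType} n (rows : seq (seq K)) : 'M[K]_n :=
  \matrix_(i, j) nth 0 (nth [::] rows i) j.

Section TypeA2.
Context {K : numFieldType} {g : lmodType K} (br : g -> g -> g).
Hypothesis hL : is_lie_bracket br.
Context (e f h : 'I_2 -> g).
Local Notation o0 := (0%R : 'I_2).
Local Notation o1 := (1%R : 'I_2).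
Hypothesis hh : forall i j, br (h i) (h j) = 0.
Hypothesis ef : forall i j, br (e i) (f j) = if i == j then h i else 0.
Hypothesis gen : forall P : set g, is_submod P -> (forall u v, P u -> P v -> P (br u v)) ->
  (forall i, P (e i) /\ P (f i)) -> P = setT.
Hypothesis nz : e o0 <> 0.

Let gs (j : 'I_4) : g := nth 0 [:: e o0; e o1; f o0; f o1] j.
Let gen4 (P : set g) : is_submod P -> (forall u v, P u -> P v -> P (br u v)) ->
  (forall j, P (gs j)) -> P = setT.
Proof.
move=> h1 h2 h3; apply: gen => // i.
have g0 := h3 (@Ordinal 4 0 isT); have g1 := h3 (@Ordinal 4 1 isT).
have g2 := h3 (@Ordinal 4 2 isT); have g3 := h3 (@Ordinal 4 3 isT).
by case: i => -[|[|//]] p; [rewrite (_ : Ordinal p = o0) | rewrite (_ : Ordinal p = o1)] => //; exact: val_inj.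
Qed.
Let fe i j : br (f i) (e j) = - (if i == j then h i else 0).
Proof. by rewrite (brC hL) ef eq_sym; case: eqP => // ->. Qed.

Section A2.
Hypothesis he : forall i j, br (h i) (e j) = (cartan_A2 i j)%:~R *: e j.
Hypothesis hf : forall i j, br (h i) (f j) = - ((cartan_A2 i j)%:~R *: f j).
Hypothesis See : forall i j, i != j -> iter `|(1 - cartan_A2 i j)%R|%N (br (e i)) (e j) = 0.
Hypothesis Sff : forall i j, i != j -> iter `|(1 - cartan_A2 i j)%R|%N (br (f i)) (f j) = 0.

Let e12 := br (e o0) (e o1).
Let f12 := br (f o0) (f o1).
Let vs i : g := nth 0 [:: e o0; e o1; e12; f o0; f o1; f12; h o0; h o1] i.
Let rm (j : 'I_4) (c : nat -> K) : nat -> K :=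
  nth 0 (nth [::]
   [:: [:: - 2 * c 6%N + c 7%N; 0; c 1%N; 0; c 5%N; 0; c 3%N; 0];
       [:: 0; c 6%N - 2 * c 7%N; - c 0%N; - c 5%N; 0; 0; 0; c 4%N];
       [:: 0; c 2%N; 0; 2 * c 6%N - c 7%N; 0; c 4%N; - c 0%N; 0];
       [:: - c 2%N; 0; 0; 0; - c 6%N + 2 * c 7%N; - c 3%N; 0; - c 1%N]] j).
Let gc (j : 'I_4) (k : nat) : K := nth 0 (nth [::] [:: [:: 1]; [:: 0; 1]; [:: 0; 0; 0; 1]; [:: 0; 0; 0; 0; 1]] j) k.
Local Notation lc := (lcomb 8 vs).

Let A00 : cartan_A2 o0 o0 = 2. Proof. by rewrite mxE. Qed.
Let A01 : cartan_A2 o0 o1 = -1. Proof. by rewrite mxE. Qed.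
Let A10 : cartan_A2 o1 o0 = -1. Proof. by rewrite mxE. Qed.
Let A11 : cartan_A2 o1 o1 = 2. Proof. by rewrite mxE. Qed.
Let h0e0 : br (h o0) (e o0) = 2 *: e o0. Proof. by rewrite he A00. Qed.
Let h0e1 : br (h o0) (e o1) = - e o1. Proof. by rewrite he A01 scaleN1r. Qed.
Let h1e0 : br (h o1) (e o0) = - e o0. Proof. by rewrite he A10 scaleN1r. Qed.
Let h1e1 : br (h o1) (e o1) = 2 *: e o1. Proof. by rewrite he A11. Qed.
Let h0f0 : br (h o0) (f o0) = - (2 *: f o0). Proof. by rewrite hf A00. Qed.
Let h0f1 : br (h o0) (f o1) = f o1. Proof. by rewrite hf A01 scaleN1r opprK. Qed.
Let h1f0 : br (h o1) (f o0) = f o0. Proof. by rewrite hf A10 scaleN1r opprK. Qed.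
Let h1f1 : br (h o1) (f o1) = - (2 *: f o1). Proof. by rewrite hf A11. Qed.
Let e0f0 : br (e o0) (f o0) = h o0. Proof. by rewrite ef. Qed.
Let e0f1 : br (e o0) (f o1) = 0. Proof. by rewrite ef. Qed.
Let e1f0 : br (e o1) (f o0) = 0. Proof. by rewrite ef. Qed.
Let e1f1 : br (e o1) (f o1) = h o1. Proof. by rewrite ef. Qed.
Let f0e0 : br (f o0) (e o0) = - h o0. Proof. by rewrite fe. Qed.
Let f0e1 : br (f o0) (e o1) = 0. Proof. by rewrite fe oppr0. Qed.
Let f1e0 : br (f o1) (e o0) = 0. Proof. by rewrite fe oppr0. Qed.
Let f1e1 : br (f o1) (e o1) = - h o1. Proof. by rewrite fe. Qed.
Let e0h i : br (e o0) (h i) = - br (h i) (e o0). Proof. exact: brC. Qed.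
Let e1h i : br (e o1) (h i) = - br (h i) (e o1). Proof. exact: brC. Qed.
Let f0h i : br (f o0) (h i) = - br (h i) (f o0). Proof. exact: brC. Qed.
Let f1h i : br (f o1) (h i) = - br (h i) (f o1). Proof. exact: brC. Qed.
Let e1e0 : br (e o1) (e o0) = - e12. Proof. exact: brC. Qed.
Let f1f0 : br (f o1) (f o0) = - f12. Proof. exact: brC. Qed.
Let e0e0 := brxx hL (e o0). Let e1e1 := brxx hL (e o1).
Let f0f0 := brxx hL (f o0). Let f1f1 := brxx hL (f o1).
Let tab1 := (h0e0, h0e1, h1e0, h1e1, h0f0, h0f1, h1f0, h1f1, e0f0, e0f1, e1f0, e1f1,
  f0e0, f0e1, f1e0, f1e1, e0e0, e1e1, f0f0, f1f1, e1e0, f1f0).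
Let tab2 := (e0h, e1h, f0h, f1h).
Let e0e12 : br (e o0) e12 = 0. Proof. by have := @See o0 o1 isT; rewrite A01. Qed.
Let f0f12 : br (f o0) f12 = 0. Proof. by have := @Sff o0 o1 isT; rewrite A01. Qed.
Let e1e12 : br (e o1) e12 = 0.
Proof. by have := @See o1 o0 isT; rewrite A10 /= e1e0 (brE hL) => /eqP; rewrite oppr_eq0 => /eqP. Qed.
Let f1f12 : br (f o1) f12 = 0.
Proof. by have := @Sff o1 o0 isT; rewrite A10 /= f1f0 (brE hL) => /eqP; rewrite oppr_eq0 => /eqP. Qed.
Let e0f12 : br (e o0) f12 = f o1.
Proof. by rewrite /f12 (jac hL) e0f0 e0f1 h0f1 (br0r hL) addr0. Qed.
Let e1f12 : br (e o1) f12 = - f o0.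
Proof. by rewrite /f12 (jac hL) e1f0 e1f1 f0h h1f0 (br0l hL) add0r. Qed.
Let f0e12 : br (f o0) e12 = e o1.
Proof. by rewrite /e12 (jac hL) f0e0 f0e1 (br0r hL) addr0 (brNl hL) h0e1 opprK. Qed.
Let f1e12 : br (f o1) e12 = - e o0.
Proof. by rewrite /e12 (jac hL) f1e0 f1e1 (br0l hL) add0r (brNr hL) e0h opprK h1e0. Qed.
Let tab3 := (e0e12, f0f12, e1e12, f1f12, e0f12, e1f12, f0e12, f1e12).

Let rowE j c : br (gs j) (lc c) = lc (rm j c).
Proof.
case: j => -[|[|[|[|//]]]] p; rewrite /lcomb /gs /rm /=.
all: rewrite ?(brE hL) ?tab3 ?tab2 ?tab1; lin_comb K g.
Qed.
Let gsE j : gs j = lc (gc j).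
Proof.
by case: j => -[|[|[|[|//]]]] p; rewrite /lcomb /gs /gc /vs /= ?scale0r ?scale1r ?add0r ?addr0.
Qed.

Let bot (I : set g) : is_submod I -> (forall u v, I v -> I (br u v)) ->
  forall c, I (lc c) -> c 5%N = 0 \/ I e12.
Proof.
move=> sI iI c hc; have [c0|c0] := eqVneq (c 5%N) 0; [by left | right].
have T v : I v -> I (br e12 v) by exact: iI.
have e12T v : br e12 v = br (e o0) (br (e o1) v) - br (e o1) (br (e o0) v) by exact: jacl.
(* Bracketing twice with the highest root vector [e12] kills every root vector and the Cartan part
   except the lowest root vector [f12], which goes to twice [e12]. *)
have Tr b : br e12 (lc b) = lc (nth 0 [:: b 4%N; - b 3%N; - b 6%N - b 7%N; 0; 0; 0; - b 5%N; - b 5%N]).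
  rewrite /lcomb /vs /= ?(brE hL) ?e12T; do 3 rewrite ?(brE hL) ?tab3 ?tab2 ?tab1.
  lin_comb K g.
have := T _ (T _ hc); rewrite !Tr /=.
have -> : lc (nth 0 [:: 0; - 0; - - c 5%N - - c 5%N; 0; 0; 0; - 0; - 0]) = (2 * c 5%N) *: e12.
  by rewrite /lcomb /vs /=; lin_comb K g.
move=> hI; have [I0 IP] := sI; have := IP (2 * c 5%N)^-1 _ _ hI I0.
rewrite addr0 scalerA mulVf ?scale1r // mulf_neq0 //; by rewrite (pnatr_eq0 K 2).
Qed.

Let reach c : (forall l, foldr rm c l 5%N = 0) -> forall i, (i < 8)%N -> c i = 0.
Proof.
pose j0 := @Ordinal 4 0 isT; pose j1 := @Ordinal 4 1 isT; pose j2 := @Ordinal 4 2 isT; pose j3 := @Ordinal 4 3 isT.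
move=> H; have two : 2 != 0 :> K by by rewrite (pnatr_eq0 K 2).
have three : 3 != 0 :> K by by rewrite (pnatr_eq0 K 3).
have R2 := ((fun c => erefl : rm j2 c 0%N = 0), (fun c => erefl : rm j2 c 1%N = c 2%N), (fun c => erefl : rm j2 c 2%N = 0), (fun c => erefl : rm j2 c 3%N = 2 * c 6%N - c 7%N), (fun c => erefl : rm j2 c 4%N = 0), (fun c => erefl : rm j2 c 5%N = c 4%N), (fun c => erefl : rm j2 c 6%N = - c 0%N), (fun c => erefl : rm j2 c 7%N = 0)).
have R3 := ((fun c => erefl : rm j3 c 0%N = - c 2%N), (fun c => erefl : rm j3 c 1%N = 0), (fun c => erefl : rm j3 c 2%N = 0), (fun c => erefl : rm j3 c 3%N = 0), (fun c => erefl : rm j3 c 4%N = - c 6%N + 2 * c 7%N), (fun c => erefl : rm j3 c 5%N = - c 3%N), (fun c => erefl : rm j3 c 6%N = 0), (fun c => erefl : rm j3 c 7%N = - c 1%N)).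
have h5 : (c) 5%N = 0 := H [:: ].
have h4 : (rm j2 c) 5%N = 0 := H [:: j2].
have h3 : (rm j3 c) 5%N = 0 := H [:: j3].
have h6 : (rm j2 (rm j3 c)) 5%N = 0 := H [:: j2; j3].
have h7 : (rm j3 (rm j2 c)) 5%N = 0 := H [:: j3; j2].
have h0 : (rm j3 (rm j2 (rm j2 c))) 5%N = 0 := H [:: j3; j2; j2].
have h1 : (rm j2 (rm j3 (rm j3 c))) 5%N = 0 := H [:: j2; j3; j3].
have h2 : (rm j2 (rm j3 (rm j3 (rm j2 c)))) 5%N = 0 := H [:: j2; j3; j3; j2].
pose R := (R2, R3); rewrite ?R in h0 h1 h2 h3 h4 h5 h6 h7.
have ne (k x : K) : k != 0 -> k * x = 0 -> x = 0 by move=> k0 /eqP; rewrite mulf_eq0 (negPf k0) => /eqP.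
have e6 : c 6%N = 0 by apply: (ne 3) => //; rewrite -(addr0 0) -{1}h6 -(mulr0 (-2)) -h7; ring.
have e7 : c 7%N = 0 by move: h6; rewrite e6 oppr0 add0r; exact: ne.
move=> [|[|[|[|[|[|[|[|//]]]]]]]] _ //.
- by apply: (ne 2) => //; rewrite -h0; ring.
- by apply: (ne 2) => //; rewrite -[RHS]oppr0 -h1; ring.
- by apply: (ne 2) => //; rewrite -[RHS]oppr0 -h2; ring.
- by rewrite -[RHS]oppr0 -h3 opprK.
Qed.

Let top (I : set g) : is_submod I -> (forall u v, I v -> I (br u v)) ->
  I e12 -> forall j, I (gs j).
Proof.
move=> [I0 IP] iI h1; have IN v : I (- v) -> I v.
  by move=> hv; have := IP (-1) _ _ hv I0; rewrite addr0 scaleN1r opprK.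
have i1 : I (e o1) by rewrite -f0e12; exact: iI.
have i0 : I (e o0) by apply: IN; rewrite -f1e12; exact: iI.
have k0 : I (h o0) by apply: IN; rewrite -f0e0; exact: iI.
have k1 : I (h o1) by apply: IN; rewrite -f1e1; exact: iI.
have l1 : I (f o1) by apply: IN; rewrite -h0f1 -f1h; exact: iI.
have l0 : I (f o0) by apply: IN; rewrite -h1f0 -f0h; exact: iI.
by case=> -[|[|[|[|//]]]].
Qed.

(** The generators go to elementary matrices next to the diagonal. Then [e12] goes to $E_{13}$,
    while [f12], the bracket of $E_{21}$ and $E_{32}$, goes to $-E_{31}$; this explains the sign. *)
Let th (c : nat -> K) : 'M[K]_3 := mk 3 [:: [:: c 6%N; c 0%N; c 2%N]; [:: c 3%N; c 7%N - c 6%N; c 1%N]; [:: - c 5%N; c 4%N; - c 7%N]].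

Lemma typeA2 : lie_iso_mx br (sl_mx K 3) /\ simple_lie br.
Proof.
have nz' : exists u : g, u <> 0 by exists (e o0).
split.
  apply: (lie_iso hL rowE gsE gen4 bot reach top nz' (th := th)).
  - by move=> c c' H; rewrite /th !H.
  - move=> a c c'; apply/matrixP => -[[|[|[|//]]] ?] -[[|[|[|//]]] ?]; rewrite !mxE /=; ring.
  - move=> c /matrixP H; have E (i j : 'I_3) : nth 0 (nth [::] [:: [:: c 6%N; c 0%N; c 2%N]; [:: c 3%N; c 7%N - c 6%N; c 1%N]; [:: - c 5%N; c 4%N; - c 7%N]] i) j = 0.
      by have := H i j; rewrite !mxE.
    pose p0 := @Ordinal 3 0 isT; pose p1 := @Ordinal 3 1 isT; pose p2 := @Ordinal 3 2 isT.
    move=> [|[|[|[|[|[|[|[|//]]]]]]]] _.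
    + exact: (E p0 p1). + exact: (E p1 p2). + exact: (E p0 p2). + exact: (E p1 p0).
    + exact: (E p2 p1). + by apply/eqP; rewrite -oppr_eq0; apply/eqP; exact: (E p2 p0).
    + exact: (E p0 p0). + by apply/eqP; rewrite -oppr_eq0; apply/eqP; exact: (E p2 p2).
  - move=> j c; case: j => -[|[|[|[|//]]]] ?; apply/matrixP => -[[|[|[|//]]] ?] -[[|[|[|//]]] ?];
    rewrite !mxE !big_ord_recl !big_ord0 !mxE /=; rewrite /gc /rm /=; ring.
  - move=> A; split=> [hA|[c ->]]; last first.
      rewrite /sl_mx /= /mxtrace !big_ord_recl big_ord0 !mxE /=; ring.
    have [a eA] : exists a : nat -> nat -> K, A = \matrix_(i, j) a i j.
      by exists (fun k l => A (inord k) (inord l)); apply/matrixP => i j; rewrite mxE !inord_val.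
    move: hA; rewrite eA /sl_mx /= /mxtrace !big_ord_recl big_ord0 !mxE /= => ht.
    have {ht} : a 0%N 0%N + (a 1%N 1%N + (a 2%N 2%N + 0)) = 0 by exact: ht.
    rewrite addr0 addrA addrC => /eqP; rewrite addr_eq0 => /eqP ht.
    exists (nth 0 [:: a 0%N 1%N; a 1%N 2%N; a 0%N 2%N; a 1%N 0%N; a 2%N 1%N; - a 2%N 0%N; a 0%N 0%N; a 0%N 0%N + a 1%N 1%N]).
    apply/matrixP => -[[|[|[|//]]] ?] -[[|[|[|//]]] ?]; rewrite !mxE /= ?ht; ring.
apply: (lie_simple hL rowE gsE gen4 bot reach top); exists (h o0), (e o0); rewrite h0e0.
by move=> /eqP; rewrite scaler_eq0 (pnatr_eq0 K 2) => /eqP.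
Qed.
End A2.
End TypeA2.

End TypeA2Part.
Export TypeA2Part.

(** * Chevalley generators of type B_2 and symplectic matrices *)

Module TypeB2Part.

Definition mk {K : pzSemiRingType} n (rows : seq (seq K)) : 'M[K]_n :=
  \matrix_(i, j) nth 0 (nth [::] rows i) j.

Section TypeB2.
Context {K : numFieldType} {g : lmodType K} (br : g -> g -> g).
Hypothesis hL : is_lie_bracket br.
Context (e f h : 'I_2 -> g).
Local Notation o0 := (0%R : 'I_2).
Local Notation o1 := (1%R : 'I_2).
Hypothesis hh : forall i j, br (h i) (h j) = 0.
Hypothesis ef : forall i j, br (e i) (f j) = if i == j then h i else 0.
Hypothesis gen : forall P : set g, is_submod P -> (forall u v, P u -> P v -> P (br u v)) ->
  (forall i, P (e i) /\ P (f i)) -> P = setT.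
Hypothesis nz : e o0 <> 0.

Let gs (j : 'I_4) : g := nth 0 [:: e o0; e o1; f o0; f o1] j.
Let gen4 (P : set g) : is_submod P -> (forall u v, P u -> P v -> P (br u v)) ->
  (forall j, P (gs j)) -> P = setT.
Proof.
move=> h1 h2 h3; apply: gen => // i.
have g0 := h3 (@Ordinal 4 0 isT); have g1 := h3 (@Ordinal 4 1 isT).
have g2 := h3 (@Ordinal 4 2 isT); have g3 := h3 (@Ordinal 4 3 isT).
by case: i => -[|[|//]] p; [rewrite (_ : Ordinal p = o0) | rewrite (_ : Ordinal p = o1)] => //; exact: val_inj.
Qed.
Let fe i j : br (f i) (e j) = - (if i == j then h i else 0).
Proof. by rewrite (brC hL) ef eq_sym; case: eqP => // ->. Qed.

Section B2.
Hypothesis he : forall i j, br (h i) (e j) = (cartan_B2 i j)%:~R *: e j.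
Hypothesis hf : forall i j, br (h i) (f j) = - ((cartan_B2 i j)%:~R *: f j).
Hypothesis See : forall i j, i != j -> iter `|(1 - cartan_B2 i j)%R|%N (br (e i)) (e j) = 0.
Hypothesis Sff : forall i j, i != j -> iter `|(1 - cartan_B2 i j)%R|%N (br (f i)) (f j) = 0.

Let e01 := br (e o0) (e o1).
Let e001 := br (e o0) e01.
Let f01 := br (f o0) (f o1).
Let f001 := br (f o0) f01.
(** The first simple root is the short one, so the positive roots are
    $\alpha_0,\alpha_1,\alpha_0+\alpha_1,2\alpha_0+\alpha_1$, and [e001] is the highest root
    vector. *)
Let vs i : g := nth 0 [:: e o0; e o1; e01; e001; f o0; f o1; f01; f001; h o0; h o1] i.
Let rm (j : 'I_4) (c : nat -> K) : nat -> K :=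
  nth 0 (nth [::]
   [:: [:: - 2 * c 8%N + c 9%N; 0; c 1%N; c 2%N; 0; 2 * c 6%N; 2 * c 7%N; 0; c 4%N; 0];
       [:: 0; 2 * c 8%N - 2 * c 9%N; - c 0%N; 0; - c 6%N; 0; 0; 0; 0; c 5%N];
       [:: 0; 2 * c 2%N; 2 * c 3%N; 0; 2 * c 8%N - c 9%N; 0; c 5%N; c 6%N; - c 0%N; 0];
       [:: - c 2%N; 0; 0; 0; 0; - 2 * c 8%N + 2 * c 9%N; - c 4%N; 0; 0; - c 1%N]] j).
Let gc (j : 'I_4) (k : nat) : K := nth 0 (nth [::] [:: [:: 1]; [:: 0; 1]; [:: 0; 0; 0; 0; 1]; [:: 0; 0; 0; 0; 0; 1]] j) k.
Local Notation lc := (lcomb 10 vs).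

Let A00 : cartan_B2 o0 o0 = 2. Proof. by rewrite mxE. Qed.
Let A01 : cartan_B2 o0 o1 = -2. Proof. by rewrite mxE. Qed.
Let A10 : cartan_B2 o1 o0 = -1. Proof. by rewrite mxE. Qed.
Let A11 : cartan_B2 o1 o1 = 2. Proof. by rewrite mxE. Qed.
Let h0e0 : br (h o0) (e o0) = 2 *: e o0. Proof. by rewrite he A00. Qed.
Let h0e1 : br (h o0) (e o1) = - (2 *: e o1). Proof. by rewrite he A01 -scaleNr. Qed.
Let h1e0 : br (h o1) (e o0) = - e o0. Proof. by rewrite he A10 scaleN1r. Qed.
Let h1e1 : br (h o1) (e o1) = 2 *: e o1. Proof. by rewrite he A11. Qed.
Let h0f0 : br (h o0) (f o0) = - (2 *: f o0). Proof. by rewrite hf A00. Qed.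
Let h0f1 : br (h o0) (f o1) = 2 *: f o1. Proof. by rewrite hf A01 -scaleNr opprK. Qed.
Let h1f0 : br (h o1) (f o0) = f o0. Proof. by rewrite hf A10 scaleN1r opprK. Qed.
Let h1f1 : br (h o1) (f o1) = - (2 *: f o1). Proof. by rewrite hf A11. Qed.
Let e0f0 : br (e o0) (f o0) = h o0. Proof. by rewrite ef. Qed.
Let e0f1 : br (e o0) (f o1) = 0. Proof. by rewrite ef. Qed.
Let e1f0 : br (e o1) (f o0) = 0. Proof. by rewrite ef. Qed.
Let e1f1 : br (e o1) (f o1) = h o1. Proof. by rewrite ef. Qed.
Let f0e0 : br (f o0) (e o0) = - h o0. Proof. by rewrite fe. Qed.
Let f0e1 : br (f o0) (e o1) = 0. Proof. by rewrite fe oppr0. Qed.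
Let f1e0 : br (f o1) (e o0) = 0. Proof. by rewrite fe oppr0. Qed.
Let f1e1 : br (f o1) (e o1) = - h o1. Proof. by rewrite fe. Qed.
Let e0h i : br (e o0) (h i) = - br (h i) (e o0). Proof. exact: brC. Qed.
Let e1h i : br (e o1) (h i) = - br (h i) (e o1). Proof. exact: brC. Qed.
Let f0h i : br (f o0) (h i) = - br (h i) (f o0). Proof. exact: brC. Qed.
Let f1h i : br (f o1) (h i) = - br (h i) (f o1). Proof. exact: brC. Qed.
Let e1e0 : br (e o1) (e o0) = - e01. Proof. exact: brC. Qed.
Let f1f0 : br (f o1) (f o0) = - f01. Proof. exact: brC. Qed.
Let e0e0 := brxx hL (e o0). Let e1e1 := brxx hL (e o1).
Let f0f0 := brxx hL (f o0). Let f1f1 := brxx hL (f o1).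
Let tab1 := (h0e0, h0e1, h1e0, h1e1, h0f0, h0f1, h1f0, h1f1, e0f0, e0f1, e1f0, e1f1,
  f0e0, f0e1, f1e0, f1e1, e0e0, e1e1, f0f0, f1f1, e1e0, f1f0).
Let tab2 := (e0h, e1h, f0h, f1h).
Let e0e001 : br (e o0) e001 = 0. Proof. by have := @See o0 o1 isT; rewrite A01. Qed.
Let f0f001 : br (f o0) f001 = 0. Proof. by have := @Sff o0 o1 isT; rewrite A01. Qed.
Let e1e01 : br (e o1) e01 = 0.
Proof. by have := @See o1 o0 isT; rewrite A10 /= e1e0 (brE hL) => /eqP; rewrite oppr_eq0 => /eqP. Qed.
Let f1f01 : br (f o1) f01 = 0.
Proof. by have := @Sff o1 o0 isT; rewrite A10 /= f1f0 (brE hL) => /eqP; rewrite oppr_eq0 => /eqP. Qed.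
Let e1e001 : br (e o1) e001 = 0.
Proof. by rewrite /e001 (jac hL) e1e01 e1e0 (brE hL) (brxx hL) oppr0 (br0r hL) addr0. Qed.
Let f1f001 : br (f o1) f001 = 0.
Proof. by rewrite /f001 (jac hL) f1f01 f1f0 (brE hL) (brxx hL) oppr0 (br0r hL) addr0. Qed.
Let e0f01 : br (e o0) f01 = 2 *: f o1.
Proof. by rewrite /f01 (jac hL) e0f0 e0f1 h0f1 (br0r hL) addr0. Qed.
Let e1f01 : br (e o1) f01 = - f o0.
Proof. by rewrite /f01 (jac hL) e1f0 e1f1 f0h h1f0 (br0l hL) add0r. Qed.
Let f0e01 : br (f o0) e01 = 2 *: e o1.
Proof. by rewrite /e01 (jac hL) f0e0 f0e1 (br0r hL) addr0 (brNl hL) h0e1 opprK. Qed.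
Let f1e01 : br (f o1) e01 = - e o0.
Proof. by rewrite /e01 (jac hL) f1e0 f1e1 (br0l hL) add0r (brNr hL) e0h opprK h1e0. Qed.
Let h0e01 : br (h o0) e01 = 0.
Proof. by rewrite /e01 (jac hL) h0e0 h0e1 ?(brE hL) subrr. Qed.
Let h0f01 : br (h o0) f01 = 0.
Proof. by rewrite /f01 (jac hL) h0f0 h0f1 ?(brE hL) addNr. Qed.
Let e0f001 : br (e o0) f001 = 2 *: f01.
Proof. by rewrite /f001 (jac hL) e0f0 e0f01 h0f01 (brZr hL) add0r. Qed.
Let f0e001 : br (f o0) e001 = 2 *: e01.
Proof. by rewrite /e001 (jac hL) f0e0 f0e01 (brNl hL) h0e01 oppr0 add0r (brZr hL). Qed.
Let e1f001 : br (e o1) f001 = 0.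
Proof. by rewrite /f001 (jac hL) e1f0 e1f01 (brE hL) (brE hL) f0f0 oppr0 addr0. Qed.
Let f1e001 : br (f o1) e001 = 0.
Proof. by rewrite /e001 (jac hL) f1e0 f1e01 (brE hL) (brE hL) e0e0 oppr0 addr0. Qed.
Let e0e01 : br (e o0) e01 = e001. Proof. by []. Qed.
Let f0f01 : br (f o0) f01 = f001. Proof. by []. Qed.
Let tab3 := (e0e001, f0f001, e1e001, f1f001, e1e01, f1f01, e0f01, e1f01, f0e01, f1e01,
  e0f001, f0e001, e1f001, f1e001).

Let rowE j c : br (gs j) (lc c) = lc (rm j c).
Proof.
case: j => -[|[|[|[|//]]]] p; rewrite /lcomb /gs /rm /=.
all: rewrite ?(brE hL) ?tab3 ?tab2 ?tab1; lin_comb K g.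
Qed.
Let gsE j : gs j = lc (gc j).
Proof.
by case: j => -[|[|[|[|//]]]] p; rewrite /lcomb /gs /gc /vs /= ?scale0r ?scale1r ?add0r ?addr0.
Qed.

Let bot (I : set g) : is_submod I -> (forall u v, I v -> I (br u v)) ->
  forall c, I (lc c) -> c 7%N = 0 \/ I e001.
Proof.
move=> sI iI c hc; have [c0|c0] := eqVneq (c 7%N) 0; [by left | right].
have T v : I v -> I (br e001 v) by exact: iI.
have e01T v : br e01 v = br (e o0) (br (e o1) v) - br (e o1) (br (e o0) v) by exact: jacl.
have e001T v : br e001 v = br (e o0) (br e01 v) - br e01 (br (e o0) v) by exact: jacl.
(* As in type A_2, bracketing twice with [e001] isolates the lowest root vector [f001], which goes
   to -8 times [e001]. *)
have Tr b : br e001 (lc b) = lc (nth 0 [:: - 2 * b 6%N; 0; - 2 * b 4%N; - 2 * b 8%N; 0; 0; 0; 0; 4 * b 7%N; 4 * b 7%N]).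
  rewrite /lcomb /vs /= ?(brE hL) ?e001T ?e01T; do 5 rewrite ?(brE hL) ?tab3 ?tab2 ?tab1 ?e01T.
  lin_comb K g.
have := T _ (T _ hc); rewrite !Tr /=.
have -> : lc (nth 0 [:: - 2 * 0; 0; - 2 * 0; - 2 * (4 * c 7%N); 0; 0; 0; 0; 4 * 0; 4 * 0]) = (- 8 * c 7%N) *: e001.
  by rewrite /lcomb /vs /=; lin_comb K g.
move=> hI; have [I0 IP] := sI; have := IP (- 8 * c 7%N)^-1 _ _ hI I0.
rewrite addr0 scalerA mulVf ?scale1r // mulf_neq0 // oppr_eq0; by rewrite (pnatr_eq0 K 8).
Qed.

Let reach c : (forall l, foldr rm c l 7%N = 0) -> forall i, (i < 10)%N -> c i = 0.
Proof.
pose j0 := @Ordinal 4 0 isT; pose j1 := @Ordinal 4 1 isT; pose j2 := @Ordinal 4 2 isT; pose j3 := @Ordinal 4 3 isT.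
move=> H; have two : 2 != 0 :> K by by rewrite (pnatr_eq0 K 2).
have four : 4 != 0 :> K by by rewrite (pnatr_eq0 K 4).
have R2 := ((fun c => erefl : rm j2 c 0%N = 0), (fun c => erefl : rm j2 c 1%N = 2 * c 2%N), (fun c => erefl : rm j2 c 2%N = 2 * c 3%N), (fun c => erefl : rm j2 c 3%N = 0), (fun c => erefl : rm j2 c 4%N = 2 * c 8%N - c 9%N), (fun c => erefl : rm j2 c 5%N = 0), (fun c => erefl : rm j2 c 6%N = c 5%N), (fun c => erefl : rm j2 c 7%N = c 6%N), (fun c => erefl : rm j2 c 8%N = - c 0%N), (fun c => erefl : rm j2 c 9%N = 0)).
have R3 := ((fun c => erefl : rm j3 c 0%N = - c 2%N), (fun c => erefl : rm j3 c 1%N = 0), (fun c => erefl : rm j3 c 2%N = 0), (fun c => erefl : rm j3 c 3%N = 0), (fun c => erefl : rm j3 c 4%N = 0), (fun c => erefl : rm j3 c 5%N = - 2 * c 8%N + 2 * c 9%N), (fun c => erefl : rm j3 c 6%N = - c 4%N), (fun c => erefl : rm j3 c 7%N = 0), (fun c => erefl : rm j3 c 8%N = 0), (fun c => erefl : rm j3 c 9%N = - c 1%N)).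
have h7 : (c) 7%N = 0 := H [:: ].
have h6 : (rm j2 c) 7%N = 0 := H [:: j2].
have h5 : (rm j2 (rm j2 c)) 7%N = 0 := H [:: j2; j2].
have h4 : (rm j2 (rm j3 c)) 7%N = 0 := H [:: j2; j3].
have h8 : (rm j2 (rm j3 (rm j2 c))) 7%N = 0 := H [:: j2; j3; j2].
have h9 : (rm j2 (rm j2 (rm j3 c))) 7%N = 0 := H [:: j2; j2; j3].
have h0 : (rm j2 (rm j3 (rm j2 (rm j2 c)))) 7%N = 0 := H [:: j2; j3; j2; j2].
have h1 : (rm j2 (rm j2 (rm j3 (rm j3 c)))) 7%N = 0 := H [:: j2; j2; j3; j3].
have h2 : (rm j2 (rm j3 (rm j2 (rm j2 (rm j3 c))))) 7%N = 0 := H [:: j2; j3; j2; j2; j3].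
have h3 : (rm j2 (rm j3 (rm j2 (rm j2 (rm j3 (rm j2 c)))))) 7%N = 0 := H [:: j2; j3; j2; j2; j3; j2].
pose R := (R2, R3); rewrite ?R in h0 h1 h2 h3 h4 h5 h6 h7 h8 h9.
have ne (k x : K) : k != 0 -> k * x = 0 -> x = 0 by move=> k0 /eqP; rewrite mulf_eq0 (negPf k0) => /eqP.
have e8 : c 8%N = 0.
  apply: (ne 2) => //; have -> : 2 * c 8%N = (- 2 * c 8%N + 2 * c 9%N) - 2 * (- (2 * c 8%N - c 9%N)) by ring.
  by rewrite h9 h8 mulr0 subrr.
have e9 : c 9%N = 0 by apply: (ne 2) => //; rewrite -h9 e8; ring.
move=> [|[|[|[|[|[|[|[|[|[|//]]]]]]]]]] _ //.
- by apply: (ne 2) => //; rewrite -h0; ring.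
- by apply: (ne 2) => //; rewrite -[RHS]oppr0 -h1; ring.
- by apply: (ne 2) => //; rewrite -[RHS]oppr0 -h2; ring.
- by apply: (ne 4) => //; rewrite -[RHS]oppr0 -h3; ring.
- by rewrite -[RHS]oppr0 -h4 opprK.
Qed.

Let top (I : set g) : is_submod I -> (forall u v, I v -> I (br u v)) ->
  I e001 -> forall j, I (gs j).
Proof.
move=> [I0 IP] iI h1; have IZ (k : K) v : k != 0 -> I (k *: v) -> I v.
  by move=> k0 hv; have := IP k^-1 _ _ hv I0; rewrite addr0 scalerA mulVf ?scale1r.
have two : 2 != 0 :> K by by rewrite (pnatr_eq0 K 2).
have IN v : I (- v) -> I v by rewrite -scaleN1r; apply: IZ; rewrite oppr_eq0 oner_eq0.
have i01 : I e01 by apply: (IZ 2) => //; rewrite -f0e001; exact: iI.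
have i1 : I (e o1) by apply: (IZ 2) => //; rewrite -f0e01; exact: iI.
have i0 : I (e o0) by apply: IN; rewrite -f1e01; exact: iI.
have k0 : I (h o0) by apply: IN; rewrite -f0e0; exact: iI.
have k1 : I (h o1) by apply: IN; rewrite -f1e1; exact: iI.
have l1 : I (f o1) by apply: (IZ 2) => //; apply: IN; rewrite -h0f1 -f1h; exact: iI.
have l0 : I (f o0) by apply: IN; rewrite -h1f0 -f0h; exact: iI.
by case=> -[|[|[|[|//]]]].
Qed.

(** Symplectic matrices in the block form with diagonal blocks $A$ and $-A^T$ and symmetric
    off-diagonal blocks. The factors 2 come from the double brackets [e001] and [f001]. *)
Let rows (c : nat -> K) := [:: [:: c 8%N; c 0%N; 2 * c 3%N; c 2%N]; [:: c 4%N; c 9%N - c 8%N; c 2%N; c 1%N];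
   [:: 2 * c 7%N; - c 6%N; - c 8%N; - c 4%N]; [:: - c 6%N; c 5%N; - c 0%N; c 8%N - c 9%N]].
Let th (c : nat -> K) : 'M[K]_4 := mk 4 (rows c).

Lemma sp4E A : sp4_mx K A <-> exists c, A = th c.
Proof.
have J : block_mx 0 1%:M (- 1%:M) 0 = mk 4 [:: [:: 0; 0; 1; 0]; [:: 0; 0; 0; 1]; [:: -1; 0; 0; 0]; [:: 0; -1; 0; 0]] :> 'M[K]_(2 + 2).
  apply/matrixP => i j; case: (split_ordP i) => i' ->; case: (split_ordP j) => j' ->;
  rewrite ?(block_mxEul, block_mxEur, block_mxEdl, block_mxEdr) !mxE;
  case: i' => -[|[|//]] ?; case: j' => -[|[|//]] ? /=; rewrite ?oppr0 //.
rewrite /sp4_mx J; split=> [hA|[c ->]]; last first.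
  apply/matrixP => -[[|[|[|[|//]]]] ?] -[[|[|[|[|//]]]] ?];
  rewrite !mxE !big_ord_recl !big_ord0 !mxE /=; ring.
have [a eA] : exists a : nat -> nat -> K, A = \matrix_(i, j) a i j.
  by exists (fun k l => A (inord k) (inord l)); apply/matrixP => i j; rewrite mxE !inord_val.
move: hA; rewrite eA /= => /matrixP hA.
pose p0 := @Ordinal 4 0 isT; pose p1 := @Ordinal 4 1 isT; pose p2 := @Ordinal 4 2 isT; pose p3 := @Ordinal 4 3 isT.
have two : 2 != 0 :> K by by rewrite (pnatr_eq0 K 2).
have h02 := hA p0 p2; have h03 := hA p0 p3; have h12 := hA p1 p2; have h13 := hA p1 p3.
have h01 := hA p0 p1; have h23 := hA p2 p3.
rewrite !mxE !big_ord_recl !big_ord0 !mxE /= /bump /= in h02 h03 h12 h13 h01 h23.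
have z (x y : K) : x - y = 0 -> x = y by move=> /eqP; rewrite subr_eq0 => /eqP.
have q22 : a 2%N 2%N = - a 0%N 0%N by apply: z; rewrite -h02; ring.
have q32 : a 3%N 2%N = - a 0%N 1%N by apply: z; rewrite -h12; ring.
have q23 : a 2%N 3%N = - a 1%N 0%N by apply: z; rewrite -h03; ring.
have q33 : a 3%N 3%N = - a 1%N 1%N by apply: z; rewrite -h13; ring.
have q30 : a 3%N 0%N = a 2%N 1%N by apply: z; rewrite -[RHS]oppr0 -h01; ring.
have q12 : a 1%N 2%N = a 0%N 3%N by apply: z; rewrite -h23; ring.
exists (nth 0 [:: a 0%N 1%N; a 1%N 3%N; a 0%N 3%N; a 0%N 2%N / 2; a 1%N 0%N; a 3%N 1%N; - a 2%N 1%N; a 2%N 0%N / 2;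
   a 0%N 0%N; a 0%N 0%N + a 1%N 1%N]).
apply/matrixP => -[[|[|[|[|//]]]] ?] -[[|[|[|[|//]]]] ?]; rewrite !mxE /= ?q22 ?q32 ?q23 ?q33 ?q30 ?q12;
by field.
Qed.

Lemma typeB2 : lie_iso_mx br (sp4_mx K) /\ simple_lie br.
Proof.
have nz' : exists u : g, u <> 0 by exists (e o0).
split.
  apply: (lie_iso hL rowE gsE gen4 bot reach top nz' (th := th)); last exact: sp4E.
  - by move=> c c' H; rewrite /th /rows !H.
  - move=> a c c'; apply/matrixP => -[[|[|[|[|//]]]] ?] -[[|[|[|[|//]]]] ?]; rewrite !mxE /=; ring.
  - move=> c /matrixP H; have E (i j : 'I_4) : nth 0 (nth [::] (rows c) i) j = 0.
      by have := H i j; rewrite !mxE.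
    pose p0 := @Ordinal 4 0 isT; pose p1 := @Ordinal 4 1 isT; pose p2 := @Ordinal 4 2 isT; pose p3 := @Ordinal 4 3 isT.
    have ne (x : K) : 2 * x = 0 -> x = 0 by move=> /eqP; rewrite mulf_eq0 (pnatr_eq0 K 2) => /eqP.
    have c8 : c 8%N = 0 := E p0 p0.
    move=> [|[|[|[|[|[|[|[|[|[|//]]]]]]]]]] _.
    + exact: (E p0 p1). + exact: (E p1 p3). + exact: (E p0 p3). + exact: (ne _ (E p0 p2)).
    + exact: (E p1 p0). + exact: (E p3 p1). + by apply/eqP; rewrite -oppr_eq0; apply/eqP; exact: (E p2 p1).
    + exact: (ne _ (E p2 p0)). + exact: c8.
    + by have := E p1 p1; rewrite /= c8 subr0.
  - move=> j c; case: j => -[|[|[|[|//]]]] ?; apply/matrixP => -[[|[|[|[|//]]]] ?] -[[|[|[|[|//]]]] ?];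
    rewrite !mxE !big_ord_recl !big_ord0 !mxE /=; rewrite /gc /rm /=; ring.
apply: (lie_simple hL rowE gsE gen4 bot reach top); exists (h o0), (e o0); rewrite h0e0.
by move=> /eqP; rewrite scaler_eq0 (pnatr_eq0 K 2) => /eqP.
Qed.
End B2.
End TypeB2.

End TypeB2Part.
Export TypeB2Part.

(** * Weights of the sl_2-triple, and projection to weight spaces *)

Module WeightsPart.

Section Pack.
Context {K : numFieldType} {g : lmodType K} (br : g -> g -> g).
Hypothesis hL : is_lie_bracket br.
Context (e0 e1 f0 f1 h0 h1 : g) (A : 'M[int]_2) (a b : nat).
Local Notation o0 := (0%R : 'I_2).
Local Notation o1 := (1%R : 'I_2).
Hypothesis A00 : A o0 o0 = 2.
Hypothesis A11 : A o1 o1 = 2.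
Hypothesis A01 : A o0 o1 = - a%:Z.
Hypothesis A10 : A o1 o0 = - b%:Z.

Definition two_fun (u v : g) (i : 'I_2) : g := if i == 0 then u else v.

Let absA n : `|(1 - - n%:Z)%R|%N = n.+1. Proof. by rewrite opprK. Qed.

Lemma ord2_ind (P : 'I_2 -> Prop) : P o0 -> P o1 -> forall i, P i.
Proof.
by move=> h h' [[|[|//]] p]; [rewrite (_ : Ordinal p = o0) | rewrite (_ : Ordinal p = o1)] => //; exact: val_inj.
Qed.

Lemma chevalley_pack :
  br h0 h1 = 0 -> br e0 f0 = h0 -> br e0 f1 = 0 -> br e1 f0 = 0 -> br e1 f1 = h1 ->
  br h0 e0 = 2 *: e0 -> br h0 e1 = (- a%:R) *: e1 -> br h1 e0 = (- b%:R) *: e0 -> br h1 e1 = 2 *: e1 ->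
  br h0 f0 = - (2 *: f0) -> br h0 f1 = a%:R *: f1 -> br h1 f0 = b%:R *: f0 -> br h1 f1 = - (2 *: f1) ->
  iter a.+1 (br e0) e1 = 0 -> iter b.+1 (br e1) e0 = 0 ->
  iter a.+1 (br f0) f1 = 0 -> iter b.+1 (br f1) f0 = 0 ->
  (forall P : set g, is_submod P -> (forall u v, P u -> P v -> P (br u v)) ->
       P e0 -> P e1 -> P f0 -> P f1 -> P = setT) ->
  let e := two_fun e0 e1 in let f := two_fun f0 f1 in let h := two_fun h0 h1 in
    (forall i j, br (h i) (h j) = 0) /\
    (forall i j, br (e i) (f j) = if i == j then h i else 0) /\
    (forall i j, br (h i) (e j) = (A i j)%:~R *: e j) /\
    (forall i j, br (h i) (f j) = - ((A i j)%:~R *: f j)) /\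
    (forall i j, i != j -> iter `|(1 - A i j)%R|%N (br (e i)) (e j) = 0) /\
    (forall i j, i != j -> iter `|(1 - A i j)%R|%N (br (f i)) (f j) = 0) /\
    (forall P : set g, is_submod P -> (forall u v, P u -> P v -> P (br u v)) ->
       (forall i, P (e i) /\ P (f i)) -> P = setT).
Proof.
move=> hh *; split.
  by apply: ord2_ind; apply: ord2_ind => //=; rewrite ?(brxx hL) // (brC hL) hh oppr0.
split; first by apply: ord2_ind; apply: ord2_ind.
split.
  by apply: ord2_ind; apply: ord2_ind; rewrite ?A00 ?A11 ?A01 ?A10 ?rmorphN.
split.
  by apply: ord2_ind; apply: ord2_ind; rewrite ?A00 ?A11 ?A01 ?A10 ?rmorphN ?scaleNr ?opprK.
split; first by apply: ord2_ind; apply: ord2_ind => // _; rewrite ?A01 ?A10 absA.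
split; first by apply: ord2_ind; apply: ord2_ind => // _; rewrite ?A01 ?A10 absA.
by move=> P hP hb hg; have [? ?] := hg o0; have [? ?] := hg o1; eauto.
Qed.

End Pack.

Section Weights.
Context {K : numFieldType} {g : lmodType K} (br : g -> g -> g).
Hypothesis hL : is_lie_bracket br.
Context (d : nat) (q Q e : g) (a : nat -> g).
Hypothesis hqQ : br q Q = e.
Hypothesis heQ : br e Q = 2 *: Q.
Hypothesis heq : br e q = - (2 *: q).
Hypothesis hQa : forall i, br Q (a i) = - (i.+1%:R *: a i.+1).
Hypothesis hqa : forall i, br q (a i.+1) = (d - i)%:R *: a i.
Hypothesis hqa0 : br q (a 0) = 0.
Hypothesis span : forall P : set g, is_submod P -> P q -> P Q -> P e ->
  (forall i, (i <= d)%N -> P (a i)) -> P = setT.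

(** Since e is the bracket of q and Q, it acts on $a_i$ by $-(i+1)(d-i)+i(d-i+1)=2i-d$. *)
Lemma hea i : (i <= d)%N -> br e (a i) = ((2 * i)%:Z - d%:Z)%:~R *: a i.
Proof.
move=> le; rewrite -hqQ (jacl hL) hQa (brNr hL) (brZr hL) hqa rmorphB /=.
case: i le => [|i] le; first by rewrite hqa0 (br0r hL) subr0 subn0 muln0 sub0r scale1r scaleNr.
have [m em] : exists m, d = (m + i.+1)%N by exists (d - i.+1)%N; rewrite subnK.
rewrite hqa (brZr hL) hQa (_ : (d - i.+1)%N = m); last by rewrite em addnK.
rewrite (_ : (d - i)%N = m.+1); last by rewrite em; lia.
rewrite -rmorphB (_ : (2 * i.+1)%:Z - d%:Z = i%:Z + 1 - m%:Z); last by rewrite em; lia.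
rewrite rmorphB rmorphD /= -!pmulrn.
lin_comb K g.
Qed.

(** The product of the operators $\mathrm{ad}\,e-m$ over m in [ms] kills the spanning vectors of
    these weights and maps the others into S, so it maps everything into S. On u it is a nonzero
    scalar, as n is not in [ms]. *)
Lemma weight_in (S : set g) (n : int) (ms : seq int) u :
  is_submod S -> n \notin ms -> (-2 \in ms \/ S q) -> (2 \in ms \/ S Q) -> (0 \in ms \/ S e) ->
  (forall i, (i <= d)%N -> (2 * i)%:Z - d%:Z \in ms \/ S (a i)) ->
  br e u = n%:~R *: u -> S u.
Proof.
move=> sS nms hq hQ he ha hu; have [S0 SP] := sS.
pose op v := foldr (fun m v => br e v - m%:~R *: v) v ms.
have op_lin k v v' : op (k *: v + v') = k *: op v + op v'.
  rewrite /op; elim: ms {nms hq hQ he ha op} => //= m ms ->.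
  rewrite (brPr hL); lin_comb K g.
have op_eig (m : int) v : br e v = m%:~R *: v -> op v = (\prod_(x <- ms) (m - x))%:~R *: v.
  move=> hv; rewrite /op; elim: ms {nms hq hQ he ha op op_lin} => [|x ms IH] /=; first by rewrite big_nil scale1r.
  rewrite big_cons IH (brZr hL) hv rmorphM rmorphB /=; lin_comb K g.
have SZ k v : S v -> S (k *: v) by move=> hv; have := SP k _ _ hv S0; rewrite addr0.
have op_S (m : int) v : br e v = m%:~R *: v -> m \in ms \/ S v -> S (op v).
  move=> hv [hm|hs]; last by rewrite (op_eig _ _ hv); exact: SZ.
  rewrite (op_eig _ _ hv) (_ : \prod_(x <- ms) (m - x) = 0) ?scale0r //.
  by rewrite (big_rem m) //= subrr mul0r.
have all_op v : S (op v).
  suff e1 : [set v | S (op v)]%classic = setT by have : [set v | S (op v)]%classic v by rewrite e1.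
  apply: span.
  - split=> [|k v1 v2 h1 h2]; last by rewrite /= op_lin; exact: SP.
    have := op_lin (-1) 0 0; rewrite scaler0 addr0 scaleN1r addNr /= => ->; exact: S0.
  - by apply: op_S hq; rewrite heq -scaleNr.
  - exact: op_S hQ.
  - by apply: op_S he; rewrite (brxx hL) scale0r.
  - by move=> i le; apply: op_S (ha i le); exact: hea.
have := all_op u; rewrite (op_eig _ _ hu) => /(SZ (\prod_(x <- ms) (n - x))%:~R^-1).
rewrite scalerA mulVf ?scale1r // intr_eq0 prodf_seq_neq0; apply/allP => x hx /=.
by rewrite subr_eq0; apply: contraNneq nms => ->.
Qed.

Lemma weight_br u v (m n : int) : br e u = m%:~R *: u -> br e v = n%:~R *: v ->
  br e (br u v) = (m + n)%:~R *: br u v.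
Proof. by move=> hu hv; rewrite (jac hL) hu hv !(brE hL) rmorphD scalerDl. Qed.

Lemma submod0 : is_submod ([set 0]%classic : set g).
Proof. by split=> // k u v -> ->; rewrite scaler0 addr0. Qed.
Lemma submod2 (v1 v2 : g) : is_submod [set u | exists x y, u = x *: v1 + y *: v2]%classic.
Proof.
split=> [|k u v [x [y ->]] [x' [y' ->]]]; first by exists 0, 0; rewrite !scale0r addr0.
by exists (k * x + x'), (k * y + y'); lin_comb K g.
Qed.
Lemma submod2l (v1 v2 : g) : exists x y : K, v1 = x *: v1 + y *: v2.
Proof. by exists 1, 0; rewrite scale1r scale0r addr0. Qed.
Lemma submod2r (v1 v2 : g) : exists x y : K, v2 = x *: v1 + y *: v2.
Proof. by exists 0, 1; rewrite scale1r scale0r add0r. Qed.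

End Weights.

Lemma lin_from {K : fieldType} {g : lmodType K} (k : K) (A B u v : g) :
  A = B -> u - v = k *: (A - B) -> u = v.
Proof. by move=> ->; rewrite subrr scaler0 => /eqP; rewrite subr_eq0 => /eqP. Qed.

End WeightsPart.
Export WeightsPart.

(** * The bracket table for d = 4 *)

Module TableA2Part.

Section TableA2.
Context {K : numFieldType} {g : lmodType K} (br : g -> g -> g).
Hypothesis hL : is_lie_bracket br.
Context (q Q e : g) (a : nat -> g).
Hypothesis hqQ : br q Q = e.
Hypothesis heQ : br e Q = 2 *: Q.
Hypothesis heq : br e q = - (2 *: q).
Hypothesis hQa : forall i, br Q (a i) = - (i.+1%:R *: a i.+1).
Hypothesis had : a 5 = 0.
Hypothesis hqa : forall i, br q (a i.+1) = (4 - i)%:R *: a i.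
Hypothesis hqa0 : br q (a 0) = 0.
Hypothesis span : forall P : set g, is_submod P -> P q -> P Q -> P e ->
  (forall i, (i <= 4)%N -> P (a i)) -> P = setT.
Hypothesis Q0 : Q <> 0.
Hypothesis a4a1 : br (a 4) (a 1) <> 0.

Let wt i (le : (i <= 4)%N) := hea hL hqQ hQa hqa hqa0 le.
Let win := weight_in hL hqQ heQ heq hQa hqa hqa0 span.

Let Qa4 : br Q (a 4) = 0. Proof. by rewrite hQa had scaler0 oppr0. Qed.
Let Qe : br Q e = - (2 *: Q). Proof. by rewrite (brC hL) heQ. Qed.
Let qe : br q e = 2 *: q. Proof. by rewrite (brC hL) heq opprK. Qed.
Let qa1 : br q (a 1) = 4 *: a 0. Proof. exact: hqa. Qed.
Let qa2 : br q (a 2) = 3 *: a 1. Proof. exact: hqa. Qed.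
Let qa3 : br q (a 3) = 2 *: a 2. Proof. exact: hqa. Qed.
Let qa4 : br q (a 4) = 1 *: a 3. Proof. exact: hqa. Qed.
Let Qa0 : br Q (a 0) = - (1 *: a 1). Proof. exact: hQa. Qed.
Let Qa1 : br Q (a 1) = - (2 *: a 2). Proof. exact: hQa. Qed.
Let Qa2 : br Q (a 2) = - (3 *: a 3). Proof. exact: hQa. Qed.
Let Qa3 : br Q (a 3) = - (4 *: a 4). Proof. exact: hQa. Qed.
Let tab0 := (hqQ, heQ, heq, Qa4, Qe, qe, hqa0, qa1, qa2, qa3, qa4, Qa0, Qa1, Qa2, Qa3).

Let a4_neq0 : a 4 <> 0. Proof. by move=> h; apply: a4a1; rewrite h (br0l hL). Qed.
Let Z1 (x : K) (v : g) : v <> 0 -> x *: v = 0 -> x = 0.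
Proof. by move=> v0 /eqP; rewrite scaler_eq0 => /orP[/eqP|/eqP]. Qed.

(** The bracket has weight 6, which does not occur. *)
Let T1 : br (a 4) (a 3) = 0.
Proof.
apply: (win (S := [set 0]%classic) (n := 6) (ms := [:: -4; -2; 0; 2; 4])); rewrite ?submod0 //; try by left.
- exact: submod0.
- by case=> [|[|[|[|[|//]]]]] _; left.
- by rewrite (weight_br hL (wt (isT : 4 <= 4)%N) (wt (isT : 3 <= 4)%N)).
Qed.
Let T2 : br (a 4) (a 2) = 0.
Proof.
have := congr1 (br q) T1; rewrite (jac hL) ?tab0 ?(brE hL) ?(brxx hL) /= => h.
by apply: (lin_from (k := 2^-1) h); lin_comb K g by field.
Qed.

(** The bracket has weight 2, so it is a combination of Q and $a_3$. Bracketing with Q gives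
    $-2[a_4,a_2]=0$, whereas it sends $a_3$ to $-4a_4\ne0$; so $a_3$ does not occur. *)
Lemma a4a1_Q : exists2 k : K, k != 0 & br (a 4) (a 1) = k *: Q.
Proof.
have [x [y E]] : exists x y : K, br (a 4) (a 1) = x *: Q + y *: a 3.
  apply: (win (S := [set u | exists x y : K, u = x *: Q + y *: a 3]%classic) (n := 2) (ms := [:: -4; -2; 0; 4])); try by left.
  - exact: submod2.
  - by [].
  - by right; exact: submod2l.
  - by case=> [|[|[|[|[|//]]]]] _; try (by left); right; exact: submod2r.
  - by rewrite (weight_br hL (wt (isT : 4 <= 4)%N) (wt (isT : 1 <= 4)%N)).
have := congr1 (br Q) E; rewrite (jac hL) ?tab0 ?(brE hL) T2 ?(brxx hL) ?tab0 => h.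
have y0 : y = 0.
  by apply: (Z1 a4_neq0); apply: (lin_from (k := 4^-1) h); lin_comb K g by field.
rewrite y0 scale0r addr0 in E; exists x => //.
by apply/eqP => x0; apply: a4a1; rewrite E x0 scale0r.
Qed.

Section Chevalley.
Context (k mu : K).
Hypothesis mu0 : mu != 0.
Hypothesis kE : k = mu ^- 2.
Hypothesis T3 : br (a 4) (a 1) = k *: Q.

Let T4 : br (a 4) (a 0) = (k / 2) *: e.
Proof.
have [x [y E]] : exists x y : K, br (a 4) (a 0) = x *: e + y *: a 2.
  apply: (win (S := [set u | exists x y : K, u = x *: e + y *: a 2]%classic) (n := 0) (ms := [:: -4; -2; 2; 4])); try by left.
  - exact: submod2.
  - by [].
  - by right; exact: submod2l.
  - by case=> [|[|[|[|[|//]]]]] _; try (by left); right; exact: submod2r.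
  - by rewrite (weight_br hL (wt (isT : 4 <= 4)%N) (wt (isT : 0 <= 4)%N)).
have h := congr1 (br Q) E; rewrite (jac hL) ?tab0 ?(brE hL) T3 ?tab0 ?(brE hL) in h.
have h' := congr1 (br Q) h; rewrite ?(brE hL) ?tab0 ?(brxx hL) ?(brE hL) ?tab0 in h'.
have y0 : y = 0.
  by apply: (Z1 a4_neq0); apply: (lin_from (k := - 12^-1) h'); lin_comb K g by field.
rewrite y0 scale0r addr0 in E h.
have x0 : 2 * x - k = 0.
  by apply: (Z1 Q0); apply: (lin_from (k := 1) h); lin_comb K g by field.
rewrite E; congr (_ *: _); move/eqP: x0; rewrite subr_eq0 => /eqP <-; by field.
Qed.
Let T5 : br (a 3) (a 1) = - k *: e.
Proof.
have h := congr1 (br q) T3; rewrite (jac hL) ?tab0 ?(brE hL) T4 ?tab0 /= in h.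
by apply: (lin_from (k := 1) h); lin_comb K g by field.
Qed.
Let T7 : br (a 3) (a 0) = k *: q.
Proof.
have h := congr1 (br q) T4; rewrite (jac hL) ?tab0 ?(brE hL) ?tab0 /= in h.
by apply: (lin_from (k := 1) h); lin_comb K g by field.
Qed.
Let T6 : br (a 3) (a 2) = (- 3 * k) *: Q.
Proof.
have h := congr1 (br q) T2; rewrite (jac hL) ?tab0 ?(brE hL) T3 /= in h.
by apply: (lin_from (k := 1) h); lin_comb K g by field.
Qed.
Let T8 : br (a 2) (a 1) = (- 3 * k) *: q.
Proof.
have h := congr1 (br q) T5; rewrite (jac hL) ?tab0 ?(brE hL) T7 ?tab0 /= in h.
by apply: (lin_from (k := 2^-1) h); lin_comb K g by field.
Qed.
Let T9 : br (a 2) (a 0) = 0.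
Proof.
have h := congr1 (br q) T8; rewrite (jac hL) ?tab0 ?(brE hL) ?(brxx hL) /= in h.
by apply: (lin_from (k := 4^-1) h); lin_comb K g by field.
Qed.
Let T10 : br (a 1) (a 0) = 0.
Proof.
have h := congr1 (br q) T9; rewrite (jac hL) ?tab0 ?(brE hL) /= in h.
by apply: (lin_from (k := 3^-1) h); lin_comb K g by field.
Qed.
Let wt0 : br e (a 0) = (-4) *: a 0. Proof. by rewrite wt. Qed.
Let wt1 : br e (a 1) = (-2) *: a 1. Proof. by rewrite wt. Qed.
Let wt2 : br e (a 2) = 0. Proof. by rewrite wt // scale0r. Qed.
Let wt3 : br e (a 3) = 2 *: a 3. Proof. by rewrite wt. Qed.
Let wt4 : br e (a 4) = 4 *: a 4. Proof. by rewrite wt. Qed.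
Let aq0 : br (a 0) q = 0. Proof. by rewrite (brC hL) hqa0 oppr0. Qed.
Let Qq : br Q q = - e. Proof. by rewrite (brC hL) hqQ. Qed.
Let aq1 : br (a 1) q = - (4 *: a 0). Proof. by rewrite (brC hL) qa1. Qed.
Let aq2 : br (a 2) q = - (3 *: a 1). Proof. by rewrite (brC hL) qa2. Qed.
Let aq3 : br (a 3) q = - (2 *: a 2). Proof. by rewrite (brC hL) qa3. Qed.
Let aq4 : br (a 4) q = - (1 *: a 3). Proof. by rewrite (brC hL) qa4. Qed.
Let aQ0 : br (a 0) Q = 1 *: a 1. Proof. by rewrite (brC hL) Qa0 opprK. Qed.
Let aQ1 : br (a 1) Q = 2 *: a 2. Proof. by rewrite (brC hL) Qa1 opprK. Qed.
Let aQ2 : br (a 2) Q = 3 *: a 3. Proof. by rewrite (brC hL) Qa2 opprK. Qed.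
Let aQ3 : br (a 3) Q = 4 *: a 4. Proof. by rewrite (brC hL) Qa3 opprK. Qed.
Let a1a3 : br (a 1) (a 3) = k *: e. Proof. by rewrite (brC hL) T5 scaleNr opprK. Qed.
Let a2a3 : br (a 2) (a 3) = (3 * k) *: Q. Proof. by rewrite (brC hL) T6 mulNr scaleNr opprK. Qed.
Let a3a4 : br (a 3) (a 4) = 0. Proof. by rewrite (brC hL) T1 oppr0. Qed.
Let ae2 : br (a 2) e = 0. Proof. by rewrite (brC hL) wt2 oppr0. Qed.
Let tabA := (T1, T2, T3, T4, T5, T6, T7, T8, T9, T10, a1a3, a2a3, a3a4, ae2, wt0, wt1, wt2, wt3, wt4, Qq, aq0, brxx hL, aq1, aq2, aq3, aq4, aQ0, aQ1, aQ2, aQ3).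

(** The elements of weight 2 are spanned by Q and $a_3$, with $[a_2,Q]=3a_3$ and $[a_2,a_3]=3kQ$. As
    $k=\mu^{-2}$, the eigenvectors of $a_2$ there are $Q\pm\mu a_3$. They serve as simple root
    vectors, for the Cartan subalgebra spanned by e and $a_2$. *)
Local Notation e0 := (Q + mu *: a 3).
Local Notation e1 := (Q - mu *: a 3).
Local Notation f0 := ((- 8^-1) *: (q + mu *: a 1)).
Local Notation f1 := ((- 8^-1) *: (q - mu *: a 1)).
Local Notation h0 := (4^-1 *: (e + (2 * mu) *: a 2)).
Local Notation h1 := (4^-1 *: (e - (2 * mu) *: a 2)).

Local Ltac crunch := rewrite ?iterS /=; do 6 rewrite ?(brE hL) ?tabA ?tab0 ?had; rewrite ?kE /=; lin_comb K g by (field; rewrite ?mu0).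

Lemma A2_conclusion :
  [/\ lie_iso_mx br (sl_mx K 3), simple_lie br & has_cartan_type br cartan_A2].
Proof.
have e0n : e0 <> 0.
  move=> h; have h' := congr1 (br Q) h; rewrite ?(brE hL) ?(brxx hL) ?tab0 in h'.
  apply: a4_neq0; have h2 := Z1 (x := - 4 * mu) a4_neq0.
  have : - 4 * mu = 0 by apply: h2; apply: (lin_from (k := 1) h'); lin_comb K g by field.
  by move/eqP; rewrite mulf_eq0 (negPf mu0) orbF oppr_eq0 (pnatr_eq0 K 4).
have A00 : cartan_A2 0 0 = 2 by rewrite mxE.
have A11 : cartan_A2 1 1 = 2 by rewrite mxE.
have A01 : cartan_A2 0 1 = - 1%:Z by rewrite mxE.
have A10 : cartan_A2 1 0 = - 1%:Z by rewrite mxE.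
have [] := @chevalley_pack K g br hL e0 e1 f0 f1 h0 h1 cartan_A2 1 1 A00 A11 A01 A10.
1-17: by crunch.
- move=> P hP hb P0 P1 P2 P3; have [I0 IP] := hP.
  have LC x y u v : P u -> P v -> P (x *: u + y *: v).
    by move=> hu hv; apply: (IP _ _ _ hu); have := IP y _ _ hv I0; rewrite addr0.
  have PZ x u : P u -> P (x *: u) by move=> hu; have := IP x _ _ hu I0; rewrite addr0.
  have PQ : P Q.
    rewrite (_ : Q = 2^-1 *: e0 + 2^-1 *: e1); first exact: LC.
    by lin_comb K g by field.
  have Pq : P q.
    rewrite (_ : q = (- 4) *: f0 + (- 4) *: f1); first exact: LC.
    by lin_comb K g by field.
  have p3 : P (a 3).
    rewrite (_ : a 3 = (2 * mu)^-1 *: e0 + (- (2 * mu)^-1) *: e1); first exact: LC.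
    by lin_comb K g by (field; rewrite ?mu0).
  have p1 : P (a 1).
    rewrite (_ : a 1 = (- 4 / mu) *: f0 + (4 / mu) *: f1); first exact: LC.
    by lin_comb K g by (field; rewrite ?mu0).
  have Pe : P e by rewrite -hqQ; exact: hb.
  have down i : (i < 4)%N -> P (a i.+1) -> P (a i).
    move=> lt hi; rewrite (_ : a i = (4 - i)%:R^-1 *: br q (a i.+1)); first by apply: PZ; exact: hb.
    by rewrite hqa scalerA mulVf ?scale1r // pnatr_eq0 -lt0n subn_gt0.
  have p4 : P (a 4).
    rewrite (_ : a 4 = (- 4^-1) *: br Q (a 3)); first by apply: PZ; exact: hb.
    by rewrite hQa; lin_comb K g by field.
  apply: span => //; case=> [|[|[|[|[|//]]]]] _ //; by apply: down => //; apply: down.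
move=> hh [ef [he [hf [See [Sff gen]]]]].
have [h1' h2'] := typeA2 hL ef gen e0n he hf See Sff.
split=> //; exists (two_fun e0 e1), (two_fun f0 f1), (two_fun h0 h1).
by do 6 (split; first assumption).
Qed.

End Chevalley.
End TableA2.

End TableA2Part.
Export TableA2Part.

(** * The bracket table for d = 6 *)

Module TableB2Part.

Section TableB2.
Context {K : numFieldType} {g : lmodType K} (br : g -> g -> g).
Hypothesis hL : is_lie_bracket br.
Context (q Q e : g) (a : nat -> g).
Hypothesis hqQ : br q Q = e.
Hypothesis heQ : br e Q = 2 *: Q.
Hypothesis heq : br e q = - (2 *: q).
Hypothesis hQa : forall i, br Q (a i) = - (i.+1%:R *: a i.+1).
Hypothesis had : a 7 = 0.
Hypothesis hqa : forall i, br q (a i.+1) = (6 - i)%:R *: a i.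
Hypothesis hqa0 : br q (a 0) = 0.
Hypothesis span : forall P : set g, is_submod P -> P q -> P Q -> P e ->
  (forall i, (i <= 6)%N -> P (a i)) -> P = setT.
Hypothesis a6a3 : br (a 6) (a 3) <> 0.

Let wt i (le : (i <= 6)%N) := hea hL hqQ hQa hqa hqa0 le.
Let win := weight_in hL hqQ heQ heq hQa hqa hqa0 span.

Let Qa6 : br Q (a 6) = 0. Proof. by rewrite hQa had scaler0 oppr0. Qed.
Let Qe : br Q e = - (2 *: Q). Proof. by rewrite (brC hL) heQ. Qed.
Let qe : br q e = 2 *: q. Proof. by rewrite (brC hL) heq opprK. Qed.
Let qa1 : br q (a 1) = 6 *: a 0. Proof. exact: hqa. Qed.
Let qa2 : br q (a 2) = 5 *: a 1. Proof. exact: hqa. Qed.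
Let qa3 : br q (a 3) = 4 *: a 2. Proof. exact: hqa. Qed.
Let qa4 : br q (a 4) = 3 *: a 3. Proof. exact: hqa. Qed.
Let qa5 : br q (a 5) = 2 *: a 4. Proof. exact: hqa. Qed.
Let qa6 : br q (a 6) = 1 *: a 5. Proof. exact: hqa. Qed.
Let Qa0 : br Q (a 0) = - (1 *: a 1). Proof. exact: hQa. Qed.
Let Qa1 : br Q (a 1) = - (2 *: a 2). Proof. exact: hQa. Qed.
Let Qa2 : br Q (a 2) = - (3 *: a 3). Proof. exact: hQa. Qed.
Let Qa3 : br Q (a 3) = - (4 *: a 4). Proof. exact: hQa. Qed.
Let Qa4 : br Q (a 4) = - (5 *: a 5). Proof. exact: hQa. Qed.
Let Qa5 : br Q (a 5) = - (6 *: a 6). Proof. exact: hQa. Qed.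
Let tab0 := (hqQ, heQ, heq, Qa6, Qe, qe, hqa0, qa1, qa2, qa3, qa4, qa5, qa6, Qa0, Qa1, Qa2, Qa3, Qa4, Qa5).

Let a6_neq0 : a 6 <> 0. Proof. by move=> h; apply: a6a3; rewrite h (br0l hL). Qed.
Let Z1 (x : K) (v : g) : v <> 0 -> x *: v = 0 -> x = 0.
Proof. by move=> v0 /eqP; rewrite scaler_eq0 => /orP[/eqP|/eqP]. Qed.

Let T1 : br (a 6) (a 5) = 0.
Proof.
apply: (win (S := [set 0]%classic) (n := 10) (ms := [:: -6; -4; -2; 0; 2; 4; 6])); rewrite ?submod0 //; try by left.
- exact: submod0.
- by case=> [|[|[|[|[|[|[|//]]]]]]] _; left.
- by rewrite (weight_br hL (wt (isT : 6 <= 6)%N) (wt (isT : 5 <= 6)%N)).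
Qed.
Let T2 : br (a 6) (a 4) = 0.
Proof.
apply: (win (S := [set 0]%classic) (n := 8) (ms := [:: -6; -4; -2; 0; 2; 4; 6])); rewrite ?submod0 //; try by left.
- exact: submod0.
- by case=> [|[|[|[|[|[|[|//]]]]]]] _; left.
- by rewrite (weight_br hL (wt (isT : 6 <= 6)%N) (wt (isT : 4 <= 6)%N)).
Qed.

(** The bracket has weight 6, and only $a_6$ has this weight. *)
Lemma a6a3_a6 : exists2 k : K, k != 0 & br (a 6) (a 3) = k *: a 6.
Proof.
have [x [y E]] : exists x y : K, br (a 6) (a 3) = x *: a 6 + y *: 0.
  apply: (win (S := [set u | exists x y : K, u = x *: a 6 + y *: 0]%classic) (n := 6) (ms := [:: -6; -4; -2; 0; 2; 4])); try by left.
  - exact: submod2.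
  - by [].
  - by case=> [|[|[|[|[|[|[|//]]]]]]] _; try (by left); right; exact: submod2l.
  - by rewrite (weight_br hL (wt (isT : 6 <= 6)%N) (wt (isT : 3 <= 6)%N)).
rewrite scaler0 addr0 in E; exists x => //.
by apply/eqP => x0; apply: a6a3; rewrite E x0 scale0r.
Qed.

Let a5_neq0 : a 5 <> 0.
Proof.
move=> h; have h' := Qa5; rewrite h (br0r hL) in h'; apply: a6_neq0.
by apply: (lin_from (k := 6^-1) h'); lin_comb K g by field.
Qed.
Let Q0 : Q <> 0.
Proof. by move=> h; have h' := Qa4; rewrite h (br0l hL) in h'; apply: a5_neq0; apply: (lin_from (k := 5^-1) h'); lin_comb K g by field. Qed.

Section Chevalley.
Context (k : K).
Hypothesis k0 : k != 0.
Hypothesis T3 : br (a 6) (a 3) = k *: a 6.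

Let T4 : br (a 5) (a 4) = (- 3 * k) *: a 6.
Proof.
have h := congr1 (br q) T2; rewrite (jac hL) ?tab0 ?(brE hL) ?(brxx hL) T3 ?tab0 ?(brE hL) /= in h.
by apply: (lin_from (k := 1) h); lin_comb K g by field.
Qed.
Let T5 : br (a 5) (a 3) = (- k) *: a 5.
Proof.
have h := congr1 (br q) T4; rewrite (jac hL) ?tab0 ?(brE hL) ?(brxx hL)  ?tab0 ?(brE hL) /= in h.
by apply: (lin_from (k := 3^-1) h); lin_comb K g by field.
Qed.
Let T6 : br (a 6) (a 2) = (k / 2) *: a 5.
Proof.
have h := congr1 (br q) T3; rewrite (jac hL) ?tab0 ?(brE hL) ?(brxx hL) T5 ?tab0 ?(brE hL) /= in h.
by apply: (lin_from (k := 4^-1) h); lin_comb K g by field.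
Qed.
(** Weight 2 is spanned by Q and $a_4$, and bracketing with Q determines the coefficient of $a_4$.
    The coefficient y of Q is invisible to this and is found in [yE]. *)
Lemma a6a1E : exists y : K, br (a 6) (a 1) = y *: Q + (k / 5) *: a 4.
Proof.
have [x [y E]] : exists x y : K, br (a 6) (a 1) = x *: Q + y *: a 4.
  apply: (win (S := [set u | exists x y : K, u = x *: Q + y *: a 4]%classic) (n := 2) (ms := [:: -6; -4; -2; 0; 4; 6])); try by left.
  - exact: submod2.
  - by [].
  - by right; exact: submod2l.
  - by case=> [|[|[|[|[|[|[|//]]]]]]] _; try (by left); right; exact: submod2r.
  - by rewrite (weight_br hL (wt (isT : 6 <= 6)%N) (wt (isT : 1 <= 6)%N)).
have h := congr1 (br Q) E; rewrite (jac hL) ?tab0 ?(brE hL) T6 ?(brxx hL) ?tab0 ?(brE hL) in h.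
have : y - k / 5 = 0 by apply: (Z1 a5_neq0); apply: (lin_from (k := 5^-1) h); lin_comb K g by field.
by move/eqP; rewrite subr_eq0 => /eqP <-; exists x.
Qed.

Section WithY.
Context (y : K).
Hypothesis T7 : br (a 6) (a 1) = y *: Q + (k / 5) *: a 4.

Let T8 : br (a 5) (a 2) = (- 5 * y) *: Q.
Proof.
have h := congr1 (br q) T6; rewrite (jac hL) ?tab0 ?(brE hL) ?(brxx hL) T7 ?tab0 ?(brE hL) /= in h.
by apply: (lin_from (k := 1) h); lin_comb K g by field.
Qed.
Let T9 : br (a 4) (a 3) = (- k) *: a 4 + (10 * y) *: Q.
Proof.
have h := congr1 (br q) T5; rewrite (jac hL) ?tab0 ?(brE hL) ?(brxx hL) T8 ?tab0 ?(brE hL) /= in h.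
by apply: (lin_from (k := 2^-1) h); lin_comb K g by field.
Qed.
Let T10 : br (a 6) (a 0) = (y / 2) *: e + (k / 20) *: a 3.
Proof.
have [x [z E]] : exists x z : K, br (a 6) (a 0) = x *: e + z *: a 3.
  apply: (win (S := [set u | exists x y : K, u = x *: e + y *: a 3]%classic) (n := 0) (ms := [:: -6; -4; -2; 2; 4; 6])); try by left.
  - exact: submod2.
  - by [].
  - by right; exact: submod2l.
  - by case=> [|[|[|[|[|[|[|//]]]]]]] _; try (by left); right; exact: submod2r.
  - by rewrite (weight_br hL (wt (isT : 6 <= 6)%N) (wt (isT : 0 <= 6)%N)).
have h := congr1 (br Q) E; rewrite (jac hL) ?tab0 ?(brE hL) T7 ?tab0 ?(brE hL) in h.
have h' := congr1 (br Q) h; rewrite ?(brE hL) ?tab0 ?(brxx hL) ?(brE hL) ?tab0 in h'.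
have z0 : z - k / 20 = 0.
  by apply: (Z1 a5_neq0); apply: (lin_from (k := - 20^-1) h'); lin_comb K g by field.
have zE : z = k / 20 by apply/eqP; rewrite -subr_eq0 z0.
rewrite zE in E h.
have x0 : 2 * x - y = 0.
  by apply: (Z1 Q0); apply: (lin_from (k := 1) h); lin_comb K g by field.
rewrite E; congr (_ *: _ + _); move/eqP: x0; rewrite subr_eq0 => /eqP <-; by field.
Qed.
Let T11 : br (a 5) (a 1) = (- 2 * y) *: e + (3 * k / 10) *: a 3.
Proof.
have h := congr1 (br q) T7; rewrite (jac hL) ?tab0 ?(brE hL) ?(brxx hL) T10 ?tab0 ?(brE hL) /= in h.
by apply: (lin_from (k := 1) h); lin_comb K g by field.
Qed.
Let wt6 : br e (a 6) = 6 *: a 6. Proof. by rewrite wt. Qed.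
Let aq1 : br (a 1) q = - (6 *: a 0). Proof. by rewrite (brC hL) qa1. Qed.
Let aq2 : br (a 2) q = - (5 *: a 1). Proof. by rewrite (brC hL) qa2. Qed.
Let aq3 : br (a 3) q = - (4 *: a 2). Proof. by rewrite (brC hL) qa3. Qed.
Let aq4 : br (a 4) q = - (3 *: a 3). Proof. by rewrite (brC hL) qa4. Qed.
Let aq5 : br (a 5) q = - (2 *: a 4). Proof. by rewrite (brC hL) qa5. Qed.
Let aq6 : br (a 6) q = - (1 *: a 5). Proof. by rewrite (brC hL) qa6. Qed.
Let aQ0 : br (a 0) Q = 1 *: a 1. Proof. by rewrite (brC hL) Qa0 opprK. Qed.
Let aQ1 : br (a 1) Q = 2 *: a 2. Proof. by rewrite (brC hL) Qa1 opprK. Qed.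
Let aQ2 : br (a 2) Q = 3 *: a 3. Proof. by rewrite (brC hL) Qa2 opprK. Qed.
Let aQ3 : br (a 3) Q = 4 *: a 4. Proof. by rewrite (brC hL) Qa3 opprK. Qed.
Let aQ4 : br (a 4) Q = 5 *: a 5. Proof. by rewrite (brC hL) Qa4 opprK. Qed.
Let aQ5 : br (a 5) Q = 6 *: a 6. Proof. by rewrite (brC hL) Qa5 opprK. Qed.
(** The Jacobi identity for $a_6,a_5,a_1$, three elements outside the sl_2, ties y to k by comparing
    the coefficients of $a_6$. *)
Let yE : y = - (3 / 20) * k ^+ 2.
Proof.
have h := jac hL (a 6) (a 5) (a 1).
rewrite T11 T1 T7 ?(brE hL) T3 (brC hL (a 6) e) wt6 aQ5 T4 in h.
have y0 : y + (3 / 20) * k ^+ 2 = 0.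
  by apply: (Z1 a6_neq0); apply: (lin_from (k := 6^-1) h); lin_comb K g by field.
by move/eqP: y0; rewrite addr_eq0 mulNr => /eqP.
Qed.
Let T13 : br (a 4) (a 2) = (5 / 2 * y) *: e - (3 / 4 * k) *: a 3.
Proof.
have h := congr1 (br q) T8; rewrite (jac hL) ?tab0 ?(brE hL) ?(brxx hL) T11 ?tab0 ?(brE hL) /= in h.
by apply: (lin_from (k := 2^-1) h); lin_comb K g by field.
Qed.
Let T14 : br (a 5) (a 0) = y *: q + (k / 5) *: a 2.
Proof.
have h := congr1 (br q) T10; rewrite (jac hL) ?tab0 ?(brE hL) ?(brxx hL)  ?tab0 ?(brE hL) /= in h.
by apply: (lin_from (k := 1) h); lin_comb K g by field.
Qed.
Let T15 : br (a 4) (a 1) = (- 5 * y) *: q.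
Proof.
have h := congr1 (br q) T11; rewrite (jac hL) ?tab0 ?(brE hL) ?(brxx hL) T14 ?tab0 ?(brE hL) /= in h.
by apply: (lin_from (k := 2^-1) h); lin_comb K g by field.
Qed.
Let T16 : br (a 3) (a 2) = (10 * y) *: q - k *: a 2.
Proof.
have h := congr1 (br q) T13; rewrite (jac hL) ?tab0 ?(brE hL) ?(brxx hL) T15 ?tab0 ?(brE hL) /= in h.
by apply: (lin_from (k := 3^-1) h); lin_comb K g by field.
Qed.
Let T17 : br (a 3) (a 1) = - k *: a 1.
Proof.
have h := congr1 (br q) T16; rewrite (jac hL) ?tab0 ?(brE hL) ?(brxx hL)  ?tab0 ?(brE hL) /= in h.
by apply: (lin_from (k := 5^-1) h); lin_comb K g by field.
Qed.
Let T18 : br (a 4) (a 0) = (k / 2) *: a 1.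
Proof.
have h := congr1 (br q) T15; rewrite (jac hL) ?tab0 ?(brE hL) ?(brxx hL) T17 ?tab0 ?(brE hL) /= in h.
by apply: (lin_from (k := 6^-1) h); lin_comb K g by field.
Qed.
Let T19 : br (a 3) (a 0) = k *: a 0.
Proof.
have h := congr1 (br q) T18; rewrite (jac hL) ?tab0 ?(brE hL) ?(brxx hL)  ?tab0 ?(brE hL) /= in h.
by apply: (lin_from (k := 3^-1) h); lin_comb K g by field.
Qed.
Let T20 : br (a 2) (a 1) = (- 3 * k) *: a 0.
Proof.
have h := congr1 (br q) T17; rewrite (jac hL) ?tab0 ?(brE hL) ?(brxx hL) T19 ?tab0 ?(brE hL) /= in h.
by apply: (lin_from (k := 4^-1) h); lin_comb K g by field.
Qed.
Let T21 : br (a 2) (a 0) = 0.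
Proof.
have h := congr1 (br q) T19; rewrite (jac hL) ?tab0 ?(brE hL) ?(brxx hL)  ?tab0 ?(brE hL) /= in h.
by apply: (lin_from (k := 4^-1) h); lin_comb K g by field.
Qed.
Let wt0 : br e (a 0) = (-6) *: a 0. Proof. by rewrite wt. Qed.
Let wt1 : br e (a 1) = (-4) *: a 1. Proof. by rewrite wt. Qed.
Let wt2 : br e (a 2) = (-2) *: a 2. Proof. by rewrite wt. Qed.
Let wt3 : br e (a 3) = 0. Proof. by rewrite wt // scale0r. Qed.
Let wt4 : br e (a 4) = 2 *: a 4. Proof. by rewrite wt. Qed.
Let wt5 : br e (a 5) = 4 *: a 5. Proof. by rewrite wt. Qed.
Let aq0 : br (a 0) q = 0. Proof. by rewrite (brC hL) hqa0 oppr0. Qed.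
Let Qq : br Q q = - e. Proof. by rewrite (brC hL) hqQ. Qed.
Let a3a4 : br (a 3) (a 4) = k *: a 4 - (10 * y) *: Q.
Proof. by rewrite (brC hL) T9 opprD scaleNr opprK. Qed.
Let a4a5 : br (a 4) (a 5) = (3 * k) *: a 6. Proof. by rewrite (brC hL) T4 mulNr scaleNr opprK. Qed.
Let a4a6 : br (a 4) (a 6) = 0. Proof. by rewrite (brC hL) T2 oppr0. Qed.
Let ae3 : br (a 3) e = 0. Proof. by rewrite (brC hL) wt3 oppr0. Qed.
Let tabA := (T13, T16, T20, T21, a3a4, a4a5, a4a6, ae3, wt0, wt1, wt2, wt3, wt4, wt5, wt6, Qq, aq0, brxx hL, aq1, aq2, aq3, aq4, aq5, aq6, aQ0, aQ1, aQ2, aQ3, aQ4, aQ5).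

(** On the span of Q and $a_4$ one has $[a_3,Q]=4a_4$ and $[a_3,a_4]=ka_4+\tfrac32k^2Q$. So
    $Q+(s/k)a_4$ is an eigenvector of $a_3$ exactly when $3s^2-2s-8=0$, that is, s is 2 or -4/3. *)
Local Notation e0 := (Q + (- 4 / (3 * k)) *: a 4).
Local Notation e1 := (Q + (2 / k) *: a 4).
Local Notation f0 := ((- (3 / 25)) *: (q + (- 4 / (3 * k)) *: a 2)).
Local Notation f1 := ((- 25^-1) *: (q + (2 / k) *: a 2)).
Local Notation h0 := (5^-1 *: e + (- 4 / (5 * k)) *: a 3).
Local Notation h1 := (10^-1 *: e + (3 / (5 * k)) *: a 3).

Local Ltac crunch := rewrite ?iterS /=; do 6 rewrite ?(brE hL) ?tabA ?tab0 ?had; rewrite ?yE /=; lin_comb K g by (field; rewrite ?k0).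

Lemma B2_conclusion :
  [/\ lie_iso_mx br (sp4_mx K), simple_lie br & has_cartan_type br cartan_B2].
Proof.
have e0n : e0 <> 0.
  move=> h; have h' := congr1 (br Q) h; rewrite ?(brE hL) ?(brxx hL) ?tab0 in h'.
  by apply: a5_neq0; apply: (lin_from (k := 3 * k / 20) h'); lin_comb K g by (field; rewrite ?k0).
have A00 : cartan_B2 0 0 = 2 by rewrite mxE.
have A11 : cartan_B2 1 1 = 2 by rewrite mxE.
have A01 : cartan_B2 0 1 = - 2%:Z by rewrite mxE.
have A10 : cartan_B2 1 0 = - 1%:Z by rewrite mxE.
have [] := @chevalley_pack K g br hL e0 e1 f0 f1 h0 h1 cartan_B2 2 1 A00 A11 A01 A10.
1-17: by crunch.
- move=> P hP hb P0 P1 P2 P3; have [I0 IP] := hP.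
  have LC x z u v : P u -> P v -> P (x *: u + z *: v).
    by move=> hu hv; apply: (IP _ _ _ hu); have := IP z _ _ hv I0; rewrite addr0.
  have PZ x u : P u -> P (x *: u) by move=> hu; have := IP x _ _ hu I0; rewrite addr0.
  have PQ : P Q.
    rewrite (_ : Q = (3 / 5) *: e0 + (2 / 5) *: e1); first exact: LC.
    by lin_comb K g by (field; rewrite ?k0).
  have Pq : P q.
    rewrite (_ : q = (- 5) *: f0 + (- 10) *: f1); first exact: LC.
    by lin_comb K g by (field; rewrite ?k0).
  have p4 : P (a 4).
    rewrite (_ : a 4 = (- (3 * k / 10)) *: e0 + (3 * k / 10) *: e1); first exact: LC.
    by lin_comb K g by (field; rewrite ?k0).
  have p2 : P (a 2).
    rewrite (_ : a 2 = (5 / 2 * k) *: f0 + (- (15 / 2) * k) *: f1); first exact: LC.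
    by lin_comb K g by (field; rewrite ?k0).
  have Pe : P e by rewrite -hqQ; exact: hb.
  have down i : (i < 6)%N -> P (a i.+1) -> P (a i).
    move=> lt hi; rewrite (_ : a i = (6 - i)%:R^-1 *: br q (a i.+1)); first by apply: PZ; exact: hb.
    by rewrite hqa scalerA mulVf ?scale1r // pnatr_eq0 -lt0n subn_gt0.
  have up i : P (a i) -> P (a i.+1).
    move=> hi; rewrite (_ : a i.+1 = (- i.+1%:R^-1) *: br Q (a i)); first by apply: PZ; exact: hb.
    by rewrite hQa scaleNr scalerN opprK scalerA mulVf ?scale1r // pnatr_eq0.
  have p1 : P (a 1) by exact: (down 1%N).
  have p3 : P (a 3) by exact: (down 3%N).
  have p0 : P (a 0) by exact: (down 0%N).
  have p5 : P (a 5) by exact: up.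
  have p6 : P (a 6) by exact: up.
  by apply: span => //; case=> [|[|[|[|[|[|[|//]]]]]]].
move=> hh [ef [he [hf [See [Sff gen]]]]].
have [h1' h2'] := typeB2 hL ef gen e0n he hf See Sff.
split=> //; exists (two_fun e0 e1), (two_fun f0 f1), (two_fun h0 h1).
by do 6 (split; first assumption).
Qed.

End WithY.
End Chevalley.
End TableB2.

End TableB2Part.
Export TableB2Part.

(** * The Lie algebra of the family: bracket table and detection of nonzero classes *)

Module LieTablePart.

Lemma pwd_rmorph (A B : pzRingType) (f : {rmorphism A -> B}) u v u' v' m i :
  f (pwd u v u' v' m i) = pwd (f u) (f v) (f u') (f v') m i.
Proof.
elim: m i => [|m IH] [|i] /=; rewrite ?rmorph0 //.
  by rewrite rmorphD !rmorphM IH pw_rmorph.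
by rewrite !rmorphD !rmorphM !IH !pw_rmorph.
Qed.

Definition ada {A : pzRingType} d (x y X Y : A) i : A :=
  pwd x Y (- (X ^+ d.-1 *+ d)) 0 d i + pwd y X (- (Y ^+ d.-1 *+ d)) 0 d i.

Lemma ada_rmorph (A B : pzRingType) (f : {rmorphism A -> B}) d x y X Y i :
  f (ada d x y X Y i) = ada d (f x) (f y) (f X) (f Y) i.
Proof. by rewrite rmorphD !pwd_rmorph !rmorphN !rmorphMn !rmorphXn rmorph0. Qed.

Lemma comm_ada (A : pzRingType) d (x y X Y t : A) rsg i : (0 < d)%N ->
  dunkl_rel d x y X Y t rsg ->
  comm (pw x Y d d + pw y X d d) (pw x Y d i + pw y X d i) = t * ada d x y X Y i.
Proof.
move=> d0 rr; rewrite !pwmm addrC; set R0 := X ^+ d + Y ^+ d.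
have anti a : comm R0 a = - comm a R0 by rewrite /comm opprB.
have Rx : comm R0 x = t * - (X ^+ d.-1 *+ d) by rewrite anti (comm_xR d0 rr) mulrN mulrnAr.
have Ry : comm R0 y = t * - (Y ^+ d.-1 *+ d) by rewrite anti (comm_yR d0 rr) mulrN mulrnAr.
have RX : comm R0 X = t * 0.
  by rewrite mulr0 /comm mulrDl mulrDr -exprS -exprSr (commrX d (rXY rr)) subrr.
have RY : comm R0 Y = t * 0.
  by rewrite mulr0 /comm mulrDl mulrDr -exprS -exprSr (commrX d (esym (rXY rr))) subrr.
by rewrite commDr (comm_pw (tC rr) Rx RY) (comm_pw (tC rr) Ry RX) -mulrDr.
Qed.

Lemma pw_top (A : pzRingType) d (x y X Y : A) : pw x Y d d.+1 + pw y X d d.+1 = 0.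
Proof. by rewrite !pw_gt ?addr0. Qed.

(** The sum factors as $(a+zb)(1+z^2)$, and $1+z^2=0$ when $z^2\ne1$. The case of sixth roots is the
    same with $1+z^2+z^4$. *)
Lemma refl_sum4_aux (K : fieldType) (z a b : K) : z ^+ 4 = 1 ->
  0 + z ^+ 0 * a + z ^+ 1 * b + z ^+ 2 * a + z ^+ 3 * b =
  if z == 1 then 2 * (a + b) else if z ^+ 2 == 1 then 2 * (a - b) else 0.
Proof.
move=> z4; have -> : 0 + z ^+ 0 * a + z ^+ 1 * b + z ^+ 2 * a + z ^+ 3 * b = (a + z * b) * (1 + z ^+ 2) by ring.
case: eqP => [->|/eqP z1]; first by ring.
case: eqP => [e|/eqP z2].
  have /eqP := e; rewrite sqrf_eq1 (negPf z1) => /eqP zE; rewrite zE; ring.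
have : (z ^+ 2) ^+ 2 == 1 by rewrite -exprM z4.
by rewrite sqrf_eq1 (negPf z2) => /eqP ->; rewrite subrr mulr0.
Qed.

Lemma refl_sum6_aux (K : fieldType) (z a b : K) : z ^+ 6 = 1 ->
  0 + z ^+ 0 * a + z ^+ 1 * b + z ^+ 2 * a + z ^+ 3 * b + z ^+ 4 * a + z ^+ 5 * b =
  if z == 1 then 3 * (a + b) else if z ^+ 2 == 1 then 3 * (a - b) else 0.
Proof.
move=> z6; have -> : 0 + z ^+ 0 * a + z ^+ 1 * b + z ^+ 2 * a + z ^+ 3 * b + z ^+ 4 * a + z ^+ 5 * b =
  (a + z * b) * (1 + z ^+ 2 + z ^+ 4) by ring.
case: eqP => [->|/eqP z1]; first by ring.
case: eqP => [e|/eqP z2].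
  have /eqP := e; rewrite sqrf_eq1 (negPf z1) => /eqP zE; rewrite zE; ring.
have : (z ^+ 2 - 1) * (1 + z ^+ 2 + z ^+ 4) = z ^+ 6 - 1 by ring.
rewrite z6 subrr => /eqP; rewrite mulf_eq0 subr_eq0 (negPf z2) => /eqP ->.
by rewrite mulr0.
Qed.

Section ReflectionSums.
Context {R : realType} {zeta : R[i]}.
Local Notation C := R[i].
Context (c : reflection zeta -> C) (hc : is_param c).
Local Notation a := (c (ref_s zeta 0)).
Local Notation b := (c (ref_s zeta 1)).

Lemma param_parity d (hz : d.-primitive_root zeta) i : c (ref_s zeta i) = if odd i then b else a.
Proof.
case: ifP => o; apply: hc.
  by apply: (ref_conj_s hz (k := i.+1./2)); congr (_ %% d)%N; lia.
by apply: (ref_conj_s hz (k := i./2)); congr (_ %% d)%N; lia.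
Qed.

Lemma refl_sum_parity d (hz : d.-primitive_root zeta) m :
  refl_sum (d := d) c m = \sum_(i < d) (zeta ^+ m) ^+ i * (if odd i then b else a).
Proof. by apply: eq_bigr => i _; rewrite (param_parity hz) -exprM mulnC. Qed.

Lemma refl_sum4 (hz : 4.-primitive_root zeta) m : refl_sum (d := 4) c m =
  if (m %% 4 == 0)%N then 2 * (a + b) else if (m %% 4 == 4./2)%N then 2 * (a - b) else 0.
Proof.
rewrite (refl_sum_parity hz) !big_ord_recr big_ord0 /= refl_sum4_aux; last first.
  by rewrite -exprM mulnC exprM (prim_expr_order hz) expr1n.
rewrite -(prim_order_dvd hz) -exprM -(prim_order_dvd hz).
have e1 : (4 %| m)%N = (m %% 4 == 0)%N by [].
rewrite e1; case: ifP => // e; rewrite (_ : (4 %| m * 2)%N = (m %% 4 == 2)%N) //.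
by apply/idP/idP; lia.
Qed.

Lemma refl_sum6 (hz : 6.-primitive_root zeta) m : refl_sum (d := 6) c m =
  if (m %% 6 == 0)%N then 3 * (a + b) else if (m %% 6 == 6./2)%N then 3 * (a - b) else 0.
Proof.
rewrite (refl_sum_parity hz) !big_ord_recr big_ord0 /= refl_sum6_aux; last first.
  by rewrite -exprM mulnC exprM (prim_expr_order hz) expr1n.
rewrite -(prim_order_dvd hz) -exprM -(prim_order_dvd hz).
have e1 : (6 %| m)%N = (m %% 6 == 0)%N by [].
rewrite e1; case: ifP => // e; rewrite (_ : (6 %| m * 2)%N = (m %% 6 == 3)%N) //.
by apply/idP/idP; lia.
Qed.
End ReflectionSums.

Section LieTable.
Context {R : realType} {d : nat} {zeta : R[i]}.
Hypothesis hz : d.-primitive_root zeta.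
Local Notation C := R[i].
Local Notation F := (freealg C (gen zeta)).
Local Notation Z := (Z d zeta).
Local Notation psiT := (@psiT R d zeta).
Local Notation psiH := (@psiH R d zeta).
Context (c : reflection zeta -> C) (hc : is_param c).
Context (fam : set (Irr zeta)) (chi0 : Irr zeta).
Hypothesis famE : fam = [set chi' | forall z : Z, Omega d c chi' z = Omega d c chi0 z]%classic.
Hypothesis hcusp : cuspidal d c fam.
Local Notation w := (Omega d c chi0).
Local Notation g := (Lie d c fam).
Local Notation gam := (gam c fam).
Local Notation br := (lie_br d c fam).
Local Notation zq := (@zq R d zeta).
Local Notation zQ := (@zQ R d zeta).
Local Notation zeu := (@zeu R d zeta).
Local Notation za := (@za R d zeta).
Local Notation word := (@word_ada R d zeta).

Let gbr u v : w u = 0 -> w v = 0 -> br (gam u) (gam v) = gam (poisson u v).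
Proof. by move=> hu hv; exact: (gam_br hz hc famE hcusp hu hv). Qed.
Let wp u v : w u = 0 -> w v = 0 -> w (poisson u v) = 0.
Proof. by move=> hu hv; exact: (K0_pois hz hc famE hcusp hu hv). Qed.
Let wq := w_q hz hc chi0.
Let wQ := w_Q hz hc chi0.
Let we := w_eu hz hc famE hcusp.
Let wa i := w_a hz hc famE hcusp i.
Let wMn (u : Z) n : w u = 0 -> w (u *+ n) = 0.
Proof. by move=> h; apply: etrans (linearMn w n u) _; rewrite h mul0rn. Qed.
Let wD (u v : Z) : w u = 0 -> w v = 0 -> w (u + v) = 0.
Proof. by move=> hu hv; apply: etrans (linearD w u v) _; rewrite hu hv addr0. Qed.

Lemma br_anti x y : br x y = - br y x.
Proof.
have [u hu <-] := gam_surj hz hc famE x; have [v hv <-] := gam_surj hz hc famE y.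
rewrite (gbr hu hv) (gbr hv hu) (poissonC hz u v).
exact: (gamN hz hc famE (wp hv hu)).
Qed.

Lemma br_linl a x y z : br (a *: x + y) z = a *: br x z + br y z.
Proof.
have [u hu <-] := gam_surj hz hc famE x; have [v hv <-] := gam_surj hz hc famE y.
have [r hr <-] := gam_surj hz hc famE z.
rewrite (gbr hu hr) (gbr hv hr) -(gam_lin hz hc famE a hu hv) -(gam_lin hz hc famE a (wp hu hr) (wp hv hr)).
have hl : w (algc a * u + v) = 0.
  apply: etrans (linearP w a u v) _; rewrite hu hv; exact: (etrans (addr0 _) (mulr0 a)).
by rewrite (gbr hl hr) (poissonDl hz) (poissonZl hz).
Qed.

Lemma br_jacobi x y z : br (br x y) z = br x (br y z) - br y (br x z).
Proof.
have [u hu <-] := gam_surj hz hc famE x; have [v hv <-] := gam_surj hz hc famE y.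
have [r hr <-] := gam_surj hz hc famE z.
rewrite (gbr hu hv) (gbr hv hr) (gbr hu hr) (gbr (wp hu hv) hr) (gbr hu (wp hv hr)) (gbr hv (wp hu hr)).
rewrite (poisson_jacobi hz u v r).
have hN : w (- poisson v (poisson u r)) = 0.
  by apply: etrans (linearN w _) _; rewrite (wp hv (wp hu hr)) oppr0.
by rewrite (gamD hz hc famE (wp hu (wp hv hr)) hN) (gamN hz hc famE (wp hv (wp hu hr))).
Qed.

Lemma lie_br_is_lie : is_lie_bracket br.
Proof.
have h2 a x y z : br z (a *: x + y) = a *: br z x + br z y.
  by rewrite br_anti br_linl opprD -scalerN -!br_anti.
split=> [a x y z||x|x y z].
- exact: br_linl.
- exact: h2.
- have [u hu <-] := gam_surj hz hc famE x; rewrite (gbr hu hu) (poisson_xx hz).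
  exact: (gam0 hz hc famE).
rewrite (br_anti z (br x y)) br_jacobi (br_anti z x).
have -> : br y (- br x z) = - br y (br x z).
  have b0 : br y 0 = 0 by have := h2 1 0 0 y; rewrite scale1r addr0 scale1r => /eqP; rewrite -subr_eq0 opprD addrA subrr sub0r oppr_eq0 => /eqP.
  by have := h2 (-1) (br x z) 0 y; rewrite addr0 b0 addr0 !scaleN1r.
exact: (subrr (br x (br y z) - br y (br x z))).
Qed.

Lemma tab_qQ : br (gam zq) (gam zQ) = gam zeu.
Proof. by rewrite (gbr wq wQ) (poisson_qQ hz). Qed.
Lemma tab_eQ : br (gam zeu) (gam zQ) = 2 *: gam zQ.
Proof. by rewrite (gbr we wQ) (poisson_euQ hz) (gamD hz hc famE wQ wQ) scaler_nat mulr2n. Qed.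
Lemma tab_eq : br (gam zeu) (gam zq) = - (2 *: gam zq).
Proof.
by rewrite (gbr we wq) (poisson_euq hz) (gamN hz hc famE (wD wq wq)) (gamD hz hc famE wq wq) scaler_nat mulr2n.
Qed.
Lemma tab_Qa i : br (gam zQ) (gam (za i)) = - (i.+1%:R *: gam (za i.+1)).
Proof.
by rewrite (gbr wQ (wa i)) (poisson_Qa hz) (gamN hz hc famE (wMn i.+1 (wa i.+1))) (gamMn hz hc famE i.+1 (wa i.+1)).
Qed.
Lemma tab_qa i : br (gam zq) (gam (za i.+1)) = (d - i)%:R *: gam (za i).
Proof. by rewrite (gbr wq (wa i.+1)) (poisson_qa hz) (gamMn hz hc famE (d - i) (wa i)). Qed.
Lemma tab_qa0 : br (gam zq) (gam (za 0)) = 0.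
Proof. rewrite (gbr wq (wa 0)) (poisson_qa0 hz); exact: (gam0 hz hc famE). Qed.
Lemma tab_top : gam (za d.+1) = 0.
Proof.
have e : fa (d := d) (zeta := zeta) d.+1 = 0 by exact: pw_top.
have -> : za d.+1 = 0.
  apply: zF_morph; rewrite e; exact: (rmorph0 psiH).
exact: (gam0 hz hc famE).
Qed.

Lemma brk_ada i : psiT (fT (zeta := zeta)) * psiT (word i) = comm (psiT (fa (d := d) d)) (psiT (fa (d := d) i)).
Proof.
have e : psiT (word i) = ada d (psiT fx) (psiT fy) (psiT fX) (psiT fY) i := ada_rmorph psiT d fx fy fX fY i.
exact: (brk_eq (psi_fa psiT d) (psi_fa psiT i) e (comm_ada i (prim_order_gt0 hz) (dunklT hz))).
Qed.
Lemma poisson_ada i : poisson (za d) (za i) = zF (d := d) (word i).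
Proof. exact: (poisson_psi hz (a_central hz d) (a_central hz i) (brk_ada i)). Qed.
Lemma word_central i : psiH (word i) \in central (A := H d zeta).
Proof. exact: (bracket_psi_central hz (a_central hz d) (a_central hz i) (brk_ada i)). Qed.

Section Detect.
Context (p n : C).
Hypothesis sumE : forall m, refl_sum (d := d) c m =
  if (m %% d == 0)%N then p else if (m %% d == d./2)%N then n else 0.
Context (ok : nat -> nat -> bool) (chk : mono -> bool).
Hypothesis ok_up : forall a b a' b', ok a b -> ok (a + a')%N (b + b')%N.
Hypothesis chkP : forall t, chk t -> mc p n t = 0 \/ ok t.2.2.1.1 t.2.2.1.2.
Local Notation E := (nat_rep (zeta := zeta)).

Lemma fil_z a U : psiH a \in central (A := H d zeta) -> sem (d := d) c p n a U ->
  (forall b, all chk (U (unit_term 0 0 b))) -> forall j, fil ok (zact c (E := E) (zF (d := d) a) (std_e j)).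
Proof.
move=> ha hU hall j; have [b eb] := std_e_ev (zeta := zeta) p n j.
have e : zact c (E := E) (zF (d := d) a) (std_e j) = ev p n (U (unit_term 0 0 b)).
  by apply: etrans (zact_zF hz hc (std_e j) ha) _; rewrite eb; exact: hU.
rewrite e; apply: fil_ev => t ht; apply: chkP.
by have /allP := hall b; apply.
Qed.

Context (i a0 b0 : nat).
Hypothesis ok_low : forall a b a' b', ok a b -> ok a' b' -> ((a + a', b + b') == (a0, b0))%N = false.
Hypothesis chk_q : forall b, all chk (lx d (ly d (unit_term 0 0 b))).
Hypothesis chk_Q : forall b, all chk (lX (lY (unit_term 0 0 b))).
Hypothesis chk_e : forall b, all chk (lX (lx d (unit_term 0 0 b)) ++ ly d (lY (unit_term 0 0 b))).
Hypothesis chk_a : forall i b, (i <= d)%N -> all chk (la d i (unit_term 0 0 b)).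

Let vanish u v m : w u = 0 -> w v = 0 ->
  coefun (R := R) a0 b0 false (zact c (E := E) (u * v) m) = 0.
Proof.
have sx := sem_x hz hc sumE; have sy := sem_y hz hc sumE.
have sX := sem_X (d := d) c p n; have sY := sem_Y (d := d) c p n.
apply: (zact_prod_vanish hz hc (chi0 := chi0) ok_up wq wQ we (fun i _ => wa i)) => [j|j|j|k hk j|a b a' b' j h h'].
- exact: (fil_z (q_central hz) (semM sx sy) chk_q).
- exact: (fil_z (Q_central hz) (semM sX sY) chk_Q).
- exact: (fil_z (eu_central hz) (semD (semM sX sx) (semM sy sY)) chk_e).
- exact: (fil_z (a_central hz k) (sem_a hz hc sumE k) (fun b => chk_a b hk)).
by rewrite coefunE xpair_eqE ok_low.
Qed.

Lemma gam_detect a U : psiH a \in central (A := H d zeta) -> sem (d := d) c p n a U -> w (zF (d := d) a) = 0 ->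
  \sum_(t <- [seq t <- U (unit_term 0 0 false) | t.2.2 == (a0, b0, false)]) mc p n t <> 0 ->
  gam (zF (d := d) a) <> 0.
Proof.
move=> ha hU hw hs e.
have := gam_functional hz hc famE (fun u v hu hv => vanish (ev p n (unit_term 0 0 false)) hu hv) hw e.
by rewrite (zact_zF hz hc _ ha) hU coefun_ev.
Qed.

Lemma detect_ada :
  \sum_(t <- [seq t <- lada d i (unit_term 0 0 false) | t.2.2 == (a0, b0, false)]) mc p n t <> 0 ->
  br (gam (za d)) (gam (za i)) <> 0.
Proof.
rewrite (gbr (wa d) (wa i)) poisson_ada; apply: gam_detect.
- exact: word_central.
- exact: (sem_ada hz hc sumE i).
- by rewrite -poisson_ada; exact: (wp (wa d) (wa i)).
Qed.
End Detect.
End LieTable.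

End LieTablePart.
Export LieTablePart.

(** * The two cases of the theorem *)

Lemma intr_mul_neq0 (K : numDomainType) (z : int) (x : K) : z != 0 -> x != 0 -> z%:~R * x != 0.
Proof. by move=> z0 x0; rewrite mulf_neq0 ?intr_eq0. Qed.

Theorem theorem5p6 (R : realType) (d : nat) (zeta : R[i])
    (hzeta : d.-primitive_root zeta)
    (c : reflection zeta -> R[i]) (hc : is_param c)
    (fam : set (Irr zeta)) (hfam : is_family d c fam)
    (hcusp : cuspidal d c fam) :
  let a := c (ref_s zeta 0) in
  let b := c (ref_s zeta 1) in
  (d = 4%N -> a = b -> a <> 0 ->
     [/\ lie_iso_mx (lie_br d c fam) (sl_mx R[i] 3),
         simple_lie (lie_br d c fam) &
         has_cartan_type (lie_br d c fam) cartan_A2]) /\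
  (d = 6%N -> a * b * (a ^+ 2 - b ^+ 2) <> 0 ->
     [/\ lie_iso_mx (lie_br d c fam) (sp4_mx R[i]),
         simple_lie (lie_br d c fam) &
         has_cartan_type (lie_br d c fam) cartan_B2]).
Proof.
move=> a b; have [chi0 famE] := hfam.
have hL := lie_br_is_lie hzeta hc famE hcusp.
pose q0 := gam c fam (@zq R d zeta); pose Q0 := gam c fam (@zQ R d zeta).
pose e0 := gam c fam (@zeu R d zeta); pose A i := gam c fam (@za R d zeta i).
have hqQ : lie_br d c fam q0 Q0 = e0 := tab_qQ hzeta hc famE hcusp.
have heQ : lie_br d c fam e0 Q0 = 2 *: Q0 := tab_eQ hzeta hc famE hcusp.
have heq : lie_br d c fam e0 q0 = - (2 *: q0) := tab_eq hzeta hc famE hcusp.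
have hQa : forall i, lie_br d c fam Q0 (A i) = - (i.+1%:R *: A i.+1) := tab_Qa hzeta hc famE hcusp.
have hqa : forall i, lie_br d c fam q0 (A i.+1) = (d - i)%:R *: A i := tab_qa hzeta hc famE hcusp.
have hqa0 : lie_br d c fam q0 (A 0%N) = 0 := tab_qa0 hzeta hc famE hcusp.
have had : A d.+1 = 0 := tab_top hzeta hc famE.
have span : forall P : set (Lie d c fam), is_submod P -> P q0 -> P Q0 -> P e0 ->
  (forall i, (i <= d)%N -> P (A i)) -> P = setT := Lie_gen hzeta hc famE hcusp.
split=> [d4 ab an|d6 abn]; subst d.
(* As n = 0 when a = b, elements of m raise the degree by at least 2. So m^2 raises it by at least
   4, and the coefficient of XY, of degree 2, vanishes on m^2. *)
- pose ok x y := (2 <= x + y)%N.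
  have sumE := refl_sum4 hc hzeta.
  have n0 : 2 * (a - b) = 0 by rewrite ab subrr mulr0.
  have p0 : 2 * (a + b) != 0.
    by rewrite mulf_neq0 ?(pnatr_eq0 _ 2) // -ab -mulr2n mulrn_eq0; apply/eqP.
  have okU x y x' y' : ok x y -> ok (x + x')%N (y + y')%N by rewrite /ok; lia.
  have okL x y x' y' : ok x y -> ok x' y' -> ((x + x', y + y') == (1, 1))%N = false.
    by rewrite /ok xpair_eqE => h h'; apply/negbTE/negP => /andP[/eqP h1 /eqP h2]; lia.
  have chkP t : ok4 t -> mc (2 * (a + b)) (2 * (a - b)) t = 0 \/ ok t.2.2.1.1 t.2.2.1.2.
    by move=> /orP[h|h]; [left; rewrite /mc n0 expr0n eqn0Ngt h mulr0 | right].
  have cq b0 : all ok4 (lx 4 (ly 4 (unit_term 0 0 b0))) by case: b0; vm_compute.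
  have cQ b0 : all ok4 (lX (lY (unit_term 0 0 b0))) by case: b0; vm_compute.
  have ce b0 : all ok4 (lX (lx 4 (unit_term 0 0 b0)) ++ ly 4 (lY (unit_term 0 0 b0))) by case: b0; vm_compute.
  have ca i b0 : (i <= 4)%N -> all ok4 (la 4 i (unit_term 0 0 b0)).
    by case: i => [|[|[|[|[|//]]]]] _; case: b0; vm_compute.
  have Q0n : Q0 <> 0.
    apply: (gam_detect hzeta hc famE hcusp sumE okU chkP okL cq cQ ce ca
      (Q_central hzeta) (semM (sem_X (d := 4) c _ _) (sem_Y (d := 4) c _ _))).
      exact: w_Q.
    rewrite (_ : [seq t <- lX (lY (unit_term 0 0 false)) | _] = [:: (1%Z, (0, 0, (1, 1, false)))]%N); last by vm_compute.
    by rewrite big_seq1 /mc /= !expr0 !mulr1; apply/eqP; exact: oner_neq0.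
  have a41 : lie_br 4 c fam (A 4) (A 1%N) <> 0.
    apply: (detect_ada hzeta hc famE hcusp sumE okU chkP okL cq cQ ce ca).
    (* The coefficient of XY is $16p^2+16n^2$, where $p=2(a+b)=4a$ is nonzero and n = 0. *)
    rewrite (_ : [seq t <- lada 4 1 (unit_term 0 0 false) | _] =
      [:: (16%Z, (2, 0, (1, 1, false))); (16%Z, (0, 2, (1, 1, false)))]%N); last by vm_compute.
    rewrite !big_cons big_nil /mc /= -/a -/b n0 !expr0n /= ?mulr0 ?addr0 ?mulr1; apply/eqP.
    exact: (intr_mul_neq0 (z := 16) isT (expf_neq0 2 p0)).
  have [k k0 T3] : exists2 k : R[i], k != 0 & lie_br 4 c fam (A 4) (A 1%N) = k *: Q0.
    by eapply (@a4a1_Q _ _ _ hL q0 Q0 e0 A); eassumption.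
  (* The scalar k is normalised by a square root: the root vectors need $\mu$ with $\mu^2k=1$. *)
  pose mu := (sqrtC k)^-1.
  have mu0 : mu != 0 by rewrite invr_eq0 sqrtC_eq0.
  have kE : k = mu ^- 2 by rewrite /mu exprVn invrK sqrtCK.
  exact: (@A2_conclusion _ _ _ hL q0 Q0 e0 A hqQ heQ heq hQa had hqa hqa0 span Q0n a41 k mu mu0 kE T3).
(* Elements of m send the degree 0 part to multiples of XY and terms of degree at least 4. The
   monomial $X^6$ is not divisible by Y and has degree less than 8, so its coefficient vanishes on
   m^2. *)
pose ok x y := ((0 < x) && (0 < y) || (4 <= x + y))%N.
have sumE := refl_sum6 hc hzeta.
have pn0 : 3 * (a + b) != 0 /\ 3 * (a - b) != 0.
  have three : 3 != 0 :> R[i] by rewrite (pnatr_eq0 _ 3).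
  split; apply: mulf_neq0 => //; apply/eqP => e; apply: abn.
    by rewrite subr_sqr e !mulr0.
  by rewrite subr_sqr e mul0r mulr0.
have okU x y x' y' : ok x y -> ok (x + x')%N (y + y')%N by rewrite /ok; lia.
have okL x y x' y' : ok x y -> ok x' y' -> ((x + x', y + y') == (6, 0))%N = false.
  by rewrite /ok xpair_eqE => h h'; apply/negbTE/negP => /andP[/eqP h1 /eqP h2]; lia.
have chkP t : ok6 t -> mc (3 * (a + b)) (3 * (a - b)) t = 0 \/ ok t.2.2.1.1 t.2.2.1.2.
  by move=> h; right.
have cq b0 : all ok6 (lx 6 (ly 6 (unit_term 0 0 b0))) by case: b0; vm_compute.
have cQ b0 : all ok6 (lX (lY (unit_term 0 0 b0))) by case: b0; vm_compute.
have ce b0 : all ok6 (lX (lx 6 (unit_term 0 0 b0)) ++ ly 6 (lY (unit_term 0 0 b0))) by case: b0; vm_compute.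
have ca i b0 : (i <= 6)%N -> all ok6 (la 6 i (unit_term 0 0 b0)).
  by case: i => [|[|[|[|[|[|[|//]]]]]]] _; case: b0; vm_compute.
have a63 : lie_br 6 c fam (A 6) (A 3) <> 0.
  apply: (detect_ada hzeta hc famE hcusp sumE okU chkP okL cq cQ ce ca).
  (* The coefficient of $X^6$ is $12pn$ with $p=3(a+b)$ and $n=3(a-b)$, that is $108(a^2-b^2)$. *)
  rewrite (_ : [seq t <- lada 6 3 (unit_term 0 0 false) | _] = [:: (12%Z, (1, 1, (6, 0, false)))]%N); last by vm_compute.
  rewrite big_seq1 /mc /= !expr1 -/a -/b -mulrA; apply/eqP; have [h1 h2] := pn0.
  exact: (intr_mul_neq0 (z := 12) isT (mulf_neq0 h1 h2)).
have [k k0 T3] : exists2 k : R[i], k != 0 & lie_br 6 c fam (A 6) (A 3) = k *: A 6.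
  by eapply (@a6a3_a6 _ _ _ hL q0 Q0 e0 A); eassumption.
have [y T7] : exists y : R[i], lie_br 6 c fam (A 6) (A 1%N) = y *: Q0 + (k / 5) *: A 4.
  exact: (@a6a1E _ _ _ hL q0 Q0 e0 A hqQ heQ heq hQa had hqa hqa0 span a63 k T3).
exact: (@B2_conclusion _ _ _ hL q0 Q0 e0 A hqQ heQ heq hQa had hqa hqa0 span a63 k k0 T3 y T7).
Qed.
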